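(* Let $X$ be a cocompact Fuchsian building and let $\Gamma<\mathrm{Aut}(X)$ be a cocompact lattice. Assume that $\mathrm{Confdim}(\partial X)<2$. Then $H^1(\Gamma,\ell^2(\Gamma))\neq 0$ and $H^2(\Gamma,\ell^2(\Gamma))=0$. Consequently, for every $n\ge 1$, every $n$-tuple $(c_1,\dots,c_n)$ of skew-adjoint elements of $Z^1(\Gamma,\mathrm{HS}(\ell^2(\Gamma))_{\mathrm{Ad}\,\lambda})$ integrates to an $n$-parameter analytic unitary Hilbert–Schmidt deformation of the left regular representation $\lambda$ of $\Gamma$.
   Context: Fuchsian buildings. Let $R\subset\mathbb H^2$ be a compact convex hyperbolic polygon whose angles are of the form $\pi/m$ with integers $m\ge 2$, and let $W$ be the (Coxeter) group generated by the reflections in the sides of $R$; the translates of $R$ under $W$ tessellate $\mathbb H^2$. A Fuchsian building is a locally finite building of type $W$, realized as a polygonal 2-complex: a (contractible) 2-dimensional cell complex $X$, whose 2-cells (chambers) are copies of $R$, with a family of subcomplexes (apartments) each isomorphic to the tessellated plane $\mathbb H^2$, such that any two cells lie in a common apartment and any two apartments are related by a (type-preserving) isomorphism fixing their intersection pointwise. With its natural path metric $X$ is Gromov hyperbolic; $\partial X$ is its Gromov boundary. $X$ is cocompact if $\mathrm{Aut}(X)$ acts cocompactly on it. A cocompact lattice $\Gamma<\mathrm{Aut}(X)$ is a discrete subgroup acting properly (with finite stabilizers) and cocompactly on $X$. $\mathrm{Confdim}(\partial X)$ is the (Ahlfors regular) conformal dimension of $\partial X$: the infimum of the Hausdorff dimensions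 of all Ahlfors regular metrics on $\partial X$ that are quasisymmetric to a visual metric. Cohomology. $\ell^2(\Gamma)$ carries the left regular representation $\lambda$. For a $\Gamma$-module $V$, $C^k(\Gamma,V)=V^{\Gamma^k}$ are the inhomogeneous cochains with the usual differential $d_k$, $Z^k(\Gamma,V)=\ker d_k$, and $H^k(\Gamma,V)=Z^k(\Gamma,V)/d_{k-1}C^{k-1}(\Gamma,V)$ is unreduced cohomology. $\mathrm{HS}(\ell^2(\Gamma))_{\mathrm{Ad}\,\lambda}$ is the Hilbert space of Hilbert–Schmidt operators on $\ell^2(\Gamma)$ (norm $\|T\|_2^2=\operatorname{Tr}(T^*T)$) with the action $g\cdot T=\lambda(g)T\lambda(g)^{-1}$. A 1-cochain $c$ is skew-adjoint if $c(g)^*=-c(g)$ for all $g$. Deformations. $(c_1,\dots,c_n)$ integrates to an $n$-parameter analytic unitary Hilbert–Schmidt deformation of $\lambda$ if there are unitary representations $\lambda_t$ of $\Gamma$ on $\ell^2(\Gamma)$, for $t$ in an open neighbourhood of $0\in\mathbb R^n$, of the form $\lambda_t(g)=u_t(g)\lambda(g)$, $u_t(g)=1+\sum_{|\alpha|\ge1}c_\alpha(g)t^\alpha$ with $\alpha\in\mathbb N^n$, $c_\alpha(g)\in\mathrm{HS}(\ell^2(\Gamma))$, the series converging absolutely in $\|\cdot\|_2$ for each $g$ on that neighbourhood, and with $c_{e_i}=c_i$ for $1\le i\le n$ ($e_i$ the standard basis multi-indices). *)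

(* Defs.v *)
From HB Require Import structures.
From mathcomp Require Import all_boot all_order all_algebra finmap complex ring lra.
From mathcomp Require Import all_classical all_reals all_analysis.

Set Implicit Arguments.
Unset Strict Implicit.
Unset Printing Implicit Defensive.

Import Order.TTheory GRing.Theory Num.Theory.
Import numFieldNormedType.Exports.

Local Open Scope classical_set_scope.
Local Open Scope ring_scope.

Section hyperbolic_plane.
Variable R : realType.
Implicit Types u v : 'rV[R]_3.

(* Hyperboloid model, with the Lorentz form of signature (2, 1). *)
Definition lform u v : R :=
  - (u 0 0 * v 0 0) + u 0 1 * v 0 1 + u 0 2%:R * v 0 2%:R.

Definition hplane : set 'rV[R]_3 := [set v | lform v v = -1 /\ 0 < v 0 0].

Definition arcosh (x : R) : R := ln (x + Num.sqrt (x ^+ 2 - 1)).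

Definition hdist u v : R := arcosh (- lform u v).

(* For a unit space-like [e], this is the hyperbolic reflection in the geodesic
   [hplane `&` [set v | lform v e = 0]]. *)
Definition reflection (e v : 'rV[R]_3) : 'rV[R]_3 := v - (2 * lform v e) *: e.

(* The interior angle at a point common to the sides [i] and [j] is the one
   whose cosine is [- lform (outer_normal i) (outer_normal j)]. *)
Record coxeter_polygon := CoxeterPolygon {
  nsides : nat ;
  outer_normal : 'I_nsides -> 'rV[R]_3 ;
  polygon : set 'rV[R]_3 :=
    [set v | hplane v /\ forall i, lform v (outer_normal i) <= 0] ;
  side : 'I_nsides -> set 'rV[R]_3 :=
    fun i => [set v | polygon v /\ lform v (outer_normal i) = 0] ;
  normal_unit : forall i, lform (outer_normal i) (outer_normal i) = 1 ;
  polygon_compact : compact polygon ;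
  polygon_interior :
    exists v, hplane v /\ forall i, lform v (outer_normal i) < 0 ;
  side_nondegenerate : forall i, exists u v, [/\ side i u, side i v & u <> v] ;
  polygon_angle : forall i j, i != j -> (side i `&` side j) !=set0 ->
    exists2 m : nat, (2 <= m)%N &
      lform (outer_normal i) (outer_normal j) = - cos (pi / m%:R)
}.

Inductive coxeter_group (P : coxeter_polygon) :
    ('rV[R]_3 -> 'rV[R]_3) -> Prop :=
| coxeter_group1 : coxeter_group P id
| coxeter_groupM (i : 'I_(nsides P)) w :
    coxeter_group P w -> coxeter_group P (reflection (outer_normal i) \o w).

End hyperbolic_plane.

Section polygonal_complex.
Variables (R : realType) (P : coxeter_polygon R).

(* The chambers are copies of the polygon, glued along faces in a
   type-preserving way: a point shared by two chambers has the same coordinate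
   in both, and the closed face that carries it is then shared.  The values of
   the charts outside of the polygon are irrelevant. *)
Record polygonal_complex := PolygonalComplex {
  point_of :> Type ;
  chamber : Type ;
  chart : chamber -> 'rV[R]_3 -> point_of ;
  chart_cover : forall p, exists c x, polygon P x /\ chart c x = p ;
  chart_typed : forall c d x y, polygon P x -> polygon P y ->
    chart c x = chart d y -> x = y ;
  chart_face : forall c d x y, polygon P x -> polygon P y ->
    chart c x = chart d x ->
    (forall i : 'I_(nsides P), side i x -> side i y) -> chart c y = chart d y ;
  chart_inj : forall c d,
    (forall x, polygon P x -> chart c x = chart d x) -> c = d
}.

Variable X : polygonal_complex.

Definition closed_chamber (c : chamber X) : set X := chart c @` polygon P.

Definition locally_finite :=
  forall p : X, finite_set [set c : chamber X | closed_chamber c p].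

(* [broken_path p q l]: there is a broken path of length [l] from [p] to [q],
   each piece of which is a geodesic segment of a chamber. *)
Inductive broken_path : X -> X -> R -> Prop :=
| broken_path0 p : broken_path p p 0
| broken_pathS (c : chamber X) x y q l : polygon P x -> polygon P y ->
    broken_path (chart c y) q l -> broken_path (chart c x) q (hdist x y + l).

Definition path_dist (p q : X) : R := inf [set l | broken_path p q l].

Definition polygon_isometry (s : 'rV[R]_3 -> 'rV[R]_3) :=
  set_bij (polygon P) (polygon P) s /\
  forall x y, polygon P x -> polygon P y -> hdist (s x) (s y) = hdist x y.

(* Cellular isometries, not required to preserve types. *)
Definition automorphism (phi : X -> X) :=
  bijective phi /\
  forall c : chamber X, exists d : chamber X, exists2 s, polygon_isometry s &
    forall x, polygon P x -> phi (chart c x) = chart d (s x).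

Definition apartment (A : set X) := exists f : 'rV[R]_3 -> X,
  set_bij (@hplane R) A f /\
  forall w, coxeter_group P w ->
    exists c : chamber X, forall x, polygon P x -> f (w x) = chart c x.

(* [phi] only matters on [A]. *)
Definition apartment_iso (A B : set X) (phi : X -> X) :=
  [/\ set_bij A B phi,
      (forall c : chamber X, closed_chamber c `<=` A ->
        exists d : chamber X, forall x, polygon P x ->
          phi (chart c x) = chart d x)
    & forall p, (A `&` B) p -> phi p = p].

(* Every cell is a face of a chamber, so that any two cells lie in a common
   apartment as soon as any two chambers do.  Thickness is not required. *)
Definition fuchsian_building :=
  locally_finite /\
  exists apts : set (set X),
  [/\ apts !=set0,
      (forall A, apts A -> apartment A),
      (forall c d : chamber X, exists2 A, apts A &
         closed_chamber c `|` closed_chamber d `<=` A)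
    & (forall A B, apts A -> apts B -> exists phi, apartment_iso A B phi)].

End polygonal_complex.

Section metric_notions.
Variables (R : realType) (T : Type) (d : T -> T -> R).

Definition is_metric :=
  [/\ forall x y, d x y = 0 <-> x = y,
      forall x y, d x y = d y x
    & forall x y z, d x z <= d x y + d y z].

Definition metric_ball (x : T) (r : R) : set T := [set y | d x y < r].

Definition metric_open (U : set T) :=
  forall x, U x -> exists2 r, 0 < r & metric_ball x r `<=` U.

Definition metric_compact (K : set T) :=
  forall (I : choiceType) (D : set I) (f : I -> set T),
    (forall i, D i -> metric_open (f i)) -> K `<=` cover D f ->
    finite_subset_cover D f K.

Local Open Scope ereal_scope.

(* The added [0] only matters for the empty set. *)
Definition metric_diam (A : set T) : \bar R :=
  ereal_sup ([set 0] `|` [set (d x y)%:E | x in A & y in A]).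

Definition hausdorff_content (s : R) (delta : R) (A : set T) : \bar R :=
  ereal_inf [set \sum_(i <oo) (metric_diam (U i) `^ s) | U in
    [set U : nat -> set T | A `<=` \bigcup_i U i /\
                            forall i, metric_diam (U i) <= delta%:E]].

Definition hausdorff_measure (s : R) (A : set T) : \bar R :=
  ereal_sup [set hausdorff_content s delta A | delta in [set e | (0 < e)%R]].

Definition hausdorff_dim : \bar R :=
  ereal_inf [set s%:E | s in
    [set s | (0 < s)%R /\ hausdorff_measure s setT = 0]].

Definition ahlfors_regular := exists Q C : R,
  [/\ (0 < Q)%R, (0 < C)%R &
      forall x r, (0 < r)%R -> r%:E <= metric_diam setT ->
        (C^-1 * r `^ Q)%:E <= hausdorff_measure Q (metric_ball x r) <=
        (C * r `^ Q)%:E].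

End metric_notions.

Section quasisymmetry.
Variables (R : realType) (T : Type).

(* The identity map from [(T, d)] to [(T, d')] is quasisymmetric. *)
Definition quasisymmetric (d d' : T -> T -> R) := exists eta : R -> R,
  [/\ {within `[0, +oo[%classic, continuous eta},
      set_bij `[0, +oo[%classic `[0, +oo[%classic eta
    & forall x y z, x <> z ->
        d' x y / d' x z <= eta (d x y / d x z)].

End quasisymmetry.

Section gromov_boundary.
Variables (R : realType) (T : Type) (d : T -> T -> R).

Definition gromov_prod (o x y : T) : R := (d o x + d o y - d x y) / 2.

Definition gromov_sim (u v : nat -> T) := forall (o : T) (M : R),
  exists N, forall i j, (N <= i)%N -> (N <= j)%N ->
    M <= gromov_prod o (u i) (v j).

Definition gromov_seq (u : nat -> T) := gromov_sim u u.

Definition gromov_class (u : nat -> T) : set (nat -> T) :=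
  [set v | gromov_seq v /\ gromov_sim u v].

Definition gromov_boundary :=
  {xi : set (nat -> T) | exists2 u, gromov_seq u & xi = gromov_class u}.

Local Open Scope ereal_scope.

Definition gromov_liminf (o : T) (u v : nat -> T) : \bar R :=
  ereal_sup [set ereal_inf
    [set (gromov_prod o (u ij.1) (v ij.2))%:E | ij in
       [set ij : nat * nat | (N <= ij.1)%N /\ (N <= ij.2)%N]] | N in setT].

(* Equal to [+oo] on the diagonal. *)
Definition boundary_prod (o : T) (xi eta : gromov_boundary) : \bar R :=
  ereal_sup [set gromov_liminf o u v | u in sval xi & v in sval eta].

Definition visual_metric (rho : gromov_boundary -> gromov_boundary -> R) :=
  is_metric rho /\
  exists (o : T) (a C : R), [/\ (0 < a)%R, (0 < C)%R &
    forall xi eta,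
      C^-1%:E * expeR (- (a%:E * boundary_prod o xi eta)) <= (rho xi eta)%:E <=
      C%:E * expeR (- (a%:E * boundary_prod o xi eta))].

Definition boundary_confdim : \bar R :=
  ereal_inf [set hausdorff_dim theta | theta in
    [set theta : gromov_boundary -> gromov_boundary -> R |
      [/\ is_metric theta, ahlfors_regular theta &
          exists2 rho, visual_metric rho & quasisymmetric rho theta]]].

End gromov_boundary.

Section lattices.
Variables (R : realType) (P : coxeter_polygon R) (X : polygonal_complex P).

Definition cocompact_complex := exists2 K : set X,
  metric_compact (@path_dist _ _ X) K &
  forall p, exists phi, exists2 q, K q & automorphism phi /\ phi q = p.

(* [act] identifies [G] with a subgroup of the automorphism group; discreteness
   is with respect to the compact-open topology. *)
Definition cocompact_lattice (G : groupType) (act : G -> X -> X) :=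
  [/\ (forall p, act 1%g p = p) /\
        (forall g h p, act (g * h)%g p = act g (act h p)),
      (forall g, automorphism (act g)) /\
        (forall g, (forall p, act g p = p) -> g = 1%g),
      (exists2 K : set X, metric_compact (@path_dist _ _ X) K &
        exists2 e : R, 0 < e &
        forall g, (forall p, K p -> path_dist (act g p) p < e) -> g = 1%g),
      (forall K : set X, metric_compact (@path_dist _ _ X) K ->
        finite_set [set g | (act g @` K) `&` K !=set0])
    & (exists2 K : set X, metric_compact (@path_dist _ _ X) K &
        forall p, exists g, exists2 q, K q & act g q = p)].

End lattices.

Lemma esumZ_lty (R : realType) (I : choiceType) (r : R) (a : I -> \bar R) :
  0 <= r -> (forall i, 0 <= a i)%E ->
  (\esum_(i in setT) a i < +oo -> \esum_(i in setT) (r%:E * a i) < +oo)%E.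
Proof.
move=> r0 a0 aoo.
apply: (@le_lt_trans _ _ (r%:E * \esum_(i in setT) a i)%E); last first.
  by rewrite lte_mul_pinfty// lee_fin.
apply: ge_ereal_sup => /= _ [X [finX _]] <-.
rewrite -ge0_mule_fsumr// lee_wpmul2l ?lee_fin//.
by apply: ereal_sup_ubound; exists X.
Qed.

Section l2_pred.
Variables (R : realType) (T : choiceType).

Definition normsq (z : R[i]) : R := complex.Re z ^+ 2 + complex.Im z ^+ 2.

Lemma normsq_ge0 z : 0 <= normsq z.
Proof. by rewrite /normsq addr_ge0 // sqr_ge0. Qed.

Lemma normsqM a z : normsq (a * z) = normsq a * normsq z.
Proof. by case: a z => [a b] [c e]; rewrite /normsq /=; ring. Qed.

Lemma normsqD z w : normsq (z + w) <= 2 * normsq z + 2 * normsq w.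
Proof.
case: z w => [a b] [c e]; rewrite /normsq /=.
by have := sqr_ge0 (a - c); have := sqr_ge0 (b - e); lra.
Qed.

Lemma normsq0 : normsq 0 = 0.
Proof. by rewrite /normsq /= expr0n addr0. Qed.

Lemma normsq1 : normsq 1 = 1.
Proof. by rewrite /normsq /= expr1n expr0n addr0. Qed.

Definition l2_pred : {pred T -> R[i]} :=
  mem [set f : T -> R[i] | (\esum_(x in setT) (normsq (f x))%:E < +oo)%E].

Lemma l2_submod_closed : submod_closed l2_pred.
Proof.
split=> [|a f g].
  rewrite inE /= esum1 ?ltry// => x _.
  by rewrite [X in normsq X](_ : _ = 0) ?normsq0.
rewrite !inE /= => f2 g2.
pose F x := ((2 * normsq a)%:E * (normsq (f x))%:E + 2%:E * (normsq (g x))%:E)%E.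
apply: (@le_lt_trans _ _ (\esum_(x in setT) F x)%E).
  apply: le_esum => x _; rewrite /F -!EFinM -EFinD lee_fin -mulrA -normsqM.
  exact: normsqD.
rewrite esumD; try by move=> x _; rewrite -EFinM lee_fin !mulr_ge0 ?normsq_ge0.
by rewrite lte_add_pinfty// esumZ_lty ?mulr_ge0 ?normsq_ge0// => x;
  rewrite lee_fin normsq_ge0.
Qed.

HB.instance Definition _ :=
  GRing.isSubmodClosed.Build _ _ l2_pred l2_submod_closed.

Record l2 := L2 { l2_fun :> T -> R[i] ; l2_funP : l2_fun \in l2_pred }.

HB.instance Definition _ := [isSub for l2_fun].
HB.instance Definition _ := [Choice of l2 by <:].
HB.instance Definition _ := [SubChoice_isSubLmodule of l2 by <:].

End l2_pred.

Section l2_theory.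
Variables (R : realType) (T : choiceType).
Local Notation H := (l2 R T).
Implicit Types (f g : H) (A : H -> H).

Definition l2_normsq f : R := fine (\esum_(x in setT) (normsq (f x))%:E).

Definition l2_norm f : R := Num.sqrt (l2_normsq f).

(* Sum of an absolutely summable real family. *)
Definition real_sum (a : T -> R) : R :=
  fine (\esum_(x in setT) (Num.max (a x) 0)%:E) -
  fine (\esum_(x in setT) (Num.max (- a x) 0)%:E).

Definition l2_dot f g : R[i] :=
  Complex (real_sum (fun x => complex.Re (f x * conjc (g x))))
          (real_sum (fun x => complex.Im (f x * conjc (g x)))).

Lemma l2_delta_proof (x : T) : (fun y => (y == x)%:R) \in @l2_pred R T.
Proof.
rewrite inE /=; set F := (F in esum _ F).
rewrite (_ : esum _ _ = \esum_(y in [set x]) F y)%E.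
  by rewrite esum_set1 ?ltry// lee_fin normsq_ge0.
rewrite [RHS]esum_mkcond; apply: eq_esum => y _; rewrite /F.
case: (eqVneq y x) => [->|yx]; first by rewrite mem_set.
by rewrite memNset ?normsq0// => /= /eqP; apply/negP.
Qed.

Definition l2_delta (x : T) : H := L2 (l2_delta_proof x).

Definition bounded_op A := exists C : R, forall f, l2_norm (A f) <= C * l2_norm f.

Definition unitary_op A :=
  [/\ linear A, forall g, exists f, A f = g
    & forall f g, l2_dot (A f) (A g) = l2_dot f g].

Definition adjoint_ops A B := forall f g, l2_dot (A f) g = l2_dot f (B g).

(* [Tr (A^* A)], computed in the standard orthonormal basis. *)
Definition hs_esum A : \bar R :=
  \esum_(x in setT) (l2_norm (A (l2_delta x)) ^+ 2)%:E.

Definition hs_pred : {pred H -> H} :=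
  mem [set A : H -> H | [/\ linear A, bounded_op A & (hs_esum A < +oo)%E]].

Lemma l2_normsq_ge0 f : 0 <= l2_normsq f.
Proof.
by apply: fine_ge0; apply: esum_ge0 => x _; rewrite lee_fin normsq_ge0.
Qed.

Lemma l2_norm_ge0 f : 0 <= l2_norm f. Proof. exact: sqrtr_ge0. Qed.

Lemma sqr_l2_norm f : l2_norm f ^+ 2 = l2_normsq f.
Proof. by rewrite sqr_sqrtr ?l2_normsq_ge0. Qed.

Lemma l2_normsqE f : (l2_normsq f)%:E = (\esum_(x in setT) (normsq (f x))%:E)%E.
Proof.
rewrite fineK// ge0_fin_numE; first by have := l2_funP f; rewrite inE.
by apply: esum_ge0 => x _; rewrite lee_fin normsq_ge0.
Qed.

Lemma l2_norm0 : l2_norm 0 = 0.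
Proof.
rewrite /l2_norm /l2_normsq esum1 ?sqrtr0// => x _.
by rewrite [X in normsq X](_ : _ = 0) ?normsq0.
Qed.

Lemma l2_normsqZD a f g :
  l2_normsq (a *: f + g) <= 2 * normsq a * l2_normsq f + 2 * l2_normsq g.
Proof.
rewrite -lee_fin EFinD !EFinM !l2_normsqE.
have h0 (r : R) (u : H) : 0 <= r -> forall x : T,
    (0 <= r%:E * (normsq (u x))%:E)%E.
  by move=> r0 x; rewrite -EFinM lee_fin mulr_ge0 ?normsq_ge0.
have esumZ (r : R) (u : H) : 0 <= r ->
   (\esum_(x in setT) (r%:E * (normsq (u x))%:E) <=
    r%:E * \esum_(x in setT) (normsq (u x))%:E)%E.
  move=> r0; apply: ge_ereal_sup => /= _ [X [finX _]] <-.
  rewrite -ge0_mule_fsumr => [|x]; last by rewrite lee_fin normsq_ge0.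
  by rewrite lee_wpmul2l ?lee_fin//; apply: ereal_sup_ubound; exists X.
rewrite -EFinM; apply: le_trans (leeD (esumZ _ _ _) (esumZ _ _ _)) => //; last first.
  by rewrite mulr_ge0 ?normsq_ge0.
rewrite -esumD; try by move=> x _; apply: h0; rewrite ?mulr_ge0 ?normsq_ge0.
apply: le_esum => x _; rewrite -!EFinM -EFinD lee_fin -mulrA -normsqM.
exact: normsqD.
Qed.

Lemma l2_normZD a f g :
  l2_norm (a *: f + g) <= 2 * Num.sqrt (normsq a) * l2_norm f + 2 * l2_norm g.
Proof.
rewrite -(@ler_pXn2r _ 2)// ?nnegrE ?l2_norm_ge0//; last first.
  by rewrite addr_ge0 ?mulr_ge0 ?sqrtr_ge0 ?l2_norm_ge0.
rewrite sqr_l2_norm (le_trans (l2_normsqZD _ _ _))// -!sqr_l2_norm.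
have := l2_norm_ge0 f; have := l2_norm_ge0 g; have := sqrtr_ge0 (normsq a).
have := sqr_sqrtr (normsq_ge0 a).
move: (Num.sqrt (normsq a)) (l2_norm f) (l2_norm g) => p r q <- p0 q0 r0.
rewrite -(mulrA 2 (p ^+ 2)) -exprMn -(mulrA 2 p).
have : 0 <= p * r by rewrite mulr_ge0.
move: (p * r) => s s0; rewrite sqrrD.
by have := mulr_ge0 s0 q0; have := sqr_ge0 s; have := sqr_ge0 q; nra.
Qed.

Lemma hs_submod_closed : submod_closed hs_pred.
Proof.
split=> [|a A B].
  rewrite inE /=; split.
  - by move=> b f g; rewrite [RHS](_ : _ = b *: 0 + 0) ?scaler0 ?addr0.
  - by exists 0 => f; rewrite mul0r [X in l2_norm X](_ : _ = 0) ?l2_norm0.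
  - rewrite /hs_esum esum1 ?ltry// => x _.
    by rewrite [X in l2_norm X](_ : _ = 0) ?l2_norm0 ?expr0n.
rewrite !inE /= => -[linA [C bA] hA] [linB [D bB] hB].
have E f : (a *: A + B) f = a *: A f + B f by [].
split.
- move=> b f g; rewrite !E linA linB !scalerDr !scalerA (mulrC a) -!addrA.
  by congr (_ + _); rewrite addrCA.
- exists (2 * Num.sqrt (normsq a) * C + 2 * D) => f; rewrite E.
  rewrite (le_trans (l2_normZD _ _ _))// [leRHS]mulrDl lerD//.
    by rewrite -[leRHS]mulrA ler_wpM2l// mulr_ge0 ?sqrtr_ge0.
  by rewrite -[leRHS]mulrA ler_wpM2l.
- pose N S x := ((l2_norm (S (l2_delta x)) ^+ 2)%:E : \bar R).
  have N0 S x : (0 <= N S x)%E by rewrite lee_fin sqr_ge0.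
  apply: (@le_lt_trans _ _ (\esum_(x in setT)
     ((2 * normsq a)%:E * N A x + 2%:E * N B x))%E).
    apply: le_esum => x _; rewrite /N -!EFinM -EFinD lee_fin E !sqr_l2_norm.
    exact: l2_normsqZD.
  rewrite esumD; try by move=> x _; rewrite mule_ge0// lee_fin ?mulr_ge0 ?normsq_ge0.
  by rewrite lte_add_pinfty// esumZ_lty// mulr_ge0 ?normsq_ge0.
Qed.

HB.instance Definition _ :=
  GRing.isSubmodClosed.Build _ _ hs_pred hs_submod_closed.

Record hs_op := HSOp { hs_fun :> H -> H ; hs_funP : hs_fun \in hs_pred }.

HB.instance Definition _ := [isSub for hs_fun].
HB.instance Definition _ := [Choice of hs_op by <:].
HB.instance Definition _ := [SubChoice_isSubLmodule of hs_op by <:].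

Definition hs_norm (A : hs_op) : R := Num.sqrt (fine (hs_esum A)).

Definition skew_adjoint (A : hs_op) := adjoint_ops A (\- (A : H -> H)).

End l2_theory.

Section cohomology.
Variables (G : groupType) (V : zmodType) (act : G -> V -> V).

Definition cochain (k : nat) := ('I_k -> G) -> V.

(* (s_0, ..., s_i * s_(i+1), ..., s_k) *)
Definition merge_args k (i : 'I_k) (s : 'I_k.+1 -> G) : 'I_k -> G := fun j =>
  if (j < i)%N then s (widen_ord (leqnSn k) j)
  else if j == i then (s (widen_ord (leqnSn k) j) * s (lift ord0 j))%g
  else s (lift ord0 j).

Definition coboundary k (c : cochain k) : cochain k.+1 := fun s =>
  act (s ord0) (c (fun j => s (lift ord0 j)))
  + \sum_(i < k) c (merge_args i s) *~ ((-1) ^+ i.+1)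
  + c (fun j => s (widen_ord (leqnSn k) j)) *~ ((-1) ^+ k.+1).

Definition cocycles k : set (cochain k) := [set c | coboundary c = fun=> 0].

Definition coboundaries k : set (cochain k) :=
  match k with
  | 0 => [set fun=> 0]
  | k'.+1 => range (@coboundary k')
  end.

(* The (unreduced) quotient [cocycles k / coboundaries k] is zero. *)
Definition cohomology_vanishes k := @cocycles k `<=` @coboundaries k.

End cohomology.

Section regular_representation.
Variables (R : realType) (G : groupType).
Local Notation H := (l2 R G).

Lemma lreg_proof (g : G) (f : H) : (fun h => f (g^-1 * h)%g) \in @l2_pred R G.
Proof.
have := l2_funP f; rewrite !inE /= (@reindex_esum _ _ _ setT setT (fun h => (g^-1 * h)%g))//.
split=> //; first by move=> x y _ _; apply: mulgI.
by move=> h _; exists (g * h)%g => //; rewrite mulKg.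
Qed.

Definition lreg (g : G) (f : H) : H := L2 (lreg_proof g f).

Lemma lreg_linear g : linear (lreg g).
Proof. by move=> a u v; apply/val_inj/funext. Qed.

Lemma lreg_norm g f : l2_norm (lreg g f) = l2_norm f.
Proof.
congr (Num.sqrt (fine _)); symmetry.
rewrite (@reindex_esum _ _ _ setT setT (fun h => (g^-1 * h)%g))//.
split=> //; first by move=> x y _ _; apply: mulgI.
by move=> h _; exists (g * h)%g => //; rewrite mulKg.
Qed.

Lemma lreg_delta g h : lreg g (l2_delta R h) = l2_delta R (g * h)%g.
Proof.
apply/val_inj/funext => x /=; congr (_%:R).
by rewrite -(inj_eq (@mulgI _ g)) mulVKg.
Qed.

Lemma hs_ad_proof (g : G) (A : hs_op R G) :
  lreg g \o A \o lreg g^-1%g \in @hs_pred R G.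
Proof.
have := hs_funP A; rewrite !inE /= => -[linA [C bA] hA]; split.
- by move=> a u v /=; rewrite lreg_linear linA lreg_linear.
- by exists C => f /=; rewrite lreg_norm -(lreg_norm g^-1%g f).
- move: hA; rewrite /hs_esum.
  rewrite (@reindex_esum _ _ _ setT setT (fun h => (g^-1 * h)%g)); last first.
    split=> //; first by move=> x y _ _; apply: mulgI.
    by move=> h _; exists (g * h)%g => //; rewrite mulKg.
  by under eq_esum do rewrite -lreg_delta -(lreg_norm g).
Qed.

Definition hs_ad (g : G) (A : hs_op R G) : hs_op R G := HSOp (hs_ad_proof g A).

Definition unitary_rep (pi : G -> H -> H) :=
  [/\ forall g, unitary_op (pi g), pi 1%g = id
    & forall g h, pi (g * h)%g = pi g \o pi h].

Definition multi_degree n (alpha : {ffun 'I_n -> nat}) : nat :=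
  \sum_(i < n) alpha i.

Definition multi_unit n (i : 'I_n) : {ffun 'I_n -> nat} :=
  [ffun j => nat_of_bool (j == i)].

Definition multi_pow n (t : 'rV[R]_n) (alpha : {ffun 'I_n -> nat}) : R :=
  \prod_(i < n) t 0 i ^+ alpha i.

(* [S] is the sum in Hilbert-Schmidt norm of the absolutely convergent series
   of the [F i], for [i] in [D]. *)
Definition hs_abs_sum (I : choiceType) (D : set I) (F : I -> hs_op R G)
    (S : hs_op R G) :=
  (\esum_(i in D) (hs_norm (F i))%:E < +oo)%E /\
  forall e : R, 0 < e -> exists2 J0 : {fset I}, [set` J0] `<=` D &
    forall J : {fset I}, [set` J0] `<=` [set` J] -> [set` J] `<=` D ->
      hs_norm (S - \sum_(i <- J) F i) < e.

(* The operators [u_t(g)] are [1 + D t g]. *)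
Definition integrates n (c : 'I_n -> cochain G (hs_op R G) 1) :=
  exists (U : set 'rV[R]_n) (C : {ffun 'I_n -> nat} -> G -> hs_op R G)
         (D : 'rV[R]_n -> G -> hs_op R G),
  [/\ open U /\ U 0,
      (forall i g, C (multi_unit i) g = c i (fun=> g)),
      (forall t, U t -> forall g,
         hs_abs_sum [set alpha | (1 <= multi_degree alpha)%N]
           (fun alpha => real_complex R (multi_pow t alpha) *: C alpha g)
           (D t g))
    & (forall t, U t ->
         unitary_rep (fun g f => lreg g f + D t g (lreg g f)))].

End regular_representation.

(* Main.v *)
Require Import Defs.
From HB Require Import structures.
From mathcomp Require Import all_boot all_order all_algebra finmap complex.
From mathcomp Require Import ring lra zify.
From mathcomp Require Import all_classical all_reals all_analysis.

Set Implicit Arguments.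
Unset Strict Implicit.
Unset Printing Implicit Defensive.
Import Order.TTheory GRing.Theory Num.Theory.
Import numFieldNormedType.Exports.
Local Open Scope classical_set_scope.
Local Open Scope ring_scope.

(* The only input from geometry is a hyperbolic filling of the boundary by the orbit of the
   lattice. Each [x] in the group has a shadow on the boundary, the end of a geodesic ray
   through [x]; a metric [theta] on the boundary of dimension less than 2 gives it a size
   [2 ^- nn x], and there are at most [M * lam ^ m] shadows of size [2 ^- (n + m)] near a
   shadow of size [2 ^- n], for some [lam < 4].

   Since [lam < 4], the function [x |-> theta z (xi x)] has square-summable differences
   [f (x * g) - f x]; it accumulates at several values, so it is not a constant plus an
   element of l2, and [H^1] is not zero.

   A 2-cocycle is a function [c x y z] whose values near the diagonal are square-summable.
   Join [1] to [x] by the fuzzy path which at scale [2 ^- n] is a partition of unity around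
   the shadow of [x]. The cone from [1] corrected by the integral of [c] along these paths is
   a primitive of [c]; its value on [(x, x * g)] is a sum over [n] of integrals of [c] over
   prisms of width [2 ^ n * 2 ^- nn x], and Schur's test with [lam < 4] shows that it is
   square-summable. The construction is linear and bounded, and applies uniformly to the
   copies of the regular module in the Hilbert-Schmidt operators.

   A deformation is then built degree by degree as a series in non-commuting variables: the
   obstruction in each degree is a 2-cocycle, of which the linear bounded primitive is taken
   and then corrected to be unitary. Finite generation turns the bound of the primitive into
   a majorant for the norms on the generators, hence a positive radius of convergence. *)

(** * The hyperbolic plane *)

(** The bound on the dimension is available only for a metric [theta] that is quasisymmetric to a
    visual one, and a quasisymmetry controls ratios of distances from a common point but no scale.
    Each shadow therefore carries a second boundary point, the end of a perpendicular to its ray,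
    and its size is the [theta]-distance of the two points. The cohomology is unreduced, so
    approximate primitives do not suffice: the primitive of a 2-cocycle is an explicit formula,
    whose value at [g] is estimated by the values of the cocycle at finitely many pairs that depend
    on [g] only. This uniformity is what allows infinitely many copies of the regular module to be
    treated at once. The same estimate spreads over the group: iterated naively, it would bring in
    more and more elements as the degree of the deformation grows. The majorant avoids this by
    multiplicativity, which bounds the norm at each of these elements by a polynomial in the norms
    on the generators. *)

Section hyperbolic_functions.
Variable R : realType.
Implicit Types s t x : R.

Definition cosh t := (expR t + expR (- t)) / 2.
Definition sinh t := (expR t - expR (- t)) / 2.

Lemma expRNM t : expR t * expR (- t) = 1.
Proof. by rewrite -expRD subrr expR0. Qed.

Lemma cosh_sinh t : cosh t ^+ 2 - sinh t ^+ 2 = 1.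
Proof. by rewrite -(expRNM t) /cosh /sinh; field. Qed.

Lemma sqr_sinh t : sinh t ^+ 2 = cosh t ^+ 2 - 1.
Proof. by rewrite -(cosh_sinh t); ring. Qed.

Lemma coshN t : cosh (- t) = cosh t.
Proof. by rewrite /cosh opprK addrC. Qed.

Lemma sinhN t : sinh (- t) = - sinh t.
Proof. by rewrite /sinh opprK; field. Qed.

Lemma coshD s t : cosh (s + t) = cosh s * cosh t + sinh s * sinh t.
Proof. by rewrite /cosh /sinh opprD !expRD; field. Qed.

Lemma sinhD s t : sinh (s + t) = sinh s * cosh t + cosh s * sinh t.
Proof. by rewrite /cosh /sinh opprD !expRD; field. Qed.

Lemma coshB s t : cosh (s - t) = cosh s * cosh t - sinh s * sinh t.
Proof. by rewrite coshD coshN sinhN mulrN. Qed.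

Lemma sinhB s t : sinh (s - t) = sinh s * cosh t - cosh s * sinh t.
Proof. by rewrite sinhD coshN sinhN mulrN. Qed.

Lemma cosh0 : cosh 0 = 1. Proof. by rewrite /cosh oppr0 expR0; field. Qed.

Lemma sinh0 : sinh 0 = 0. Proof. by rewrite /sinh oppr0 subrr mul0r. Qed.

Lemma cosh_gt0 t : 0 < cosh t.
Proof. by rewrite divr_gt0// addr_gt0// expR_gt0. Qed.

Lemma cosh_ge1 t : 1 <= cosh t.
Proof.
have := sqr_ge0 (sinh t); rewrite sqr_sinh; have := cosh_gt0 t.
by move: (cosh t) => c; nra.
Qed.

Lemma sinh_ge0 t : 0 <= t -> 0 <= sinh t.
Proof. by move=> t0; rewrite divr_ge0// subr_ge0 ler_expR; lra. Qed.

Lemma sinh_gt0 t : 0 < t -> 0 < sinh t.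
Proof. by move=> t0; rewrite divr_gt0// subr_gt0 ltr_expR; lra. Qed.

Lemma cosh_norm t : cosh `|t| = cosh t.
Proof. by case: (ger0P t) => // _; rewrite coshN. Qed.

Lemma abs_sinh_lt t : `|sinh t| < cosh t.
Proof.
rewrite -(@ltr_pXn2r _ 2)// ?nnegrE ?normr_ge0 ?ltW ?cosh_gt0//.
by rewrite real_normK ?num_real// sqr_sinh; lra.
Qed.

Lemma cosh_lt s t : 0 <= s -> s < t -> cosh s < cosh t.
Proof.
move=> s0 st; have [d d0 ->] : exists2 d, 0 < d & t = s + d by exists (t - s); lra.
have := sinh_gt0 d0; have := sinh_ge0 s0; have := cosh_ge1 d.
have := sqr_sinh d; have := cosh_gt0 s; rewrite coshD.
move: (cosh s) (sinh s) (cosh d) (sinh d) => a b c k a0 dc c1 b0 k0.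
have : 1 < c by nra.
by nra.
Qed.

Lemma cosh_le s t : 0 <= s -> 0 <= t -> (cosh s <= cosh t) = (s <= t).
Proof.
move=> s0 t0; apply/idP/idP => [|st].
  by rewrite leNgt => H; rewrite leNgt; apply: contra H => /(cosh_lt t0).
by case: (ltgtP s t) st => [/(cosh_lt s0)/ltW||->].
Qed.

Lemma cosh_inj s t : 0 <= s -> 0 <= t -> cosh s = cosh t -> s = t.
Proof. by move=> s0 t0 e; apply: le_anti; rewrite -cosh_le// -[t <= s]cosh_le// e !lexx. Qed.

Lemma arcoshK x : 1 <= x -> cosh (arcosh x) = x.
Proof.
move=> x1; rewrite /arcosh /cosh.
set r := Num.sqrt _.
have r0 : 0 <= r by exact: sqrtr_ge0.
have r2 : r ^+ 2 = x ^+ 2 - 1 by rewrite sqr_sqrtr//; nra.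
have xr : 0 < x + r by lra.
rewrite expRN lnK ?posrE//.
have -> : (x + r)^-1 = x - r.
  apply: (mulfI (lt0r_neq0 xr)); rewrite divff ?lt0r_neq0//.
  by rewrite mulrC -subr_sqr r2; ring.
by field.
Qed.

Lemma arcosh_ge0 x : 1 <= x -> 0 <= arcosh x.
Proof. by move=> x1; apply: ln_ge0; have := sqrtr_ge0 (x ^+ 2 - 1); lra. Qed.

Lemma coshK t : 0 <= t -> arcosh (cosh t) = t.
Proof.
move=> t0; have c1 := cosh_ge1 t.
by apply: cosh_inj => //; [exact: arcosh_ge0|rewrite arcoshK].
Qed.

Lemma cosh_le_expR t : 0 <= t -> cosh t <= expR t.
Proof.
move=> t0; have : expR (- t) <= expR t by rewrite ler_expR; lra.
by rewrite /cosh; lra.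
Qed.

Lemma expR_le_cosh t : expR t <= 2 * cosh t.
Proof. by have := expR_gt0 (- t); rewrite /cosh; lra. Qed.

(** The weights [sinh (L - s) / sinh L] of [geod_stewart] decay exponentially; the coarse comparison
    [path_dist_cat] rests on this. *)
Lemma sinh_ratio L s : 0 <= s -> s <= L -> sinh (L - s) <= expR (- s) * sinh L.
Proof.
move=> s0 sL; rewrite /sinh opprB expRD (addrC s) expRD.
have : expR (- s) <= expR s by rewrite ler_expR; lra.
have := expR_gt0 (- L); nra.
Qed.

End hyperbolic_functions.

(** * The Lorentz form and the geometry of the hyperboloid *)

Section lorentz.
Variable R : realType.
Implicit Types (u v w x y z e : 'rV[R]_3) (a s t : R).

Lemma row3P u v : u 0 0 = v 0 0 -> u 0 1 = v 0 1 -> u 0 2%:R = v 0 2%:R -> u = v.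
Proof.
move=> h0 h1 h2; apply/rowP => -[[|[|[|//]]] p].
- by rewrite (_ : Ordinal p = 0) //; exact: val_inj.
- by rewrite (_ : Ordinal p = 1) //; exact: val_inj.
- by rewrite (_ : Ordinal p = 2%:R) //; exact: val_inj.
Qed.

Lemma lformC u v : lform u v = lform v u.
Proof. by rewrite /lform; ring. Qed.

Lemma lformDl u v w : lform (u + v) w = lform u w + lform v w.
Proof. by rewrite /lform !mxE; ring. Qed.

Lemma lformZl a v w : lform (a *: v) w = a * lform v w.
Proof. by rewrite /lform !mxE; ring. Qed.

Lemma lformNl v w : lform (- v) w = - lform v w.
Proof. by rewrite /lform !mxE; ring. Qed.

Lemma lformDr u v w : lform w (u + v) = lform w u + lform w v.
Proof. by rewrite lformC lformDl !(lformC w). Qed.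

Lemma lformZr a v w : lform w (a *: v) = a * lform w v.
Proof. by rewrite lformC lformZl (lformC w). Qed.

Lemma lformNr v w : lform w (- v) = - lform w v.
Proof. by rewrite lformC lformNl (lformC w). Qed.

Definition lformE := (lformDl, lformDr, lformZl, lformZr, lformNl, lformNr).

(* The Gram determinant of three vectors is minus the square of their
   determinant. *)
Lemma lform_gram v z e : lform v v = -1 ->
  (lform z e + lform z v * lform e v) ^+ 2 <=
  (lform z z + lform z v ^+ 2) * (lform e e + lform e v ^+ 2).
Proof.
move=> vv; rewrite -subr_ge0.
pose det := v 0 0 * (z 0 1 * e 0 2%:R - z 0 2%:R * e 0 1)
          - v 0 1 * (z 0 0 * e 0 2%:R - z 0 2%:R * e 0 0)
          + v 0 2%:R * (z 0 0 * e 0 1 - z 0 1 * e 0 0).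
suff -> : (lform z z + lform z v ^+ 2) * (lform e e + lform e v ^+ 2) -
  (lform z e + lform z v * lform e v) ^+ 2 = det ^+ 2 by exact: sqr_ge0.
have H : (- lform v v * lform z z + lform z v ^+ 2) *
         (- lform v v * lform e e + lform e v ^+ 2) -
  (- lform v v * lform z e + lform z v * lform e v) ^+ 2 = - lform v v * det ^+ 2.
  by rewrite /lform /det; ring.
by move: H; rewrite vv !opprK !mul1r.
Qed.

(** The reversed Cauchy-Schwarz inequality for time-like vectors; it places [- lform u v] in the
    range of [arcoshK]. *)
Lemma hplane_le u v : hplane u -> hplane v -> 1 <= - lform u v.
Proof.
move=> -[uu u0] [vv v0]; move: uu u0 vv v0; rewrite /lform => uu u0 vv v0.
move: (u 0 0) (u 0 1) (u 0 2%:R) (v 0 0) (v 0 1) (v 0 2%:R) uu u0 vv v0.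
move=> a b c a' b' c' uu a0 vv a'0.
have h1 : (b * b' + c * c') ^+ 2 <= (a * a' - 1) ^+ 2.
  have : 0 <= (b * c' - c * b') ^+ 2 + (a - a') ^+ 2 by rewrite addr_ge0// sqr_ge0.
  have -> : (a * a' - 1) ^+ 2 = (a ^+ 2 - 1) * (a' ^+ 2 - 1) + (a - a') ^+ 2 by ring.
  have -> : a ^+ 2 - 1 = b ^+ 2 + c ^+ 2 by nra.
  have -> : a' ^+ 2 - 1 = b' ^+ 2 + c' ^+ 2 by nra.
  by nra.
have a1 : 1 <= a by nra.
have a'1 : 1 <= a' by nra.
have h0 : 0 <= a * a' - 1 by nra.
have := ler_norm (b * b' + c * c').
have : `|b * b' + c * c'| <= a * a' - 1.
  by rewrite -(@ler_pXn2r _ 2)// ?nnegrE ?real_normK ?num_real.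
by lra.
Qed.

Lemma cosh_hdist u v : hplane u -> hplane v -> cosh (hdist u v) = - lform u v.
Proof. by move=> hu hv; rewrite /hdist arcoshK// hplane_le. Qed.

Lemma hdist_ge0 u v : hplane u -> hplane v -> 0 <= hdist u v.
Proof. by move=> hu hv; rewrite arcosh_ge0// hplane_le. Qed.

Lemma hdistC u v : hdist u v = hdist v u.
Proof. by rewrite /hdist lformC. Qed.

Lemma hdistxx u : hplane u -> hdist u u = 0.
Proof. by case=> uu _; rewrite /hdist uu opprK -(@cosh0 R) coshK. Qed.

Lemma hdistP u v t : 0 <= t -> hplane u -> hplane v -> - lform u v = cosh t ->
  hdist u v = t.
Proof. by move=> t0 hu hv h; rewrite /hdist h coshK. Qed.

(** The Gram inequality at the middle vertex is the bound [cosh c <= cosh a * cosh b + sinh a * sinh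
    b] contained in the hyperbolic law of cosines. *)
Lemma hdist_triangle v u w : hplane u -> hplane v -> hplane w ->
  hdist u w <= hdist u v + hdist v w.
Proof.
move=> hu hv hw.
have [d1 d2 d3] : [/\ 0 <= hdist u v, 0 <= hdist v w & 0 <= hdist u w]
  by split; exact: hdist_ge0.
rewrite -cosh_le ?addr_ge0// coshD.
have vv : lform v v = -1 by case: hv.
have uu : lform u u = -1 by case: hu.
have ww : lform w w = -1 by case: hw.
have := lform_gram u w vv.
have e1 : -1 + lform u v ^+ 2 = sinh (hdist u v) ^+ 2.
  by rewrite sqr_sinh cosh_hdist// sqrrN addrC.
have e2 : -1 + lform w v ^+ 2 = sinh (hdist v w) ^+ 2.
  by rewrite sqr_sinh cosh_hdist// sqrrN (lformC v) addrC.
rewrite uu ww e1 e2 (cosh_hdist hu hw) (cosh_hdist hu hv) (cosh_hdist hv hw).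
rewrite (lformC w v) mulrNN.
have := sinh_ge0 d1; have := sinh_ge0 d2; move: (sinh _) (sinh _) => p q p0 q0.
rewrite -exprMn => h.
have : `|lform u w + lform u v * lform v w| <= p * q.
  rewrite -(@ler_pXn2r _ 2)// ?nnegrE ?real_normK ?num_real//.
  exact: mulr_ge0.
by rewrite ler_norml => /andP[]; lra.
Qed.

(** The quantity is the square of [z + lform z v *: v], the projection of [z] to the orthogonal of
    [v], which is space-like. *)
Lemma lform_pd v z : lform v v = -1 -> 0 <= lform z z + lform z v ^+ 2.
Proof.
move=> vv.
have H : (lform z z + lform z v ^+ 2) * v 0 0 ^+ 2 =
   (z 0 1 * v 0 0 - z 0 0 * v 0 1) ^+ 2 + (z 0 2%:R * v 0 0 - z 0 0 * v 0 2%:R) ^+ 2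
   + (z 0 0 * (v 0 1 ^+ 2 + v 0 2%:R ^+ 2) - v 0 0 * (z 0 1 * v 0 1 + z 0 2%:R * v 0 2%:R)) ^+ 2
    + (z 0 1 * v 0 2%:R - z 0 2%:R * v 0 1) ^+ 2 * 0.
  have h : v 0 0 ^+ 2 = 1 + v 0 1 ^+ 2 + v 0 2%:R ^+ 2.
    by move: vv; rewrite /lform => vv; nra.
  rewrite /lform.
  move: (v 0 0) (v 0 1) (v 0 2%:R) (z 0 0) (z 0 1) (z 0 2%:R) h => a b c x y z'.
  move=> h.
  have e1 : b ^+ 2 + c ^+ 2 = a ^+ 2 - 1 by rewrite h; ring.
  rewrite e1.
  by ring: h.
have v0 : 0 < v 0 0 ^+ 2 by move: vv; rewrite /lform => vv; nra.
by rewrite -(pmulr_lge0 _ v0) H mulr0 addr0 !addr_ge0// sqr_ge0.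
Qed.

(** This is [lform_gram] at [u] for [v - u] and [e]. The bound depends on [v] through the distance
    only, so that half-planes are open for the hyperbolic distance. *)
Lemma lform_near u v e : hplane u -> hplane v ->
  (lform v e - lform u e) ^+ 2 <=
  2 * (cosh (hdist u v) - 1) * (cosh (hdist u v) + 1) *
    (lform e e + 2 * lform e u ^+ 2).
Proof.
move=> hu hv; rewrite cosh_hdist//.
have := hplane_le hu hv.
case: hu => uu _; case: hv => vv _.
have := lform_gram (v - u) e uu.
have := lform_pd e uu.
rewrite !lformE uu vv (lformC v u) (lformC e u).
move: (lform u v) (lform v e) (lform u e) (lform e e) => k a b c h1 h2 h3.
have [m m0 e0] : exists2 m, 0 <= m & k = - (m + 1) by exists (- k - 1); lra.
move: h2; rewrite e0; set A := a - b + _ => h2.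
have {}h2 : A ^+ 2 <= m * (m + 2) * (c + b ^+ 2).
  by move: h2; congr (_ <= _); ring.
have -> : a - b = A + m * b by rewrite /A; ring.
have h4 : (A + m * b) ^+ 2 <= 2 * A ^+ 2 + 2 * (m * b) ^+ 2.
  by have := sqr_ge0 (A - m * b); nra.
apply: le_trans h4 _.
have : 0 <= m * b ^+ 2 by rewrite mulr_ge0// sqr_ge0.
by nra.
Qed.

(** The cross product of Lorentzian geometry. *)
Definition lcross u v : 'rV[R]_3 := \row_(j < 3)
  if j == 0 then - (u 0 1 * v 0 2%:R - u 0 2%:R * v 0 1)
  else if j == 1 then u 0 2%:R * v 0 0 - u 0 0 * v 0 2%:R
  else u 0 0 * v 0 1 - u 0 1 * v 0 0.

Lemma lcross_l u v : lform (lcross u v) u = 0.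
Proof. by rewrite /lform !mxE /=; ring. Qed.

Lemma lcross_r u v : lform (lcross u v) v = 0.
Proof. by rewrite /lform !mxE /=; ring. Qed.

Lemma lcross_sq u v :
  lform (lcross u v) (lcross u v) = lform u v ^+ 2 - lform u u * lform v v.
Proof. by rewrite /lform !mxE /=; ring. Qed.

(** The witness is the image of the second basis vector under the boost that carries the base point
    of the hyperboloid to [u]. *)
Lemma tangent_exists u : hplane u -> exists e, lform e e = 1 /\ lform u e = 0.
Proof.
move=> [uu u0].
have u1 : 1 + u 0 0 != 0 by rewrite gt_eqF// addr_gt0.
exists (\row_(j < 3) if j == 0 then u 0 1 else
   if j == 1 then 1 + u 0 1 ^+ 2 / (1 + u 0 0) else u 0 1 * u 0 2%:R / (1 + u 0 0)).
have h : u 0 2%:R ^+ 2 = u 0 0 ^+ 2 - u 0 1 ^+ 2 - 1.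
  by move: uu; rewrite /lform => uu; nra.
split; rewrite /lform !mxE /=; apply/eqP; rewrite -subr_eq0; apply/eqP.
  have -> : u 0 1 * u 0 2%:R / (1 + u 0 0) * (u 0 1 * u 0 2%:R / (1 + u 0 0)) =
    u 0 1 ^+ 2 * u 0 2%:R ^+ 2 / (1 + u 0 0) ^+ 2 by field.
  by rewrite h; field.
have -> : u 0 2%:R * (u 0 1 * u 0 2%:R / (1 + u 0 0)) =
   u 0 1 * u 0 2%:R ^+ 2 / (1 + u 0 0) by field.
by rewrite h; field.
Qed.

Definition geod u e t : 'rV[R]_3 := cosh t *: u + sinh t *: e.

Definition frame u e := [/\ hplane u, lform e e = 1 & lform u e = 0].

Lemma geod0 u e : geod u e 0 = u.
Proof. by rewrite /geod cosh0 sinh0 scale1r scale0r addr0. Qed.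

Lemma geod_lform u e s t : frame u e -> - lform (geod u e s) (geod u e t) = cosh (s - t).
Proof.
case=> [[uu _] ee ue]; rewrite /geod !lformE uu ee ue (lformC e u) ue coshB; ring.
Qed.

Lemma geod_hplane u e t : frame u e -> hplane (geod u e t).
Proof.
move=> fr; split.
  by rewrite -[LHS]opprK geod_lform// subrr cosh0.
case: fr => -[uu u0] ee ue; rewrite !mxE.
have : `|e 0 0| < u 0 0.
  rewrite -(@ltr_pXn2r _ 2)// ?nnegrE ?normr_ge0 ?ltW// real_normK ?num_real//.
  move: uu u0 ee ue; rewrite /lform.
  move: (u 0 0) (u 0 1) (u 0 2%:R) (e 0 0) (e 0 1) (e 0 2%:R) => a b c x y z.
  move=> uu a0 ee ue.
  have : (a * x) ^+ 2 <= (a ^+ 2 - 1) * (x ^+ 2 + 1).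
    have -> : a * x = b * y + c * z by lra.
    have -> : a ^+ 2 - 1 = b ^+ 2 + c ^+ 2 by nra.
    have -> : x ^+ 2 + 1 = y ^+ 2 + z ^+ 2 by nra.
    by have := sqr_ge0 (b * z - c * y); nra.
  by nra.
have := abs_sinh_lt t; have := cosh_gt0 t.
rewrite !ltr_norml => c0 /andP[h1 h2] /andP[h3 h4].
have e0 := mulr_gt0 c0 u0; move: (cosh t) (sinh t) (e 0 0) (u 0 0) c0 h1 h2 h3 h4 u0 e0 => c s x a.
move=> c0 h1 h2 h3 h4 u0 e0.
by have [x0|x0] := lerP 0 x; nra.
Qed.

Lemma geod_dist u e s t : frame u e -> hdist (geod u e s) (geod u e t) = `|s - t|.
Proof.
move=> fr; apply: hdistP; rewrite ?normr_ge0//; try exact: geod_hplane.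
by rewrite cosh_norm geod_lform.
Qed.

Lemma hdist_eq0 u v : hplane u -> hplane v -> hdist u v = 0 -> u = v.
Proof.
move=> hu hv d0.
have k : lform u v = -1 by rewrite -[LHS]opprK -cosh_hdist// d0 cosh0.
case: hu hv => uu u0 [vv v0].
move: k uu vv u0 v0; rewrite /lform => k uu vv u0 v0.
have h : u 0 1 * v 0 0 = u 0 0 * v 0 1 /\ u 0 2%:R * v 0 0 = u 0 0 * v 0 2%:R.
  have : (u 0 1 * v 0 0 - u 0 0 * v 0 1) ^+ 2 + (u 0 2%:R * v 0 0 - u 0 0 * v 0 2%:R) ^+ 2 <= 0.
    move: (u 0 0) (u 0 1) (u 0 2%:R) (v 0 0) (v 0 1) (v 0 2%:R) k uu vv u0 v0.
    move=> a b c a' b' c' k uu vv a0 a'0.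
    have -> : (b * a' - a * b') ^+ 2 + (c * a' - a * c') ^+ 2 =
      (b ^+ 2 + c ^+ 2) * a' ^+ 2 + (b' ^+ 2 + c' ^+ 2) * a ^+ 2
      - 2 * a * a' * (b * b' + c * c') by ring.
    have -> : b ^+ 2 + c ^+ 2 = a ^+ 2 - 1 by nra.
    have -> : b' ^+ 2 + c' ^+ 2 = a' ^+ 2 - 1 by nra.
    have -> : b * b' + c * c' = a * a' - 1 by lra.
    by have := sqr_ge0 (a - a'); nra.
  have := sqr_ge0 (u 0 1 * v 0 0 - u 0 0 * v 0 1).
  have := sqr_ge0 (u 0 2%:R * v 0 0 - u 0 0 * v 0 2%:R).
  move=> h1 h2 h3; split; apply/eqP; rewrite -subr_eq0 -sqrf_eq0; apply/eqP; lra.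
have e0 : u 0 0 = v 0 0.
  have [h1 h2] := h.
  have : (u 0 0 - v 0 0) * (u 0 0 + v 0 0) = 0.
    have -> : (u 0 0 - v 0 0) * (u 0 0 + v 0 0) = u 0 0 ^+ 2 - v 0 0 ^+ 2 by ring.
    have e1 : u 0 0 ^+ 2 * (v 0 1 ^+ 2 + v 0 2%:R ^+ 2) = (u 0 1 ^+ 2 + u 0 2%:R ^+ 2) * v 0 0 ^+ 2.
      by rewrite mulrDr mulrDl -!exprMn h1 h2.
    have e2 : v 0 1 ^+ 2 + v 0 2%:R ^+ 2 = v 0 0 ^+ 2 - 1 by nra.
    have e3 : u 0 1 ^+ 2 + u 0 2%:R ^+ 2 = u 0 0 ^+ 2 - 1 by nra.
    by move: e1; rewrite e2 e3; nra.
  by move/eqP; rewrite mulf_eq0 => /orP[/eqP|/eqP]; lra.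
have u00 : u 0 0 != 0 by rewrite gt_eqF.
case: h; rewrite -e0 => h1 h2.
by apply: row3P => //; apply: (mulfI u00); rewrite mulrC ?h1 ?h2.
Qed.

Lemma geod_exists u v : hplane u -> hplane v ->
  exists2 e, frame u e & v = geod u e (hdist u v).
Proof.
move=> hu hv; have [uv|uv] := eqVneq (hdist u v) 0.
  have [e [ee ue]] := tangent_exists hu; exists e => //.
  by rewrite uv geod0; apply/esym/hdist_eq0.
have d0 : 0 < hdist u v by rewrite lt_neqAle eq_sym uv hdist_ge0.
have s0 := sinh_gt0 d0; set d := hdist u v in s0 *.
have s1 : sinh d != 0 by rewrite gt_eqF.
have cd : lform u v = - cosh d by rewrite cosh_hdist// opprK.
exists ((sinh d)^-1 *: (v - cosh d *: u)).
  split=> //; first last.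
    by case: hu => uu _; rewrite !lformE uu cd; ring.
  case: hu hv => uu _ [vv _].
  rewrite !lformE uu (lformC v u) cd vv.
  transitivity ((sinh d)^-1 ^+ 2 * (cosh d ^+ 2 - 1)); first by ring.
  by rewrite -sqr_sinh; field.
by rewrite /geod scalerA divff// scale1r addrC subrK.
Qed.

(** Along a geodesic, [cosh] of the distance to [q] is a combination of [cosh s] and [sinh s], hence
    determined by its values at [0] and [L]. *)
Lemma geod_stewart u e q L s : frame u e -> hplane q ->
  sinh L * cosh (hdist q (geod u e s)) =
  sinh (L - s) * cosh (hdist q u) + sinh s * cosh (hdist q (geod u e L)).
Proof.
move=> fr hq; rewrite !cosh_hdist//; try exact: geod_hplane; last by case: fr.
by rewrite /geod !lformE sinhB; ring.
Qed.

(** The hyperbolic Pythagoras theorem: [lcross u e] is orthogonal to all the points of the geodesic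
    and directs the perpendicular at each of them. *)
Lemma perp_exists u e t : frame u e -> exists2 e', frame (geod u e t) e' &
  forall s t', cosh (hdist (geod u e t') (geod (geod u e t) e' s)) =
               cosh s * cosh (t' - t).
Proof.
move=> fr; have hp := geod_hplane _ fr.
have [[uu u0] ee ue] := fr.
have c0 : lform (lcross u e) (lcross u e) = 1 by rewrite lcross_sq uu ee ue; ring.
have fr' : frame (geod u e t) (lcross u e).
  split=> //.
  by rewrite !lformE lformC lcross_l (lformC e) lcross_r; ring.
exists (lcross u e) => // s t'.
rewrite cosh_hdist//; try exact: geod_hplane.
rewrite {2}/geod lformDr !lformZr (_ : lform (geod u e t') (lcross u e) = 0); last first.
  by rewrite !lformE lformC lcross_l (lformC e) lcross_r; ring.
by rewrite mulr0 addr0 -mulrN geod_lform.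
Qed.

End lorentz.

Section finite_sets.

Lemma finite_set_inj T U (A : set T) (B : set U) (g : T -> U) :
  finite_set B -> (forall a, A a -> B (g a)) ->
  (forall a b, A a -> A b -> g a = g b -> a = b) -> finite_set A.
Proof.
move=> finB AB ginj.
apply: (@sub_finite_set _ _ (\bigcup_(b in B) [set a | A a /\ g a = b])).
  by move=> a Aa; exists (g a) => //; exact: AB.
apply: bigcup_finite => // b _.
have [[a [Aa <-]]|none] := pselect (exists a, A a /\ g a = b).
  by apply: (@sub_finite_set _ _ [set a]) => // c [Ac /(ginj _ _ Ac Aa)].
by rewrite (_ : mkset _ = set0)//; apply/seteqP; split=> // a /= h; apply: none; exists a.
Qed.

Lemma finite_set_argmin (R : realType) T (A : set T) (f : T -> R) :
  finite_set A -> A !=set0 -> exists2 a, A a & forall b, A b -> f a <= f b.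
Proof.
elim/Pchoice: T => T in A f * => /finite_seqP[s ->] [a0 /= a0s].
suff : forall s : seq T, s != [::] -> exists2 a, a \in s & forall b, b \in s -> f a <= f b.
  by case/(_ s); [case: s a0s|move=> a; exists a].
elim=> // a {a0 a0s}s IH _.
have [->|/IH[b bs hb]] := eqVneq s [::].
  by exists a; rewrite ?mem_head// => b; rewrite inE => /eqP ->.
have [ab|ba] := lerP (f a) (f b).
  exists a; rewrite ?mem_head// => c; rewrite inE => /orP[/eqP->//|/hb].
  exact: le_trans.
exists b; rewrite ?inE ?bs ?orbT// => c; rewrite inE => /orP[/eqP->|/hb//].
exact: ltW.
Qed.

Lemma finite_set_eps (R : realType) T (A : set T) (Q : T -> R -> Prop) :
  finite_set A -> (forall a e e', 0 < e' -> e' <= e -> Q a e -> Q a e') ->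
  (forall a, A a -> exists2 e, 0 < e & Q a e) ->
  exists2 e, 0 < e & forall a, A a -> Q a e.
Proof.
elim/Pchoice: T => T in A Q *; move=> /finite_seqP[s ->] mono; elim: s => [|a s IH] h.
  by exists 1.
have [|e e0 he] := IH; first by move=> b bs; apply: h; rewrite /= inE bs orbT.
have [|d d0 hd] := h a; first by rewrite /= mem_head.
exists (Num.min d e) => [|b]; first by rewrite lt_min d0.
have m0 : 0 < Num.min d e by rewrite lt_min d0.
rewrite /= inE => /orP[/eqP ->|bs].
  by apply: mono hd => //; rewrite ge_min lexx.
by apply: mono (he _ bs) => //; rewrite ge_min lexx orbT.
Qed.

End finite_sets.

(** * Tessellations and apartments *)

Section coxeter_group_theory.
Variables (R : realType) (P : coxeter_polygon R).
Implicit Types (u v x y z : 'rV[R]_3) (w : 'rV[R]_3 -> 'rV[R]_3).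
Local Notation W := (coxeter_group P).
Local Notation nrm := (@outer_normal R P).
Local Notation sideP := (@side R P).

Definition lorentz_map w :=
  [/\ forall a u v, w (a *: u + v) = a *: w u + w v,
      forall u v, lform (w u) (w v) = lform u v
    & forall u, hplane u -> hplane (w u)].

Lemma reflection_lorentz (e : 'rV[R]_3) : lform e e = 1 -> lorentz_map (reflection e).
Proof.
move=> ee; have pres u v : lform (reflection e u) (reflection e v) = lform u v.
  by rewrite /reflection !lformE ee (lformC e v); ring.
split=> //.
- by move=> a u v; rewrite /reflection !lformE; apply/rowP => j; rewrite !mxE; ring.
- move=> u hu; have [uu u0] := hu; split; first by rewrite pres.
  rewrite ltNge; apply/negP => neg.
  have uu' : lform (reflection e u) (reflection e u) = -1 by rewrite pres.
  have uv : lform u (reflection e u) <= -1.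
    by rewrite /reflection !lformE uu; have := sqr_ge0 (lform u e); nra.
  have n0 : reflection e u 0 0 != 0.
    apply/eqP => z0; move: uu'; rewrite {1}/lform z0.
    have := sqr_ge0 (reflection e u 0 1); have := sqr_ge0 (reflection e u 0 2%:R); nra.
  have : hplane (- reflection e u).
    split; first by rewrite lformNl lformNr uu' opprK.
    by rewrite mxE oppr_gt0 lt_neqAle n0.
  by move=> /(hplane_le hu); rewrite lformNr; lra.
Qed.

Lemma reflectionK (e : 'rV[R]_3) : lform e e = 1 -> involutive (reflection e).
Proof.
move=> ee u; rewrite /reflection !lformE ee; apply/rowP => j; rewrite !mxE; ring.
Qed.

Lemma W_refl i : W (reflection (nrm i)).
Proof. exact: (coxeter_groupM i (coxeter_group1 P)). Qed.

Lemma W_lorentz w : W w -> lorentz_map w.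
Proof.
elim=> [|i v _ [h1 h2 h3]]; first by split.
have [g1 g2 g3] := reflection_lorentz (normal_unit i).
split=> [a x y|x y|x /h3 /g3//] /=; first by rewrite h1 g1.
by rewrite g2.
Qed.

Lemma W_comp w w' : W w -> W w' -> W (w \o w').
Proof.
move=> Ww Ww'; elim: Ww => [//|i v _ IH].
exact: (coxeter_groupM i IH).
Qed.

Lemma W_inv w : W w -> exists w', [/\ W w', cancel w w' & cancel w' w].
Proof.
elim=> [|i v _ [v' [Wv' h1 h2]]]; first by exists id; split=> //; exact: coxeter_group1.
exists (v' \o reflection (nrm i)); split.
- exact: W_comp (W_refl i).
- by move=> x /=; rewrite reflectionK ?normal_unit// h1.
- by move=> x /=; rewrite h2 reflectionK ?normal_unit.
Qed.

(** [coxeter_group] grows by generators on the left, whereas neighbouring tiles differ by a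
    generator on the right. *)
Lemma W_ind_r (Q : ('rV[R]_3 -> 'rV[R]_3) -> Prop) : Q id ->
  (forall w i, W w -> Q w -> Q (w \o reflection (nrm i))) -> forall w, W w -> Q w.
Proof.
move=> Q1 QM; suff H : forall w, W w -> forall v : 'rV[R]_3 -> 'rV[R]_3, W v -> Q v -> Q (v \o w).
  by move=> w Ww; exact: (H w Ww id (coxeter_group1 P)).
move=> w; elim=> [//|i w' _ IH] v Wv Qv.
apply: (IH (v \o reflection (nrm i))); last exact: QM.
by apply: W_comp => //; exact: W_refl.
Qed.

Lemma W_inj w : W w -> injective w.
Proof. by move=> /W_inv[w' [_ h _]]; exact: can_inj h. Qed.

Lemma W_hdist w u v : W w -> hdist (w u) (w v) = hdist u v.
Proof. by move=> /W_lorentz[_ h _]; rewrite /hdist h. Qed.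

Lemma W_hplane w u : W w -> hplane u -> hplane (w u).
Proof. by move=> /W_lorentz[_ _]; apply. Qed.

Lemma polygon_hplane x : polygon P x -> hplane x. Proof. by case. Qed.

Definition inside : set 'rV[R]_3 := [set o | hplane o /\ forall i, lform o (nrm i) < 0].

Lemma inside_polygon o : inside o -> polygon P o.
Proof. by move=> [ho h]; split=> // i; exact: ltW. Qed.

Lemma inside_side o x i : inside o -> sideP i o -> sideP i x.
Proof. by move=> [_ h] [_]; have := h i => /[swap] ->; rewrite ltxx. Qed.

Lemma side_polygon i x : sideP i x -> polygon P x. Proof. by case. Qed.

Lemma reflection_side i x : sideP i x -> reflection (nrm i) x = x.
Proof. by move=> [_ h]; rewrite /reflection h mulr0 scale0r subr0. Qed.

Lemma reflection_inside i o : inside o -> reflection (nrm i) o <> o.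
Proof.
move=> [_ h] e; have := congr1 (fun z => lform z (nrm i)) e.
by rewrite /reflection !lformE normal_unit; have := h i; lra.
Qed.

(** Two distinct points of a side are linearly independent, so their orthogonal is a line, and it
    contains the normal of the side. *)
Lemma orth_side i u v z : sideP i u -> sideP i v -> u <> v ->
  lform z u = 0 -> lform z v = 0 -> z = lform z (nrm i) *: nrm i.
Proof.
move=> [pu eu] [pv ev] uv zu zv.
have ee := normal_unit i; set e := nrm i in eu ev ee *.
have hu := polygon_hplane pu; have hv := polygon_hplane pv.
have c0 : lform (lcross u v) (lcross u v) != 0.
  have [uu _] := hu; have [vv _] := hv.
  rewrite lcross_sq uu vv.
  have d0 : 0 < hdist u v.
    rewrite lt_neqAle hdist_ge0// andbT eq_sym; apply/eqP.
    by move/(hdist_eq0 hu hv).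
  have := cosh_hdist hu hv; have := sinh_gt0 d0; have := sqr_sinh (hdist u v).
  by move=> h1 h2 h3; rewrite gt_eqF// -[lform u v]opprK -h3; nra.
have par y : lform y u = 0 -> lform y v = 0 ->
   lform (lcross u v) (lcross u v) *: y = lform y (lcross u v) *: lcross u v.
  have [uu _] := hu; have [vv _] := hv.
  move=> yu yv.
  suff -> : lform (lcross u v) (lcross u v) *: y = lform y (lcross u v) *: lcross u v
     + lform y u *: (lform u v *: v - lform v v *: u)
     + lform y v *: (lform u v *: u - lform u u *: v).
    by rewrite yu yv !scale0r !addr0.
  by apply: row3P; rewrite /lform !mxE /=; ring.
have pz := par z zu zv.
have pe := par e (etrans (lformC _ _) eu) (etrans (lformC _ _) ev).
have ne : lform e (lcross u v) != 0.
  apply/eqP => h; move: pe; rewrite h scale0r => /eqP.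
  rewrite scaler_eq0 (negPf c0) /= => /eqP e0.
  by move: ee; rewrite e0 /lform !mxE; lra.
have -> : z = (lform z (lcross u v) / lform e (lcross u v)) *: e.
  apply: (scalerI c0); rewrite pz scalerA mulrC -scalerA pe scalerA.
  by rewrite divfK.
by rewrite lformZl ee mulr1.
Qed.

(** Such a map fixes the plane spanned by the side, hence preserves the line of the normal and acts
    on it by 1 or by -1. *)
Lemma lorentz_fix_side i g : lorentz_map g -> (forall x, sideP i x -> g x = x) ->
  (g =1 id) \/ (g =1 reflection (nrm i)).
Proof.
move=> [glin gl _] fx.
have [u [v [su sv uv]]] := side_nondegenerate i.
have gu := fx _ su; have gv := fx _ sv.
have [_ eu] := su; have [_ ev] := sv.
pose e := nrm i; have ee := normal_unit i.
have ge : g e = lform (g e) e *: e.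
  by apply: (orth_side su sv uv); rewrite -1?gu -1?gv gl lformC.
have k2 : lform (g e) e ^+ 2 = 1.
  by have := gl e e; rewrite ge !lformE ee => h; nra.
have key x : g x - x = (lform (g x) e - lform x e) *: e.
  rewrite (orth_side su sv uv (z := g x - x)) ?lformE//.
  - by rewrite -{1}gu gl subrr.
  - by rewrite -{1}gv gl subrr.
have gxe x : lform (g x) e = lform (g e) e * lform x e.
  by rewrite -(gl x e) {2}ge lformZr mulrA -expr2 k2 mul1r.
have : (lform (g e) e == 1) || (lform (g e) e == -1) by rewrite -sqrf_eq1 k2.
case/orP => /eqP k; [left|right] => x; have := key x; rewrite gxe k.
  by rewrite mul1r subrr scale0r => /eqP; rewrite subr_eq0 => /eqP.
by move/eqP; rewrite subr_eq => /eqP ->; rewrite /reflection; apply/rowP => j; rewrite !mxE; ring.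
Qed.

Lemma lorentz_fix_polygon g : (0 < nsides P)%N -> lorentz_map g ->
  (forall x, polygon P x -> g x = x) -> g =1 id.
Proof.
move=> n0 gl fx; pose i := Ordinal n0.
have [//|h] := lorentz_fix_side gl (fun x (sx : sideP i x) => fx x (side_polygon sx)).
have [ o io] := polygon_interior P.
by case: (reflection_inside (i := i) io); rewrite -h fx//; exact: inside_polygon.
Qed.

Lemma lform_lt_near u e a : hplane u -> lform u e < a ->
  exists2 eps : R, 0 < eps & forall v, hplane v -> hdist u v < eps -> lform v e < a.
Proof.
move=> hu ue; set d := a - lform u e.
have d0 : 0 < d by rewrite subr_gt0.
pose K := lform e e + 2 * lform e u ^+ 2.
have K0 : 0 <= K.
  by case: hu => uu _; have := lform_pd e uu; have := sqr_ge0 (lform e u); rewrite /K; lra.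
(* For [cosh] below [1 + k <= 2], [lform_near] bounds the squared variation by [2 * k * 3 * K]; the
   factor 7 leaves a strict inequality. *)
pose k := Num.min 1 (d ^+ 2 / (7 * (K + 1))).
have k0 : 0 < k by rewrite lt_min ltr01 divr_gt0 ?mulr_gt0 ?exprn_gt0//; lra.
have k1 : k <= 1 by rewrite ge_min lexx.
have k2 : k * (7 * (K + 1)) <= d ^+ 2.
  rewrite -ler_pdivlMr; last by rewrite mulr_gt0//; lra.
  by rewrite ge_min lexx orbT.
exists (arcosh (1 + k)) => [|v hv duv].
  rewrite lt_neqAle arcosh_ge0 ?lerDl ?ltW// andbT; apply/eqP => h.
  have := @arcoshK R (1 + k); rewrite -h cosh0 => /(_ _); lra.
have dk : cosh (hdist u v) < 1 + k.
  by rewrite -(@arcoshK R (1 + k)) ?lerDl ?ltW// cosh_lt ?hdist_ge0.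
have := lform_near e hu hv; have := cosh_ge1 (hdist u v).
move: (cosh _) dk => c dk c1; rewrite -/K => h.
rewrite ltNge; apply/negP => le_a.
have : d ^+ 2 <= (lform v e - lform u e) ^+ 2.
  have h1 : d <= lform v e - lform u e by rewrite /d lerD2r.
  by rewrite ler_pXn2r// nnegrE ?(le_trans (ltW d0) h1)// ltW.
have : 2 * (c - 1) * (c + 1) * K <= 6 * k * K.
  by rewrite ler_wpM2r//; nra.
nra.
Qed.

Lemma inside_near o : inside o ->
  exists2 eps : R, 0 < eps & forall v, hplane v -> hdist o v < eps -> polygon P v.
Proof.
move=> [ho io].
pose Q (i : 'I_(nsides P)) (e : R) := forall v, hplane v -> hdist o v < e -> lform v (nrm i) < 0.
have [|a e e' _ ee' h v hv /lt_le_trans/(_ ee')|i _|e e0 he] := @finite_set_eps R _ setT Q.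
- exact: finite_finset.
- exact: h.
- exact: lform_lt_near.
- by exists e => // v hv dv; split=> // i; apply: ltW; exact: (he i I v hv dv).
Qed.

Lemma polygon_bounded o : hplane o ->
  exists2 D : R, 0 <= D & forall y, polygon P y -> hdist o y <= D.
Proof.
move=> ho; have /compact_bounded [M [_ HM]] := @polygon_compact R P.
pose N := Num.max 1 (M + 1).
have bd y j : polygon P y -> `|y 0 j| <= N.
  move=> py; have MN : M < N by rewrite lt_max ltrDl ltr01 orbT.
  by apply: le_trans (HM _ MN y py); rewrite [leRHS]mx_normrE; 
  exact: (le_bigmax_cond 0 (fun ij : 'I_1 * 'I_3 => `|y ij.1 ij.2|) (j := (0, j))).
pose K := (`|o 0 0| + `|o 0 1| + `|o 0 2%:R|) * N.
exists (arcosh (Num.max 1 K)) => [|y py]; first by rewrite arcosh_ge0// le_max lexx.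
have hy := polygon_hplane py.
rewrite -cosh_le ?hdist_ge0 ?arcosh_ge0 ?le_max ?lexx// arcoshK ?le_max ?lexx//.
apply/orP; right; rewrite cosh_hdist// /lform /K !mulrDl !opprD opprK.
have p j : `|o 0 j * y 0 j| <= `|o 0 j| * N by rewrite normrM ler_wpM2l// bd.
have := p 0; have := p 1; have := p 2%:R; rewrite !ler_norml.
by move=> /andP[h1 h2] /andP[h3 h4] /andP[h5 h6]; lra.
Qed.

End coxeter_group_theory.

Section tessellation.
Variables (R : realType) (P : coxeter_polygon R).
Implicit Types (u v x y z : 'rV[R]_3) (w : 'rV[R]_3 -> 'rV[R]_3).
Local Notation W := (coxeter_group P).
Local Notation nrm := (@outer_normal R P).
Local Notation sideP := (@side R P).

(** The tessellation properties used below: a point has the same coordinate in all its tiles, and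
    tiles that share a point share the face carrying it. Both are read off an apartment in
    [apt_chart_tess]. *)
Definition strict_tessellation :=
  (forall w w' x y, W w -> W w' -> polygon P x -> polygon P y ->
     w x = w' y -> x = y) /\
  (forall w w' x y, W w -> W w' -> polygon P x -> polygon P y -> w x = w' x ->
     (forall i, sideP i x -> sideP i y) -> w y = w' y).

Hypothesis tess : strict_tessellation.

(** A translate of [o] near [w o] lies in the tile of [w], where [w o] is the only point with the
    coordinate of [o]. *)
Lemma orbit_separated o : inside P o ->
  exists2 eps : R, 0 < eps & forall w w', W w -> W w' ->
    hdist (w o) (w' o) < eps -> w o = w' o.
Proof.
move=> io; have [e e0 he] := inside_near io.
exists e => // w w' Ww Ww' d.
have [v [Wv wv vw]] := W_inv Ww.
have po := inside_polygon io.
have px : polygon P (v (w' o)).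
  apply: he; last by rewrite -(W_hdist _ _ Ww) vw.
  exact: (W_hplane Wv (W_hplane Ww' (polygon_hplane po))).
have [h _] := tess.
have oE : o = v (w' o) by apply: (h w' w) => //; rewrite vw.
by rewrite [in LHS]oE vw.
Qed.

(** Pigeonhole on a grid in the last two coordinates: two translates in one cell are closer than the
    separation constant. *)
Lemma orbit_finite o u r : inside P o -> hplane u ->
  finite_set [set z | exists2 w, W w & z = w o /\ hdist u z <= r].
Proof.
move=> io hu; have [e e0 sep] := orbit_separated io.
have ho := polygon_hplane (inside_polygon io).
have [uu u0] := hu.
pose b : 'rV[R]_3 := \row_(j < 3) (j == 0)%:R.
have hb : hplane b by split; rewrite /lform !mxE /= ?ltr01//; ring.
pose M := cosh (hdist b u + `|r|).
have M1 : 1 <= M := cosh_ge1 _.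
have bd z j : hplane z -> hdist u z <= r -> `|z 0 j| <= M.
  move=> hz dz.
  have z0M : z 0 0 <= M.
    have -> : z 0 0 = cosh (hdist b z) by rewrite cosh_hdist// /lform !mxE /=; ring.
    rewrite cosh_le ?hdist_ge0 ?addr_ge0 ?hdist_ge0//.
    rewrite (le_trans (hdist_triangle hb hu hz))// lerD2l.
    by rewrite (le_trans dz)// ler_norm.
  have [zz z0] := hz.
  have h : z 0 j ^+ 2 <= z 0 0 ^+ 2.
    have : [|| j == 0, j == 1 | j == 2%:R] by case: j => -[|[|[|]]].
    by move: zz; rewrite /lform => zz /or3P[] /eqP ->; nra.
  apply: le_trans z0M; rewrite -(@ler_pXn2r _ 2)// ?nnegrE ?normr_ge0 ?(ltW z0)//.
  by rewrite real_normK ?num_real.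
(* Points of one cell satisfy [cosh (hdist z z') < 1 + eta ^ 2], and [eta <= 1] gives
   [eta ^ 2 <= eta]. *)
pose eta := Num.min 1 (cosh e - 1).
have ch1 : 1 < cosh e by rewrite -(@cosh0 R) cosh_lt.
have eta0 : 0 < eta by rewrite lt_min ltr01 subr_gt0.
have eta1 : eta <= 1 by rewrite ge_min lexx.
have eta2 : 1 + eta ^+ 2 <= cosh e.
  have : eta <= cosh e - 1 by rewrite ge_min lexx orbT.
  by nra.
pose cell (z : 'rV[R]_3) (j : 'I_3) := Num.truncn ((z 0 j + M) / eta).
pose N := (Num.truncn ((M + M) / eta)).+1.
apply: (@finite_set_inj _ _ _ (`I_N `*` `I_N) (fun z => (cell z 1, cell z 2%:R))).
- exact: finite_setX.
- move=> z [w Ww [zw dz]]; have hz : hplane z by rewrite zw; exact: (W_hplane Ww ho).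
  have cN j : (cell z j < N)%N.
    have := bd z j hz dz; rewrite ler_norml => /andP[lo hi].
    have h0 : 0 <= (z 0 j + M) / eta by rewrite divr_ge0 ?(ltW eta0)//; lra.
    have h1 : (z 0 j + M) / eta <= (M + M) / eta.
      by rewrite ler_pM2r ?invr_gt0// lerD2r.
    have /andP[c1 _] := truncn_itv h0; have /andP[_ c2] := truncn_itv (le_trans h0 h1).
    by rewrite -(ltr_nat R) (le_lt_trans c1)// (le_lt_trans h1).
  by split => /=; exact: cN.
- move=> z z' [w Ww [zw dz]] [w' Ww' [zw' dz']] [c1 c2].
  have hz : hplane z by rewrite zw; exact: (W_hplane Ww ho).
  have hz' : hplane z' by rewrite zw'; exact: (W_hplane Ww' ho).
  rewrite zw zw'; apply: sep => //; rewrite -zw -zw'.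
  have cl j : cell z j = cell z' j -> (z 0 j - z' 0 j) ^+ 2 < eta ^+ 2.
    move=> c; have nn y : hplane y -> hdist u y <= r -> 0 <= (y 0 j + M) / eta.
      move=> hy dy; rewrite divr_ge0 ?(ltW eta0)//.
      by have := bd y j hy dy; rewrite ler_norml => /andP[]; lra.
    have := truncn_itv (nn z hz dz); have := truncn_itv (nn z' hz' dz').
    rewrite -!/(cell _ _) c !ler_pdivlMr// !ltr_pdivrMr// => /andP[h1 h2] /andP[h3 h4].
    rewrite -[ltLHS]real_normK ?num_real// ltr_pXn2r// ?nnegrE ?ltW//.
    by rewrite ltr_norml; move: h1 h2 h3 h4; rewrite -natr1 mulrDl mul1r; lra.
  rewrite ltNge; apply/negP => ed.
  have : cosh e <= cosh (hdist z z') by rewrite cosh_le ?hdist_ge0 ?(ltW e0).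
  rewrite cosh_hdist//; apply/negP; rewrite -ltNge; apply: lt_le_trans eta2.
  have := cl _ c1; have := cl _ c2; have [zz _] := hz; have [zz' _] := hz'.
  have := sqr_ge0 (z 0 0 - z' 0 0); move: zz zz'; rewrite /lform => zz zz'.
  have h : - (- (z 0 0 * z' 0 0) + z 0 1 * z' 0 1 + z 0 2%:R * z' 0 2%:R) =
    1 + ((z 0 1 - z' 0 1) ^+ 2 + (z 0 2%:R - z' 0 2%:R) ^+ 2 - (z 0 0 - z' 0 0) ^+ 2) / 2.
    by lra.
  by rewrite h; lra.
Qed.

(* Among the translates of an interior point [o] the one closest to [v]
   determines a chamber that contains [v]. *)
Lemma tessellation_cover v : hplane v -> exists2 w, W w & exists2 x, polygon P x & v = w x.
Proof.
move=> hv; have [ o io] := polygon_interior P.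
have ho := polygon_hplane (inside_polygon io).
have [|z [w Ww [zw _]] zmin] := finite_set_argmin (hdist v)
  (orbit_finite (hdist v o) io hv).
- by exists o, id => //; exact: coxeter_group1.
have {}zmin w' : W w' -> hdist v z <= hdist v (w' o).
  move=> Ww'; have [le_o|/ltW lt_o] := lerP (hdist v (w' o)) (hdist v o).
    by apply: zmin; exists w'.
  apply: le_trans lt_o; apply: zmin; exists id => //; exact: coxeter_group1.
exists w => //; have [w' [Ww' ww' w'w]] := W_inv Ww.
exists (w' v); last by rewrite w'w.
have hw'v := W_hplane Ww' hv.
split=> // i.
have := zmin (w \o reflection (nrm i)) (W_comp Ww (W_refl i)).
rewrite zw -(W_hdist v (w o) Ww') -(W_hdist v _ Ww') /= !ww'.
have hro := W_hplane (W_refl i) ho.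
rewrite -cosh_le ?hdist_ge0// !cosh_hdist// /reflection !lformE.
by have [_ /(_ i)] := io; nra.
Qed.

Lemma W_inside_eq o w w' x : inside P o -> W w -> W w' -> w o = w' o ->
  polygon P x -> w x = w' x.
Proof.
move=> io Ww Ww' h px; have [_ t2] := tess.
by apply: (t2 w w' o x) => // [|i]; [exact: inside_polygon|exact: inside_side].
Qed.

(** Finitely many tiles come near [x]. If a tile misses [x], the preimage of [x] violates a side
    inequality of the polygon, and this persists under a small move. *)
Lemma tessellation_star x : polygon P x ->
  exists2 eps : R, 0 < eps & forall w v, W w -> hplane v -> hdist (w x) v < eps ->
    exists2 w', W w' & exists2 y, polygon P y & v = w' y /\ w' x = w x.
Proof.
move=> px; have [ o io] := polygon_interior P.
have hx := polygon_hplane px; have ho := polygon_hplane (inside_polygon io).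
have [D D0 hD] := polygon_bounded P ho.
pose Q z e := forall w y, W w -> polygon P y -> w o = z -> hdist x (w y) < e -> w x = x.
have [a e e' _ ee' h w y Ww py wa /lt_le_trans/(_ ee')|z [w Ww [-> _]]|e e0 he] :=
  @finite_set_eps R _ _ Q (orbit_finite (1 + D) io hx).
- exact: h.
- have [wx|wx] := pselect (w x = x).
    exists 1 => // w' y Ww' py wo _.
    by rewrite (W_inside_eq io Ww' Ww wo).
  have [w' [Ww' ww' w'w]] := W_inv Ww.
  have : ~ polygon P (w' x).
    move=> pw'; apply: wx; have [t1 _] := tess.
    have xE : x = w' x.
      apply: (t1 id w) => //; exact: coxeter_group1.
    by rewrite [in LHS]xE w'w.
  move=> /not_andP[/(_ (W_hplane Ww' hx))//|/existsNP[i /negP]].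
  rewrite -ltNge => lti.
  have [||e e0 he] := @lform_lt_near R (w' x) (- nrm i) 0; first exact: (W_hplane Ww' hx).
    by rewrite lformE oppr_lt0.
  exists e => // w1 y Ww1 py w1o.
  rewrite (W_inside_eq io Ww1 Ww w1o)// -(W_hdist _ _ Ww') ww' => /he.
  move=> /(_ (polygon_hplane py)); rewrite lformE oppr_lt0.
  by rewrite ltNge; have [_ ->] := py.
exists (Num.min 1 e) => [|w v Ww hv]; first by rewrite lt_min ltr01.
rewrite lt_min => /andP[d1 de].
have [w' [Ww' ww' w'w]] := W_inv Ww.
have [w1 Ww1 [y py vE]] := tessellation_cover (W_hplane Ww' hv).
exists (w \o w1); first exact: W_comp.
exists y => //; split; first by rewrite /= -vE w'w.
have dE : hdist x (w1 y) = hdist (w x) v by rewrite -vE -(W_hdist _ _ Ww) w'w.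
congr (w _); apply: (he (w1 o) _ w1 y) => //; last by rewrite dE.
exists w1 => //; split=> //.
have hw1y := W_hplane Ww1 (polygon_hplane py).
rewrite (le_trans (hdist_triangle hx hw1y (W_hplane Ww1 ho)))// lerD//.
  by rewrite dE ltW.
by rewrite (W_hdist _ _ Ww1) hdistC hD.
Qed.

(** Without sides the polygon would be the whole plane, which is unbounded. *)
Lemma nsides_gt0 : (0 < nsides P)%N.
Proof.
rewrite lt0n; apply/eqP => n0.
have nP i : ~ (i : 'I_(nsides P)) = i by case: (i) => m; rewrite n0.
have all_in v : hplane v -> polygon P v by move=> hv; split=> // i; case: (nP i).
have [ o [ho _]] := polygon_interior P.
have [D D0 hD] := polygon_bounded P ho.
have [e [ee oe]] := tangent_exists ho.
have fr : frame o e by [].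
have := hD (geod o e (D + 1)) (all_in _ (geod_hplane _ fr)).
by rewrite -{1}(geod0 o e) geod_dist// sub0r normrN ger0_norm; lra.
Qed.

End tessellation.

Section apartments.
Variables (R : realType) (P : coxeter_polygon R) (X : polygonal_complex P).
Implicit Types (u v x y z : 'rV[R]_3) (w : 'rV[R]_3 -> 'rV[R]_3) (p q : X)
  (f g : 'rV[R]_3 -> X) (A : set X) (c d : chamber X).
Local Notation W := (coxeter_group P).
Local Notation nrm := (@outer_normal R P).
Local Notation sideP := (@side R P).

Definition apt_chart f :=
  (forall u v, hplane u -> hplane v -> f u = f v -> u = v) /\
  (forall w, W w -> exists c, forall x, polygon P x -> f (w x) = chart c x).

Lemma apartmentP A : apartment A -> exists f, apt_chart f /\ f @` @hplane R = A.
Proof.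
move=> [f [[fA finj fsurj] fW]]; exists f; split.
  by split=> // u v hu hv; apply: finj; rewrite inE.
by apply/seteqP; split=> // p [u hu <-]; exact: fA.
Qed.

Lemma apt_chart_comp f w : apt_chart f -> W w -> apt_chart (f \o w).
Proof.
move=> [finj fW] Ww; split=> [u v hu hv /finj|w' Ww'].
  by move=> /(_ (W_hplane Ww hu) (W_hplane Ww hv))/(W_inj Ww).
exact: (fW _ (W_comp Ww Ww')).
Qed.

Lemma image_comp_W f w : W w -> (f \o w) @` @hplane R = f @` @hplane R.
Proof.
move=> Ww; have [w' [Ww' _ ww']] := W_inv Ww; apply/seteqP; split=> p [u hu <-].
  by exists (w u) => //; exact: W_hplane Ww hu.
by exists (w' u); [exact: W_hplane Ww' hu|rewrite /= ww'].
Qed.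

(** A chart is injective and maps tiles to chambers, so the gluing rules of the complex pass to the
    tiles. *)
Lemma apt_chart_tess f : apt_chart f -> strict_tessellation P.
Proof.
move=> [finj fW]; split=> w w' x y Ww Ww' px py.
  have [c hc] := fW _ Ww; have [c' hc'] := fW _ Ww'.
  move=> e; apply: (@chart_typed _ _ X c c') => //.
  by rewrite -hc// -hc'// e.
have [c hc] := fW _ Ww; have [c' hc'] := fW _ Ww'.
move=> e sxy; apply: finj.
- exact: (W_hplane Ww (polygon_hplane py)).
- exact: (W_hplane Ww' (polygon_hplane py)).
rewrite hc// hc'//; apply: (@chart_face _ _ X c c' x) => //.
by rewrite -hc// -hc'// e.
Qed.

(** An interior point of [d] falls in a tile; as it lies on no side, its image determines the whole
    chamber by [chart_face]. *)
Lemma apt_chamber f d : apt_chart f -> closed_chamber d `<=` f @` @hplane R ->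
  exists2 w, W w & forall x, polygon P x -> chart d x = f (w x).
Proof.
move=> af dA; have tess := apt_chart_tess af.
have [ o io] := polygon_interior P; have po := inside_polygon io.
have [u hu fu] : (f @` @hplane R) (chart d o) by apply: dA; exists o.
have [w Ww [y py uE]] := tessellation_cover tess hu.
exists w => // x px; have [_ /(_ w Ww)[c hc]] := af.
rewrite hc//.
have e : chart d o = chart c y by rewrite -fu uE hc.
have oy := chart_typed po py e.
apply: (@chart_face _ _ X d c o) => //; first by rewrite e oy.
by move=> i; exact: inside_side.
Qed.

(* The reflections and the identity are the only Lorentz maps that fix a side
   pointwise, so a chamber map is determined along galleries. *)
Lemma chamber_map_W f g (phi : X -> X) : apt_chart f -> apt_chart g ->
  (forall u v, hplane u -> hplane v -> phi (f u) = phi (f v) -> u = v) ->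
  (forall w, W w -> exists2 w', W w' & forall x, polygon P x -> phi (f (w x)) = g (w' x)) ->
  exists2 w0, W w0 & forall u, hplane u -> phi (f u) = g (w0 u).
Proof.
move=> af ag inj cm; have tess := apt_chart_tess af.
have [w0 Ww0 hw0] := cm _ (coxeter_group1 P).
exists w0 => // u hu; have [w Ww [x px ->]] := tessellation_cover tess hu.
elim/W_ind_r: w / Ww x px {u hu} => [|w i Ww IH] x px; first exact: hw0.
have Wwi := W_comp Ww (W_refl i); have [w1 Ww1 hw1] := cm _ Wwi.
have [w2 [Ww2 h2 h2']] := W_inv (W_comp Ww0 Ww).
have Wg := W_comp Ww2 Ww1.
have [] := @lorentz_fix_side _ _ i (w2 \o w1) (W_lorentz Wg).
- move=> y sy; have py := side_polygon sy; have hy := polygon_hplane py.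
  have : g (w1 y) = g ((w0 \o w) y).
    by rewrite -hw1//= reflection_side// IH.
  move=> /(proj1 ag _ _ (W_hplane Ww1 hy) (W_hplane (W_comp Ww0 Ww) hy)) e.
  by rewrite /= e h2.
- move=> e; have [ o io] := polygon_interior P.
  have po := inside_polygon io; have ho := polygon_hplane po.
  have w1E : w1 o = w0 (w o) by rewrite -[w1 o]h2'; have /= -> := e o.
  case: (reflection_inside (i := i) io); apply: (W_inj Ww).
  apply: inj.
  + exact: (W_hplane Wwi ho).
  + exact: (W_hplane Ww ho).
  + by rewrite [LHS]hw1// w1E IH.
- move=> e; have w1E y : w1 y = w0 (w (reflection (nrm i) y)) by rewrite -[w1 y]h2'; have /= -> := e y.
  by rewrite hw1// w1E.
Qed.

Lemma broken_path_cat p q r a b :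
  @broken_path _ _ X p q a -> broken_path q r b -> broken_path p r (a + b).
Proof.
elim=> {p q a} [p|c x y q l px py _ IH] h; first by rewrite add0r.
by rewrite -addrA; apply: broken_pathS => //; exact: IH.
Qed.

Lemma broken_path_ge0 p q a : @broken_path _ _ X p q a -> 0 <= a.
Proof.
elim=> // {p q a} c x y q l px py _ IH.
rewrite addr_ge0// hdist_ge0//.
  exact: (polygon_hplane px).
exact: (polygon_hplane py).
Qed.

Lemma apt_local f u : apt_chart f -> hplane u -> exists2 eps : R, 0 < eps &
  forall v, hplane v -> hdist u v < eps ->
    broken_path (f u) (f v) (hdist u v) /\ broken_path (f v) (f u) (hdist u v).
Proof.
move=> af hu; have tess := apt_chart_tess af.
have [w Ww [x px uE]] := tessellation_cover tess hu.
have [e e0 he] := tessellation_star tess px.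
exists e => // v hv; rewrite uE => /(he _ _ Ww hv) [w' Ww' [y py [-> <-]]].
have [_ /(_ _ Ww')[c hc]] := af.
rewrite (W_hdist _ _ Ww') !hc//; split.
  by rewrite -[hdist x y]addr0; apply: broken_pathS => //; exact: broken_path0.
by rewrite hdistC -[hdist y x]addr0; apply: broken_pathS => //; exact: broken_path0.
Qed.

(** The supremum of the times reached by broken paths is attained and cannot be less than [L],
    because [apt_local] joins a point to its neighbours on both sides. *)
Lemma apt_segment f u v : apt_chart f -> hplane u -> hplane v ->
  broken_path (f u) (f v) (hdist u v).
Proof.
move=> af hu hv; have [e fr vE] := geod_exists hu hv.
set L := hdist u v in vE *.
have L0 : 0 <= L by exact: hdist_ge0.
pose S := [set t : R | 0 <= t <= L /\ broken_path (f u) (f (geod u e t)) t].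
have S0 : S 0 by split; rewrite ?lexx ?L0//; rewrite geod0; exact: broken_path0.
have supS : has_sup S by split; [exists 0|exists L => t [/andP[]]].
set T := sup S.
have T0 : 0 <= T by apply: ub_le_sup => //; case: supS.
have TL : T <= L by apply: ge_sup; [exists 0|move=> t [/andP[]]].
have hp t := geod_hplane t fr.
have [d d0 hd] := apt_local af (hp T).
have ST : S T.
  have [t St tT] := sup_adherent d0 supS.
  have tT' : t <= T by apply: ub_le_sup => //; case: supS.
  have dE : hdist (geod u e T) (geod u e t) = T - t.
    by rewrite geod_dist// ger0_norm// subr_ge0.
  have := hd _ (hp t); rewrite dE => -[|_ bp]; first by move: tT; rewrite -/T; lra.
  split; first by rewrite T0.
  rewrite (_ : T = t + (T - t)); last by ring.
  rewrite [X in f (geod _ _ X)](_ : _ = T); last by ring.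
  by apply: broken_path_cat bp; case: St.
suff TE : T = L by rewrite vE -TE; case: ST.
apply: le_anti; rewrite TL leNgt; apply/negP => lt.
pose t := Num.min L (T + d / 2).
have Tt : T < t by rewrite lt_min lt; lra.
have tL : t <= L by rewrite ge_min lexx.
have td : t < T + d by rewrite gt_min; apply/orP; right; lra.
have dE : hdist (geod u e T) (geod u e t) = t - T.
  by rewrite geod_dist// ltr0_norm ?subr_lt0//; ring.
have := hd _ (hp t); rewrite dE => -[|bp _]; first by lra.
have St : S t.
  split; first by rewrite tL andbT (le_trans T0)// ltW.
  rewrite (_ : t = T + (t - T)); last by ring.
  rewrite [X in f (geod _ _ X)](_ : _ = t); last by ring.
  by apply: broken_path_cat bp; case: ST.
have : t <= T by apply: ub_le_sup => //; case: supS.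
by rewrite leNgt Tt.
Qed.

End apartments.

(** * Hyperbolicity of the building and the lattice action *)

Section building_geometry.
Variables (R : realType) (P : coxeter_polygon R) (X : polygonal_complex P).
Implicit Types (s : R) (u v x y z : 'rV[R]_3) (w : 'rV[R]_3 -> 'rV[R]_3) (p q m : X)
  (f g : 'rV[R]_3 -> X) (A : set X) (c : chamber X).
Local Notation W := (coxeter_group P).
Local Notation d := (@path_dist R P X).
Local Notation broken := (@broken_path R P X).

Variable apts : set (set X).
Hypothesis apt_apartment : forall A, apts A -> apartment A.
Hypothesis apt_chambers : forall c d : chamber X, exists2 A, apts A &
  closed_chamber c `|` closed_chamber d `<=` A.
Hypothesis apt_isos : forall A B, apts A -> apts B -> exists phi, apartment_iso A B phi.

Definition based c g :=
  [/\ apt_chart g, apts (g @` @hplane R) & forall x, polygon P x -> g x = chart c x].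

Lemma based_exists c c' : exists2 g, based c g &
  exists2 w, W w & forall x, polygon P x -> chart c' x = g (w x).
Proof.
have [A aA] := apt_chambers c c'; rewrite subUset => -[cA c'A].
have [f [af fA]] := apartmentP (apt_apartment aA).
move: cA c'A; rewrite -fA => /(apt_chamber af)[w Ww hw] /(apt_chamber af)[w' Ww' hw'].
exists (f \o w).
  by split=> [||x /hw->//]; [exact: apt_chart_comp|rewrite image_comp_W// fA].
have [v [Wv _ vw]] := W_inv Ww; exists (v \o w'); first exact: W_comp.
by move=> x px; rewrite /= vw hw'.
Qed.

(** In the charts, the isomorphism of the two apartments is an element of the Coxeter group by
    [chamber_map_W]. It fixes the tile over [c], so it is the identity and both charts give a common
    point the same coordinate. *)
Lemma based_unique c g g' v v' : based c g -> based c g' ->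
  hplane v -> hplane v' -> g v = g' v' -> v = v'.
Proof.
move=> [ag Ag bg] [ag' Ag' bg'] hv hv' e.
have [phi [[phiAB phi_inj _] phi_ch phi_fix]] := apt_isos Ag Ag'.
have tess := apt_chart_tess ag.
have im u : hplane u -> (g @` @hplane R) (g u) by move=> hu; exists u.
have [||w0 Ww0 hw0] := @chamber_map_W _ _ _ g g' phi ag ag'.
- move=> u1 u2 h1 h2 /phi_inj; rewrite !inE => /(_ (im _ h1) (im _ h2)).
  exact: (proj1 ag).
- move=> w Ww; have [_ /(_ _ Ww)[c' hc']] := ag.
  have [|d hd] := phi_ch c'.
    move=> _ [x px <-]; rewrite -hc'//; apply: im.
    exact: (W_hplane Ww (polygon_hplane px)).
  have [|w' Ww' hw'] := apt_chamber (d := d) ag'.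
    move=> _ [x px <-]; rewrite -hd// -hc'//; apply: phiAB; apply: im.
    exact: (W_hplane Ww (polygon_hplane px)).
  by exists w' => // x px; rewrite hc'// hd// hw'.
have w0E : w0 =1 id.
  apply: (lorentz_fix_polygon (nsides_gt0 P) (W_lorentz Ww0)) => x px.
  have hx := polygon_hplane px.
  apply: (proj1 ag') => //; first exact: (W_hplane Ww0 hx).
  rewrite -hw0// phi_fix ?bg' ?bg//; split; first by rewrite -bg//; exists x.
  by rewrite -bg'//; exists x.
apply: (proj1 ag') => //; rewrite -e -(phi_fix (g v)).
  by rewrite hw0// w0E.
by split; [exists v|rewrite e; exists v'].
Qed.

(** The retraction of a building centred at the chamber [c], with values in the model plane; it is
    single-valued by [based_unique]. *)
Definition retraction c p v := hplane v /\ exists2 g, based c g & g v = p.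

Lemma retraction_ex c p : exists v, retraction c p v.
Proof.
have [c' [x [px <-]]] := chart_cover p.
have [g bg [w Ww hw]] := based_exists c c'.
exists (w x); split; first exact: (W_hplane Ww (polygon_hplane px)).
by exists g => //; rewrite -hw.
Qed.

Definition retract c p := sval (cid (retraction_ex c p)).

Lemma retractP c p : retraction c p (retract c p).
Proof. exact: svalP (cid (retraction_ex c p)). Qed.

Lemma retract_hplane c p : hplane (retract c p).
Proof. by case: (retractP c p). Qed.

Lemma retract_based c g v : based c g -> hplane v -> retract c (g v) = v.
Proof.
move=> bg hv; have [hr [g' bg' e]] := retractP c (g v).
exact: (based_unique bg' bg).
Qed.

(** Each piece lies in a chamber that shares an apartment with [c], and the retraction is an
    isometry there. *)
Lemma retract_broken c p q l : broken p q l -> hdist (retract c p) (retract c q) <= l.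
Proof.
elim=> {p q l} [p|c' x y q l px py _ IH]; first by rewrite hdistxx//; exact: retract_hplane.
apply: le_trans (hdist_triangle (v := retract c (chart c' y)) _ _ _) _;
  do ?exact: retract_hplane.
apply: lerD => //.
have [g bg [w Ww hw]] := based_exists c c'.
have hx := polygon_hplane px; have hy := polygon_hplane py.
rewrite !hw// !(retract_based bg) ?(W_hdist _ _ Ww)//.
  exact: (W_hplane Ww hy).
exact: (W_hplane Ww hx).
Qed.

Lemma based_chart g : apt_chart g -> apts (g @` @hplane R) -> exists c, based c g.
Proof.
move=> ag Ag; have [_ /(_ _ (coxeter_group1 P))[c hc]] := ag.
by exists c; split.
Qed.

(** [apt_segment] bounds the distance from above, and a retraction centred in the apartment, being
    1-Lipschitz, bounds it from below. *)
Lemma dist_chart g u v : apt_chart g -> apts (g @` @hplane R) ->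
  hplane u -> hplane v -> d (g u) (g v) = hdist u v.
Proof.
move=> ag Ag hu hv; have [c bg] := based_chart ag Ag.
have bp := apt_segment ag hu hv.
have lb : lbound [set l | broken (g u) (g v) l] (hdist u v).
  by move=> l /(retract_broken c); rewrite !(retract_based bg).
apply: le_anti; apply/andP; split.
  by apply: ge_inf => //; exists (hdist u v).
by apply: lb_le_inf => //; exists (hdist u v).
Qed.

Lemma common_chart p q : exists g u v, [/\ apt_chart g, apts (g @` @hplane R),
  hplane u, hplane v & g u = p /\ g v = q].
Proof.
have [c [x [px <-]]] := chart_cover p; have [c' [y [py <-]]] := chart_cover q.
have [g [ag Ag bg] [w Ww hw]] := based_exists c c'.
exists g, x, (w y); split=> //.
- exact: (polygon_hplane px).
- exact: (W_hplane Ww (polygon_hplane py)).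
- by rewrite bg// hw.
Qed.

Lemma dist_embedding p q : exists g u v, [/\ hplane u, hplane v, g u = p, g v = q
  & forall a b, hplane a -> hplane b -> d (g a) (g b) = hdist a b].
Proof.
have [g [u [v [ag Ag hu hv [gu gv]]]]] := common_chart p q.
by exists g, u, v; split=> // a b; exact: dist_chart.
Qed.

Lemma retract_lip c p q : hdist (retract c p) (retract c q) <= d p q.
Proof.
have [g [u [v [ag Ag hu hv [gu gv]]]]] := common_chart p q.
apply: lb_le_inf; last by move=> l /(retract_broken c).
by exists (hdist u v); rewrite -gu -gv; exact: apt_segment.
Qed.

Lemma retract_center c x p : polygon P x ->
  retract c (chart c x) = x /\ d p (chart c x) = hdist (retract c p) x.
Proof.
move=> px; have hx := polygon_hplane px.
have [hr [g bg e]] := retractP c p; have [ag Ag gE] := bg.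
rewrite -gE// (retract_based bg)//; split=> //.
by rewrite -{1}e dist_chart.
Qed.

Lemma path_dist_ge0 p q : 0 <= d p q.
Proof.
by have [g [u [v [hu hv <- <- ->]]]] := dist_embedding p q => //; exact: hdist_ge0.
Qed.

Lemma path_distC p q : d p q = d q p.
Proof.
by have [g [u [v [hu hv <- <- h]]]] := dist_embedding p q; rewrite !h// hdistC.
Qed.

Lemma path_distxx p : d p p = 0.
Proof.
have [g [u [v [hu hv <- _ h]]]] := dist_embedding p p.
by rewrite h// hdistxx.
Qed.

Lemma path_dist_triangle m p q : d p q <= d p m + d m q.
Proof.
have [g [u [v [ag Ag hu hv [gu gv]]]]] := common_chart p q.
have [c bg] := based_chart ag Ag.
rewrite -gu -gv dist_chart//.
rewrite -{1}(retract_based bg hu) -{1}(retract_based bg hv).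
apply: le_trans (hdist_triangle (v := retract c m) _ _ _) _; do ?exact: retract_hplane.
by apply: lerD; exact: retract_lip.
Qed.

(* The hyperbolic Stewart identity for the retraction centered at a chamber
   that contains [m]. *)
Lemma path_dist_cat p q s : 0 <= s -> s <= d p q -> exists m,
  [/\ d p m = s, d m q = d p q - s & forall r,
   d r m <= Num.max (d r p - s) (d r q - (d p q - s)) + ln 4].
Proof.
have dbl (a b : R) : a <= b + b -> 2 * a <= 4 * b by lra.
move=> s0; have [g [u [v [ag Ag hu hv [gu gv]]]]] := common_chart p q.
have L : d p q = hdist u v by rewrite -gu -gv dist_chart.
have [e fr vE] := geod_exists hu hv.
rewrite L; move: (hdist_ge0 hu hv) vE; move: (hdist u v) L => L dL L0 vE sL.
have tess := apt_chart_tess ag.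
have hm := geod_hplane s fr.
have d1 : d p (g (geod u e s)) = s.
  by rewrite -gu dist_chart// -{1}(geod0 u e) geod_dist// sub0r normrN ger0_norm.
have d2 : d (g (geod u e s)) q = L - s.
  by rewrite -gv dist_chart// vE geod_dist// distrC ger0_norm// subr_ge0.
exists (g (geod u e s)); split=> // r.
have l4 : 0 <= ln 4 :> R by rewrite ln_ge0// ler1n.
(* The Stewart identity is going to be divided by [sinh L]. *)
have [L00|Lne] := eqVneq L 0.
  have s00 : s = 0 by apply: le_anti; rewrite s0 -L00 sL.
  rewrite s00 geod0 gu subr0; apply: (@le_trans _ _ (d r p + ln 4)); first by lra.
  by rewrite lerD2r le_max lexx.
have Lgt : 0 < L by rewrite lt_neqAle eq_sym Lne.
have [w Ww [x px mE]] := tessellation_cover tess hm.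
have bgc : exists2 c, based c (g \o w) & g (geod u e s) = chart c x.
  have [_ /(_ _ Ww)[c hc]] := ag; exists c; last by rewrite mE hc.
  by split=> //; [exact: apt_chart_comp|rewrite image_comp_W].
have [c bg mcE] := bgc.
have [w' [Ww' ww' w'w]] := W_inv Ww.
have ret y : hplane y -> retract c (g y) = w' y.
  move=> hy; rewrite -{1}(w'w y) -[g _]/((g \o w) (w' y)) (retract_based bg)//.
  exact: (W_hplane Ww' hy).
pose t := w (retract c r).
have ht : hplane t by exact: (W_hplane Ww (retract_hplane c r)).
have dm : d r (g (geod u e s)) = hdist t (geod u e s).
  by rewrite mcE (proj2 (retract_center c r px)) mE (W_hdist _ _ Ww).
have dp : hdist t u <= d r p.
  rewrite -gu; apply: le_trans (retract_lip c _ _).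
  by rewrite ret// -(W_hdist (retract c r) (w' u) Ww) w'w.
have dq : hdist t (geod u e L) <= d r q.
  rewrite -gv vE; apply: le_trans (retract_lip c _ _).
  by rewrite ret -?vE// -(W_hdist (retract c r) (w' v) Ww) w'w.
rewrite dm; have st := geod_stewart L s fr ht.
set a := d r p in dp *; set b := d r q in dq *; set D := hdist t _.
have hL := geod_hplane L fr.
have sL0 := sinh_gt0 Lgt.
have h1 : cosh D <= expR (- s) * cosh a + expR (- (L - s)) * cosh b.
  have ca : cosh (hdist t u) <= cosh a.
    by rewrite cosh_le ?hdist_ge0 ?path_dist_ge0.
  have cb : cosh (hdist t (geod u e L)) <= cosh b.
    by rewrite cosh_le ?hdist_ge0 ?path_dist_ge0.
  rewrite -(ler_pM2l sL0) st mulrDr.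
  have r1 := sinh_ratio s0 sL.
  have Ls0 : 0 <= L - s by rewrite subr_ge0.
  have := @sinh_ratio _ L (L - s) Ls0; rewrite subKr => /(_ _) r2.
  have {}r2 : sinh s <= expR (- (L - s)) * sinh L by apply: r2; rewrite gerBl.
  have c0 t' := ltW (cosh_gt0 (t' : R)).
  rewrite [X in _ <= X + _](_ : _ = expR (- s) * sinh L * cosh a); last by ring.
  rewrite [X in _ <= _ + X](_ : _ = expR (- (L - s)) * sinh L * cosh b); last by ring.
  have Ls : 0 <= L - s by rewrite subr_ge0.
  by rewrite lerD// ler_pM ?c0 ?sinh_ge0.
set M := Num.max _ _.
have aM : a - s <= M by rewrite le_max lexx.
have bM : b - (L - s) <= M by rewrite le_max lexx orbT.
(* The two terms of [h1] are at most [expR M] each, and [expR D <= 2 * cosh D]; the factor 4 becomes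
   the additive [ln 4]. *)
have h2 : expR D <= 4 * expR M.
  apply: le_trans (expR_le_cosh _) _.
  have e1 : expR (- s) * cosh a <= expR M.
    apply: (@le_trans _ _ (expR (- s) * expR a)).
      by rewrite ler_pM2l ?expR_gt0// cosh_le_expR// path_dist_ge0.
    by rewrite -expRD ler_expR addrC.
  have e2 : expR (- (L - s)) * cosh b <= expR M.
    apply: (@le_trans _ _ (expR (- (L - s)) * expR b)).
      by rewrite ler_pM2l ?expR_gt0// cosh_le_expR// path_dist_ge0.
    by rewrite -expRD ler_expR addrC.
  exact: (dbl _ _ (le_trans h1 (lerD e1 e2))).
by rewrite -ler_expR expRD lnK ?posrE// mulrC.
Qed.

Lemma path_dist_star p : exists2 eps : R, 0 < eps &
  forall q, d p q < eps -> exists2 c : chamber X, closed_chamber c p & closed_chamber c q.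
Proof.
have [c [x [px <-]]] := chart_cover p.
have [g0 [ag0 _ _] _] := based_exists c c.
have [e e0 he] := tessellation_star (apt_chart_tess ag0) px.
exists e => // q; have [c' [y [py <-]]] := chart_cover q.
have [g [ag Ag bg] [w Ww hw]] := based_exists c c'.
have hx := polygon_hplane px; have hy := W_hplane Ww (polygon_hplane py).
rewrite hw// -bg// dist_chart// => de.
have [w' Ww' [z pz [wE w'x]]] := he id (w y) (coxeter_group1 P) hy de.
have [_ /(_ _ Ww')[c1 hc1]] := ag.
exists c1; first by exists x => //; rewrite -hc1// w'x.
by exists z => //; rewrite wE hc1.
Qed.

Lemma chart_lip c x y : polygon P x -> polygon P y -> d (chart c x) (chart c y) <= hdist x y.
Proof.
move=> px py; have [g [ag Ag bg] _] := based_exists c c.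
rewrite -!bg// dist_chart//; first exact: (polygon_hplane px).
exact: (polygon_hplane py).
Qed.

End building_geometry.

Section hyperbolic_spaces.
Variable R : realType.

(** Two features of the building are kept: the comparison [dist_cat], from which hyperbolicity with
    constant [ln 4] follows, and the planes of [dist_plane], which contain geodesic rays and the
    perpendiculars to them. *)
Record hyp_space (X : Type) (d : X -> X -> R) : Prop := HypSpace {
  dist_ge0 : forall p q, 0 <= d p q ;
  distC : forall p q, d p q = d q p ;
  distxx : forall p, d p p = 0 ;
  dist_triangle : forall m p q, d p q <= d p m + d m q ;
  dist_cat : forall p q s, 0 <= s -> s <= d p q -> exists m,
    [/\ d p m = s, d m q = d p q - s & forall r,
     d r m <= Num.max (d r p - s) (d r q - (d p q - s)) + ln 4] ;
  dist_plane : forall p q, exists g u v, [/\ @hplane R u, hplane v, g u = p, g v = q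
    & forall a b, hplane a -> hplane b -> d (g a) (g b) = hdist a b]
}.

(** [act_gen] expresses generation as an induction on the right, the form in which the deformation
    is later estimated along words. *)
Record proper_action (X : Type) (d : X -> X -> R) (G : groupType) (act : G -> X -> X)
  (o : X) (D : R) (S : set G) : Prop := ProperAction {
  act1 : forall p, act 1%g p = p ;
  actM : forall g h p, act (g * h)%g p = act g (act h p) ;
  act_isom : forall g p q, d (act g p) (act g q) = d p q ;
  act_cover : forall p, exists g, d p (act g o) <= D ;
  act_proper : forall r, finite_set [set g | d o (act g o) <= r] ;
  gen_finite : finite_set S ;
  act_gen : forall Q : G -> Prop, Q 1%g ->
    (forall g s, S s -> Q g -> Q (g * s)%g) -> forall g, Q g
}.

End hyperbolic_spaces.

Section metric_compactness.
Variables (R : realType) (T : Type) (d : T -> T -> R).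

Lemma metric_compact0 : metric_compact d set0.
Proof. by move=> I D f _ _; exists fset0 => // x; rewrite in_fset0. Qed.

Lemma metric_compactU (A B : set T) : metric_compact d A -> metric_compact d B ->
  metric_compact d (A `|` B).
Proof.
move=> cA cB I D f of_ sub.
have [DA sA hA] := cA I D f of_ (fun x Ax => sub x (or_introl Ax)).
have [DB sB hB] := cB I D f of_ (fun x Bx => sub x (or_intror Bx)).
exists (DA `|` DB)%fset.
  by move=> i; rewrite in_fsetU => /orP[/sA|/sB].
move=> x [/hA|/hB] [i Di fi]; exists i => //=; rewrite in_fsetU.
  by rewrite Di.
by move: Di => /= ->; rewrite orbT.
Qed.

Lemma metric_compact_bigcup J (S : set J) (F : J -> set T) : finite_set S ->
  (forall j, S j -> metric_compact d (F j)) -> metric_compact d (\bigcup_(j in S) F j).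
Proof.
elim/Pchoice: J => J in S F *; move=> /finite_seqP[s ->]; elim: s => [|j s IH] h.
  by rewrite (_ : \bigcup_(_ in _) _ = set0); [exact: metric_compact0|rewrite set_nil bigcup_set0].
rewrite (_ : \bigcup_(_ in _) _ = F j `|` \bigcup_(i in [set` s]) F i); last first.
  apply/seteqP; split=> [x [i /=]|x [Fx|[i /= si Fx]]].
  - by rewrite inE => /orP[/eqP ->|si Fx]; [left|right; exists i].
  - by exists j => //=; rewrite mem_head.
  - by exists i => //=; rewrite inE si orbT.
apply: metric_compactU; first by apply: h; rewrite /= mem_head.
by apply: IH => i ins; apply: h; rewrite /= inE ins orbT.
Qed.

Lemma metric_compact_bounded (K : set T) o : (forall p q m, d p q <= d p m + d m q) ->
  metric_compact d K -> exists D, forall k, K k -> d o k <= D.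
Proof.
move=> tri cK; have [||E _ hE] := cK nat setT (fun n : nat => [set k | d o k < n%:R]).
- move=> n _ k /= dk; exists (n%:R - d o k); first by rewrite subr_gt0.
  by move=> m /=; rewrite /metric_ball /= => dkm; apply: le_lt_trans (tri _ _ k) _; lra.
- move=> k _; exists (Num.truncn `|d o k|).+1 => //=.
  have /andP[_] := truncn_itv (normr_ge0 (d o k)).
  exact: le_lt_trans (ler_norm _).
exists (\sum_(n <- E) n%:R) => k /hE [n /= nE kn].
apply: ltW; apply: lt_le_trans kn _; rewrite (big_fsetD1 n nE) /= lerDl sumr_ge0// => i _.
Qed.

End metric_compactness.

(** * Compactness of chambers and the Milnor-Svarc argument *)

Section lattice_action.
Variables (R : realType) (P : coxeter_polygon R) (X : polygonal_complex P).
Local Notation d := (@path_dist R P X).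

Lemma building_hyp_space : fuchsian_building X -> hyp_space d.
Proof.
move=> [_ [apts [_ h1 h2 h3]]]; split.
- exact: path_dist_ge0 h1 h2 h3.
- exact: path_distC h1 h2 h3.
- exact: path_distxx h1 h2 h3.
- move=> m p q; exact: path_dist_triangle h1 h2 h3 m p q.
- exact: path_dist_cat h1 h2 h3.
- exact: dist_embedding h1 h2 h3.
Qed.

Hypothesis build : fuchsian_building X.

Let hX := building_hyp_space build.

Lemma building_star p : exists2 eps : R, 0 < eps &
  forall q, d p q < eps -> exists2 c : chamber X, closed_chamber c p & closed_chamber c q.
Proof. by case: build => _ [apts [_ h1 h2 h3]]; exact: path_dist_star h1 h2 h3 p. Qed.

(** The cover is pulled back to the polygon, which is compact for the topology of matrices; a
    hyperbolic ball is open there, being given by [- lform x y < cosh r]. *)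
Lemma closed_chamber_compact (c : chamber X) : metric_compact d (closed_chamber c).
Proof.
move=> I D f of_ sub.
have lip x y : polygon P x -> polygon P y -> d (chart c x) (chart c y) <= hdist x y.
  by case: build => _ [apts [_ h1 h2 h3]]; exact: chart_lip h1 h2 h3 c x y.
(* A radius is chosen for every pair, so a pair for which [chart c x] is not in [f i] receives the
   default 2. *)
have rad x i : exists2 r : R, 1 < r & (D i -> polygon P x -> f i (chart c x) ->
    forall y, polygon P y -> - lform x y < r -> f i (chart c y)).
  have [[Di [px fx]]|] := pselect (D i /\ polygon P x /\ f i (chart c x)); last first.
    by move=> n; exists 2; [lra|move=> *; case: n].
  have [r r0 hr] := of_ i Di _ fx.
  exists (cosh r); first by rewrite -(@cosh0 R) cosh_lt.
  move=> _ _ _ y py lt; apply: hr; apply: le_lt_trans (lip _ _ px py) _.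
  have hx := polygon_hplane px; have hy := polygon_hplane py.
  have r0' := ltW r0.
  by rewrite ltNge; apply/negP; rewrite -cosh_le ?hdist_ge0// cosh_hdist// leNgt lt.
pose rd x i := sval (cid2 (rad x i)).
have rd1 x i : 1 < rd x i by rewrite /rd; case: cid2.
have rdP x i : D i -> polygon P x -> f i (chart c x) ->
    forall y, polygon P y -> - lform x y < rd x i -> f i (chart c y).
  by rewrite /rd; case: cid2.
have := @polygon_compact R P; rewrite compact_cover => /(_ I D
  (fun i => \bigcup_(x in [set x | polygon P x /\ f i (chart c x)])
      [set y | - lform x y < rd x i])).
case.
- move=> i Di; apply: bigcup_open => x _.
  rewrite (_ : mkset _ = (fun y => - lform x y) @^-1` [set r | r < rd x i])//.
  apply: open_comp; last exact: open_lt.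
  move=> y _; have cj j : (x 0 j * z 0 j) @[z --> y] --> x 0 j * y 0 j.
    by apply: cvgM; [exact: cvg_cst|exact: coord_continuous].
  exact: (cvgN (cvgD (cvgD (cvgN (cj 0)) (cj 1)) (cj 2%:R))).
- move=> x px; have [i Di fi] := sub (chart c x) (ex_intro2 _ _ x px erefl).
  exists i => //; exists x => //=.
  by have [xx _] := polygon_hplane px; rewrite xx opprK.
- move=> E ED hE; exists E => // p [x px <-].
  have [i iE [y [py fy]] /= lt] := hE x px.
  exists i => //; apply: rdP py fy _ px lt.
  by have := ED i iE; rewrite inE.
Qed.

Lemma broken_dist p q : broken_path p q (d p q).
Proof.
case: build => _ [apts [_ h1 h2 h3]].
have [g [u [v [ag Ag hu hv [<- <-]]]]] := common_chart h1 h2 p q.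
rewrite (dist_chart h1 h2 h3)//; exact: apt_segment.
Qed.

Lemma automorphism_lip (phi : X -> X) p q : automorphism phi -> d (phi p) (phi q) <= d p q.
Proof.
move=> [_ ha].
have bp a b l : broken_path a b l -> broken_path (phi a) (phi b) l.
  elim=> {a b l} [a|c x y b l px py _ IH]; first exact: broken_path0.
  have [c' [s [[sP _ _] si] h]] := ha c.
  rewrite h// -si//; apply: broken_pathS; [exact: sP|exact: sP|by rewrite -h].
apply: ge_inf; last exact: bp (broken_dist p q).
exists 0 => l; exact: broken_path_ge0.
Qed.

(** Milnor-Svarc: the generators are the elements that move [K1] to meet itself, where [K1] is a
    compact neighbourhood of [K]. A geodesic cut into steps shorter than [e] writes an element as a
    product of them, and the number of factors is bounded by the displacement, which gives
    properness. *)
Lemma lattice_proper_action (G : groupType) (act : G -> X -> X) o :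
  cocompact_lattice act -> exists D S, proper_action d act o D S.
Proof.
move=> [[a1 aM] [aut _] _ prop [K cK cov]].
have isom g p q : d (act g p) (act g q) = d p q.
  apply: le_anti; rewrite automorphism_lip//=.
  have := automorphism_lip (act g p) (act g q) (aut g^-1%g).
  by rewrite -!aM mulVg !a1.
have tri := dist_triangle hX; have dC := distC hX; have d0 := dist_ge0 hX.
have [k0 Kk0] : K !=set0 by have [_ [k Kk _]] := cov o; exists k.
have [D hD] := metric_compact_bounded o (fun p q m => tri m p q) cK.
pose ep p := sval (cid2 (building_star p)).
have ep0 p : 0 < ep p by rewrite /ep; case: cid2.
have epP p q : d p q < ep p -> exists2 c : chamber X, closed_chamber c p & closed_chamber c q.
  by rewrite /ep; case: cid2 => /= e _ h /h.
have [||E _ hE] := cK {classic X} setT (fun p => metric_ball d p (ep p / 2)).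
- move=> p _ q /= dpq; exists (ep p / 2 - d p q); first by rewrite subr_gt0.
  move=> m /=; rewrite /metric_ball /= in dpq * => dqm.
  by apply: le_lt_trans (tri q _ _) _; lra.
- move=> p _; exists p => //; rewrite /metric_ball /= distxx//.
  by rewrite divr_gt0.
(* The chambers through finitely many points stand in for a metric neighbourhood of [K]: their union
   is compact by local finiteness, and contains all points within [e] of [K]. *)
pose K1 : set X := \bigcup_(p in [set` E]) \bigcup_(c in [set c | closed_chamber c p])
   closed_chamber c.
have cK1 : metric_compact d K1.
  apply: metric_compact_bigcup => // p _; apply: metric_compact_bigcup.
    by case: build => lf _; exact: lf.
  by move=> c _; exact: closed_chamber_compact.
have [|p e e' _ ee' h|p _|e e0 he] := @finite_set_eps R _ [set` E] (fun p e => e <= ep p / 2).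
- exact: finite_fset.
- exact: le_trans h.
- by exists (ep p / 2); rewrite ?divr_gt0.
have KK1 k q : K k -> d k q < e -> K1 q.
  move=> /hE[p pE dpk] dkq; rewrite /metric_ball /= in dpk.
  have [|c cp cq] := epP p q.
    by have hep := he p pE; apply: le_lt_trans (tri k _ _) _; lra.
  by exists p => //; exists c.
pose F1 : set G := [set g | (act g @` K1) `&` K1 !=set0].
have finF1 : finite_set F1 by exact: prop.
have sKK1 k : K k -> K1 k by move=> Kk; apply: (KK1 k) => //; rewrite distxx.
have stepF g h k k' : K k -> K k' -> d (act g k) (act h k') < e -> F1 (g^-1 * h)%g.
  move=> Kk Kk' dd; exists (act (g^-1 * h)%g k'); split; first by exists k' => //; exact: sKK1.
  by apply: (KK1 k) => //; rewrite -(isom g) -aM mulVKg.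
pose pw := fix pw n : set G := if n is m.+1 then
   [set gh.1 * gh.2 | gh in F1 `*` pw m]%g else [set 1%g].
have pwfin n : finite_set (pw n).
  by elim: n => [|n IH] /=; [exact: finite_set1|apply: finite_image; exact: finite_setX].
have claim g n h k : K k -> d (act h k) (act g k0) <= n%:R * (e / 2) -> pw n.+1 (h^-1 * g)%g.
  elim: n h k => [|n IH] h k Kk dd.
    exists ((h^-1 * g)%g, 1%g); last by rewrite /= mulg1.
    split=> //=; apply: stepF Kk Kk0 _; apply: le_lt_trans dd _.
    by rewrite mul0r.
  (* The shortest step after which the remaining distance is at most [n] times [e / 2]; it is
     shorter than [e], as [stepF] requires. *)
  set L := d _ _ in dd; pose s := Num.max 0 (L - n%:R * (e / 2)).
  have s0 : 0 <= s by rewrite le_max lexx.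
  have ne0 : 0 <= n%:R * (e / 2) by rewrite mulr_ge0// ltW// divr_gt0.
  have sL : s <= L by rewrite ge_max d0 gerBl ne0.
  have se : s < e.
    rewrite gt_max e0 /=; move: dd; rewrite -natr1 mulrDl mul1r; lra.
  have sL2 : L - s <= n%:R * (e / 2).
    have : L - n%:R * (e / 2) <= s by rewrite le_max lexx orbT.
    by lra.
  have [m [dm1 dm2 _]] := dist_cat hX s0 sL.
  have [h' [k' Kk' mE]] := cov m; rewrite -mE in dm1 dm2.
  have := IH h' k' Kk'; rewrite dm2 => /(_ sL2) pwh.
  exists ((h^-1 * h')%g, (h'^-1 * g)%g) => /=; last by rewrite mulgA mulgK.
  by split=> //; apply: stepF Kk Kk' _; rewrite dm1.
have e2 : 0 < e / 2 by rewrite divr_gt0.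
have bound r : exists n : nat, r <= n%:R * (e / 2).
  exists (Num.truncn (`|r| / (e / 2))).+1.
  have /andP[_ h] := truncn_itv (divr_ge0 (normr_ge0 r) (ltW e2)).
  by rewrite -ler_pdivrMr//; apply: le_trans (ltW h); rewrite ler_pM2r ?invr_gt0// ler_norm.
exists D, F1; split=> //.
- move=> p; have [g [k Kk <-]] := cov p; exists g.
  by rewrite isom dC; exact: hD.
- move=> r; have [n hn] := bound (r + 2 * d o k0).
  apply: sub_finite_set (pwfin n.+1) => g /= dg.
  have := @claim g n 1%g k0 Kk0; rewrite invg1 mul1g; apply.
  apply: le_trans hn; rewrite a1.
  have := tri o k0 (act g k0); have := tri (act g o) o (act g k0).
  rewrite isom (dC k0 o); lra.
- move=> Q Q1 QS g; have [n hn] := bound (d k0 (act g k0)).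
  have := @claim g n 1%g k0 Kk0; rewrite invg1 mul1g a1 => /(_ hn).
  suff H m h h' : pw m h -> Q h' -> Q (h' * h)%g by move=> /H/(_ Q1); rewrite mul1g.
  elim: m h h' => [|m IH] h h'; first by move=> ->; rewrite mulg1.
  move=> [[s t] /= [Fs pt] <-] Qh'; rewrite mulgA; apply: IH => //; exact: QS.
Qed.

End lattice_action.

(** * The Gromov boundary *)

Section gromov_products.
Variables (R : realType) (X : Type) (d : X -> X -> R).
Hypothesis hX : hyp_space d.
Implicit Types (o p q x y z : X) (u v : nat -> X).
Local Notation gp := (gromov_prod d).
Local Notation delta := (ln (4 : R)).

Let d0 := dist_ge0 hX.
Let dC := distC hX.
Let dxx := distxx hX.
Let tri := dist_triangle hX.

Lemma ln4_ge0 : 0 <= delta. Proof. by rewrite ln_ge0// ler1n. Qed.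

Lemma gpC o x y : gp o x y = gp o y x.
Proof. by rewrite /gromov_prod (dC x y) (addrC (d o x)). Qed.

Lemma gp_ge0 o x y : 0 <= gp o x y.
Proof.
rewrite /gromov_prod divr_ge0// subr_ge0.
by have := tri o x y; rewrite (dC x o).
Qed.

Lemma gp_le o x y : gp o x y <= d o x.
Proof. by rewrite /gromov_prod; have := tri x o y; lra. Qed.

Lemma gp_base o o' x y : gp o x y <= gp o' x y + d o o'.
Proof.
by rewrite /gromov_prod; have := tri o' o x; have := tri o' o y; lra.
Qed.

Lemma gp_near o x y y' : gp o x y <= gp o x y' + d y y'.
Proof.
by rewrite /gromov_prod; have := tri y' o y; have := tri y x y'; rewrite (dC y' y); lra.
Qed.

(** [m] is the point of a geodesic from [x] to [z] at which the two bounds of [dist_cat] for [o]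
    agree, so that [d o m <= gp o x z + delta]. The claim follows from the bound of [dist_cat] for
    [y] and [d o y <= d o m + d m y]. *)
Lemma gp_hyp o y x z : Num.min (gp o x y) (gp o y z) - delta <= gp o x z.
Proof.
pose L := d x z; pose s := (d o x - d o z + L) / 2.
have s0 : 0 <= s by rewrite divr_ge0//; have := tri x o z; rewrite /L; lra.
have sL : s <= L by have := tri z o x; rewrite (dC z x) /s /L; lra.
have [m [_ _ hm]] := dist_cat hX s0 sL.
have := hm o; have := hm y; have := tri m o y; rewrite -/L (dC m y).
have -> : d o z - (L - s) = d o x - s by rewrite /s; lra.
rewrite maxxx /gromov_prod -/L.
rewrite {1}/Num.max; case: ifP => _ h1 h2 h3; rewrite lerBlDr ge_min; apply/orP.
  by right; move: h1 h2 h3; rewrite /s; lra.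
by left; move: h1 h2 h3; rewrite /s (dC x y); lra.
Qed.

Lemma gp_hyp3 o y z x w : Num.min (gp o x y) (Num.min (gp o y z) (gp o z w)) - 2 * delta
  <= gp o x w.
Proof.
have h1 := gp_hyp o y x w; have h2 := gp_hyp o z y w; have l0 := ln4_ge0.
move: h1 h2; rewrite !lerBlDr !ge_min => /orP[h1|h1] /orP[h2|h2]; apply/orP.
- by left; lra.
- by left; lra.
- by right; apply/orP; left; lra.
- by right; apply/orP; right; lra.
Qed.

Lemma gromov_simP o u v : (forall M, exists N, forall i j, (N <= i)%N -> (N <= j)%N ->
  M <= gp o (u i) (v j)) -> gromov_sim d u v.
Proof.
move=> h o' M; have [N hN] := h (M + d o o'); exists N => i j Ni Nj.
by have := hN i j Ni Nj; have := gp_base o o' (u i) (v j); lra.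
Qed.

Definition bclass u (gu : gromov_seq d u) : gromov_boundary d :=
  exist _ (gromov_class d u) (ex_intro2 _ _ u gu erefl).

Lemma bclassP (xi : gromov_boundary d) : exists u gu, xi = @bclass u gu.
Proof.
case: xi => xi p; have [u gu xiE] := p; exists u, gu.
by move: p; rewrite xiE => p; congr exist; exact: Prop_irrelevance.
Qed.

Local Open Scope ereal_scope.

Lemma boundary_prod_ge o u v (gu : gromov_seq d u) (gv : gromov_seq d v) (m : R) N :
  (forall i j, (N <= i)%N -> (N <= j)%N -> (m <= gp o (u i) (v j))%R) ->
  m%:E <= boundary_prod o (bclass gu) (bclass gv).
Proof.
move=> h; apply: (@le_trans _ _ (gromov_liminf d o u v)); last first.
  by apply: ereal_sup_ubound; exists u => //; exists v.
apply: (@le_trans _ _ (ereal_inf [set (gromov_prod d o (u ij.1) (v ij.2))%:E | ij in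
       [set ij : nat * nat | (N <= ij.1)%N /\ (N <= ij.2)%N]])); last first.
  by apply: ereal_sup_ubound; exists N.
by apply: le_ereal_inf_tmp => _ [[i j] /= [Ni Nj] <-]; rewrite lee_fin h.
Qed.

(** The supremum runs over all representatives; passing from [u'], [v'] to [u], [v] applies the
    hyperbolic inequality twice and costs [2 * delta]. *)
Lemma boundary_prod_le o u v (gu : gromov_seq d u) (gv : gromov_seq d v) (m : R) :
  (forall N, exists i j, [/\ (N <= i)%N, (N <= j)%N & (gp o (u i) (v j) <= m)%R]) ->
  boundary_prod o (bclass gu) (bclass gv) <= (m + 2 * delta)%:E.
Proof.
move=> h; apply: ge_ereal_sup => _ [u' [gu' uu'] [v' [gv' vv'] <-]].
apply: ge_ereal_sup => _ [N _ <-].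
set I := ereal_inf _; rewrite leNgt; apply/negP => lt.
have [N1 hN1] := uu' o (m + 2 * delta + 1)%R.
have [N2 hN2] := vv' o (m + 2 * delta + 1)%R.
have [i [j [Ni Nj le]]] := h (maxn N1 N2).
pose i' := maxn N N1; pose j' := maxn N N2.
have lt' : ((m + 2 * delta) < gp o (u' i') (v' j'))%R.
  rewrite -lte_fin; apply: (lt_le_trans lt); apply: ereal_inf_lbound.
  by exists (i', j') => //=; rewrite !leq_maxl.
have h1 : (m + 2 * delta + 1 <= gp o (u i) (u' i'))%R.
  by apply: hN1; [exact: leq_trans (leq_maxl _ _) Ni|exact: leq_maxr].
have h2 : (m + 2 * delta + 1 <= gp o (v' j') (v j))%R.
  by rewrite gpC; apply: hN2; [exact: leq_trans (leq_maxr _ _) Nj|exact: leq_maxr].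
have := gp_hyp3 o (u' i') (v' j') (u i) (v j); clear lt.
rewrite lerBlDr !ge_min => /orP[|/orP[]] h3; lra.
Qed.

End gromov_products.

(** * Rays, perpendiculars and visual metrics *)

Section visual.
Variables (R : realType) (X : Type) (d : X -> X -> R).
Hypothesis hX : hyp_space d.
Implicit Types (p q : X) (u v : nat -> X).
Local Notation gp := (gromov_prod d).
Local Notation delta := (ln (4 : R)).
Local Notation B := (gromov_boundary d).

Let d0 := dist_ge0 hX.
Let dC := distC hX.
Let dxx := distxx hX.
Let tri := dist_triangle hX.

Variables (rho : B -> B -> R) (o : X) (a C : R).
Hypotheses (a0 : 0 < a) (C0 : 0 < C).
Hypothesis rho_visual : forall xi eta,
  (C^-1%:E * expeR (- (a%:E * boundary_prod o xi eta)) <= (rho xi eta)%:E <=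
   C%:E * expeR (- (a%:E * boundary_prod o xi eta)))%E.

Lemma rho_le u v (gu : gromov_seq d u) (gv : gromov_seq d v) (m : R) N :
  (forall i j, (N <= i)%N -> (N <= j)%N -> m <= gp o (u i) (v j)) ->
  rho (bclass gu) (bclass gv) <= C * expR (- (a * m)).
Proof.
move=> h; have /andP[_] := rho_visual (bclass gu) (bclass gv).
rewrite -lee_fin => /le_trans; apply; rewrite EFinM.
apply: lee_wpmul2l; first by rewrite lee_fin ltW.
rewrite -[(expR _)%:E]/(expeR (- (a * m))%:E) ler_expeR EFinN leeN2 EFinM.
apply: lee_wpmul2l; first by rewrite lee_fin ltW.
exact: boundary_prod_ge h.
Qed.

Lemma rho_ge u v (gu : gromov_seq d u) (gv : gromov_seq d v) (m : R) :
  (forall N, exists i j, [/\ (N <= i)%N, (N <= j)%N & gp o (u i) (v j) <= m]) ->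
  C^-1 * expR (- (a * (m + 2 * delta))) <= rho (bclass gu) (bclass gv).
Proof.
move=> h; have /andP[+ _] := rho_visual (bclass gu) (bclass gv).
rewrite -lee_fin => /(le_trans _); apply; rewrite EFinM.
apply: lee_wpmul2l; first by rewrite lee_fin invr_ge0 ltW.
rewrite -[(expR _)%:E]/(expeR (- (a * (m + 2 * delta)))%:E) ler_expeR EFinN leeN2 EFinM.
apply: lee_wpmul2l; first by rewrite lee_fin ltW.
exact: boundary_prod_le h.
Qed.

(** In a plane through [o] and [x], [r] is the geodesic from [o] through [x] and [v] follows the
    perpendicular to it at [x]. Their Gromov product is [d o x] up to [delta], so their ends lie at
    a visual distance comparable to [expR (- (a * d o x))]. *)
Lemma ray_exists x : exists (r : R -> X) (v : nat -> X),
  [/\ r 0 = o, r (d o x) = x, (forall s t, d (r s) (r t) = `|s - t|),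
   gromov_seq d v
  & forall i j : nat, d o x <= i%:R ->
     d o x - delta <= gp o (r i%:R) (v j) <= d o x + delta].
Proof.
have [g [y [z [hy hz gy gz dg]]]] := dist_plane hX o x.
have [e fr zE] := geod_exists hy hz.
have dL : d o x = hdist y z by rewrite -gy -gz dg.
rewrite dL; set L := hdist y z in zE *.
have L0 : 0 <= L by exact: hdist_ge0.
have [e' fr' pyth] := perp_exists L fr.
pose r t := g (geod y e t); pose v (j : nat) := g (geod (geod y e L) e' j%:R).
have hr t := geod_hplane t fr; have hv t := geod_hplane t fr'.
have r0 : r 0 = o by rewrite /r geod0.
(* By Pythagoras [cosh D] is a product of two [cosh], so [D] is the sum of the two legs up to
   [ln 4]. *)
have est (i : R) (j : nat) : `|i - L| + j%:R - delta <= d (r i) (v j) <= `|i - L| + j%:R.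
  rewrite /r /v dg//; set D := hdist _ _.
  have D0 : 0 <= D by exact: hdist_ge0.
  have py := pyth j%:R i; rewrite -/D -(cosh_norm (i - L)) in py.
  have n0 := normr_ge0 (i - L); move: `|i - L| n0 py => b b0 py.
  have j0 : 0 <= j%:R :> R by exact: ler0n.
  have c1 : cosh D <= cosh (b + j%:R).
    rewrite py coshD mulrC lerDl mulr_ge0// sinh_ge0//.
  rewrite cosh_le ?addr_ge0// in c1; rewrite c1 andbT.
  rewrite lerBlDr -ler_expR expRD expRD lnK ?posrE//.
  have e1 := expR_le_cosh b; have e2 := expR_le_cosh (j%:R : R); have e3 := cosh_le_expR D0.
  rewrite mulrC (mulrC _ 4); apply: (@le_trans _ _ (4 * cosh D)); last by rewrite ler_pM2l.
  rewrite py (_ : 4 * _ = (2 * cosh j%:R) * (2 * cosh b)); last by ring.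
  by apply: ler_pM; rewrite ?expR_ge0.
exists r, v; split=> //.
- by rewrite /r -zE.
- by move=> s t; rewrite /r dg// geod_dist.
- apply: (gromov_simP hX (o := o)) => M.
  exists (Num.truncn (`|M| + delta)).+1 => i j Ni Nj.
  have /andP[_ hM] := truncn_itv (addr_ge0 (normr_ge0 M) (ln4_ge0 R)).
  have {}Ni : `|M| + delta <= i%:R by apply: ltW; apply: lt_le_trans hM _; rewrite ler_nat.
  have {}Nj : `|M| + delta <= j%:R by apply: ltW; apply: lt_le_trans hM _; rewrite ler_nat.
  have dv : d (v i) (v j) = `|i%:R - j%:R| by rewrite /v dg// geod_dist.
  rewrite /gromov_prod dv -r0; have := est 0 i; have := est 0 j.
  rewrite sub0r normrN (ger0_norm L0) => /andP[h1 _] /andP[h2 _].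
  have := ler_norm M; have l0 := ln4_ge0 R.
  have : `|i%:R - j%:R| <= i%:R + j%:R - 2 * (`|M| + delta) :> R.
    by rewrite ler_norml; apply/andP; split; lra.
  by move: `|_| `|_| (d _ _) (d _ _) h1 h2 Ni Nj => n1 n2 d1 d2; lra.
- move=> i j Li; rewrite /gromov_prod -{1 3}r0 {1}/r {1}/r dg// geod_dist// sub0r normrN.
  rewrite ger0_norm//.
  have := est 0 j; have := est i%:R j; rewrite sub0r normrN (ger0_norm L0).
  rewrite ger0_norm ?subr_ge0// -r0 => /andP[h1 h2] /andP[h3 h4].
  by have l0 := ln4_ge0 R; apply/andP; split; lra.
Qed.

Definition ray x : R -> X := sval (cid (ray_exists x)).
Definition perp x : nat -> X := sval (cid (svalP (cid (ray_exists x)))).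

Lemma rayP x : [/\ ray x 0 = o, ray x (d o x) = x,
  (forall s t, d (ray x s) (ray x t) = `|s - t|), gromov_seq d (perp x)
  & forall i j : nat, d o x <= i%:R ->
     d o x - delta <= gp o (ray x i%:R) (perp x j) <= d o x + delta].
Proof. exact: svalP (cid (svalP (cid (ray_exists x)))). Qed.

Lemma ray_gp x s t : 0 <= s -> s <= t -> gp o (ray x s) (ray x t) = s.
Proof.
have [r0 _ dr _ _] := rayP x => s0 st; rewrite /gromov_prod -{1 2}r0 !dr.
rewrite !sub0r !normrN distrC !ger0_norm ?subr_ge0//; last by rewrite (le_trans s0).
by field.
Qed.

Lemma ray_end_gp x t : d o x <= t -> gp o x (ray x t) = d o x.
Proof.
have [_ rx _ _ _] := rayP x => h.
by have := ray_gp x (d0 o x) h; rewrite rx.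
Qed.

Lemma ray_seq x : gromov_seq d (fun i => ray x i%:R).
Proof.
apply: (gromov_simP hX (o := o)) => M; exists (Num.truncn `|M|).+1 => i j Ni Nj.
have /andP[_ hM] := truncn_itv (normr_ge0 M).
have hi : M <= i%:R.
  by apply: le_trans (ler_norm _) (ltW (lt_le_trans hM _)); rewrite ler_nat.
have hj : M <= j%:R.
  by apply: le_trans (ler_norm _) (ltW (lt_le_trans hM _)); rewrite ler_nat.
have [ij|/ltnW ji] := leqP i j; first by rewrite ray_gp// ler_nat.
by rewrite (gpC hX) ray_gp// ler_nat.
Qed.

Definition endpt x : B := bclass (ray_seq x).

Lemma perp_seq x : gromov_seq d (perp x). Proof. by case: (rayP x). Qed.

Definition sidept x : B := bclass (perp_seq x).

Lemma nat_bound (r : R) : exists N : nat, forall i : nat, (N <= i)%N -> r <= i%:R.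
Proof.
exists (Num.truncn `|r|).+1 => i Ni.
have /andP[_ h] := truncn_itv (normr_ge0 r).
by apply: le_trans (ler_norm _) (ltW (lt_le_trans h _)); rewrite ler_nat.
Qed.

Lemma endpt_sidept x :
  C^-1 * expR (- (a * (d o x + 3 * delta))) <= rho (endpt x) (sidept x) <=
  C * expR (- (a * (d o x - delta))).
Proof.
have [_ _ _ _ h] := rayP x; have [N hN] := nat_bound (d o x).
apply/andP; split; last first.
  by apply: (rho_le _ _ (N := N)) => i j Ni _; have /andP[] := h i j (hN i Ni).
rewrite (_ : d o x + 3 * delta = d o x + delta + 2 * delta); last by ring.
apply: rho_ge => n; exists (maxn N n), n; rewrite leq_maxr leqnn; split=> //.
by have /andP[] := h (maxn N n) n (hN _ (leq_maxl _ _)).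
Qed.

Lemma endpt_le x y m : m <= d o x -> m <= d o y -> m <= gp o x y ->
  rho (endpt x) (endpt y) <= C * expR (- (a * (m - 2 * delta))).
Proof.
move=> mx my mxy; have [N hN] := nat_bound (d o x); have [N' hN'] := nat_bound (d o y).
apply: (rho_le _ _ (N := maxn N N')) => i j Ni Nj.
apply: le_trans (gp_hyp3 hX o x y _ _); rewrite lerB// !le_min; apply/and3P; split=> //.
  by rewrite (gpC hX) ray_end_gp// hN// (leq_trans (leq_maxl _ _) Ni).
by rewrite ray_end_gp// hN'// (leq_trans (leq_maxr _ _) Nj).
Qed.

Lemma endpt_ge x y : gp o x y + 2 * delta < d o x -> gp o x y + 2 * delta < d o y ->
  C^-1 * expR (- (a * (gp o x y + 4 * delta))) <= rho (endpt x) (endpt y).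
Proof.
move=> hx hy; have [N hN] := nat_bound (d o x); have [N' hN'] := nat_bound (d o y).
rewrite (_ : _ + 4 * delta = gp o x y + 2 * delta + 2 * delta); last by ring.
apply: rho_ge => n; pose i := maxn n (maxn N N').
have iN : (N <= i)%N by rewrite /i !leq_max leqnn !orbT.
have iN' : (N' <= i)%N by rewrite /i !leq_max leqnn !orbT.
exists i, i; split; try exact: leq_maxl.
have := gp_hyp3 hX o (ray x i%:R) (ray y i%:R) x y.
rewrite ray_end_gp ?hN// (gpC hX _ (ray y _)) ray_end_gp ?hN'// lerBlDr !ge_min.
by move=> /orP[|/orP[]] h //; lra.
Qed.

Lemma endpt_dense z K eps M : 0 < eps -> exists q, forall y, d q y <= K ->
  M <= d o y /\ rho z (endpt y) <= eps.
Proof.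
move=> e0; have [u [gu ->]] := bclassP z.
have [k hk] : exists k, C * expR (- (a * k)) <= eps.
  exists (- ln (eps / C) / a).
  rewrite (_ : - _ = ln (eps / C)); last by field; rewrite gt_eqF.
  by rewrite lnK ?posrE ?divr_gt0// mulrC divfK// gt_eqF.
pose M' := Num.max M k + `|K| + 2 * delta.
have [N hN] := gu o M'.
have l0 := ln4_ge0 R.
have hM : M <= Num.max M k by rewrite le_max lexx.
have hk' : k <= Num.max M k by rewrite le_max lexx orbT.
exists (u N) => y dy; have Kn := ler_norm K.
have oN : M' <= d o (u N).
  by apply: le_trans (hN N N (leqnn N) (leqnn N)) _; exact: gp_le.
have oy : d o (u N) - K <= d o y by have := tri y o (u N); rewrite (dC y); lra.
split; first by rewrite /M' in oN; lra.
apply: le_trans hk.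
have [N' hN'] := nat_bound (d o y).
apply: (le_trans (@rho_le _ _ gu (ray_seq y) k (maxn N N') _)) => // i j Ni Nj.
have h1 : M' <= gp o (u i) (u N).
  by apply: hN => //; exact: leq_trans (leq_maxl _ _) Ni.
have h2 : d o (u N) - K <= gp o (u N) y.
  by rewrite /gromov_prod; have := tri y o (u N); rewrite (dC y); lra.
have h3 : gp o y (ray y j%:R) = d o y.
  by apply: ray_end_gp; apply: hN'; exact: leq_trans (leq_maxr _ _) Nj.
apply: le_trans (gp_hyp3 hX o (u N) y _ _); rewrite lerBrDr !le_min h3.
by have K0 := normr_ge0 K; rewrite /M' in h1 oN; apply/and3P; split; lra.
Qed.

End visual.

Section orbit_boundary.
Variables (R : realType) (X : Type) (d : X -> X -> R) (G : groupType) (act : G -> X -> X).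
Variables (o : X) (D : R) (S : set G).
Hypothesis hX : hyp_space d.
Hypothesis hG : proper_action d act o D S.
Local Notation B := (gromov_boundary d).
Local Notation delta := (ln (4 : R)).
Variables (rho : B -> B -> R) (a C : R).
Hypotheses (a0 : 0 < a) (C0 : 0 < C).
Hypothesis rho_visual : forall xi eta,
  (C^-1%:E * expeR (- (a%:E * boundary_prod o xi eta)) <= (rho xi eta)%:E <=
   C%:E * expeR (- (a%:E * boundary_prod o xi eta)))%E.

Let d0 := dist_ge0 hX.
Let dC := distC hX.
Let dxx := distxx hX.
Let tri := dist_triangle hX.

Definition len (x : G) : R := d o (act x o).
Definition gdist (x y : G) : R := d (act x o) (act y o).
(* The end of a geodesic ray from [o] through [act x o], and that of a perpendicular to it
   at [act x o]: their distance is comparable to [expR (- (a * len x))] and provides a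
   scale attached to [x] that survives the passage to a quasisymmetric metric. *)
Definition bd_end (x : G) : B := endpt hX o (act x o).
Definition bd_side (x : G) : B := sidept hX o (act x o).

Lemma gdistE x y : gdist x y = len (x^-1 * y)%g.
Proof. by rewrite /len -(act_isom hG x o) -(actM hG) mulVKg. Qed.

Lemma len_finite r : finite_set [set g | len g <= r].
Proof. exact: (act_proper hG r). Qed.

Lemma len_lip x y : len y <= len x + gdist x y.
Proof. exact: tri. Qed.

Lemma gdistC x y : gdist x y = gdist y x. Proof. exact: dC. Qed.

Lemma bd_end_side : exists2 c : R, 0 < c & forall x,
  c^-1 * expR (- (a * len x)) <= rho (bd_end x) (bd_side x) <= c * expR (- (a * len x)).
Proof.
exists (C * expR (a * (3 * delta))); first by rewrite mulr_gt0// expR_gt0.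
move=> x; have /andP[h1 h2] := endpt_sidept hX a0 C0 rho_visual (act x o).
have l0 := ln4_ge0 R; apply/andP; split.
  apply: le_trans h1; rewrite mulrDr opprD expRD invfM -mulrA -expRN (mulrC (expR _)).
  by rewrite /len.
apply: le_trans h2 _; rewrite -mulrA ler_pM2l// -expRD ler_expR /len.
by rewrite mulrBr opprB lerD2r ler_pM2l//; lra.
Qed.

Lemma bd_end_near r : exists2 K : R, 0 < K & forall x y, gdist x y <= r ->
  rho (bd_end x) (bd_end y) <= K * expR (- (a * len x)).
Proof.
exists (C * expR (a * (`|r| + 2 * delta))); first by rewrite mulr_gt0// expR_gt0.
move=> x y xy; have rn := ler_norm r; have n0 := normr_ge0 r.
have ly := len_lip y x; rewrite gdistC in ly.
apply: le_trans (@endpt_le _ _ _ hX _ _ _ _ a0 C0 rho_visual _ _ (len x - `|r|) _ _ _) _.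
- by rewrite /len; lra.
- by move: ly xy; rewrite /len /gdist; lra.
- move: ly xy; rewrite /gromov_prod /len /gdist; lra.
by rewrite -mulrA ler_pM2l// -expRD ler_expR; lra.
Qed.

(** For distant [x] and [y] of comparable lengths the Gromov product falls far below [len x], and
    [endpt_ge] then separates the ends by more than the hypothesis allows. *)
Lemma bd_end_far K : 0 < K -> exists r, forall x y,
  rho (bd_end x) (bd_end y) <= K * expR (- (a * len x)) ->
  len x <= len y + K -> len y <= len x + K -> gdist x y <= r.
Proof.
move=> K0; have l0 := ln4_ge0 R.
pose E := `|ln (C * K)| / a + 4 * delta + 2 * delta + K.
have E0 : `|ln (C * K)| / a >= 0 by rewrite divr_ge0// ltW.
exists (K + 2 * E) => x y h xy yx; rewrite leNgt; apply/negP => lt.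
pose g := gromov_prod d o (act x o) (act y o).
have gE : g = (len x + len y - gdist x y) / 2 by [].
have g1 : g < len x - E by rewrite gE; lra.
have := @endpt_ge _ _ _ hX _ _ _ _ a0 C0 rho_visual (act x o) (act y o).
rewrite -/g -/(len x) -/(len y) => /(_ _ _)/wrap[||h2].
- by rewrite /E in g1; lra.
- by rewrite /E in g1; lra.
have := le_trans h2 h; rewrite -ler_pdivrMr ?expR_gt0// -mulrA -expRN opprK -expRD.
rewrite mulrC ler_pdivrMr// (mulrC K) => h3.
have : - (a * (g + 4 * delta)) + a * len x <= ln (C * K).
  by rewrite -ler_expR lnK ?posrE ?mulr_gt0.
have := ler_norm (ln (C * K)).
have -> : `|ln (C * K)| = a * (`|ln (C * K)| / a) by field; rewrite gt_eqF.
rewrite /E in g1; move: (_ / a) E0 g1 => e e0 g1 h4 h5.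
have : a * e < a * (len x - g - 4 * delta) by rewrite ltr_pM2l//; lra.
by lra.
Qed.

Lemma bd_dense z eps M : 0 < eps -> exists2 y, M <= len y & rho z (bd_end y) <= eps.
Proof.
move=> e0; have [q hq] := endpt_dense hX a0 C0 rho_visual z D M e0.
by have [y yq] := act_cover hG q; have [] := hq _ yq; exists y.
Qed.

(** Orbit points near the geodesic from [o] to [act x o] at integer times, and near [act x o]
    afterwards. The walk provides elements of all intermediate sizes with almost the same end as
    [x]. *)
Lemma bd_walk : exists2 K : R, 0 < K & forall x, exists w : nat -> G,
  [/\ len (w 0%N) <= K,
      (forall i, gdist (w i) (w i.+1) <= K),
      (forall i, rho (bd_end (w i)) (bd_end x) <= K * expR (- (a * len (w i)))),
      (forall i, len x <= i%:R -> gdist (w i) x <= K)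
    & forall i, Num.min i%:R (len x) - K <= len (w i)].
Proof.
have l0 := ln4_ge0 R.
have D0 : 0 <= D by have [g] := act_cover hG o; exact: le_trans.
exists (C * expR (a * (2 * D + 2 * delta)) + 2 * D + 1).
  by rewrite ltr_pwDr// addr_ge0 ?mulr_ge0 ?expR_ge0// ltW.
set K := _ + 1; move=> x.
have K1 : 2 * D + 1 <= K by rewrite /K -addrA lerDr mulr_ge0 ?expR_ge0// ltW.
pose t (i : nat) := Num.min i%:R (len x).
have t0 i : 0 <= t i by rewrite le_min ler0n d0.
have tx i : t i <= len x by rewrite ge_min lexx orbT.
pose q i := ray hX o (act x o) (t i).
have [r0 rx dr _ _] := rayP hX o (act x o).
pose w i := sval (cid (act_cover hG (q i))).
have wP i : d (q i) (act (w i) o) <= D by rewrite /w; case: cid.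
have oq i : d o (q i) = t i by rewrite -{1}r0 dr sub0r normrN ger0_norm.
have lw i : t i - D <= len (w i) <= t i + D.
  have := tri (q i) o (act (w i) o); have := tri (act (w i) o) o (q i).
  by rewrite oq (dC (act _ o)); have := wP i; rewrite /len => h1 h2 h3; apply/andP; split; lra.
exists w; split.
- have /andP[_ h] := lw 0%N; apply: le_trans h _.
  have : t 0%N <= 0 by rewrite /t ge_min lexx.
  lra.
- move=> i; rewrite /gdist.
  have := tri (q i) (act (w i) o) (act (w i.+1) o).
  have := tri (q i.+1) (q i) (act (w i.+1) o).
  have : d (q i) (q i.+1) <= 1.
    rewrite dr distrC; have : t i <= t i.+1 by rewrite le_min2 ?ler_nat.
    have : t i.+1 <= t i + 1.
      rewrite /t /Num.min -natr1; case: ifP; case: ifP => *; lra.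
    by move=> h1 h2; rewrite ger0_norm; lra.
  have := wP i; have := wP i.+1; rewrite (dC (q i) (act _ o)); lra.
- move=> i; have /andP[h1 h2] := lw i.
  apply: (@le_trans _ _ (C * expR (a * (2 * D + 2 * delta)) * expR (- (a * len (w i))))); last first.
    by rewrite ler_pM2r ?expR_gt0// /K; lra.
  have gq : gromov_prod d o (q i) (act x o) = t i.
    by have := @ray_gp _ _ _ hX o (act x o) _ _ (t0 i) (tx i); rewrite rx.
  have := gp_near hX o (act x o) (q i) (act (w i) o).
  rewrite (gpC hX o (act x o) (q i)) gq => gw; have hw := wP i.
  apply: le_trans (@endpt_le _ _ _ hX _ _ _ _ a0 C0 rho_visual _ _ (len (w i) - 2 * D) _ _ _) _.
  + by rewrite -/(len _); lra.
  + by have := tx i; rewrite -/(len x); lra.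
  + by rewrite (gpC hX); lra.
  by rewrite -mulrA ler_pM2l// -expRD ler_expR; lra.
- move=> i xi; have qx : q i = act x o.
    by rewrite /q (_ : t i = len x) ?rx// /t; apply/min_idPr.
  by have := wP i; rewrite /gdist dC qx; lra.
- by move=> i; have /andP[h _] := lw i; rewrite -/(t i); lra.
Qed.

End orbit_boundary.

(** * Quasisymmetric maps, Ahlfors regularity and hyperbolic fillings *)

Section quasisymmetric_maps.
Variables (R : realType) (T : Type) (rho theta : T -> T -> R).
Hypotheses (mrho : is_metric rho) (mtheta : is_metric theta).
Hypothesis qs : quasisymmetric rho theta.

Lemma metric_ge0 (d : T -> T -> R) x y : is_metric d -> 0 <= d x y.
Proof.
move=> [h0 hs ht]; have := ht x y x; rewrite (hs y x) (proj2 (h0 x x))//; lra.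
Qed.

Lemma metric_gt0 (d : T -> T -> R) x y : is_metric d -> x <> y -> 0 < d x y.
Proof.
move=> md xy; rewrite lt_neqAle metric_ge0// andbT eq_sym; apply/eqP.
by case: md => h0 _ _ /h0.
Qed.

(** The distortion [eta] is given as a continuous bijection of the half-line; its smallness near 0
    is extracted from injectivity and the intermediate value theorem. *)
Lemma qs_small eps : 0 < eps -> exists2 dlt : R, 0 < dlt & forall x y z,
  rho x y <= dlt * rho x z -> theta x y <= eps * theta x z.
Proof.
move=> e0; have [eta [ceta [e_in e_inj e_surj] heta]] := qs.
have inI (t : R) : 0 <= t -> `[0, +oo[%classic t by move=> t0 /=; rewrite in_itv /= t0.
have ge0I (t : R) : `[0, +oo[%classic t -> 0 <= t by rewrite /= in_itv /= andbT.
have cont (b c : R) : 0 <= b -> {within `[b, c], continuous eta}.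
  move=> b0; apply: continuous_subspaceW ceta => t /=.
  by rewrite !in_itv /= andbT => /andP[bt _]; exact: le_trans bt.
have inj s t : 0 <= s -> 0 <= t -> eta s = eta t -> s = t.
  by move=> s0 t0; apply: e_inj; rewrite inE; exact: inI.
have eta_ge0 t : 0 <= t -> 0 <= eta t by move=> t0; apply: ge0I; apply: e_in; exact: inI.
(* If [eta] vanished at some [u > 0], a small positive value would be taken on both sides of [u]. *)
have eta0 : eta 0 = 0.
  have [u u0 hu] := e_surj 0 (inI 0 (lexx 0)); have {}u0 := ge0I _ u0.
  have [u00|une] := eqVneq u 0; first by rewrite -[X in eta X]u00.
  have up : 0 < u by rewrite lt_neqAle eq_sym une.
  have p0 : 0 < eta 0.
    rewrite lt_neqAle eta_ge0// andbT eq_sym; apply/eqP => h.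
    by move: une; rewrite (inj u 0) ?eqxx// hu h.
  have u1 : 0 <= u + 1 by lra.
  have p1 : 0 < eta (u + 1).
    rewrite lt_neqAle eta_ge0// andbT eq_sym; apply/eqP => h.
    by have := inj (u + 1) u u1 u0; rewrite h hu => /(_ erefl); lra.
  pose v := Num.min (eta 0) (eta (u + 1)).
  have v0 : 0 < v by rewrite lt_min p0.
  have vle : v <= eta 0 /\ v <= eta (u + 1) by rewrite !ge_min !lexx orbT.
  have [|c1] := @IVT R eta 0 u v u0 (cont _ _ (lexx 0)).
    by rewrite hu ge_min le_max (ltW v0) (proj1 vle) orbT.
  rewrite in_itv /= => /andP[c10 c1u] e1.
  have [||c2] := @IVT R eta u (u + 1) v _ (cont _ _ u0); first by lra.
    by rewrite hu ge_min le_max (ltW v0) (proj2 vle) orbT.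
  rewrite in_itv /= => /andP[c20 c2u] e2.
  have c12 : c1 = c2 by apply: inj => //; [exact: le_trans c20|rewrite e1].
  have c1E : c1 = u by apply: le_anti; rewrite c1u c12.
  by move: e1 v0; rewrite c1E hu => ->; rewrite ltxx.
have [u u0 hu] := e_surj eps (inI eps (ltW e0)); have {}u0 := ge0I _ u0.
have up : 0 < u.
  rewrite lt_neqAle u0 andbT eq_sym; apply/eqP => u00.
  by move: e0; rewrite -hu u00 eta0 ltxx.
have small t : 0 <= t -> t <= u -> eta t <= eps.
  move=> t0 tu; rewrite leNgt; apply/negP => lt.
  have [|c] := @IVT R eta 0 t eps t0 (cont _ _ (lexx 0)).
    by rewrite eta0 ge_min le_max (ltW e0) (ltW lt) orbT.
  rewrite in_itv /= => /andP[c0 ct] ec.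
  have cu : c = u by apply: inj => //; rewrite ec hu.
  have tE : t = u by apply: le_anti; rewrite tu -cu.
  by move: lt; rewrite tE hu ltxx.
exists u => // x y z h; have [xz|xz] := pselect (x = z).
  have [r0 _ _] := mrho; have [t0 _ _] := mtheta.
  move: h; rewrite -xz (proj2 (r0 x x))// mulr0 => h.
  have /r0 -> : rho x y = 0 by apply: le_anti; rewrite h metric_ge0.
  by rewrite !(proj2 (t0 y y))// mulr0.
have rz := metric_gt0 mrho xz; have tz := metric_gt0 mtheta xz.
rewrite -ler_pdivrMr//; apply: le_trans (heta x y z xz) _; apply: small.
  by rewrite divr_ge0// metric_ge0.
by rewrite ler_pdivrMr.
Qed.

Lemma qs_bounded M : exists2 M' : R, 0 < M' & forall x y z,
  rho x y <= M * rho x z -> theta x y <= M' * theta x z.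
Proof.
have [eta [ceta _ heta]] := qs.
have [||c _ hc] := @EVT_max R eta 0 `|M|; first exact: normr_ge0.
  apply: continuous_subspaceW ceta => t /=.
  by rewrite !in_itv /= andbT => /andP[].
exists (`|eta c| + 1); first by rewrite ltr_wpDl// normr_ge0.
move=> x y z h; have [xz|xz] := pselect (x = z).
  have [r0 _ _] := mrho; have [t0 _ _] := mtheta.
  move: h; rewrite -xz (proj2 (r0 x x))// mulr0 => h.
  have /r0 -> : rho x y = 0 by apply: le_anti; rewrite h metric_ge0.
  by rewrite !(proj2 (t0 y y))// mulr0.
have rz := metric_gt0 mrho xz; have tz := metric_gt0 mtheta xz.
rewrite -ler_pdivrMr//; apply: le_trans (heta x y z xz) _.
have : eta (rho x y / rho x z) <= eta c.
  apply: hc; rewrite in_itv /= divr_ge0 ?metric_ge0//= ler_pdivrMr//.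
  by apply: le_trans h _; rewrite ler_pM2r// ler_norm.
by have := ler_norm (eta c); lra.
Qed.

(** If the ratio for [rho] were too large, [qs_small] with [y] and [z] exchanged would make the
    ratio for [theta] exceed [M]. *)
Lemma qs_inverse M : exists2 M' : R, 0 < M' & forall x y z,
  theta x y <= M * theta x z -> rho x y <= M' * rho x z.
Proof.
pose e := (2 * (`|M| + 1))^-1.
have Mp : 0 < `|M| + 1 by rewrite ltr_wpDl// normr_ge0.
have e0 : 0 < e by rewrite invr_gt0 mulr_gt0.
have [dlt d0 hd] := qs_small e0.
exists dlt^-1; first by rewrite invr_gt0.
move=> x y z h; rewrite leNgt; apply/negP => lt.
have := hd x z y; rewrite -ler_pdivrMl// => /(_ (ltW lt)) h2.
have t0 := metric_ge0 x z mtheta.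
have h3 : theta x y <= (`|M| + 1) * theta x z.
  by apply: le_trans h _; rewrite ler_wpM2r//; have := ler_norm M; lra.
have h4 : theta x z <= theta x z / 2.
  apply: le_trans h2 _; rewrite /e invfM -mulrA mulrC ler_pM2r ?invr_gt0//.
  by rewrite ler_pdivrMl.
have z0 : theta x z = 0 by lra.
have y0 : theta x y = 0 by apply: le_anti; rewrite metric_ge0// andbT; move: h3; rewrite z0 mulr0.
have [r0 _ _] := mrho; have [s0 _ _] := mtheta.
move: lt; rewrite ((proj1 (s0 x y)) y0) (proj2 (r0 y y))// ltNge mulr_ge0//.
  by rewrite invr_ge0 ltW.
exact: metric_ge0.
Qed.

End quasisymmetric_maps.

(** * Hausdorff measure and counting in Ahlfors regular spaces *)

Section hausdorff.
Variables (R : realType) (T : Type) (d : T -> T -> R).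
Implicit Types (A U : set T) (s delta : R).
Local Open Scope ereal_scope.

Lemma metric_diam_ge0 A : 0 <= metric_diam d A.
Proof. by apply: ereal_sup_ubound; left. Qed.

Lemma metric_diam_set0 : metric_diam d set0 = 0.
Proof.
apply: le_anti; rewrite metric_diam_ge0 andbT; by apply: ge_ereal_sup => y [->//|[x]].
Qed.

Lemma metric_diam_ge A x y : A x -> A y -> (d x y)%:E <= metric_diam d A.
Proof. by move=> Ax Ay; apply: ereal_sup_ubound; right; exists x => //; exists y. Qed.

Lemma hausdorff_content_mono s delta delta' A : (delta <= delta')%R ->
  hausdorff_content d s delta' A <= hausdorff_content d s delta A.
Proof.
move=> dd; apply: le_ereal_inf => _ [U [AU hU] <-]; exists U => //; split=> // i.
by apply: le_trans (hU i) _; rewrite lee_fin.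
Qed.

Lemma hausdorff_content_sub s delta A A' : A `<=` A' ->
  hausdorff_content d s delta A <= hausdorff_content d s delta A'.
Proof.
move=> AA; apply: le_ereal_inf => _ [U [AU hU] <-]; exists U => //; split=> //.
exact: subset_trans AU.
Qed.

Lemma hausdorff_measure_sub s A A' : A `<=` A' ->
  hausdorff_measure d s A <= hausdorff_measure d s A'.
Proof.
move=> AA; apply: ge_ereal_sup => _ [e e0 <-].
apply: le_trans (hausdorff_content_sub s e AA) _.
by apply: ereal_sup_ubound; exists e.
Qed.

(** A set of diameter at most [delta] meets at most one [A j], so a cover of the union splits into
    covers [V j] of the pieces without using a set twice. *)
Lemma hausdorff_content_separated s delta m (A : 'I_m -> set T) (v : \bar R) :
  (0 < s)%R -> 0 <= v ->
  (forall i j x y, i != j -> A i x -> A j y -> (delta < d x y)%R) ->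
  (forall j, v <= hausdorff_content d s delta (A j)) ->
  \sum_(j < m) v <= hausdorff_content d s delta (\bigcup_j A j).
Proof.
move=> s0 v0 sep hv; apply: le_ereal_inf_tmp => _ [U [AU hU] <-].
pose V j i : set T := [set x | U i x /\ (U i `&` A j) !=set0].
have VU j i : V j i = U i \/ V j i = set0.
  have [h|h] := pselect ((U i `&` A j) !=set0); [left|right].
    by apply/seteqP; split=> x //= [].
  by apply/seteqP; split=> x //= -[].
apply: (@le_trans _ _ (\sum_(j < m) \sum_(i <oo) (metric_diam d (V j i) `^ s))).
  apply: lee_sum => j _; apply: le_trans (hv j) _; apply: ereal_inf_lbound.
  exists (V j) => //; split=> [x Ax|i].
    by have [i _ Ux] := AU x (ex_intro2 _ _ j I Ax); exists i => //; split=> //; exists x.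
  by case: (VU j i) => ->//; rewrite metric_diam_set0; exact: le_trans (metric_diam_ge0 _) (hU i).
rewrite -nneseries_sum; last by move=> j i _; exact: poweR_ge0.
apply: lee_nneseries => [i _ _|i _]; first by apply: sume_ge0 => j _; exact: poweR_ge0.
have [[j hj]|none] := pselect (exists j, (U i `&` A j) !=set0).
  rewrite (bigD1 j)//= big1 ?adde0.
    by case: (VU j i) => ->//; rewrite metric_diam_set0 poweR0r ?gt_eqF// poweR_ge0.
  move=> k kj; case: (VU k i) => h; last by rewrite h metric_diam_set0 poweR0r// gt_eqF.
  have [x Ux] := hj; have [y [Uy Ay]] : (U i `&` A k) !=set0.
    have : V k i x by rewrite h; case: Ux.
    by case.
  case: Ux => Ux Ax; have := sep j k x y; rewrite eq_sym kj => /(_ erefl Ax Ay).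
  have := le_trans (metric_diam_ge Ux Uy) (hU i); rewrite lee_fin => h1 h2.
  by have := le_lt_trans h1 h2; rewrite ltxx.
rewrite big1 ?poweR_ge0// => j _; case: (VU j i) => h.
  have [[x Ux]|e] := pselect (exists x, U i x).
    move: (Ux); rewrite -h => -[_ n].
    by case: none; exists j.
  rewrite (_ : V j i = set0) ?metric_diam_set0 ?poweR0r ?gt_eqF//.
  by rewrite h; apply/seteqP; split=> x //= Ux; case: e; exists x.
by rewrite h metric_diam_set0 poweR0r// gt_eqF.
Qed.

Lemma hausdorff_dim_lt2 : hausdorff_dim d < 2%:E -> exists s : R,
  [/\ (0 < s)%R, (s < 2)%R & hausdorff_measure d s setT = 0].
Proof.
by move=> /ereal_inf_lt[_ [s [s0 hs] <-]]; rewrite lte_fin => s2; exists s.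
Qed.

Lemma hausdorff_measure_expo s Q A : (0 < s)%R -> (s <= Q)%R ->
  hausdorff_measure d s A = 0 -> hausdorff_measure d Q A <= 0.
Proof.
move=> s0 sQ H0; apply: ge_ereal_sup => _ [e e0 <-].
pose e1 := Num.min e 1%R; have e10 : (0 < e1)%R by rewrite lt_min; apply/andP; split.
apply: (@le_trans _ _ (hausdorff_content d Q e1 A)).
  by apply: hausdorff_content_mono; rewrite ge_min lexx.
apply: (@le_trans _ _ (hausdorff_content d s e1 A)); last first.
  by rewrite -H0; apply: ereal_sup_ubound; exists e1.
apply: le_ereal_inf_tmp => _ [U [AU hU] <-].
apply: (@le_trans _ _ (\sum_(i <oo) (metric_diam d (U i) `^ Q))).
  by apply: ereal_inf_lbound; exists U.
apply: lee_nneseries => [i _ _|i _]; first exact: poweR_ge0.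
have : metric_diam d (U i) <= 1%:E.
  by apply: le_trans (hU i) _; rewrite lee_fin ge_min lexx orbT.
have := metric_diam_ge0 (U i); move: (metric_diam d (U i)) => [r| |]//.
rewrite !lee_fin => r0 r1; move: r0; rewrite le_eqVlt => /orP[/eqP <-|r0].
  by rewrite !powR0 ?gt_eqF//; exact: lt_le_trans sQ.
by apply: ger_powR => //; rewrite r0.
Qed.

End hausdorff.

Section ahlfors.
Variables (R : realType) (T : Type) (d : T -> T -> R).
Hypothesis md : is_metric d.
Hypothesis ar : ahlfors_regular d.
Hypothesis dim2 : (hausdorff_dim d < 2%:E)%E.
Variable r0 : R.
Hypotheses (r0_gt0 : 0 < r0) (r0_diam : ((2 * r0)%:E <= metric_diam d setT)%E).
Variable p0 : T.

Definition separated (tau : R) (s : seq T) :=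
  forall i j, (i < size s)%N -> (j < size s)%N -> i != j -> tau <= d (nth p0 s i) (nth p0 s j).

(** Volume counting: the balls of radius [tau / 4] about separated points lie in a ball of radius
    [2 * r], and superadditivity is taken from contents of separated sets. [Q < 2], for otherwise
    the null measure in some dimension below 2 would contradict the lower Ahlfors bound. *)
Lemma ahlfors_count : exists Q K : R, [/\ 0 < Q, Q < 2, 0 < K &
  forall p r tau s, 0 < tau -> tau <= r -> r <= r0 -> separated tau s ->
    (forall i, (i < size s)%N -> d p (nth p0 s i) < r) ->
    (size s)%:R <= K * (r / tau) `^ Q].
Proof.
have [Q [C [Q0 C0 hAR]]] := ar.
have [d0 dC tri] := md.
have Q2 : Q < 2.
  have [s [s0 s2 Hs]] := hausdorff_dim_lt2 dim2.
  rewrite ltNge; apply/negP => Q2.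
  have r0d : (r0%:E <= metric_diam d setT)%E.
    by apply: le_trans r0_diam; rewrite lee_fin ler_peMl ?ler1n ?(ltW r0_gt0).
  have /andP[h _] := hAR p0 r0 r0_gt0 r0d.
  have := le_trans h (hausdorff_measure_sub d Q (A' := setT) (fun _ _ => I)).
  move=> /le_trans/(_ (hausdorff_measure_expo s0 (le_trans (ltW s2) Q2) Hs)).
  by rewrite lee_fin leNgt mulr_gt0 ?invr_gt0 ?powR_gt0.
(* The ratio of [2 * r] to [tau / 4] is [8 * (r / tau)]; each Ahlfors bound gives a factor [C], and
   2 comes from halving [v]. *)
exists Q, (2 * C * C * 8 `^ Q); split=> //.
  by rewrite !mulr_gt0 ?powR_gt0.
move=> p r tau s t0 tr rr sep hs.
have r_gt0 : 0 < r by exact: lt_le_trans tr.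
pose m := size s; pose A (j : 'I_m) := metric_ball d (nth p0 s j) (tau / 4).
pose v := C^-1 * (tau / 4) `^ Q.
have v0 : 0 < v by rewrite mulr_gt0 ?invr_gt0// powR_gt0// divr_gt0.
have hv j : (v%:E <= hausdorff_measure d Q (A j))%E.
  have td : ((tau / 4)%:E <= metric_diam d setT)%E.
    by apply: le_trans r0_diam; rewrite lee_fin; lra.
  by have /andP[] := hAR (nth p0 s j) (tau / 4) (divr_gt0 t0 (ltr0Sn _ _)) td.
(* The measures are suprema of contents; passing to half of [v] leaves room for one mesh [e] that
   serves all the balls. *)
have [j e e' e'0 ee' lt|j _|e e0 he] := @finite_set_eps R _ setT
  (fun j e => ((v / 2)%:E < hausdorff_content d Q e (A j))%E) finite_finset.
- exact: lt_le_trans lt (hausdorff_content_mono _ _ _ ee').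
- have : ((v / 2)%:E < hausdorff_measure d Q (A j))%E.
    by apply: lt_le_trans (hv j); rewrite lte_fin; lra.
  by move=> /ereal_sup_gt[_ [e e0 <-] h]; exists e.
pose dl := Num.min e (tau / 4).
have dl0 : 0 < dl by rewrite lt_min e0 divr_gt0.
have sepA (i j : 'I_m) x y : i != j -> A i x -> A j y -> dl < d x y.
  rewrite /A /metric_ball /= => ij xi yj.
  have := sep i j (ltn_ord i) (ltn_ord j) ij.
  have := tri (nth p0 s i) x (nth p0 s j); have := tri x y (nth p0 s j).
  rewrite (dC y) => h1 h2 h3; have dle : dl <= tau / 4 by rewrite ge_min lexx orbT.
  by lra.
have v20 : (0 <= (v / 2)%:E)%E by rewrite lee_fin; lra.
have hvA j : ((v / 2)%:E <= hausdorff_content d Q dl (A j))%E.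
  apply: ltW; apply: lt_le_trans (he j I) _; apply: hausdorff_content_mono.
  by rewrite ge_min lexx.
have := hausdorff_content_separated Q0 v20 sepA hvA.
rewrite sumEFin sumr_const card_ord => h1.
have rd : ((2 * r)%:E <= metric_diam d setT)%E.
  by apply: le_trans r0_diam; rewrite lee_fin ler_pM2l.
have /andP[_ h2] := hAR p (2 * r) (mulr_gt0 (ltr0Sn _ _) r_gt0) rd.
have sub : \bigcup_j A j `<=` metric_ball d p (2 * r).
  move=> x [j _]; rewrite /A /metric_ball /= => xj.
  by have := tri p (nth p0 s j) x; have := hs j (ltn_ord j); lra.
have h3 : (((v / 2) *+ m)%:E <= (C * (2 * r) `^ Q)%:E)%E.
  apply: le_trans h1 _; apply: le_trans h2; apply: le_trans _ (hausdorff_measure_sub d Q sub).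
  by apply: ereal_sup_ubound; exists dl.
move: h3; rewrite lee_fin -mulr_natr /v => h3.
have e1 : (2 * r) `^ Q = 8 `^ Q * (r / tau) `^ Q * (tau / 4) `^ Q.
  have a1 : 0 <= r / tau by rewrite divr_ge0// ltW.
  have a2 : 0 <= tau / 4 by rewrite divr_ge0// ltW.
  rewrite -(powRM _ (ler0n _ 8) a1) -(powRM _ (mulr_ge0 (ler0n _ 8) a1) a2).
  by congr (_ `^ _); field; rewrite gt_eqF.
rewrite e1 in h3.
have w0 : 0 < (tau / 4) `^ Q by rewrite powR_gt0// divr_gt0.
rewrite -(ler_pM2r w0) -(@ler_pM2l _ (C^-1 / 2)) ?divr_gt0 ?invr_gt0//.
apply: le_trans (le_trans _ h3) _; rewrite le_eqVlt; apply/orP; left; apply/eqP.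
  by rewrite /m; ring.
by field; rewrite gt_eqF.
Qed.

End ahlfors.

Section scales.
Variable R : realType.

Definition scale (n : nat) : R := 2^-1 ^+ n.

Lemma scale_gt0 n : 0 < scale n. Proof. by rewrite exprn_gt0// invr_gt0. Qed.

Lemma scaleD n m : scale (n + m) = scale n * scale m. Proof. exact: exprD. Qed.

Lemma scale_le n m : (m <= n)%N -> scale n <= scale m.
Proof.
move=> /subnK <-; rewrite addnC scaleD ger_pMr ?scale_gt0// /scale exprn_ile1 ?invr_ge0//.
by rewrite invf_le1 ?ler1n.
Qed.

Lemma scale_pow n m : scale n = 2 ^+ m * scale (n + m).
Proof. by rewrite scaleD mulrCA /scale -exprMn divff// expr1n mulr1. Qed.

Lemma scale_pow2 m : 2 ^+ m * scale m = 1.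
Proof. by rewrite -[m in scale m]add0n -scale_pow /scale expr0. Qed.

Lemma pow2_ge1 k : 1 <= 2 ^+ k :> R. Proof. by rewrite exprn_ege1// ler1n. Qed.

Lemma pow2_le k m : (k <= m)%N -> 2 ^+ k <= 2 ^+ m :> R.
Proof. by move=> km; rewrite ler_weXn2l// ler1n. Qed.

Lemma pow2_bound (C : R) : exists k : nat, C <= 2 ^+ k.
Proof.
exists (Num.truncn `|C|).+1; have /andP[_ h] := truncn_itv (normr_ge0 C).
apply: le_trans (ler_norm _) (le_trans (ltW h) _).
by rewrite -natrX ler_nat ltnW// ltn_expl.
Qed.

Lemma scale_bound (e : R) : 0 < e -> exists n, scale n <= e.
Proof.
move=> e0; have [k hk] := pow2_bound e^-1; exists k.
by rewrite /scale exprVn -[leRHS]invrK lef_pV2// posrE ?invr_gt0// exprn_gt0.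
Qed.

Lemma scale_lt n m : (m < n)%N -> scale n < scale m.
Proof.
move=> mn; apply: le_lt_trans (scale_le mn) _.
by rewrite -addn1 scaleD gtr_pMr ?scale_gt0// /scale expr1 invf_lt1 ?ltr1n.
Qed.

Lemma scale_compare n m k : scale m <= 2 ^+ k * scale n -> (n <= m + k)%N.
Proof.
move=> h; rewrite leqNgt; apply/negP => lt.
have := scale_lt lt; rewrite scaleD -(ltr_pM2l (exprn_gt0 k (ltr0Sn R 1))).
by rewrite mulrCA scale_pow2 mulr1 ltNge h.
Qed.

End scales.

(* The element [x] stands for the ball of centre [xi x] and radius [2 ^- nn x] of the
   metric space [T]. In [fill_count], [lam < 4 = 2 ^ 2] expresses that the dimension of
   [T] is less than 2: at scale [2 ^- n], square-summability needs [lam / 4 < 1]. *)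
Record filling (R : realType) (G : groupType) (T : Type) (theta : T -> T -> R)
    (xi : G -> T) (nn : G -> nat) : Prop := Filling {
  fill_metric : is_metric theta ;
  fill_bounded : exists C, forall p q, theta p q <= C ;
  fill_close : forall k, exists F : seq G, forall x y,
    theta (xi x) (xi y) <= 2 ^+ k * scale R (nn x) ->
    (nn x <= nn y + k)%N -> (nn y <= nn x + k)%N -> (x^-1 * y)%g \in F ;
  fill_lip : forall g, exists k, forall x,
    [/\ theta (xi x) (xi (x * g)%g) <= 2 ^+ k * scale R (nn x),
        (nn x <= nn (x * g)%g + k)%N & (nn (x * g)%g <= nn x + k)%N] ;
  fill_net : exists k, forall x n, (n <= nn x)%N -> exists w,
    [/\ (n <= nn w + k)%N, (nn w <= n + k)%N &
        theta (xi w) (xi x) <= 2 ^+ k * scale R n] ;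
  fill_count : exists lam : R, [/\ 1 <= lam, lam < 4 & forall k, exists M,
    forall p n m (s : seq G), uniq s -> (forall x, x \in s -> nn x = (n + m)%N /\
      theta (xi x) p <= 2 ^+ k * scale R n) -> (size s)%:R <= M * lam ^+ m] ;
  fill_dense : forall z eps (s : seq G), 0 < eps -> exists2 y, y \notin s &
    theta z (xi y) <= eps ;
  fill_two : exists z1 z2, 0 < theta z1 z2
}.

(** * The filling of the boundary by the lattice *)

Section hyperbolic_filling.
Variables (R : realType) (G : groupType) (T : Type) (rho theta : T -> T -> R).
Variables (xi si : G -> T) (len : G -> R) (a : R).
Local Notation gdist x y := (len (x^-1 * y)%g).
Hypotheses (mrho : is_metric rho) (mtheta : is_metric theta).
Hypothesis qs : quasisymmetric rho theta.
Hypothesis ar : ahlfors_regular theta.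
Hypothesis dim2 : (hausdorff_dim theta < 2%:E)%E.
Hypothesis rho_bounded : exists C, forall p q, rho p q <= C.
Hypothesis a0 : 0 < a.
Hypothesis len_finite : forall r, finite_set [set g | len g <= r].
Hypothesis len_lip : forall x y, len y <= len x + gdist x y.
Hypothesis gdistC : forall x y, gdist x y = gdist y x.
Hypothesis end_side : exists2 c : R, 0 < c & forall x,
  c^-1 * expR (- (a * len x)) <= rho (xi x) (si x) <= c * expR (- (a * len x)).
Hypothesis end_near : forall r, exists2 K : R, 0 < K & forall x y, gdist x y <= r ->
  rho (xi x) (xi y) <= K * expR (- (a * len x)).
Hypothesis end_far : forall K, 0 < K -> exists r, forall x y,
  rho (xi x) (xi y) <= K * expR (- (a * len x)) ->
  len x <= len y + K -> len y <= len x + K -> gdist x y <= r.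
Hypothesis end_dense : forall z eps M, 0 < eps -> exists2 y, M <= len y & rho z (xi y) <= eps.
Hypothesis end_walk : exists2 K : R, 0 < K & forall x, exists w : nat -> G,
  [/\ len (w 0%N) <= K,
      (forall i, gdist (w i) (w i.+1) <= K),
      (forall i, rho (xi (w i)) (xi x) <= K * expR (- (a * len (w i)))),
      (forall i, len x <= i%:R -> gdist (w i) x <= K)
    & forall i, Num.min i%:R (len x) - K <= len (w i)].

Let tge0 x y := metric_ge0 x y mtheta.
Let rC : forall x y, rho x y = rho y x. Proof. by case: mrho. Qed.
Let tC : forall x y, theta x y = theta y x. Proof. by case: mtheta. Qed.
Let rtri : forall y x z, rho x z <= rho x y + rho y z.
Proof. by case: mrho => _ _ h y x z. Qed.
Let ttri : forall y x z, theta x z <= theta x y + theta y z.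
Proof. by case: mtheta => _ _ h y x z. Qed.

Definition width x := theta (xi x) (si x).

Lemma end_side_neq x : xi x <> si x.
Proof.
move=> e; have [c c0 /(_ x)] := end_side; have [h _ _] := mrho.
rewrite e (proj2 (h _ _))// => /andP[+ _].
by rewrite leNgt mulr_gt0 ?invr_gt0 ?expR_gt0.
Qed.

Lemma width_gt0 x : 0 < width x.
Proof. exact: metric_gt0 mtheta (@end_side_neq x). Qed.

(** [qs_bounded] is applied with centre [xi x] and reference point [si x], whose visual distance is
    comparable to [expR (- (a * len x))]. *)
Lemma width_lip r : exists2 K : R, 0 < K & forall x y, gdist x y <= r ->
  theta (xi x) (xi y) <= K * width x /\ width y <= K * width x.
Proof.
have [c c0 hc] := end_side; have [K K0 hK] := end_near r.
have [M1 M10 hM1] := qs_bounded mrho mtheta qs (K * c).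
have [M2 M20 hM2] := qs_bounded mrho mtheta qs ((K + c * expR (a * r)) * c).
exists (M1 + M2) => [|x y xy]; first exact: addr_gt0.
have /andP[lo _] := hc x.
have ex : expR (- (a * len x)) <= c * rho (xi x) (si x) by rewrite -ler_pdivrMl.
have h1 : theta (xi x) (xi y) <= M1 * width x.
  apply: hM1; apply: le_trans (hK x y xy) _; rewrite -mulrA ler_pM2l//.
have h2 : theta (xi x) (si y) <= M2 * width x.
  apply: hM2; apply: le_trans (rtri (xi y) _ _) _.
  apply: (@le_trans _ _ ((K + c * expR (a * r)) * expR (- (a * len x)))).
    rewrite mulrDl lerD ?hK//; have /andP[_ hi] := hc y; apply: le_trans hi _.
    rewrite -mulrA ler_pM2l// -expRD ler_expR.
    have := len_lip y x; rewrite gdistC => h; rewrite -mulrBr -mulrN ler_pM2l//; lra.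
  by rewrite -mulrA ler_pM2l// addr_gt0// mulr_gt0// expR_gt0.
have w0 := width_gt0 x; rewrite mulrDl; split.
  by apply: le_trans h1 _; rewrite lerDl mulr_ge0// ltW.
by apply: le_trans (ttri (xi x) _ _) _; rewrite tC lerD.
Qed.

(** One direction of the converse of [width_lip], by quasisymmetry of the inverse; [width_close]
    applies it to both orders of [x] and [y]. *)
Lemma width_half C : exists2 K : R, 0 < K & forall x y,
  theta (xi x) (xi y) <= C * width y -> width x <= C * width y ->
  rho (xi y) (xi x) <= K * expR (- (a * len y)) /\ len y <= len x + K.
Proof.
have [c c0 hc] := end_side.
have [M1 M10 hM1] := qs_inverse mrho mtheta qs C.
have [M2 M20 hM2] := qs_inverse mrho mtheta qs (2 * C).
pose E := c * c * (M1 + M2).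
have E0 : 0 < E by rewrite !mulr_gt0// addr_gt0.
exists (M1 * c + `|ln E| / a) => [|x y h1 h2].
  by rewrite ltr_wpDr ?mulr_gt0// divr_ge0// ltW.
have /andP[_ hi] := hc y; have /andP[lo _] := hc x.
have r1 : rho (xi y) (xi x) <= M1 * rho (xi y) (si y) by apply: hM1; rewrite tC.
have r2 : rho (xi y) (si x) <= M2 * rho (xi y) (si y).
  by apply: hM2; apply: le_trans (ttri (xi x) _ _) _; rewrite tC -/(width y) -/(width x); lra.
have l0 : 0 <= `|ln E| / a by rewrite divr_ge0// ltW.
split.
  apply: le_trans r1 _; rewrite mulrDl -mulrA.
  have : M1 * rho (xi y) (si y) <= M1 * (c * expR (- (a * len y))) by rewrite ler_pM2l.
  by move=> /le_trans; apply; rewrite lerDl mulr_ge0// expR_ge0.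
have : c^-1 * expR (- (a * len x)) <= (M1 + M2) * (c * expR (- (a * len y))).
  apply: le_trans lo _; apply: le_trans (rtri (xi y) _ _) _; rewrite rC mulrDl.
  apply: lerD; first by apply: le_trans r1 _; rewrite ler_pM2l.
  by apply: le_trans r2 _; rewrite ler_pM2l.
rewrite ler_pdivrMl// => h3.
have {}h3 : expR (- (a * len x)) <= E * expR (- (a * len y)).
  by apply: le_trans h3 _; rewrite le_eqVlt; apply/orP; left; apply/eqP; rewrite /E; ring.
move: h3; rewrite -{1}(lnK (x := E)) ?posrE// -expRD ler_expR => h3.
have h4 : a * (len y - len x) <= a * (`|ln E| / a).
  rewrite (_ : a * (`|ln E| / a) = `|ln E|); last by field; rewrite gt_eqF.
  by have := ler_norm (ln E); rewrite mulrBr; lra.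
by move: h4; rewrite ler_pM2l//; have := mulr_gt0 M10 c0; lra.
Qed.

Lemma width_close C : exists r, forall x y,
  theta (xi x) (xi y) <= C * width x -> width x <= C * width y -> width y <= C * width x ->
  gdist x y <= r.
Proof.
(* A distance at most [C * width x] is also at most [C * C * width y]: [C'] serves both orders. *)
pose C' := `|C| * `|C| + `|C|.
have [K K0 hK] := width_half C'; have [r hr] := end_far K0.
have Cn := ler_norm C; have C0 := normr_ge0 C; have CC0 := mulr_ge0 C0 C0.
have CC' : C <= C' by rewrite /C'; lra.
exists r => x y h1 h2 h3; have wx := width_gt0 x; have wy := width_gt0 y.
have up z : C * width z <= C' * width z by rewrite ler_pM2r ?width_gt0.
have k1 : theta (xi x) (xi y) <= C' * width y.
  apply: le_trans h1 _; apply: (@le_trans _ _ (`|C| * (C * width y))).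
    by apply: le_trans (_ : _ <= `|C| * width x) _; [rewrite ler_pM2r|rewrite ler_wpM2l].
  apply: (@le_trans _ _ (`|C| * `|C| * width y)); last by rewrite ler_pM2r// /C'; lra.
  by rewrite -mulrA ler_wpM2l// ler_pM2r.
have [_ l1] := hK x y k1 (le_trans h2 (up y)).
have k2 : theta (xi y) (xi x) <= C' * width x by rewrite tC; exact: le_trans h1 (up x).
have [r1 l2] := hK y x k2 (le_trans h3 (up x)).
exact: hr.
Qed.

Lemma theta_bounded : exists2 K : R, 0 < K & forall p q, theta p q <= K.
Proof.
have [C hC] := rho_bounded; pose z := xi 1%g; pose z' := si 1%g.
have zz := metric_gt0 mrho (@end_side_neq 1%g); rewrite -/z -/z' in zz.
have [M M0 hM] := qs_bounded mrho mtheta qs (`|C| / rho z z').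
have b p : theta z p <= M * theta z z'.
  apply: hM; rewrite divfK ?gt_eqF//; apply: le_trans (hC _ _) _; exact: ler_norm.
have t0 := width_gt0 1%g; rewrite /width -/z -/z' in t0.
exists (2 * (M * theta z z')); first by rewrite !mulr_gt0.
move=> p q; apply: le_trans (ttri z _ _) _; rewrite (tC p).
by have := b p; have := b q; lra.
Qed.

(** One of two fixed distinct points is at visual distance at least half of theirs from [p], and
    serves as reference point in [qs_small]. *)
Lemma theta_small eps : 0 < eps -> exists2 dl : R, 0 < dl & forall p q,
  rho p q <= dl -> theta p q <= eps.
Proof.
move=> e0; have [K K0 hK] := theta_bounded.
have [dl d0 hd] := qs_small mrho mtheta qs (divr_gt0 e0 K0).
pose z := xi 1%g; pose z' := si 1%g.
have zz := metric_gt0 mrho (@end_side_neq 1%g); rewrite -/z -/z' in zz.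
exists (dl * (rho z z' / 2)) => [|p q pq]; first by rewrite !mulr_gt0// invr_gt0.
have [w hw] : exists w, rho z z' / 2 <= rho p w.
  have := rtri p z z'; rewrite (rC z p) => h.
  have [hz|hz] := lerP (rho z z' / 2) (rho p z); first by exists z.
  by exists z'; lra.
apply: (le_trans (hd p q w _)); last by rewrite mulrAC ler_pdivrMr// ler_pM2l.
by apply: le_trans pq _; rewrite ler_pM2l.
Qed.

Lemma theta_dense z eps (s : seq G) : 0 < eps -> exists2 y, y \notin s & theta z (xi y) <= eps.
Proof.
move=> e0; have [dl d0 hd] := theta_small e0.
have [M hM] : exists M, forall y, y \in s -> len y < M.
  elim: s => [|x s [M hM]]; first by exists 0.
  exists (Num.max (len x + 1) M) => y; rewrite inE lt_max => /orP[/eqP ->|/hM ->].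
    by rewrite ltrDl ltr01.
  by rewrite orbT.
have [y My ry] := end_dense z M d0.
exists y; last exact: hd.
by apply/negP => /hM; rewrite ltNge My.
Qed.

(** Total boundedness of the set of ends: the walk towards [x], stopped at a fixed time [L], ranges
    over a finite set and its end is already close to [xi x]. *)
Lemma theta_net eps : 0 < eps -> exists s : seq G, forall x, exists2 y, y \in s &
  theta (xi y) (xi x) <= eps.
Proof.
move=> e0; have [dl d0 hd] := theta_small e0; have [K K0 hK] := end_walk.
have [L hL] : exists L : nat, K * expR (- (a * (L%:R - K))) <= dl.
  have [L hL] := nat_bound (K - ln (dl / K) / a).
  exists L; rewrite mulrC -ler_pdivlMr// -{1}(lnK (x := dl / K)) ?posrE ?divr_gt0// ler_expR.
  have lE : ln (dl / K) = a * (ln (dl / K) / a) by field; rewrite gt_eqF.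
  rewrite lE -mulrN ler_pM2l//; have := hL L (leqnn L); move: (_ / a) => l; lra.
have [s hs] := (proj1 (finite_seqP _)) (len_finite (K + L%:R * K + L%:R)).
exists s => x; have [xL|Lx] := ltrP (len x) L%:R.
  exists x; last by have [h _ _] := mtheta; rewrite (proj2 (h _ _))// ltW.
  have : [set` s] x by rewrite -hs /=; have := mulr_ge0 (ler0n R L) (ltW K0); lra.
  by [].
have [w [w0 ws wr wend wlen]] := hK x.
exists (w L); last first.
  apply: hd; apply: le_trans (wr L) _; apply: le_trans hL; rewrite ler_pM2l// ler_expR.
  rewrite lerN2 ler_pM2l//; have := wlen L.
  by have -> : Num.min L%:R (len x) = L%:R by apply/min_idPl.
have : [set` s] (w L).
  rewrite -hs /=; suff h n : len (w n) <= K + n%:R * K.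
    by have := h L; have := ler0n R L; lra.
  elim: n => [|n IH]; first by rewrite mul0r addr0.
  apply: le_trans (len_lip (w n) _) _; apply: le_trans (lerD IH (ws n)) _.
  by rewrite -natr1; lra.
by [].
Qed.

(** The first point of the walk with width at most [C * t] works: the point before it is wider, and
    a step changes the width by a bounded factor. The term with [A] covers a walk that starts below
    this threshold. *)
Lemma width_walk A : 0 < A -> exists2 K : R, 0 < K & forall x t, width x <= t -> t <= A ->
  exists w, [/\ width w <= K * t, t <= K * width w & theta (xi w) (xi x) <= K * t].
Proof.
move=> A0; have [K K0 hK] := end_walk; have [C C0 hC] := width_lip K.
have [c c0 hc] := end_side.
have [M M0 hM] := qs_bounded mrho mtheta qs (K * c).
have w1 := width_gt0 1%g.
have C1 : 1 <= C.
  have [w [_ ws _ _ _]] := hK 1%g; have [_ h1] := hC _ _ (ws 0%N).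
  have [_ h2] : theta (xi (w 1%N)) (xi (w 0%N)) <= C * width (w 1%N) /\ width (w 0%N) <= C * width (w 1%N).
    by apply: hC; rewrite gdistC.
  have p0 := width_gt0 (w 0%N); have p1 := width_gt0 (w 1%N).
  rewrite leNgt; apply/negP => lt; nra.
exists (C + A * (C / width 1%g) + M * C) => [|x t wx t1].
  by rewrite !addr_gt0 ?mulr_gt0 ?invr_gt0.
have t0 : 0 < t by exact: lt_le_trans (width_gt0 x) wx.
have [w [w0 ws wr wend _]] := hK x.
have ex : exists i, width (w i) <= C * t.
  have [N hN] := nat_bound (len x); exists N.
  have := wend N (hN N (leqnn N)); rewrite gdistC => /hC[_ h].
  by apply: le_trans h _; rewrite ler_pM2l.
pose i := ex_minn ex; have [hi imin] : width (w i) <= C * t /\ forall j, width (w j) <= C * t -> (i <= j)%N.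
  by rewrite /i; case: ex_minnP => m h1 h2.
have M10 : 0 < M * C by rewrite mulr_gt0.
have q0 : 0 < A * (C / width 1%g) by rewrite mulr_gt0// divr_gt0.
exists (w i); split.
- by apply: le_trans hi _; rewrite ler_pM2r//; lra.
- have wi := width_gt0 (w i).
  case: i hi imin wi => [|i] hi imin wi.
    apply: (le_trans t1); have : gdist (w 0%N) 1%g <= K by rewrite gdistC invg1 mul1g.
    move=> /hC[_ h]; apply: (@le_trans _ _ (A * (C / width 1%g) * width (w 0%N))).
      by rewrite -mulrA ler_peMr ?(ltW A0)// mulrAC ler_pdivlMr// mul1r.
    by rewrite ler_pM2r//; lra.
  have := ws i; rewrite gdistC => /hC[_ h].
  have : C * t < width (w i).
    by rewrite ltNge; apply/negP => /imin; rewrite ltnn.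
  move=> /lt_le_trans/(_ h); rewrite ltr_pM2l// => lt.
  by apply: le_trans (ltW lt) _; rewrite ler_pMl//; lra.
- have h : theta (xi (w i)) (xi x) <= M * width (w i).
    apply: hM; apply: le_trans (wr i) _; rewrite -mulrA ler_pM2l//.
    by have /andP[lo _] := hc (w i); rewrite -ler_pdivrMl.
  apply: le_trans h _; apply: (@le_trans _ _ (M * (C * t))); first by rewrite ler_pM2l.
  by rewrite mulrA ler_pM2r//; lra.
Qed.

(** [ahlfors_count] freed of the bound on the radius: large balls are cut by a finite net into balls
    of radius [r0], at the cost of a constant factor. *)
Lemma point_count : exists Q K : R, [/\ 0 < Q, Q < 2, 0 < K &
  forall p r tau (s : seq G), 0 < tau -> tau <= r -> uniq s ->
    {in s &, forall x y, x != y -> tau <= theta (xi x) (xi y)} ->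
    {in s, forall x, theta p (xi x) <= r} ->
    (size s)%:R <= K * (r / tau) `^ Q].
Proof.
pose r0 := width 1%g / 2; have r00 : 0 < r0 by rewrite divr_gt0 ?width_gt0.
have rd : ((2 * r0)%:E <= metric_diam theta setT)%E.
  by rewrite /r0 mulrC divfK//; exact: metric_diam_ge.
pose p0 := xi 1%g.
have [Q [K [Q0 Q2 K0 hK]]] := ahlfors_count mtheta ar dim2 r00 rd p0.
have base p r tau (s : seq G) : 0 < tau -> tau <= r -> r <= r0 -> uniq s ->
    {in s &, forall x y, x != y -> tau <= theta (xi x) (xi y)} ->
    {in s, forall x, theta p (xi x) < r} -> (size s)%:R <= K * (r / tau) `^ Q.
  move=> t0 tr rr us sep hs; rewrite -(size_map xi s); apply: hK => //.
    move=> i j; rewrite size_map => iz jz ij.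
    rewrite !(nth_map 1%g)//; apply: sep; rewrite ?mem_nth//.
    by rewrite nth_uniq.
  by move=> i; rewrite size_map => iz; rewrite (nth_map 1%g)//; apply: hs; rewrite mem_nth.
have [Y hY] := theta_net (divr_gt0 r00 (ltr0Sn R 1)).
pose K' := ((size Y)%:R + 1) * K * 2 `^ Q.
exists Q, K'; split=> //; first by rewrite !mulr_gt0 ?powR_gt0// ltr_wpDl.
move=> p r tau s t0 tr us sep hs.
have r_gt0 : 0 < r by exact: lt_le_trans tr.
have rt0 : 0 <= r / tau by rewrite divr_ge0// ltW.
have e2 : K' * (r / tau) `^ Q = ((size Y)%:R + 1) * (K * (2 * r / tau) `^ Q).
  by rewrite /K' -[2 * r / tau]mulrA (powRM Q (ler0n _ 2) rt0); ring.
rewrite e2; have B0 : 0 <= K * (2 * r / tau) `^ Q by rewrite mulr_ge0 ?powR_ge0// ltW.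
have [small|big] := lerP (2 * r) r0.
  apply: (@le_trans _ _ (K * (2 * r / tau) `^ Q)); last by rewrite ler_peMl// lerDr.
  apply: (base p) => //; first by lra.
  by move=> x xs; apply: le_lt_trans (hs x xs) _; lra.
have sub y : (count (fun x => theta (xi y) (xi x) < r0) s)%:R <= K * (2 * r / tau) `^ Q.
  rewrite -size_filter.
  pose t := Num.min tau r0.
  have tt : 0 < t by rewrite lt_min t0.
  have tr0 : t <= r0 by rewrite ge_min lexx orbT.
  apply: (@le_trans _ _ (K * (r0 / t) `^ Q)).
    apply: (base (xi y)) => //; first exact: filter_uniq.
      move=> x z; rewrite !mem_filter => /andP[_ xs] /andP[_ zs] xz.
      by apply: le_trans (sep x z xs zs xz); rewrite ge_min lexx.
    by move=> x; rewrite mem_filter => /andP[].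
  rewrite ler_pM2l//; apply: ge0_ler_powR; rewrite ?nnegrE ?(ltW Q0)//.
  - by rewrite divr_ge0// ltW.
  - by rewrite divr_ge0 ?mulr_ge0// ltW.
  rewrite /t /Num.min; case: ifP => _; first by rewrite ler_pM2r ?invr_gt0// ltW.
  by rewrite divff ?gt_eqF// ler_pdivlMr// mul1r; lra.
apply: (@le_trans _ _ (\sum_(y <- Y) (count (fun x => theta (xi y) (xi x) < r0) s)%:R)).
  rewrite -natr_sum ler_nat; elim: (s) => [//|x s' IH] /=.
  rewrite big_split /= -add1n leq_add//.
  have [y yY yx] := hY x; rewrite (big_rem y)//=.
  by rewrite (le_lt_trans yx) ?addn_gt0//; lra.
apply: (@le_trans _ _ (\sum_(y <- Y) (K * (2 * r / tau) `^ Q))); first by apply: ler_sum => y _.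
move: (K * _) B0 => c c0.
by rewrite big_const_seq count_predT iter_addr_0 -[c *+ _]mulr_natl ler_wpM2r// lerDl.
Qed.

Lemma greedy (close : rel G) (s : seq G) : reflexive close -> symmetric close ->
  exists s' : seq G, [/\ uniq s', {subset s' <= s}, {in s' &, forall x y, x != y -> ~~ close x y}
    & {in s, forall x, exists2 y, y \in s' & close y x}].
Proof.
move=> crefl csym; elim: s => [|x s [s' [us sub sep cov]]]; first by exists [::].
have [/hasP[y ys cy]|/hasPn none] := boolP (has (close x) s').
  exists s'; split=> //; first by move=> z /sub; rewrite inE => ->; rewrite orbT.
  move=> z; rewrite inE => /orP[/eqP ->|/cov//]; exists y => //; by rewrite csym.
exists (x :: s'); split.
- by rewrite /= us andbT; apply/negP => /none; rewrite crefl.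
- by move=> z; rewrite !inE => /orP[->//|/sub ->]; rewrite orbT.
- move=> y z; rewrite !inE => /orP[/eqP ->|ys] /orP[/eqP ->|zs].
  + by rewrite eqxx.
  + by move=> _; exact: none.
  + by move=> _; rewrite csym; exact: none.
  + exact: sep.
- move=> z; rewrite inE => /orP[/eqP ->|/cov[y ys cy]]; first by exists x; rewrite ?mem_head.
  by exists y; rewrite // inE ys orbT.
Qed.

Definition level x : nat := ex_minn (scale_bound (width_gt0 x)).

Lemma level_le x : scale R (level x) <= width x.
Proof. by rewrite /level; case: ex_minnP. Qed.

(** Minimality of the level costs a factor 2, except at level 0, where the width is only bounded by
    the diameter. *)
Lemma level_ge : exists b : nat, forall x, width x <= 2 ^+ b * scale R (level x).
Proof.
have [K K0 hK] := theta_bounded; have [b hb] := pow2_bound K.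
exists b.+1 => x; rewrite /level; case: ex_minnP => -[|m] hm mmin.
  rewrite /scale expr0 mulr1; apply: le_trans (hK _ _) (le_trans hb _).
  exact: pow2_le.
have : ~~ (scale R m <= width x) by apply/negP => /mmin; rewrite ltnn.
rewrite -ltNge (scale_pow R m 1) addn1 expr1 => /ltW h; apply: le_trans h _.
by rewrite ler_pM2r ?scale_gt0// -[leLHS]expr1 pow2_le.
Qed.

Lemma boundary_filling : filling theta xi level.
Proof.
have [b hb] := level_ge; have wp x := width_gt0 x.
have p2 k : 0 < 2 ^+ k :> R by rewrite exprn_gt0.
have shift n m k : (n <= m + k)%N -> scale R m <= 2 ^+ k * scale R n.
  by move=> h; rewrite (scale_pow R m k) ler_pM2l//; exact: scale_le.
have closeF k : exists F : seq G, forall x y,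
    theta (xi x) (xi y) <= 2 ^+ k * scale R (level x) ->
    (level x <= level y + k)%N -> (level y <= level x + k)%N -> (x^-1 * y)%g \in F.
  have [r hr] := width_close (2 ^+ (b + k)).
  have [F hF] := (proj1 (finite_seqP _)) (len_finite r); exists F => x y h1 h2 h3.
  have cmp z z' : (level z' <= level z + k)%N -> width z <= 2 ^+ (b + k) * width z'.
    move=> /shift h; apply: le_trans (hb z) _; rewrite exprD -mulrA ler_pM2l//.
    by apply: le_trans h _; rewrite ler_pM2l// level_le.
  have : [set` F] (x^-1 * y)%g.
    rewrite -hF /=; apply: hr; [|exact: cmp|exact: cmp].
    apply: le_trans h1 _; apply: (@le_trans _ _ (2 ^+ k * width x)).
      by rewrite ler_pM2l// level_le.
    by rewrite ler_pM2r// pow2_le// leq_addl.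
  by [].
split=> //.
- by have [K _ hK] := theta_bounded; exists K.
- move=> g; have [K K0 hK] := width_lip (len g); have [k hk] := pow2_bound (K * 2 ^+ b).
  have up z : K * width z <= 2 ^+ k * scale R (level z).
    apply: (@le_trans _ _ (K * (2 ^+ b * scale R (level z)))); first by rewrite ler_pM2l.
    by rewrite mulrA ler_pM2r// scale_gt0.
  exists k => x.
  have d1 : gdist x (x * g)%g <= len g by rewrite mulKg.
  have d2 : gdist (x * g)%g x <= len g by rewrite gdistC.
  have [h1 h2] := hK _ _ d1; have [_ h3] := hK _ _ d2; split.
  + exact: le_trans h1 (up x).
  + by apply: (@scale_compare R); apply: le_trans (level_le _) (le_trans h2 (up _)).
  + by apply: (@scale_compare R); apply: le_trans (level_le _) (le_trans h3 (up _)).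
- have [K K0 hK] := width_walk (p2 b); have [k hk] := pow2_bound (K * 2 ^+ b).
  exists k => x n nx.
  have [||w [h1 h2 h3]] := hK x (2 ^+ b * scale R n).
  + by apply: le_trans (hb x) _; rewrite ler_pM2l//; exact: scale_le.
  + by rewrite ler_piMr ?(ltW (p2 b))// -[leRHS](expr0 2^-1); exact: (scale_le R (leq0n n)).
  have up : K * (2 ^+ b * scale R n) <= 2 ^+ k * scale R n by rewrite mulrA ler_pM2r// scale_gt0.
  exists w; split.
  + by apply: (@scale_compare R); apply: le_trans (level_le _) (le_trans h1 up).
  + apply: (@scale_compare R); apply: (@le_trans _ _ (2 ^+ b * scale R n)).
      by rewrite ler_peMl ?pow2_ge1// ltW// scale_gt0.
    apply: le_trans h2 _; apply: (@le_trans _ _ (K * (2 ^+ b * scale R (level w)))).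
      by rewrite ler_pM2l.
    by rewrite mulrA ler_pM2r// scale_gt0.
  + exact: le_trans h3 up.
- have [Q [K [Q0 Q2 K0 hK]]] := point_count; have [F hF] := closeF 0%N.
  have l1 : 1 <= 2 `^ Q :> R 
    by have := @ler_powR R 2 (ler1n _ 2) _ _ (ltW Q0); rewrite powRr0.
  (* The growth rate in [m] of the number of balls of radius [2 ^- (n + m)] inside one of radius
     [2 ^- n] in dimension [Q]; it is below 4 since [Q < 2]. *)
  exists (2 `^ Q); split=> //.
    have l2 : 0 < ln 2 :> R by rewrite ln_gt0// ltr1n.
    have -> : 4 = expR (ln 2 + ln 2) :> R by rewrite expRD !lnK ?posrE//; ring.
    by rewrite /powR ifF ?pnatr_eq0// ltr_expR; nra.
  move=> k; exists ((size F)%:R * (K * (2 ^+ k) `^ Q)) => p n m s us hs.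
  (* [point_count] needs separated ends, whereas distinct elements of one level may have close ends.
     These differ by an element of [F], so a separated sublist loses a factor [size F] at most. *)
  pose l := (n + m)%N; pose close x y := theta (xi x) (xi y) < scale R l.
  have cr : reflexive close.
    by move=> x; rewrite /close; have [h _ _] := mtheta; rewrite (proj2 (h _ _))// scale_gt0.
  have cs : symmetric close by move=> x y; rewrite /close tC.
  have [s' [us' sub sep cov]] := greedy s cr cs.
  have cnt x : x \in s' -> (count (close x) s <= size F)%N.
    move=> xs'; rewrite -size_filter -(size_map (fun y => x^-1 * y)%g).
    apply: uniq_leq_size; first by rewrite map_inj_uniq ?filter_uniq//; exact: mulgI.
    move=> _ /mapP[y + ->]; rewrite mem_filter => /andP[cxy ys].
    have [lx _] := hs x (sub _ xs'); have [ly _] := hs y ys.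
    by apply: hF; rewrite ?lx ?ly ?addn0// expr0 mul1r ltW.
  have s1 : (size s <= size F * size s')%N.
    apply: (@leq_trans (\sum_(x <- s') count (close x) s)).
      have {}cov : {in s, forall x, has (fun y => close y x) s'}.
        by move=> x xs; apply/hasP; have [y] := cov x xs; exists y.
      elim: (s) cov => [//|x t IH] cov /=; rewrite big_split /= -add1n leq_add//.
        have /hasP[y ys' yx] := cov x (mem_head _ _); rewrite (big_rem y)//= yx.
        by rewrite addn_gt0.
      by apply: IH => z zt; apply: cov; rewrite inE zt orbT.
    rewrite -[size s']sum1_size big_distrr /= big_seq [leqRHS]big_seq.
    by apply: leq_sum => x xs; rewrite muln1; exact: cnt.
  have tp := scale_gt0 R l; have np := scale_gt0 R n.
  have tr : scale R l <= 2 ^+ k * scale R n.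
    apply: (@le_trans _ _ (scale R n)); first by apply: scale_le; rewrite leq_addr.
    by rewrite ler_peMl ?pow2_ge1// ltW.
  have hs' : {in s', forall x, theta p (xi x) <= 2 ^+ k * scale R n}.
    by move=> x /sub/hs[_]; rewrite tC.
  have sep' : {in s' &, forall x y, x != y -> scale R l <= theta (xi x) (xi y)}.
    by move=> x y xs ys /(sep x y xs ys); rewrite -leNgt.
  have s2 := hK p _ _ s' tp tr us' sep' hs'.
  have e : 2 ^+ k * scale R n / scale R l = 2 ^+ k * 2 ^+ m.
    by rewrite (scale_pow R n m) -/l; field; rewrite gt_eqF.
  rewrite e (powRM Q (ltW (p2 k)) (ltW (p2 m))) in s2.
  have e3 : (2 ^+ m : R) `^ Q = (2 `^ Q) ^+ m.
    elim: (m) => [|j IH]; first by rewrite !expr0 powR1.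
    by rewrite !exprS (powRM Q (ler0n _ 2) (ltW (p2 j))) IH.
  apply: (@le_trans _ _ ((size F)%:R * (size s')%:R)); first by rewrite -natrM ler_nat.
  by rewrite -mulrA ler_wpM2l// (le_trans s2)// e3 mulrA.
- exact: theta_dense.
- by exists (xi 1%g), (si 1%g); exact: width_gt0.
Qed.

End hyperbolic_filling.

(** * Square-summable primitives on a filling *)

Section finite_sums.
Variable R : realType.

Lemma sum_le_sub (T : eqType) (f : T -> R) (s t : seq T) : (forall x, 0 <= f x) ->
  uniq s -> {subset s <= t} -> \sum_(x <- s) f x <= \sum_(x <- t) f x.
Proof.
move=> f0; elim: s t => [|x s IH] t; first by rewrite big_nil sumr_ge0.
move=> /= /andP[xs us] st; rewrite big_cons [leRHS](big_rem x) ?st ?mem_head//=.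
rewrite lerD2l; apply: IH => // y ys; apply: rem_mem.
  by apply: contraNneq xs => <-.
by apply: st; rewrite inE ys orbT.
Qed.

Lemma sum_term_le (T : eqType) (f : T -> R) (s : seq T) x : (forall x, 0 <= f x) ->
  x \in s -> f x <= \sum_(y <- s) f y.
Proof.
move=> f0 xs; have := @sum_le_sub _ f [:: x] s f0 isT.
by rewrite big_seq1; apply=> y; rewrite inE => /eqP ->.
Qed.

Lemma sum_support (V : zmodType) (T : eqType) (f : T -> V) (s t : seq T) :
  uniq s -> uniq t -> {subset s <= t} -> (forall x, x \notin s -> f x = 0) ->
  \sum_(x <- t) f x = \sum_(x <- s) f x.
Proof.
move=> us ut st f0; rewrite (bigID (fun x => x \in s))/= [X in _ + X]big1 ?addr0; last first.
  by move=> x; exact: f0.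
rewrite -big_filter; apply: perm_big; apply: uniq_perm => //; first exact: filter_uniq.
by move=> x; rewrite mem_filter andb_idr//; exact: st.
Qed.

Lemma geometric_sum (q : R) n : 0 <= q -> q < 1 -> \sum_(i < n) q ^+ i <= (1 - q)^-1.
Proof.
move=> q0 q1; have d0 : 0 < 1 - q by rewrite subr_gt0.
rewrite -(ler_pM2l d0) divff ?gt_eqF// -[X in X <= _]opprK -mulNr opprB -subrX1.
by rewrite opprB gerBl exprn_ge0.
Qed.

Lemma cauchy_schwarz_seq (T : eqType) (s : seq T) (f g : T -> R) :
  (\sum_(x <- s) f x * g x) ^+ 2 <= (\sum_(x <- s) f x ^+ 2) * (\sum_(x <- s) g x ^+ 2).
Proof.
elim: s => [|x s IH]; first by rewrite !big_nil expr0n mulr0.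
rewrite !big_cons.
have A0 : 0 <= \sum_(j <- s) f j ^+ 2 by apply: sumr_ge0 => i _; exact: sqr_ge0.
have B0 : 0 <= \sum_(j <- s) g j ^+ 2 by apply: sumr_ge0 => i _; exact: sqr_ge0.
move: (\sum_(j <- s) f j ^+ 2) (\sum_(j <- s) g j ^+ 2) (\sum_(j <- s) f j * g j) IH A0 B0.
move=> A B S h A0 B0; move: (f x) (g x) => a b.
have h2 : 2 * (a * b) * S <= a ^+ 2 * B + b ^+ 2 * A.
  have [->|S0] := eqVneq S 0.
    by rewrite mulr0 addr_ge0// mulr_ge0// sqr_ge0.
  have Bp : 0 < B.
    rewrite lt_neqAle B0 andbT eq_sym; apply/eqP => b0.
    have : S ^+ 2 == 0 by rewrite eq_le sqr_ge0 andbT; move: h; rewrite b0 mulr0.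
    by rewrite sqrf_eq0 (negPf S0).
  rewrite -subr_ge0 -(pmulr_rge0 _ Bp).
  have -> : B * (a ^+ 2 * B + b ^+ 2 * A - 2 * (a * b) * S) =
    (a * B - b * S) ^+ 2 + b ^+ 2 * (A * B - S ^+ 2) by ring.
  by rewrite addr_ge0 ?sqr_ge0// mulr_ge0 ?sqr_ge0// subr_ge0.
have -> : (a * b + S) ^+ 2 = (a * b) ^+ 2 + 2 * (a * b) * S + S ^+ 2 by ring.
have -> : (a ^+ 2 + A) * (b ^+ 2 + B) = (a * b) ^+ 2 + (a ^+ 2 * B + b ^+ 2 * A) + A * B by ring.
by rewrite lerD// lerD.
Qed.

Lemma sqr_sum_le (T : eqType) (s : seq T) (f : T -> R) :
  (\sum_(x <- s) f x) ^+ 2 <= (size s)%:R * \sum_(x <- s) f x ^+ 2.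
Proof.
have := cauchy_schwarz_seq s (fun=> 1) f; under eq_bigr do rewrite mul1r.
move=> /le_trans; apply; under eq_bigr do rewrite expr1n.
by rewrite big_const_seq count_predT iter_addr_0.
Qed.

Lemma sum_indicator (T : eqType) (s : seq T) (P : pred T) :
  \sum_(x <- s) (P x)%:R = (count P s)%:R :> R.
Proof. by elim: s => [|x s IH] /=; rewrite ?big_nil// big_cons IH natrD. Qed.

Definition sum_bounded (T : eqType) (f : T -> R) (C : R) :=
  forall s : seq T, uniq s -> \sum_(x <- s) f x <= C.

Lemma sum_bounded_le (T : eqType) (f g : T -> R) C : (forall x, f x <= g x) ->
  sum_bounded g C -> sum_bounded f C.
Proof. by move=> fg hg s us; apply: le_trans (hg s us); exact: ler_sum. Qed.

Lemma sum_boundedD (T : eqType) (f g : T -> R) C D : sum_bounded f C ->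
  sum_bounded g D -> sum_bounded (fun x => f x + g x) (C + D).
Proof. by move=> hf hg s us; rewrite big_split /= lerD ?hf ?hg. Qed.

Lemma sum_boundedZ (T : eqType) (f : T -> R) C k : 0 <= k -> sum_bounded f C ->
  sum_bounded (fun x => k * f x) (k * C).
Proof. by move=> k0 hf s us; rewrite -mulr_sumr ler_wpM2l// hf. Qed.

Lemma sum_bounded_inj (T U : eqType) (f : T -> R) (h : U -> T) C : injective h ->
  sum_bounded f C -> sum_bounded (f \o h) C.
Proof. by move=> ih hf s us; rewrite -(big_map h predT f) hf// map_inj_uniq. Qed.

Lemma sum_bounded_ge0 (T : eqType) (f : T -> R) C : sum_bounded f C -> 0 <= C.
Proof. by move=> /(_ [::] isT); rewrite big_nil. Qed.

Lemma sum_bounded_sum (T I : eqType) (F : seq I) (f : I -> T -> R) (N : I -> R) :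
  (forall i, i \in F -> sum_bounded (f i) (N i)) ->
  sum_bounded (fun x => \sum_(i <- F) f i x) (\sum_(i <- F) N i).
Proof.
move=> h s us; rewrite exchange_big /= big_seq [leRHS]big_seq.
by apply: ler_sum => i iF; exact: h.
Qed.

(** Schur's test in which only column sums are bounded; the row sums are absorbed in the pointwise
    hypothesis on [f], by convexity. The index [k] is inert: one bound serves a whole family of
    functions. *)
Lemma sum_bounded_schur (T K : eqType) (f phi : T * K -> R) (kap : T -> T -> R)
    (S : T -> seq T) (C M : R) : 0 <= C ->
  (forall x w, 0 <= kap x w) -> (forall xk, 0 <= phi xk) -> (forall x, uniq (S x)) ->
  (forall x k, f (x, k) <= \sum_(w <- S x) kap x w * phi (w, k)) ->
  (forall w, sum_bounded (fun x => kap x w) C) ->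
  sum_bounded phi M -> (forall xk, 0 <= f xk) -> sum_bounded f (C * M).
Proof.
move=> C0 kap0 phi0 uS hf hk hM f0 s us.
pose Xs := undup (map fst s); pose Ks := undup (map snd s).
pose U := undup (flatten (map S Xs)).
have sub : {subset s <= [seq (x, k) | x <- Xs, k <- Ks]}.
  move=> [x k] xs; apply: allpairs_f; rewrite mem_undup; apply/mapP; exists (x, k) => //.
apply: le_trans (sum_le_sub f0 us sub) _; rewrite big_allpairs.
apply: (@le_trans _ _ (\sum_(x <- Xs) \sum_(k <- Ks) \sum_(w <- U) kap x w * phi (w, k))).
  rewrite big_seq [leRHS]big_seq; apply: ler_sum => x xX; apply: ler_sum => k _.
  apply: le_trans (hf x k) _; apply: sum_le_sub => // [w|w wS].
    exact: mulr_ge0.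
  by rewrite mem_undup; apply/flattenP; exists (S x) => //; exact: map_f.
rewrite exchange_big /=.
apply: (@le_trans _ _ (\sum_(k <- Ks) \sum_(w <- U) C * phi (w, k))).
  apply: ler_sum => k _; rewrite exchange_big /=; apply: ler_sum => w _.
  by rewrite -mulr_suml ler_wpM2r// hk// undup_uniq.
rewrite exchange_big /=; under eq_bigr do rewrite -mulr_sumr.
rewrite -mulr_sumr ler_wpM2l//.
have -> : \sum_(w <- U) \sum_(k <- Ks) phi (w, k) =
  \sum_(wk <- [seq (w, k) | w <- U, k <- Ks]) phi wk by rewrite big_allpairs.
by apply: hM; rewrite allpairs_uniq ?undup_uniq// => -[? ?] [? ?].
Qed.

End finite_sums.

Section filling_measures.
Variables (R : realType) (G : groupType) (T : Type) (theta : T -> T -> R).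
Variables (xi : G -> T) (nn : G -> nat).
Hypothesis fil : filling theta xi nn.
Local Notation sc := (scale R).
Implicit Types (x y w : G) (n m k N : nat).

Let tm := fill_metric fil.
Let tge0 p q := metric_ge0 p q tm.
Let tC : forall p q, theta p q = theta q p. Proof. by case: tm. Qed.
Let ttri : forall r p q, theta p q <= theta p r + theta r q.
Proof. by case: tm => _ _ h r p q. Qed.
Let txx p : theta p p = 0. Proof. by case: tm => h _ _; apply/h. Qed.

(** The count at each level, with a ball that is the whole space, bounds the length of
    duplicate-free lists; a longest one is complete. *)
Lemma level_list N : exists E : seq G, uniq E /\ forall w, (w \in E) = (nn w <= N)%N.
Proof.
have [T0 hT] := fill_bounded fil; have [k hk] := pow2_bound T0.
have [lam [l1 _ /(_ k)[M hM]]] := fill_count fil.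
have bd (s : seq G) : uniq s -> {in s, forall x, (nn x <= N)%N} ->
    (size s)%:R <= \sum_(l < N.+1) M * lam ^+ l.
  move=> us hs; apply: (@le_trans _ _ (\sum_(l < N.+1) (count (fun x => nn x == l) s)%:R)).
    rewrite -natr_sum ler_nat; elim: (s) hs => [//|x t IH] hs /=.
    rewrite big_split /= -add1n leq_add//.
      have xN : (nn x < N.+1)%N by rewrite ltnS hs// mem_head.
      by rewrite (bigD1 (Ordinal xN))//= eqxx.
    by apply: IH => y yt; apply: hs; rewrite inE yt orbT.
  apply: ler_sum => l _; rewrite -size_filter; apply: (hM (xi 1%g) 0%N).
    exact: filter_uniq.
  move=> x; rewrite mem_filter => /andP[/eqP -> _]; split=> //.
  by rewrite /scale expr0 mulr1; apply: le_trans (hT _ _) hk.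
pose P n := `[< exists s : seq G, [/\ uniq s, {in s, forall x, (nn x <= N)%N} & size s = n] >].
have exP : exists n, P n by exists 0%N; apply/asboolP; exists [::].
pose B : R := \sum_(l < N.+1) M * lam ^+ l.
have ubP n : P n -> (n <= Num.truncn `|B|)%N.
  move=> /asboolP[s [us hs <-]]; rewrite -ltnS -(ltr_nat R).
  have /andP[_ h] := truncn_itv (normr_ge0 B).
  exact: le_lt_trans (le_trans (bd s us hs) (ler_norm _)) h.
case: (ex_maxnP exP ubP) => n /asboolP[s [us hs sn]] nmax.
exists s; split=> // w; apply/idP/idP => [/hs//|wN].
apply/negPn/negP => ws; have := nmax n.+1; rewrite ltnn => /(_ _)/wrap[|//].
apply/asboolP; exists (w :: s); split=> /=; rewrite ?ws ?sn// => x.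
by rewrite inE => /orP[/eqP ->|/hs].
Qed.

Definition lev N : seq G := sval (cid (level_list N)).

Lemma lev_uniq N : uniq (lev N). Proof. by case: (svalP (cid (level_list N))). Qed.

Lemma mem_lev N w : (w \in lev N) = (nn w <= N)%N.
Proof. by case: (svalP (cid (level_list N))) => _; exact. Qed.

Lemma lev_sub N N' : (N <= N')%N -> {subset lev N <= lev N'}.
Proof. by move=> NN w; rewrite !mem_lev => /leq_trans; apply. Qed.

Definition near_scale k n w := (nn w <= n + k)%N && (n <= nn w + k)%N.

Lemma near_close k : exists F : seq G, forall n w w', near_scale k n w ->
  near_scale k n w' -> theta (xi w) (xi w') <= 2 ^+ k * sc n -> (w^-1 * w')%g \in F.
Proof.
have [F hF] := fill_close fil (k + k); exists F => n w w' /andP[h1 h2] /andP[h3 h4] h.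
apply: hF.
- apply: le_trans h _; rewrite exprD -mulrA ler_pM2l ?exprn_gt0//.
  by rewrite (scale_pow R n k) ler_pM2l ?exprn_gt0//; exact: scale_le.
- by rewrite (leq_trans h1)// addnA leq_add2r.
- by rewrite (leq_trans h3)// addnA leq_add2r.
Qed.

Lemma near_scale_le k k' n w : (k <= k')%N -> near_scale k n w -> near_scale k' n w.
Proof.
move=> kk /andP[h1 h2]; apply/andP; split.
  by apply: leq_trans h1 _; rewrite leq_add2l.
by apply: leq_trans h2 _; rewrite leq_add2l.
Qed.

Lemma ball_count : exists lam : R, [/\ 2 <= lam, lam < 4 & forall k, exists2 M : R, 0 <= M &
  forall p n m (s : seq G), uniq s -> (forall x, x \in s -> [/\ (n <= nn x)%N,
    (nn x <= n + m)%N & theta (xi x) p <= 2 ^+ k * sc n]) -> (size s)%:R <= M * lam ^+ m].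
Proof.
(* [lam >= 2] makes the sum of [lam ^ i] over [i <= m] at most [lam * lam ^ m]. *)
have [l0 [l1 l4 hl]] := fill_count fil; pose lam : R := Num.max 2 l0; exists lam.
have lam2 : 2 <= lam by rewrite le_max lexx.
have lamp i : 0 <= lam ^+ i by rewrite exprn_ge0//; apply: le_trans lam2.
split=> //; first by rewrite /lam gt_max l4 andbT ltr_nat.
move=> k; have [M hM] := hl k.
have M0 : 0 <= M.
  by have := hM (xi 1%g) 0%N 0%N [::] isT; rewrite expr0 mulr1; exact.
exists (M * lam); first by rewrite mulr_ge0// (le_trans _ lam2).
move=> p n m s us hs.
have -> : (size s)%:R = \sum_(i < m.+1) (count (fun x => nn x == n + i)%N s)%:R :> R.
  rewrite -natr_sum; congr _%:R; rewrite -[LHS]sum1_size.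
  under [RHS]eq_bigr do rewrite -sum1_count big_mkcond.
  rewrite exchange_big /= big_seq [RHS]big_seq; apply: eq_bigr => x /hs[h1 h2 _].
  have xm : (nn x - n < m.+1)%N by rewrite ltnS leq_subLR.
  rewrite (bigD1 (Ordinal xm))//= subnKC// eqxx big1 ?addn0// => i ix.
  by case: eqP => // e; move: ix; rewrite -val_eqE /= e addKn eqxx.
apply: (@le_trans _ _ (\sum_(i < m.+1) M * lam ^+ i)).
  apply: ler_sum => i _; rewrite -size_filter.
  apply: le_trans (hM p n i _ _ _) _; first exact: filter_uniq.
    by move=> x; rewrite mem_filter => /andP[/eqP e /hs[]].
  apply: ler_wpM2l => //; apply: lerXn2r; rewrite ?nnegrE.
  - by apply: le_trans l1.
  - by apply: le_trans lam2.
  - by rewrite /lam le_max lexx orbT.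
rewrite -mulr_sumr -mulrA ler_wpM2l//; elim: m {hs} => [|m IH].
  by rewrite big_ord1 expr0 mulr1; lra.
rewrite big_ord_recr /=; apply: le_trans (lerD IH (lexx _)) _.
have := lamp m.+1; rewrite -exprS; nra.
Qed.

(** * Fuzzy paths from the identity to the elements of the group *)

Section partition_of_unity.
Variable k0 : nat.
Hypothesis net : forall x n, (n <= nn x)%N -> exists w,
    [/\ (n <= nn w + k0)%N, (nn w <= n + k0)%N &
        theta (xi w) (xi x) <= 2 ^+ k0 * sc n].

(** Twice the distance granted by [net], so that some bump is at least one half. *)
Let dn n : R := 2 ^+ k0.+1 * sc n.

Let dn_gt0 n : 0 < dn n. Proof. by rewrite mulr_gt0 ?exprn_gt0 ?scale_gt0. Qed.

(* A Lipschitz partition of unity at scale [2 ^- n]: [fuzzy n x] is a probability measure on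
   elements of level about [n] that joins the point mass at [1] ([n = 0]) to the point mass
   at [x] ([n >= nn x]). *)
Definition bump n x w : R :=
  if near_scale k0 n w then Num.max 0 (1 - theta (xi w) (xi x) / dn n) else 0.

Definition bump_sum n x := \sum_(w <- lev (n + k0)) bump n x w.

Lemma bump_ge0 n x w : 0 <= bump n x w.
Proof. by rewrite /bump; case: ifP => // _; rewrite le_max lexx. Qed.

Lemma bump_supp n x w : bump n x w != 0 ->
  near_scale k0 n w /\ theta (xi w) (xi x) <= dn n.
Proof.
rewrite /bump; case: ifP => [ns h|]; last by rewrite eqxx.
split=> //; rewrite leNgt; apply/negP => lt; move: h; rewrite max_l ?eqxx//.
by rewrite subr_le0 ler_pdivlMr// mul1r ltW.
Qed.

Lemma bump_lip n x y w : `|bump n x w - bump n y w| <= theta (xi x) (xi y) / dn n.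
Proof.
have q0 : 0 <= theta (xi x) (xi y) / dn n by rewrite divr_ge0// (ltW (dn_gt0 n)).
rewrite /bump; case: ifP => _; last by rewrite subrr normr0.
have h : `|theta (xi w) (xi x) / dn n - theta (xi w) (xi y) / dn n| <=
    theta (xi x) (xi y) / dn n.
  rewrite -mulrBl normrM (ger0_norm (x := (dn n)^-1)) ?invr_ge0 ?(ltW (dn_gt0 n))//.
  rewrite ler_pM2r ?invr_gt0// ler_norml.
  have := ttri (xi y) (xi w) (xi x); have := ttri (xi x) (xi w) (xi y).
  by rewrite (tC (xi y) (xi x)) => h1 h2; apply/andP; split; lra.
move: (theta (xi w) (xi x) / dn n) (theta (xi w) (xi y) / dn n) h => u v.
move: (theta _ _ / dn n) q0 => q q0; rewrite !ler_norml => /andP[h1 h2].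
by rewrite /Num.max; case: ifP => c1; case: ifP => c2; apply/andP; split;
  move: c1 c2; rewrite ?subr_gt0; lra.
Qed.

Lemma bump_sum_ge n x : (n <= nn x)%N -> 2^-1 <= bump_sum n x.
Proof.
move=> nx; have [w [h1 h2 h3]] := net nx.
have wl : w \in lev (n + k0) by rewrite mem_lev.
rewrite /bump_sum (big_rem w)//= -[leLHS]addr0 lerD//; last first.
  by apply: sumr_ge0 => z _; exact: bump_ge0.
rewrite /bump /near_scale h2 h1 /= le_max; apply/orP; right.
rewrite lerBrDr -lerBrDl; apply: (@le_trans _ _ (2 ^+ k0 * sc n / dn n)).
  by rewrite ler_pM2r ?invr_gt0.
have s0 := scale_gt0 R n; have p0 : 0 < 2 ^+ k0 :> R by rewrite exprn_gt0.
rewrite /dn exprS; have -> : 2 ^+ k0 * sc n / (2 * 2 ^+ k0 * sc n) = 2^-1.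
  by field; rewrite ?gt_eqF.
by lra.
Qed.

Lemma bump_sum_ext n x N : (n + k0 <= N)%N -> \sum_(w <- lev N) bump n x w = bump_sum n x.
Proof.
move=> nN; apply: sum_support; rewrite ?lev_uniq//; first exact: lev_sub.
move=> w; rewrite mem_lev => h; apply/eqP; apply/negPn/negP => /bump_supp[/andP[h1 _] _].
by rewrite h1 in h.
Qed.

(** Elements of the support have levels close to [n] and ends close to that of [x], so they differ
    by elements of a fixed finite set. *)
Lemma bump_card : exists N0 : nat, forall n x (s : seq G), uniq s ->
  (count (fun w => (bump n x w != 0)%R) s <= N0)%N.
Proof.
have [F hF] := near_close (k0 + 2); exists (size F) => n x s us.
rewrite -size_filter; set t := [seq w <- s | _].
have ut : uniq t by exact: filter_uniq.
case tE : t => [//|w1 t'].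
have w1t : w1 \in t by rewrite tE mem_head.
rewrite -tE -(size_map (fun w => w1^-1 * w)%g); apply: uniq_leq_size.
  by rewrite map_inj_uniq//; exact: mulgI.
move=> _ /mapP[w wt ->]; move: wt w1t; rewrite !mem_filter => /andP[/bump_supp[a1 a2] _].
move=> /andP[/bump_supp[b1 b2] _].
apply: (hF n); try exact: near_scale_le (leq_addr _ _) _.
apply: le_trans (ttri (xi x) _ _) _; rewrite (tC (xi x)).
have -> : 2 ^+ (k0 + 2) * sc n = dn n + dn n by rewrite /dn addn2 !exprS; ring.
exact: lerD.
Qed.

(** The case [n = 0] has priority, so that all paths start at [1] even when [nn x = 0]. *)
Definition fuzzy n x w : R :=
  if n == 0%N then (w == 1%g)%:R else
  if (nn x <= n)%N then (w == x)%:R else bump n x w / bump_sum n x.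

Lemma fuzzy_mid n x w : n != 0%N -> (n < nn x)%N ->
  fuzzy n x w = bump n x w / bump_sum n x.
Proof. by move=> n0; rewrite ltnNge => nx; rewrite /fuzzy (negPf n0) (negPf nx). Qed.

Lemma fuzzy_ge0 n x w : 0 <= fuzzy n x w.
Proof.
rewrite /fuzzy; case: ifP => _; first exact: ler0n.
case: ifP => _; first exact: ler0n.
by rewrite divr_ge0 ?bump_ge0// sumr_ge0// => z _; exact: bump_ge0.
Qed.

Lemma sum_delta (s : seq G) (f : G -> R) a : uniq s -> a \in s ->
  \sum_(w <- s) (w == a)%:R * f w = f a.
Proof.
move=> us as_; rewrite (big_rem a)//= eqxx mul1r big_seq big1 ?addr0// => w.
by rewrite mem_rem_uniq// inE => /andP[/negPf -> _]; rewrite mul0r.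
Qed.

Lemma fuzzy_sum n x N : (n + (k0 + nn 1%g) <= N)%N -> \sum_(w <- lev N) fuzzy n x w = 1.
Proof.
move=> nN; have delta a : (nn a <= N)%N -> \sum_(w <- lev N) (w == a)%:R = 1 :> R.
  move=> aN; under eq_bigr do rewrite -[_%:R]mulr1.
  by rewrite (sum_delta (fun=> 1)) ?lev_uniq// mem_lev.
rewrite /fuzzy; case: eqP => [n0|_].
  by apply: delta; apply: leq_trans nN; rewrite n0 add0n leq_addl.
case: leqP => nx.
  by apply: delta; apply: leq_trans nx (leq_trans (leq_addr _ _) nN).
rewrite -mulr_suml bump_sum_ext; last by apply: leq_trans nN; rewrite addnA leq_addr.
by rewrite divff// gt_eqF//; apply: lt_le_trans (bump_sum_ge (ltnW nx)); rewrite invr_gt0.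
Qed.

Lemma fuzzy_sum_le n x N : \sum_(w <- lev N) fuzzy n x w <= 1.
Proof.
rewrite -(@fuzzy_sum n x (maxn N (n + (k0 + nn 1%g)))) ?leq_maxr//.
by apply: sum_le_sub; rewrite ?lev_uniq//; [exact: fuzzy_ge0|apply: lev_sub; exact: leq_maxl].
Qed.

Lemma fuzzy_supp : exists k, forall n x w, fuzzy n x w != 0 ->
  [/\ (nn w <= n + k)%N, (minn n (nn x) <= nn w + k)%N
    & theta (xi w) (xi x) <= 2 ^+ k * sc n].
Proof.
have [T0 hT] := fill_bounded fil; have [kT hkT] := pow2_bound T0.
exists (k0.+1 + nn 1%g + kT)%N => n x w; rewrite /fuzzy.
have kle j : (j <= k0.+1 + nn 1%g + kT)%N -> 2 ^+ j * sc n <= 2 ^+ (k0.+1 + nn 1%g + kT) * sc n.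
  by move=> h; rewrite ler_pM2r ?scale_gt0// pow2_le.
have [n0|_] := eqVneq n 0%N.
  have [->|] := eqVneq w 1%g; last by rewrite eqxx.
  move=> _; split.
  - by rewrite (leq_trans _ (leq_addl _ _))// -addnA (leq_trans _ (leq_addl _ _))// leq_addr.
  - by rewrite n0 min0n.
  - apply: le_trans (hT _ _) _; apply: le_trans hkT _; apply: le_trans _ (kle kT (leq_addl _ _)).
    by rewrite n0 /scale expr0 mulr1.
case: leqP => nx.
  have [->|] := eqVneq w x; last by rewrite eqxx.
  move=> _; split.
  - by rewrite (leq_trans nx)// leq_addr.
  - exact: leq_addr.
  - by rewrite txx mulr_ge0 ?exprn_ge0// ltW// scale_gt0.
rewrite mulf_eq0 => /norP[/bump_supp[/andP[h1 h2] h3] _].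
have k0k : (k0 <= k0.+1 + nn 1%g + kT)%N.
  by rewrite (leq_trans (leqnSn k0))// -addnA leq_addr.
split.
- by apply: leq_trans h1 _; rewrite leq_add2l.
- by rewrite (leq_trans h2)// leq_add2l.
- by apply: le_trans h3 (kle k0.+1 _); rewrite -addnA leq_addr.
Qed.

(** If [n] is close to [nn x] or larger, the right-hand side is bounded below and the trivial bound
    2 suffices. Otherwise both measures are normalized bumps: at most [2 * N0] values differ, each
    by at most the distance of the ends over [dn n], and the total masses are at least one half. *)
Lemma fuzzy_lip g : exists2 C : R, 0 <= C & forall n x N,
  \sum_(w <- lev N) `|fuzzy n x w - fuzzy n (x * g)%g w| <= C * (2 ^+ n * sc (nn x)).
Proof.
have [kg hg] := fill_lip fil g; have [N0 hN0] := bump_card.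
pose C : R := 2 * 2 ^+ kg + 8 * N0%:R * 2 ^+ kg.
have p0 : 0 < 2 ^+ kg :> R by rewrite exprn_gt0.
have c1 : 0 <= 2 * 2 ^+ kg :> R by rewrite mulr_ge0 ?ltW.
have c2 : 0 <= 8 * N0%:R * 2 ^+ kg :> R by rewrite !mulr_ge0 ?ler0n ?ltW.
exists C; first exact: addr_ge0.
move=> n x N; set y := (x * g)%g; have [h1 h2 h3] := hg x; rewrite -/y in h1 h2 h3.
have s0 : 0 <= 2 ^+ n * sc (nn x) by rewrite mulr_ge0 ?exprn_ge0// ltW// scale_gt0.
have [n0|n0] := eqVneq n 0%N.
  rewrite n0 big1 ?mulr_ge0 ?addr_ge0 ?exprn_ge0 ?(ltW (scale_gt0 _ _))// => w _.
  by rewrite /fuzzy eqxx subrr normr0.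
have [big|small] := leqP (nn x) (n + kg)%N.
  apply: (@le_trans _ _ 2).
    apply: (@le_trans _ _ (\sum_(w <- lev N) (fuzzy n x w + fuzzy n y w))).
      apply: ler_sum => w _; apply: le_trans (ler_normB _ _) _.
      by rewrite !ger0_norm ?fuzzy_ge0.
    by rewrite big_split /= -[leRHS]/(1 + 1) lerD ?fuzzy_sum_le.
  apply: (@le_trans _ _ (2 * (2 ^+ kg * (2 ^+ n * sc (nn x))))).
    rewrite ler_peMr// mulrA -exprD addnC.
    rewrite -[X in X <= _](scale_pow2 R (n + kg)) ler_pM2l ?exprn_gt0//.
    exact: scale_le.
  by rewrite mulrA ler_wpM2r// lerDl.
have yn : (n < nn y)%N by rewrite -(ltn_add2r kg) (leq_trans small).
have xn : (n < nn x)%N by apply: leq_ltn_trans small; rewrite leq_addr.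
have A2 := bump_sum_ge (ltnW xn); have B2 := bump_sum_ge (ltnW yn).
set A := bump_sum n x in A2; set B := bump_sum n y in B2.
have A0 : 0 < A by lra.
have B0 : 0 < B by lra.
pose N' := maxn N (n + k0).
pose D := \sum_(w <- lev N') `|bump n x w - bump n y w|.
have AB : `|B - A| <= D.
  rewrite /A /B -(@bump_sum_ext n x N') ?leq_maxr// -(@bump_sum_ext n y N') ?leq_maxr//.
  rewrite -sumrB; apply: le_trans (ler_norm_sum _ _ _) _.
  by apply: ler_sum => w _; rewrite distrC.
have D0 : 0 <= D by apply: sumr_ge0.
apply: (@le_trans _ _ (\sum_(w <- lev N') `|fuzzy n x w - fuzzy n y w|)).
  by apply: sum_le_sub; rewrite ?lev_uniq//; apply: lev_sub; exact: leq_maxl.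
apply: (@le_trans _ _ (\sum_(w <- lev N') (`|bump n x w - bump n y w| / A +
    bump n y w * (`|B - A| / (A * B))))).
  apply: ler_sum => w _; rewrite !fuzzy_mid// -/A -/B.
  have -> : bump n x w / A - bump n y w / B =
    (bump n x w - bump n y w) / A + bump n y w * ((B - A) / (A * B)).
    by field; rewrite !gt_eqF.
  apply: le_trans (ler_normD _ _) _; rewrite !normrM !normfV (gtr0_norm A0).
  by rewrite (gtr0_norm (mulr_gt0 A0 B0)) (ger0_norm (bump_ge0 _ _ _)).
rewrite big_split /= -!mulr_suml bump_sum_ext ?leq_maxr// -/D -/B.
have -> : B * (`|B - A| / (A * B)) = `|B - A| / A by field; rewrite !gt_eqF.
have ai : A^-1 <= 2 by rewrite -[leRHS]invrK lef_pV2 ?posrE// invr_gt0.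
have bound : D <= (2 * N0%:R) * (2 ^+ kg * (2 ^+ n * sc (nn x))).
  have e0 : 0 <= theta (xi x) (xi y) / dn n by rewrite divr_ge0// (ltW (dn_gt0 n)).
  apply: (@le_trans _ _ (\sum_(w <- lev N') ((bump n x w != 0)%:R + (bump n y w != 0)%:R) *
      (theta (xi x) (xi y) / dn n))).
    apply: ler_sum => w _; apply: le_trans (_ : _ <= ((bump n x w != 0) || (bump n y w != 0))%:R *
      (theta (xi x) (xi y) / dn n)) _; last first.
      by rewrite ler_wpM2r//; case: (_ != 0); case: (_ != 0); rewrite /= ?addr0 ?add0r ?lerDl ?ler0n.
    have [_|ze] := boolP ((bump n x w != 0) || (bump n y w != 0)).
      by rewrite mul1r bump_lip.
    move: ze; rewrite negb_or !negbK => /andP[/eqP -> /eqP ->].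
    by rewrite subrr normr0 mul0r.
  rewrite -mulr_suml big_split /= !sum_indicator.
  apply: ler_pM => //; rewrite ?addr_ge0//; last first.
    rewrite ler_pdivrMr//; apply: le_trans h1 _.
    rewrite -mulrA ler_pM2l// mulrC mulrA ler_peMl ?(ltW (scale_gt0 _ _))//.
    rewrite /dn -mulrA (mulrC (sc n)) scale_pow2 mulr1; exact: pow2_ge1.
  by rewrite mulr_natl mulr2n lerD// ler_nat hN0 ?lev_uniq.
apply: (@le_trans _ _ (4 * D)).
  rewrite -mulrDl; apply: (@le_trans _ _ ((D + D) * 2)); last by lra.
  by apply: ler_pM; rewrite ?addr_ge0 ?invr_ge0 ?(ltW A0) ?lerD2l.
apply: (@le_trans _ _ (8 * N0%:R * 2 ^+ kg * (2 ^+ n * sc (nn x)))); last first.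
  by rewrite ler_wpM2r// lerDr.
have := bound; move: (2 ^+ kg) (2 ^+ n * _) => u v; nra.
Qed.

Lemma fuzzy_lev n x w : fuzzy n x w != 0 -> (nn w <= n + (k0 + nn 1%g))%N.
Proof.
rewrite /fuzzy; have [->|_] := eqVneq n 0%N.
  by have [->|] := eqVneq w 1%g; rewrite ?eqxx// => _; rewrite leq_addl.
case: leqP => nx.
  by have [->|] := eqVneq w x; rewrite ?eqxx// => _; rewrite (leq_trans nx)// leq_addr.
rewrite mulf_eq0 => /norP[/bump_supp[/andP[h1 _] _] _].
by rewrite addnA (leq_trans h1)// leq_addr.
Qed.

Definition mean n x (f : G -> R) := \sum_(w <- lev (n + (k0 + nn 1%g))) fuzzy n x w * f w.

Lemma mean_ext N n x f : (n + (k0 + nn 1%g) <= N)%N ->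
  \sum_(w <- lev N) fuzzy n x w * f w = mean n x f.
Proof.
move=> nN; apply: sum_support; rewrite ?lev_uniq//; first exact: lev_sub.
move=> w; rewrite mem_lev => h; have [->|/fuzzy_lev h'] := eqVneq (fuzzy n x w) 0.
  by rewrite mul0r.
by rewrite h' in h.
Qed.

Lemma meanD n x f h : mean n x (fun w => f w + h w) = mean n x f + mean n x h.
Proof. by rewrite /mean -big_split; apply: eq_bigr => w _; rewrite mulrDr. Qed.

Lemma meanZ n x a f : mean n x (fun w => a * f w) = a * mean n x f.
Proof. by rewrite /mean mulr_sumr; apply: eq_bigr => w _; rewrite mulrCA. Qed.

Lemma meanB n x f h : mean n x (fun w => f w - h w) = mean n x f - mean n x h.
Proof. by rewrite /mean -sumrB; apply: eq_bigr => w _; rewrite mulrBr. Qed.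

Lemma mean_const n x a : mean n x (fun=> a) = a.
Proof. by rewrite /mean -mulr_suml fuzzy_sum ?mul1r. Qed.

Lemma eq_mean n x f h : f =1 h -> mean n x f = mean n x h.
Proof. by move=> e; apply: eq_bigr => w _; rewrite e. Qed.

Lemma mean_exchange n x m y (f : G -> G -> R) :
  mean n x (fun a => mean m y (f a)) = mean m y (fun b => mean n x (f^~ b)).
Proof.
rewrite /mean; under eq_bigr do rewrite mulr_sumr.
rewrite exchange_big; apply: eq_bigr => b _; rewrite mulr_sumr.
by apply: eq_bigr => a _; rewrite mulrCA.
Qed.

Lemma mean_ge0 n x f : (forall w, 0 <= f w) -> 0 <= mean n x f.
Proof. by move=> f0; apply: sumr_ge0 => w _; rewrite mulr_ge0 ?fuzzy_ge0. Qed.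

Lemma mean_le n x f h : (forall w, fuzzy n x w != 0 -> `|f w| <= h w) ->
  `|mean n x f| <= mean n x h.
Proof.
move=> fh; apply: le_trans (ler_norm_sum _ _ _) _; apply: ler_sum => w _.
rewrite normrM (ger0_norm (fuzzy_ge0 _ _ _)).
have [->|nz] := eqVneq (fuzzy n x w) 0; first by rewrite !mul0r.
by rewrite ler_wpM2l ?fuzzy_ge0// fh.
Qed.

Lemma mean_jensen n x f : mean n x f ^+ 2 <= mean n x (fun w => f w ^+ 2).
Proof.
have := meanD n x (fun w => f w ^+ 2) (fun w => mean n x f ^+ 2 - 2 * mean n x f * f w).
rewrite meanB mean_const meanZ.
have -> : mean n x (fun w => f w ^+ 2 + (mean n x f ^+ 2 - 2 * mean n x f * f w)) =
  mean n x (fun w => (f w - mean n x f) ^+ 2) by apply: eq_mean => w; ring.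
have : 0 <= mean n x (fun w => (f w - mean n x f) ^+ 2).
  by apply: mean_ge0 => w; exact: sqr_ge0.
by rewrite -subr_ge0; move: (mean n x f) (mean _ _ _) (mean _ _ _) => u v w; lra.
Qed.

Lemma mean_start x f : mean 0 x f = f 1%g.
Proof.
rewrite /mean (eq_bigr (fun w => (w == 1%g)%:R * f w))// sum_delta ?lev_uniq//.
by rewrite mem_lev add0n leq_addl.
Qed.

Lemma mean_end n x f : n != 0%N -> (nn x <= n)%N -> mean n x f = f x.
Proof.
move=> n0 nx; rewrite /mean (eq_bigr (fun w => (w == x)%:R * f w)).
  by rewrite sum_delta ?lev_uniq// mem_lev (leq_trans nx)// leq_addr.
by move=> w _; rewrite /fuzzy (negPf n0) nx.
Qed.

Lemma mean_diff g : exists2 C : R, 0 <= C & forall n x f H,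
  (forall w, fuzzy n x w != 0 \/ fuzzy n (x * g)%g w != 0 -> `|f w| <= H) -> 0 <= H ->
  `|mean n x f - mean n (x * g)%g f| <= H * (C * (2 ^+ n * sc (nn x))).
Proof.
have [C C0 hC] := fuzzy_lip g; exists C => // n x f H hf H0.
rewrite /mean -sumrB; apply: le_trans (ler_norm_sum _ _ _) _.
apply: le_trans (ler_wpM2l H0 (hC n x (n + (k0 + nn 1%g))%N)); rewrite mulr_sumr.
apply: ler_sum => w _; rewrite -mulrBl normrM mulrC.
have [ze|nz] := boolP ((fuzzy n x w != 0) || (fuzzy n (x * g)%g w != 0)).
  by rewrite ler_wpM2r// hf//; exact/orP.
by move: nz; rewrite negb_or !negbK => /andP[/eqP -> /eqP ->]; rewrite subrr normr0 !mulr0.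
Qed.

Lemma fuzzy_near g j : exists K, forall n n' x w, (n <= nn x + j)%N ->
  (n <= n')%N -> (n' <= n.+1)%N ->
  fuzzy n' x w != 0 \/ fuzzy n' (x * g)%g w != 0 ->
  [/\ (nn w <= n + K)%N, (n <= nn w + K)%N & theta (xi w) (xi x) <= 2 ^+ K * sc n].
Proof.
have [kg hg] := fill_lip fil g; have [k hk] := fuzzy_supp.
exists ((k + j + kg).+1 + (k + j + kg).+1)%N => n n' x w nx nn1 nn2 h.
have s0 := scale_gt0 R n; have [y1 y2 y3] := hg x.
have p2 (a b : nat) : (a <= b)%N -> 2 ^+ a * sc n <= 2 ^+ b * sc n.
  by move=> ab; rewrite ler_pM2r// pow2_le.
have scx : sc (nn x) <= 2 ^+ j * sc n.
  by rewrite (scale_pow R (nn x) j) ler_pM2l ?exprn_gt0//; exact: scale_le.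
have e1 : theta (xi x) (xi (x * g)%g) <= 2 ^+ (k + j + kg) * sc n.
  apply: le_trans y1 _; apply: le_trans (_ : _ <= 2 ^+ kg * (2 ^+ j * sc n)) _.
    by rewrite ler_pM2l ?exprn_gt0.
  by rewrite mulrA -exprD; apply: p2; rewrite addnC leq_add2r leq_addl.
have scn : sc n' <= sc n by exact: scale_le.
have fin (T1 : R) : T1 <= 2 ^+ k * sc n' -> T1 <= 2 ^+ (k + j + kg) * sc n.
  move=> /le_trans; apply; apply: le_trans (p2 k _ _); last by rewrite -addnA leq_addr.
  by rewrite ler_pM2l ?exprn_gt0.
have dbl : 2 ^+ (k + j + kg) * sc n + 2 ^+ (k + j + kg) * sc n = 2 ^+ (k + j + kg).+1 * sc n.
  by rewrite exprS; ring.
have dbl' := p2 _ _ (leq_addl (k + j + kg).+1 (k + j + kg).+1).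
have t0 : 0 <= 2 ^+ (k + j + kg) * sc n by rewrite mulr_ge0 ?exprn_ge0// ltW.
case: h => /hk[h1 h2 h3].
  split; [by move: h1 h2; lia|by move: h1 h2; lia|].
  by apply: le_trans dbl'; rewrite -dbl; have := fin _ h3; lra.
split; [by move: h1 h2; lia|by move: h1 h2; lia|].
apply: le_trans dbl'; rewrite -dbl; apply: le_trans (ttri (xi (x * g)%g) _ _) _.
by apply: lerD; [exact: fin|rewrite tC].
Qed.

(** All the supports that enter the prism of scale [n] have their mutual quotients in one finite
    set, so a cocycle is only evaluated near the diagonal. *)
Lemma fuzzy_close g j : exists F : seq G, forall n x, (n <= nn x + j)%N ->
  forall m a l b, (n <= m)%N -> (m <= n.+1)%N -> (n <= l)%N -> (l <= n.+1)%N ->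
  fuzzy m x a != 0 \/ fuzzy m (x * g)%g a != 0 ->
  fuzzy l x b != 0 \/ fuzzy l (x * g)%g b != 0 -> (a^-1 * b)%g \in F.
Proof.
have [K hK] := fuzzy_near g j; have [F hF] := near_close K.+1; exists F.
move=> n x nx m a l b nm mn nl ln ha hb.
have [a1 a2 a3] := hK _ _ _ _ nx nm mn ha; have [b1 b2 b3] := hK _ _ _ _ nx nl ln hb.
apply: (hF n); try by rewrite /near_scale; apply/andP; split; lia.
apply: le_trans (ttri (xi x) _ _) _; rewrite (tC (xi x)) exprS -mulrA mulr_natl mulr2n.
exact: lerD.
Qed.

(** * Integration over prisms *)

Section prism.
Variable c : G -> G -> G -> R.
Hypothesis cocycle : forall x y z w, c y z w - c x z w + c x y w - c x y z = 0.

(* The antisymmetrization [alt_part] of [c] is a cocycle for which the averages over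
   [fuzzy] behave like integrals over simplices; it differs from [c] by the coboundary of
   [sym_part], which is evaluated near [x] only. *)
Definition skew_part x y := (c 1%g x y - c 1%g y x) / 2.

Definition sym_part x y := (c x y x + c x x x) / 2.

Definition alt_part x y z := skew_part y z - skew_part x z + skew_part x y.

Lemma sym_partE x y : c 1%g x y = skew_part x y + sym_part x y.
Proof.
rewrite /skew_part /sym_part; have := cocycle 1%g x y x; have := cocycle 1%g x x x; lra.
Qed.

(** The cocycle relation eliminates the apex [1], so [alt_part] involves only values of [c] at
    arguments among [x], [y] and [z]. *)
Lemma alt_partE x y z : alt_part x y z = (c x y z - c x z y - c x y x + c x z x) / 2.
Proof.
rewrite /alt_part /skew_part; have := cocycle 1%g x y z; have := cocycle 1%g x z y.
have := cocycle 1%g x y x; have := cocycle 1%g x z x; lra.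
Qed.

Definition link n x m y := mean n x (fun a => mean m y (fun b => skew_part a b)).

Lemma link_skew n x m y : link n x m y = - link m y n x.
Proof.
rewrite /link mean_exchange -mulN1r -meanZ; apply: eq_mean => b.
by rewrite -meanZ; apply: eq_mean => a; rewrite /skew_part; lra.
Qed.

Lemma link_alt n x m y l z :
  mean n x (fun a => mean m y (fun b => mean l z (fun d => alt_part a b d))) =
  link m y l z - link n x l z + link n x m y.
Proof.
rewrite /alt_part; under eq_mean => a.
  under eq_mean => b do rewrite meanD meanB mean_const.
  rewrite meanD meanB mean_const; over.
by rewrite meanD meanB mean_const.
Qed.

(** Minus the integral of [skew_part] along the fuzzy path of [x]. Above scale [nn x] both measures
    are the point mass at [x] and the links vanish, so the sum is complete. *)
Definition potential x := - \sum_(n < (nn x).+1) link n x n.+1 x.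

Definition primitive x y := c 1%g x y + potential y - potential x.

Lemma primitiveP x y z : primitive y z - primitive x z + primitive x y = c x y z.
Proof. by rewrite /primitive; have := cocycle 1%g x y z; lra. Qed.

(* The sum of [alt_part] over the square with vertices [(n, x)], [(n, y)], [(n + 1, x)] and
   [(n + 1, y)], see [prismE]. It vanishes in the limit as the two vertical sides merge, at
   the rate [2 ^ n * 2 ^- nn x] when [y] is close to [x]. *)
Definition prism n x y :=
  link n.+1 x n.+1 y - link n x n y + link n x n.+1 x - link n y n.+1 y.

(** The links between [x] and [y] telescope over the scales: both measures are at [1] for [n = 0],
    and at [x] and [y] for [n = N]. *)
Lemma primitiveE N x y : (nn x < N)%N -> (nn y < N)%N ->
  primitive x y = sym_part x y + \sum_(n < N) prism n x y.
Proof.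
move=> xN yN; have pot z : (nn z < N)%N -> potential z = - \sum_(n < N) link n z n.+1 z.
  move=> zN; rewrite /potential -!(big_mkord xpredT (fun n => link n z n.+1 z)).
  rewrite (big_cat_nat (leq0n _) zN)/= [X in _ + X]big_nat [X in _ + X]big1 ?addr0// => n.
  move=> /andP[zn _]; have n0 : n != 0%N by rewrite -lt0n (leq_ltn_trans (leq0n _) zn).
  rewrite /link mean_end ?(ltnW zn)// mean_end ?(leq_trans (ltnW zn))//.
  by rewrite /skew_part subrr mul0r.
have tel : \sum_(n < N) (link n.+1 x n.+1 y - link n x n y) = skew_part x y.
  rewrite -(big_mkord xpredT (fun n => link n.+1 x n.+1 y - link n x n y)).
  rewrite (telescope_sumr (fun n => link n x n y))// {2}/link mean_start mean_start.
  have N0 : N != 0%N by rewrite -lt0n (leq_ltn_trans (leq0n _) xN).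
  rewrite /link mean_end ?(ltnW xN)// mean_end ?(ltnW yN)//.
  by rewrite /skew_part subrr mul0r subr0.
rewrite /primitive !pot// sym_partE /prism !big_split /= sumrN -tel big_split /= !sumrN.
lra.
Qed.

(** The square is cut along the diagonal from [(n, x)] to [(n + 1, y)]. From each triangle a
    degenerate one of integral 0 is subtracted, so that only differences of means at [x] and [y]
    appear and [mean_diff] applies. *)
Lemma prismE n x y : prism n x y =
  mean n x (fun a => mean n.+1 x (fun b => mean n.+1 y (fun d => alt_part a b d) -
                                           mean n.+1 x (fun d => alt_part a b d))) +
  mean n x (fun a => mean n.+1 y (fun d => mean n x (fun b => alt_part a b d) -
                                           mean n y (fun b => alt_part a b d))).
Proof.
under [X in _ = X + _]eq_mean => a do rewrite meanB.
under [X in _ = _ + X]eq_mean => a do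
  rewrite meanB (mean_exchange n.+1 y n x) (mean_exchange n.+1 y n y).
rewrite !meanB !link_alt /prism.
have e m z : link m z m z = 0 by have := link_skew m z m z; lra.
by rewrite !e; lra.
Qed.

End prism.

Lemma fuzzy_le1 n x w : fuzzy n x w <= 1.
Proof.
apply: le_trans (fuzzy_sum_le n x (nn w)).
by apply: (sum_term_le (fuzzy_ge0 n x)); rewrite mem_lev.
Qed.

(** If [a] is in the support of the measure of [x] at scale [nn x + j - i], then [x] is about [i]
    levels deeper than [a] in a ball around [xi a]. There are [O(lam ^ i)] such [x], against the
    weight [u ^ i]. *)
Lemma fuzzy_column lam j (u : R) : (forall k, exists2 M, 0 <= M & forall p n m (s : seq G),
    uniq s -> (forall x, x \in s -> [/\ (n <= nn x)%N, (nn x <= n + m)%N &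
      theta (xi x) p <= 2 ^+ k * sc n]) -> (size s)%:R <= M * lam ^+ m) ->
  0 <= lam -> 0 <= u -> u * lam < 1 -> exists2 C : R, 0 <= C & forall a,
  sum_bounded (fun x => \sum_(i < (nn x + j).+1) u ^+ i * fuzzy (nn x + j - i) x a) C.
Proof.
move=> count lam0 u0 ul; have [K hK] := fuzzy_near 1%g j; have [M M0 hM] := count (K + K)%N.
have d0 : 0 < 1 - u * lam by rewrite subr_gt0.
exists (M * lam ^+ (K + K + j) * (1 - u * lam)^-1).
  by rewrite !mulr_ge0 ?exprn_ge0// invr_ge0 (ltW d0).
move=> a s us; pose L := \max_(x <- s) (nn x + j).+1.
pose P i x := (i <= nn x + j)%N && (fuzzy (nn x + j - i) x a != 0).
apply: (@le_trans _ _ (\sum_(x <- s) \sum_(i < L) u ^+ i * (P i x)%:R)).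
  rewrite big_seq [leRHS]big_seq; apply: ler_sum => x xs.
  have xL : ((nn x + j).+1 <= L)%N by apply: (@leq_bigmax_seq _ s xpredT (fun x => (nn x + j).+1)).
  rewrite (big_ord_widen _ (fun i => u ^+ i * fuzzy (nn x + j - i) x a) xL).
  rewrite big_mkcond; apply: ler_sum => i _; case: ifP => ix; last first.
    by rewrite mulr_ge0 ?exprn_ge0.
  rewrite ler_wpM2l ?exprn_ge0// /P -ltnS ix /=.
  by case: eqVneq => [->//|_]; exact: fuzzy_le1.
rewrite exchange_big /=.
apply: (@le_trans _ _ (\sum_(i < L) M * lam ^+ (K + K + j) * (u * lam) ^+ i)).
  apply: ler_sum => i _; rewrite -mulr_sumr sum_indicator -size_filter.
  have -> : M * lam ^+ (K + K + j) * (u * lam) ^+ i = u ^+ i * (M * lam ^+ (K + K + j + i)).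
    by rewrite exprMn [lam ^+ (_ + i)]exprD; ring.
  rewrite ler_wpM2l ?exprn_ge0//; apply: (hM (xi a) (nn a - (K + j))%N).
    exact: filter_uniq.
  move=> x; rewrite mem_filter => /andP[/andP[ix fz] _].
  have nx : (nn x + j - i <= nn x + j)%N by exact: leq_subr.
  have [h1 h2 h3] := hK _ _ x a nx (leqnn _) (leqnSn _) (or_introl fz).
  split; [lia|lia|rewrite tC; apply: le_trans h3 _].
  rewrite exprD -mulrA ler_pM2l ?exprn_gt0// (scale_pow R _ K) ler_pM2l ?exprn_gt0//.
  by apply: scale_le; lia.
rewrite -mulr_sumr ler_wpM2l ?mulr_ge0 ?exprn_ge0//.
by apply: geometric_sum => //; exact: mulr_ge0.
Qed.

Section prism_bound.
Variables (F : seq G) (c : G -> G -> G -> R).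
Hypothesis cocycle : forall x y z w, c y z w - c x z w + c x y w - c x y z = 0.

Definition pairs : seq (G * G) := [seq (f, f') | f <- undup (1%g :: F), f' <- undup (1%g :: F)].

Definition local_norm a := \sum_(h <- pairs) `|c a (a * h.1)%g (a * h.2)%g|.

Definition local_sqr a := \sum_(h <- pairs) c a (a * h.1)%g (a * h.2)%g ^+ 2.

Lemma mem_pairs f f' : f \in 1%g :: F -> f' \in 1%g :: F -> (f, f') \in pairs.
Proof. by move=> h h'; apply: allpairs_f; rewrite mem_undup. Qed.

Lemma local_norm_ge0 a : 0 <= local_norm a. Proof. exact: sumr_ge0. Qed.

Lemma local_sqr_ge0 a : 0 <= local_sqr a.
Proof. by apply: sumr_ge0 => h _; exact: sqr_ge0. Qed.

Lemma local_norm_sqr a : local_norm a ^+ 2 <= (size pairs)%:R * local_sqr a.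
Proof.
apply: le_trans (sqr_sum_le _ _) _; rewrite ler_wpM2l// ler_sum// => h _.
by rewrite real_normK ?num_real.
Qed.

Lemma alt_part_le a b d : (a^-1 * b)%g \in F -> (a^-1 * d)%g \in F ->
  `|alt_part c a b d| <= 2 * local_norm a.
Proof.
move=> hb hd; rewrite alt_partE//.
have le f f' : f \in 1%g :: F -> f' \in 1%g :: F ->
    `|c a (a * f)%g (a * f')%g| <= local_norm a.
  move=> h h'; have := mem_pairs h h'.
  exact: (@sum_term_le _ _ (fun h => `|c a (a * h.1)%g (a * h.2)%g|) pairs (f, f')).
have i1 : 1%g \in 1%g :: F by rewrite mem_head.
have ib : (a^-1 * b)%g \in 1%g :: F by rewrite inE hb orbT.
have id : (a^-1 * d)%g \in 1%g :: F by rewrite inE hd orbT.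
have := le _ _ ib id; have := le _ _ id ib; have := le _ _ ib i1; have := le _ _ id i1.
rewrite !mulVKg !mulg1 !ler_norml.
move: (local_norm a) (c _ _ _) (c _ _ _) (c _ _ _) (c _ _ _) => N u1 u2 u3 u4.
by do 4![move=> /andP[? ?]]; apply/andP; split; lra.
Qed.

Lemma prism_le g C n x : 0 <= C ->
  (forall m f H, (forall w, fuzzy m x w != 0 \/ fuzzy m (x * g)%g w != 0 -> `|f w| <= H) ->
    0 <= H -> `|mean m x f - mean m (x * g)%g f| <= H * (C * (2 ^+ m * sc (nn x)))) ->
  (forall m a l b, (n <= m)%N -> (m <= n.+1)%N -> (n <= l)%N -> (l <= n.+1)%N ->
    fuzzy m x a != 0 \/ fuzzy m (x * g)%g a != 0 ->
    fuzzy l x b != 0 \/ fuzzy l (x * g)%g b != 0 -> (a^-1 * b)%g \in F) ->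
  `|prism c n x (x * g)%g| <= 6 * C * (2 ^+ n * sc (nn x)) * mean n x local_norm.
Proof.
move=> C0 diff close; set y := (x * g)%g in diff close *.
have s0 : 0 <= 2 ^+ n * sc (nn x) by rewrite mulr_ge0 ?exprn_ge0// ltW// scale_gt0.
have n0 a : 0 <= 2 * local_norm a by rewrite mulr_ge0// local_norm_ge0.
rewrite prismE//.
apply: le_trans (ler_normD _ _) _.
(* One triangle compares means at scale [n + 1], which doubles the factor [2 ^ n], the other one at
   scale [n]: 6 is 4 + 2. *)
have -> : 6 * C * (2 ^+ n * sc (nn x)) * mean n x local_norm =
  mean n x (fun a => 4 * C * (2 ^+ n * sc (nn x)) * local_norm a) +
  mean n x (fun a => 2 * C * (2 ^+ n * sc (nn x)) * local_norm a).
  by rewrite !meanZ; ring.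
apply: lerD; apply: mean_le => a aX.
  rewrite -[leRHS](mean_const n.+1 x); apply: mean_le => b bX.
  rewrite distrC; apply: le_trans (diff n.+1 _ (2 * local_norm a) _ _) _ => //.
    move=> d dXY; apply: alt_part_le.
      by apply: close (or_introl aX) (or_introl bX).
    by apply: close (or_introl aX) dXY.
  by rewrite le_eqVlt; apply/orP; left; apply/eqP; rewrite exprS; ring.
rewrite -[leRHS](mean_const n.+1 y); apply: mean_le => d dY.
apply: le_trans (diff n _ (2 * local_norm a) _ _) _ => //.
  move=> b bXY; apply: alt_part_le.
    by apply: close (or_introl aX) bXY.
  by apply: close (or_introl aX) (or_intror dY).
by rewrite le_eqVlt; apply/orP; left; apply/eqP; ring.
Qed.

End prism_bound.

(** A prism [i] scales above the top is [O(2 ^- i)] times a mean of [c]. Cauchy-Schwarz with weights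
    [tau ^ i] turns the square of the sum of prisms into a sum of squares with weights [u ^ i], and
    Schur's test requires [u * lam < 1]. [D] and [H] are chosen before [K] and [c]. *)
Lemma primitive_bounded (g : G) : exists2 D : R, 0 <= D & exists H : seq (G * G),
  forall (K : eqType) (c : K -> G -> G -> G -> R) (N : G * G -> R),
  (forall i x y z w, c i y z w - c i x z w + c i x y w - c i x y z = 0) ->
  (forall h, h \in H ->
    sum_bounded (fun xk : G * K => c xk.2 xk.1 (xk.1 * h.1)%g (xk.1 * h.2)%g ^+ 2) (N h)) ->
  sum_bounded (fun xk : G * K => primitive (c xk.2) xk.1 (xk.1 * g)%g ^+ 2)
    (D * \sum_(h <- H) N h).
Proof.
have [kg hg] := fill_lip fil g; have [C C0 diff] := mean_diff g.
have [F0 close0] := fuzzy_close g kg; pose F := g :: F0; have [lam [lam2 lam4 count]] := ball_count.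
have lam0 : 0 <= lam by apply: le_trans lam2.
(* The mean of 1 and [lam / 4]: it is below 1, and its square exceeds [lam / 4] by the inequality of
   arithmetic and geometric means, whence [u * lam < 1]. *)
pose tau := (4 + lam) / 8.
have t0 : 0 < tau by rewrite /tau; lra.
have t1 : tau < 1 by rewrite /tau; lra.
have tt0 : 0 < 1 - tau ^+ 2 by rewrite subr_gt0 expr_lt1// ltW.
pose u := (2 * tau)^-1 ^+ 2.
have u0 : 0 <= u by exact: sqr_ge0.
have ul : u * lam < 1.
  rewrite /u exprVn mulrC ltr_pdivrMr; last by rewrite exprn_gt0// mulr_gt0.
  rewrite mul1r /tau.
  have : 0 < (4 - lam) ^+ 2 by rewrite exprn_gt0// subr_gt0.
  by rewrite !expr2; lra.
have [C1 C10 col] := fuzzy_column kg count lam0 u0 ul.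
pose A := 6 * C * 2 ^+ kg.
pose Z := A ^+ 2 * (1 - tau ^+ 2)^-1 * (size (pairs F))%:R.
have Z0 : 0 <= Z by rewrite !mulr_ge0 ?sqr_ge0 ?invr_ge0// ltW.
exists (2 * 1 + 2 * (C1 * Z)); first by have := mulr_ge0 C10 Z0; lra.
exists (pairs F) => K c N cocycle cN.
pose phi (xk : G * K) := local_sqr F (c xk.2) xk.1.
have phi0 xk : 0 <= phi xk by exact: local_sqr_ge0.
have phiN : sum_bounded phi (\sum_(h <- pairs F) N h) by exact: sum_bounded_sum.
pose S x := lev (nn x + kg + (k0 + nn 1%g)).
pose kap x a := \sum_(i < (nn x + kg).+1) u ^+ i * fuzzy (nn x + kg - i) x a.
have kap0 x a : 0 <= kap x a.
  by apply: sumr_ge0 => i _; apply: mulr_ge0; [exact: exprn_ge0|exact: fuzzy_ge0].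
pose f (xk : G * K) :=
  (\sum_(n < (nn xk.1 + kg).+1) prism (c xk.2) n xk.1 (xk.1 * g)%g) ^+ 2.
have fN : sum_bounded f (C1 * (Z * \sum_(h <- pairs F) N h)).
  apply: (@sum_bounded_schur _ _ _ f (fun xk => Z * phi xk) kap S) => //.
  - by move=> xk; exact: mulr_ge0.
  - by move=> x; exact: lev_uniq.
  - move=> x k; rewrite /f /=.
    pose p i := mean (nn x + kg - i) x (local_norm F (c k)).
    have p0 i : 0 <= p i by apply: mean_ge0 => w; exact: local_norm_ge0.
    (* With [i = nn x + kg - n], the width [2 ^ n * 2 ^- nn x] of the prism is [2 ^ kg * 2 ^- i]. *)
    have s1 : `|\sum_(n < (nn x + kg).+1) prism (c k) n x (x * g)%g| <=
        A * \sum_(i < (nn x + kg).+1) tau ^+ i * ((2 * tau)^-1 ^+ i * p i).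
      apply: le_trans (ler_norm_sum _ _ _) _; rewrite (reindex_inj rev_ord_inj)/= mulr_sumr.
      apply: ler_sum => i _; rewrite subSS.
      have ile : (i <= nn x + kg)%N by rewrite -ltnS.
      apply: le_trans (@prism_le F (c k) (cocycle k) g C _ x C0 _ _) _.
      + by move=> m h H hH; exact: diff.
      + move=> m a l b h1 h2 h3 h4 h5 h6; rewrite inE; apply/orP; right.
        by apply: (close0 _ x _ m a l b) h1 h2 h3 h4 h5 h6; exact: leq_subr.
      have -> : tau ^+ i * ((2 * tau)^-1 ^+ i * p i) = sc i * p i.
        rewrite mulrA -exprMn /scale; congr (_ ^+ _ * _).
        by field; rewrite gt_eqF.
      have -> : sc i = 2 ^+ (nn x + kg - i) * sc (nn x + kg).
        by rewrite (scale_pow R i (nn x + kg - i)) subnKC.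
      rewrite le_eqVlt; apply/orP; left; apply/eqP.
      rewrite scaleD -/(p i) /A; have := scale_pow2 R kg.
      move: (2 ^+ kg : R) (sc kg) (2 ^+ (nn x + kg - i) : R) (sc (nn x)) (p i).
      move=> a1 a2 a3 a4 a5 e.
      by rewrite -[LHS]mulr1 -e; ring.
    rewrite -[X in X <= _]real_normK ?num_real//.
    apply: (@le_trans _ _ ((A * \sum_(i < (nn x + kg).+1)
        tau ^+ i * ((2 * tau)^-1 ^+ i * p i)) ^+ 2)).
      by rewrite lerXn2r ?nnegrE ?normr_ge0// (le_trans _ s1).
    rewrite exprMn.
    have := cauchy_schwarz_seq (index_enum 'I_(nn x + kg).+1) (fun i => tau ^+ i)
      (fun i => (2 * tau)^-1 ^+ i * p i).
    have gs : \sum_(i < (nn x + kg).+1) (tau ^+ i) ^+ 2 <= (1 - tau ^+ 2)^-1.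
      under eq_bigr do rewrite exprAC.
      by apply: geometric_sum; rewrite ?sqr_ge0// -subr_gt0.
    have jen i : p i ^+ 2 <= (size (pairs F))%:R *
        \sum_(w <- S x) fuzzy (nn x + kg - i) x w * phi (w, k).
      apply: le_trans (mean_jensen _ _ _) _.
      rewrite /S mean_ext ?leq_add2r ?leq_subr// -meanZ.
      apply: ler_sum => w _; rewrite ler_wpM2l ?fuzzy_ge0//; exact: local_norm_sqr.
    have tot : \sum_(i < (nn x + kg).+1) ((2 * tau)^-1 ^+ i * p i) ^+ 2 <=
        (size (pairs F))%:R * \sum_(w <- S x) kap x w * phi (w, k).
      apply: (@le_trans _ _ (\sum_(i < (nn x + kg).+1) u ^+ i * ((size (pairs F))%:R *
          \sum_(w <- S x) fuzzy (nn x + kg - i) x w * phi (w, k)))).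
        apply: ler_sum => i _; rewrite exprMn exprAC -/u.
        by apply: ler_wpM2l; [exact: exprn_ge0|exact: jen].
      rewrite le_eqVlt; apply/orP; left; apply/eqP.
      under eq_bigr do rewrite mulrCA; rewrite -mulr_sumr; congr (_ * _).
      under eq_bigr do rewrite mulr_sumr; rewrite exchange_big /=; apply: eq_bigr => w _.
      by rewrite /kap mulr_suml; apply: eq_bigr => i _; rewrite mulrA.
    move=> cs; apply: le_trans (ler_wpM2l (sqr_ge0 A) cs) _.
    under [leRHS]eq_bigr do rewrite mulrCA; rewrite -mulr_sumr.
    apply: (@le_trans _ _ (A ^+ 2 * ((1 - tau ^+ 2)^-1 *
      ((size (pairs F))%:R * \sum_(w <- S x) kap x w * phi (w, k))))).
      apply: ler_wpM2l; first exact: sqr_ge0.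
      by apply: ler_pM => //; apply: sumr_ge0 => i _; exact: sqr_ge0.
    by rewrite /Z !mulrA.
  - by apply: sum_boundedZ.
  - by move=> xk; exact: sqr_ge0.
apply: sum_bounded_le (_ : sum_bounded (fun xk => 2 * phi xk + 2 * f xk) _); last first.
  have -> : (2 * 1 + 2 * (C1 * Z)) * \sum_(h <- pairs F) N h =
    2 * \sum_(h <- pairs F) N h + 2 * (C1 * (Z * \sum_(h <- pairs F) N h)) by ring.
  by apply: sum_boundedD; exact: sum_boundedZ.
move=> [x k] /=; have [_ _ h3] := hg x.
(* [kg] bounds the increase of level from [x] to [x * g], so this number of scales serves both
   ends. *)
rewrite (primitiveE (cocycle k) (N := (nn x + kg).+1)) ?ltnS ?leq_addr//.
have e2 : sym_part (c k) x (x * g)%g ^+ 2 <= phi (x, k).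
  have le h h' : h \in 1%g :: F -> h' \in 1%g :: F ->
      c k x (x * h)%g (x * h')%g ^+ 2 <= phi (x, k).
    move=> i1 i2; have := mem_pairs i1 i2.
    apply: (@sum_term_le _ _ (fun h => c k x (x * h.1)%g (x * h.2)%g ^+ 2) (pairs F) (h, h')).
    by move=> ?; exact: sqr_ge0.
  have i1 : 1%g \in 1%g :: F by rewrite mem_head.
  have ig : g \in 1%g :: F.
    by rewrite !inE eqxx orbT.
  have := le _ _ i1 i1; have := le _ _ ig i1; rewrite !mulg1 /sym_part.
  by move: (phi _) (c _ _ _ _) (c _ _ _ _) => P a b; rewrite !expr2; nra.
have := e2; rewrite /f /=; move: (sym_part _ _ _) (\sum_(n < _) _) (phi _) => a b P.
by have := sqr_ge0 (a - b); rewrite !expr2; lra.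
Qed.

End partition_of_unity.

Lemma filling_primitive : exists B : (G -> G -> G -> R) -> G -> G -> R,
  (forall c, (forall x y z w, c y z w - c x z w + c x y w - c x y z = 0) ->
     forall x y z, B c y z - B c x z + B c x y = c x y z) /\
  forall g : G, exists2 D : R, 0 <= D & exists H : seq (G * G),
    forall (K : eqType) (c : K -> G -> G -> G -> R) (N : G * G -> R),
    (forall i x y z w, c i y z w - c i x z w + c i x y w - c i x y z = 0) ->
    (forall h, h \in H ->
      sum_bounded (fun xk : G * K => c xk.2 xk.1 (xk.1 * h.1)%g (xk.1 * h.2)%g ^+ 2) (N h)) ->
    sum_bounded (fun xk : G * K => B (c xk.2) xk.1 (xk.1 * g)%g ^+ 2)
      (D * \sum_(h <- H) N h).
Proof.
have [k net] := fill_net fil; exists (primitive k); split.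
  by move=> c hc x y z; exact: primitiveP.
by move=> g; exact: primitive_bounded.
Qed.

(** A difference is at most [2 ^ kg * 2 ^- nn x] and [O(lam ^ l)] elements have level [l]: the sum
    of the [(lam / 4) ^ l] converges. *)
Lemma lipschitz_sqr_bounded z (g : G) :
  exists C, sum_bounded (fun x => (theta z (xi (x * g)%g) - theta z (xi x)) ^+ 2) C.
Proof.
have [T0 hT] := fill_bounded fil; have [kT hkT] := pow2_bound T0.
have [kg hg] := fill_lip fil g; have [lam [lam2 lam4 count]] := ball_count.
have [M M0 hM] := count kT.
have q0 : 0 <= 4^-1 * lam by rewrite mulr_ge0// (le_trans _ lam2).
have q1 : 4^-1 * lam < 1 by rewrite mulrC ltr_pdivrMr// mul1r.
exists ((2 ^+ kg) ^+ 2 * (M * (1 - 4^-1 * lam)^-1)) => s us.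
apply: (@le_trans _ _ (\sum_(x <- s) (2 ^+ kg) ^+ 2 * sc (nn x) ^+ 2)).
  apply: ler_sum => x _; have [h _ _] := hg x.
  rewrite -exprMn -[X in X <= _]real_normK ?num_real// lerXn2r ?nnegrE//.
    by rewrite mulr_ge0 ?exprn_ge0// (ltW (scale_gt0 _ _)).
  apply: le_trans h; rewrite ler_norml.
  have := ttri (xi x) z (xi (x * g)%g); have := ttri (xi (x * g)%g) z (xi x).
  by rewrite (tC (xi (x * g)%g) (xi x)) => h1 h2; apply/andP; split; lra.
rewrite -mulr_sumr ler_wpM2l ?sqr_ge0//.
pose L := \max_(x <- s) (nn x).+1.
apply: (@le_trans _ _ (\sum_(x <- s) \sum_(l < L) sc l ^+ 2 * (nn x == l)%:R)).
  rewrite big_seq [leRHS]big_seq; apply: ler_sum => x xs.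
  have xL : ((nn x) < L)%N by apply: (@leq_bigmax_seq _ s xpredT (fun x => (nn x).+1)).
  rewrite (bigD1 (Ordinal xL))//= eqxx mulr1 lerDl sumr_ge0// => l _.
  by rewrite mulr_ge0 ?sqr_ge0.
rewrite exchange_big /=.
apply: (@le_trans _ _ (\sum_(l < L) M * (4^-1 * lam) ^+ l)); last first.
  by rewrite -mulr_sumr ler_wpM2l// geometric_sum.
apply: ler_sum => l _; rewrite -mulr_sumr sum_indicator -size_filter.
have -> : sc l ^+ 2 = 4^-1 ^+ l.
  by rewrite /scale exprAC; congr (_ ^+ _); rewrite expr2; field.
rewrite exprMn mulrCA ler_wpM2l ?exprn_ge0 ?invr_ge0//.
apply: (hM (xi 1%g) 0%N); first exact: filter_uniq.
move=> x; rewrite mem_filter => /andP[/eqP -> _]; split=> //.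
by rewrite /scale expr0 mulr1; apply: le_trans (hT _ _) hkT.
Qed.

Lemma sum_unbounded (f : G -> R) e C : 0 < e -> (forall x, 0 <= f x) ->
  (forall s : seq G, exists2 y, y \notin s & e <= f y) -> ~ sum_bounded f C.
Proof.
move=> e0 f0 inf bd.
have big n : exists2 s : seq G, uniq s & e *+ n <= \sum_(x <- s) f x.
  elim: n => [|n [s us hs]]; first by exists [::]; rewrite ?big_nil.
  have [y ys hy] := inf s; exists (y :: s); first by rewrite /= ys.
  by rewrite big_cons mulrS lerD.
have [s us hs] := big (Num.truncn (C / e)).+1.
have C0 := sum_bounded_ge0 bd.
have /andP[_] := truncn_itv (divr_ge0 C0 (ltW e0)).
rewrite ltr_pdivrMr// ltNge => /negP; apply.
by apply: le_trans (bd s us); rewrite mulr_natl.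
Qed.

(** The function comes close to 0 infinitely often, near [z1], and close to [theta z1 z2], near
    [z2]; a constant stays away from one of these two values. *)
Lemma dist_not_sqr_bounded : exists z, forall a C,
  ~ sum_bounded (fun x => (theta z (xi x) - a) ^+ 2) C.
Proof.
have [z1 [z2 z12]] := fill_two fil; exists z1 => a C.
pose e := theta z1 z2.
have [ha|ha] := leP `|a| (e / 4).
  apply: (@sum_unbounded _ ((e / 2) ^+ 2)) => [||s].
  - by rewrite exprn_gt0// divr_gt0.
  - by move=> x; exact: sqr_ge0.
  - have e4 : 0 < e / 4 by rewrite divr_gt0.
    have [y ys hy] := @fill_dense _ _ _ _ _ _ fil z2 _ s e4; exists y => //.
    have := ttri (xi y) z1 z2; rewrite (tC (xi y)) -/e => h.
    have h2 : e / 2 <= theta z1 (xi y) - a by have := ler_norm a; lra.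
    by rewrite lerXn2r ?nnegrE ?divr_ge0 ?(ltW z12)// (le_trans _ h2)// divr_ge0// ltW.
have a0 : 0 < `|a| by apply: le_lt_trans ha; rewrite divr_ge0// ltW.
apply: (@sum_unbounded _ ((`|a| / 2) ^+ 2)) => [||s].
- by rewrite exprn_gt0// divr_gt0.
- by move=> x; exact: sqr_ge0.
- have e2 : 0 < `|a| / 2 by rewrite divr_gt0.
  have [y ys hy] := @fill_dense _ _ _ _ _ _ fil z1 _ s e2; exists y => //.
  rewrite -[leRHS]real_normK ?num_real// lerXn2r ?nnegrE ?divr_ge0//.
  have := ler_normB (theta z1 (xi y)) (theta z1 (xi y) - a).
  by rewrite opprB addrCA subrr addr0 (ger0_norm (tge0 _ _)); lra.
Qed.

End filling_measures.

(** * Hilbert spaces and Hilbert-Schmidt operators *)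

(** A norm for the additive structure: one notion for real, complex, vector and operator-valued
    sums. *)
Record group_norm (R : realType) (V : zmodType) (nrm : V -> R) : Prop := GroupNorm {
  nrm_ge0 : forall v, 0 <= nrm v ;
  nrm_eq0 : forall v, nrm v = 0 -> v = 0 ;
  nrm0 : nrm 0 = 0 ;
  nrmB : forall u v, nrm (u - v) <= nrm u + nrm v
}.

(** Unordered summation along duplicate-free lists, so that families can be regrouped and multiplied
    without an enumeration. *)
Definition has_sum (R : realType) (V : zmodType) (nrm : V -> R) (I : eqType)
    (F : I -> V) (S : V) :=
  forall e : R, 0 < e -> exists s0 : seq I, forall s, uniq s -> {subset s0 <= s} ->
    nrm (S - \sum_(i <- s) F i) <= e.

Lemma small_ge0 (R : realType) (x : R) : (forall e, 0 < e -> x <= e) -> x <= 0.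
Proof. by move=> h; apply/ler_addgt0Pl => e /h; rewrite addr0. Qed.

Lemma uniq_fibers (I J : eqType) (p : I -> J) (fib : J -> seq I) (s : seq J) :
  (forall j, uniq (fib j)) -> (forall i j, (i \in fib j) = (p i == j)) -> uniq s ->
  uniq [seq i | j <- s, i <- fib j].
Proof.
move=> ufib mfib us; apply: allpairs_uniq_dep => // -[j i] [j' i'].
have fibP (z : {_ : J & I}) : z \in [seq existT (fun=> I) x y | x <- s, y <- fib x] ->
    p (tagged z) = tag z.
  by move=> /allpairsPdep[x [y [_ h ->]]]; apply/eqP; rewrite -mfib.
by move=> /fibP /= <- /fibP /= <- ->.
Qed.

Lemma sqr_le (R : realType) (x y : R) : 0 <= x -> x <= y -> x ^+ 2 <= y ^+ 2.
Proof. by move=> x0 xy; rewrite lerXn2r ?nnegrE// (le_trans x0). Qed.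

Section norms.
Variables (R : realType) (V : zmodType) (nrm : V -> R).
Hypothesis gn : group_norm nrm.

Lemma nrmN v : nrm (- v) = nrm v.
Proof.
have h u : nrm (- u) <= nrm u by have := nrmB gn 0 u; rewrite sub0r (nrm0 gn) add0r.
by apply/eqP; rewrite eq_le h/= -{1}[v]opprK h.
Qed.

Lemma nrmD u v : nrm (u + v) <= nrm u + nrm v.
Proof. by rewrite -{1}[v]opprK -(nrmN v); exact: nrmB gn _ _. Qed.

Lemma nrm_sum (I : Type) (s : seq I) (F : I -> V) :
  nrm (\sum_(i <- s) F i) <= \sum_(i <- s) nrm (F i).
Proof.
elim: s => [|i s IH]; first by rewrite !big_nil (nrm0 gn).
by rewrite !big_cons; apply: le_trans (nrmD _ _) _; rewrite lerD2l.
Qed.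

Section families.
Variable I : eqType.
Implicit Types (F G : I -> V) (s : seq I).

Lemma eq_has_sum F G S : F =1 G -> has_sum nrm F S -> has_sum nrm G S.
Proof. by move=> /funext ->. Qed.

Lemma has_sum_unique F S T : has_sum nrm F S -> has_sum nrm F T -> S = T.
Proof.
move=> hS hT; apply/eqP; rewrite -subr_eq0; apply/eqP/(nrm_eq0 gn)/le_anti.
rewrite (nrm_ge0 gn) andbT; apply: small_ge0 => e e0.
have e2 : 0 < e / 2 by rewrite divr_gt0.
have [s0 h0] := hS _ e2; have [s1 h1] := hT _ e2.
set s := undup (s0 ++ s1).
have us : uniq s by exact: undup_uniq.
have i0 : {subset s0 <= s} by move=> x xs; rewrite mem_undup mem_cat xs.
have i1 : {subset s1 <= s} by move=> x xs; rewrite mem_undup mem_cat xs orbT.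
have -> : S - T = (S - \sum_(i <- s) F i) - (T - \sum_(i <- s) F i).
  by rewrite opprB addrA subrK.
apply: le_trans (nrmB gn _ _) _.
by have := h0 s us i0; have := h1 s us i1; lra.
Qed.

Lemma has_sumD F G S T : has_sum nrm F S -> has_sum nrm G T ->
  has_sum nrm (fun i => F i + G i) (S + T).
Proof.
move=> hS hT e e0; have e2 : 0 < e / 2 by rewrite divr_gt0.
have [s0 h0] := hS _ e2; have [s1 h1] := hT _ e2.
exists (s0 ++ s1) => s us ss; rewrite big_split /= opprD addrACA.
apply: le_trans (nrmD _ _) _.
have i0 : {subset s0 <= s} by move=> x xs; apply: ss; rewrite mem_cat xs.
have i1 : {subset s1 <= s} by move=> x xs; apply: ss; rewrite mem_cat xs orbT.
by have := h0 s us i0; have := h1 s us i1; lra.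
Qed.

Lemma has_sumN F S : has_sum nrm F S -> has_sum nrm (fun i => - F i) (- S).
Proof.
move=> hS e e0; have [s0 h0] := hS _ e0; exists s0 => s us ss.
by rewrite sumrN -opprD nrmN; exact: h0.
Qed.

Lemma has_sum_fin s F : uniq s -> (forall i, i \notin s -> F i = 0) ->
  has_sum nrm F (\sum_(i <- s) F i).
Proof.
move=> us F0 e e0; exists s => t ut st.
by rewrite -(sum_support us ut st F0) subrr (nrm0 gn) ltW.
Qed.

Lemma has_sum_le F S C : has_sum nrm F S ->
  (forall s, uniq s -> nrm (\sum_(i <- s) F i) <= C) -> nrm S <= C.
Proof.
move=> hS hC; rewrite -subr_le0; apply: small_ge0 => e e0.
have [s0 h0] := hS _ e0; have us := undup_uniq s0.
have h := h0 _ us (fun x => _ : x \in s0 -> x \in undup s0).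
have -> : S = (S - \sum_(i <- undup s0) F i) + \sum_(i <- undup s0) F i by rewrite subrK.
rewrite lerBlDr; apply: le_trans (nrmD _ _) _; apply: lerD; last exact: hC.
by apply: h => x; rewrite mem_undup.
Qed.

End families.

Lemma has_sum_regroup (I J : eqType) (p : I -> J) (fib : J -> seq I) (F : I -> V) S :
  (forall j, uniq (fib j)) -> (forall i j, (i \in fib j) = (p i == j)) ->
  has_sum nrm F S -> has_sum nrm (fun j => \sum_(i <- fib j) F i) S.
Proof.
move=> ufib mfib hS e e0; have [s0 h0] := hS _ e0; exists (map p s0) => s us ss.
have -> : \sum_(j <- s) \sum_(i <- fib j) F i =
  \sum_(i <- [seq i | j <- s, i <- fib j]) F i by rewrite big_allpairs_dep.
apply: h0; first exact: uniq_fibers ufib mfib us.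
move=> i is0; apply/allpairsPdep; exists (p i), i; split=> //.
  by apply: ss; exact: map_f.
by rewrite mfib.
Qed.

End norms.

Lemma sum_bounded_fibers (R : realType) (I J : eqType) (p : I -> J) (fib : J -> seq I)
    (f : I -> R) C : (forall j, uniq (fib j)) -> (forall i j, (i \in fib j) = (p i == j)) ->
  sum_bounded f C -> sum_bounded (fun j => \sum_(i <- fib j) f i) C.
Proof.
move=> ufib mfib h s us; rewrite -big_allpairs_dep.
by apply: h; exact: uniq_fibers ufib mfib us.
Qed.

Lemma subr_morph (V W : zmodType) (f : V -> W) : (forall u v, f (u - v) = f u - f v) ->
  [/\ f 0 = 0, (forall u v, f (u + v) = f u + f v) & forall (I : Type) (s : seq I) (F : I -> V),
      f (\sum_(i <- s) F i) = \sum_(i <- s) f (F i)].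
Proof.
move=> fB; have f0 : f 0 = 0 by rewrite -[X in f X](subrr 0) fB subrr.
have fD u v : f (u + v) = f u + f v.
  by rewrite -{1}[v]opprK fB -[- v]sub0r fB f0 sub0r opprK.
split=> // I s F; elim: s => [|i s IH]; first by rewrite !big_nil.
by rewrite !big_cons fD IH.
Qed.

Lemma has_sum_map (R : realType) (V W : zmodType) (nv : V -> R) (nw : W -> R)
    (f : V -> W) (K : R) (I : eqType) (F : I -> V) S : group_norm nv ->
  (forall u v, f (u - v) = f u - f v) -> (forall v, nw (f v) <= K * nv v) ->
  has_sum nv F S -> has_sum nw (f \o F) (f S).
Proof.
move=> gn fB fK hS e e0; pose K1 := Num.max K 1.
have K0 : 0 < K1 by rewrite lt_max ltr01 orbT.
have [s0 h0] := hS _ (divr_gt0 e0 K0); exists s0 => s us ss.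
have [_ _ fsum] := subr_morph fB; rewrite -fsum -fB; apply: le_trans (fK _) _.
have := h0 s us ss; rewrite ler_pdivlMr// mulrC; apply: le_trans.
by rewrite ler_wpM2r ?(nrm_ge0 gn)// le_max lexx.
Qed.

(** Rectangles are cofinal among the finite sets of pairs, and over a rectangle the sum is the
    product of two partial sums. *)
Lemma has_sum_prod (R : realType) (V : zmodType) (nrm : V -> R) (mul : V -> V -> V)
    (I J : eqType) (F : I -> V) (G : J -> V) S T P :
  group_norm nrm ->
  (forall u v w, mul (u - v) w = mul u w - mul v w) ->
  (forall u v w, mul w (u - v) = mul w u - mul w v) ->
  (forall u v, nrm (mul u v) <= nrm u * nrm v) ->
  has_sum nrm F S -> has_sum nrm G T ->
  has_sum nrm (fun p : I * J => mul (F p.1) (G p.2)) P -> P = mul S T.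
Proof.
move=> gn mulBl mulBr nM hS hT hP.
have rect (s : seq I) (t : seq J) :
    \sum_(p <- [seq (i, j) | i <- s, j <- t]) mul (F p.1) (G p.2) =
    mul (\sum_(i <- s) F i) (\sum_(j <- t) G j).
  have [_ _ ->] := subr_morph (fun u v => mulBl u v (\sum_(j <- t) G j)).
  rewrite big_allpairs; apply: eq_bigr => i _.
  by have [_ _ ->] := subr_morph (fun u v => mulBr u v (F i)).
apply/eqP; rewrite -subr_eq0; apply/eqP/(nrm_eq0 gn)/le_anti.
rewrite (nrm_ge0 gn) andbT; apply: small_ge0 => e e0.
pose d := Num.min 1 (e / (2 + nrm S + nrm T)).
have q0 : 0 < 2 + nrm S + nrm T.
  by have := nrm_ge0 gn S; have := nrm_ge0 gn T; lra.
have d0 : 0 < d by rewrite lt_min ltr01 divr_gt0.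
have [s0 h0] := hS _ d0; have [t0 k0] := hT _ d0; have [p0 l0] := hP _ d0.
set s := undup (s0 ++ map fst p0); set t := undup (t0 ++ map snd p0).
have us : uniq s by exact: undup_uniq.
have ut : uniq t by exact: undup_uniq.
have h := h0 s us _; have {}h : nrm (S - \sum_(i <- s) F i) <= d.
  by apply: h => x xs; rewrite mem_undup mem_cat xs.
have k := k0 t ut _; have {}k : nrm (T - \sum_(j <- t) G j) <= d.
  by apply: k => x xs; rewrite mem_undup mem_cat xs.
have l : nrm (P - mul (\sum_(i <- s) F i) (\sum_(j <- t) G j)) <= d.
  rewrite -rect; apply: l0; first by rewrite allpairs_uniq// => -[? ?] [? ?].
  by move=> [i j] ij; apply: allpairs_f; rewrite mem_undup mem_cat;
    apply/orP; right; [exact: (map_f fst ij)|exact: (map_f snd ij)].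
move: (\sum_(i <- s) F i) (\sum_(j <- t) G j) h k l => A B h k l.
have -> : P - mul S T = (P - mul A B) - (mul (S - A) T + (mul S (T - B) - mul (S - A) (T - B))).
  rewrite -(mulBl S) opprB (addrCA S) subrr addr0 mulBl mulBr addrA subrK.
  by rewrite opprB addrA subrK.
apply: le_trans (nrmB gn _ _) _; apply: le_trans (lerD l (nrmD gn _ _)) _.
apply: le_trans (lerD (lexx _) (lerD (lexx _) (nrmB gn _ _))) _.
have a0 := nrm_ge0 gn (S - A); have b0 := nrm_ge0 gn (T - B).
have S0 := nrm_ge0 gn S; have T0 := nrm_ge0 gn T.
have d1 : d <= 1 by rewrite /d ge_min lexx.
have de : d * (2 + nrm S + nrm T) <= e.
  by rewrite -ler_pdivlMr// /d ge_min lexx orbT.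
have m1 := nM (S - A) T; have m2 := nM S (T - B); have m3 := nM (S - A) (T - B).
have b1 : nrm (S - A) * nrm T <= d * nrm T by rewrite ler_wpM2r.
have b2 : nrm S * nrm (T - B) <= d * nrm S by rewrite mulrC ler_wpM2r.
have b3 : nrm (S - A) * nrm (T - B) <= d.
  by rewrite -[leRHS]mulr1 ler_pM// (le_trans k).
lra.
Qed.

Section real_sums.
Variable R : realType.

Lemma real_group_norm : group_norm (fun x : R => `|x|).
Proof.
split; [exact: normr_ge0|by move=> v /normr0_eq0|exact: normr0|exact: ler_normB].
Qed.

Notation has_rsum := (has_sum (fun x : R => `|x|)).

Lemma esum_sum_bounded (T : choiceType) (a : T -> R) C : (forall x, 0 <= a x) ->
  (\esum_(x in setT) (a x)%:E <= C%:E)%E <-> sum_bounded a C.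
Proof.
move=> a0; split=> [h s us|h].
  rewrite -lee_fin; apply: le_trans h; rewrite -sumEFin.
  by apply: esum_ge; exists [set` s]; [split|rewrite fsbig_seq].
apply: ge_ereal_sup => /= _ [A [finA _]] <-.
by rewrite fsbig_finite//= sumEFin lee_fin; exact: h.
Qed.

Lemma sum_bounded_esum (T : choiceType) (a : T -> R) C : (forall x, 0 <= a x) ->
  sum_bounded a C -> sum_bounded a (fine (\esum_(x in setT) (a x)%:E)%E) /\
  (\esum_(x in setT) (a x)%:E)%E \is a fin_num.
Proof.
move=> a0 /(esum_sum_bounded _ a0) h.
have fin : (\esum_(x in setT) (a x)%:E)%E \is a fin_num.
  rewrite ge0_fin_numE; first by apply: le_lt_trans h (ltry _).
  by apply: esum_ge0 => x _; rewrite lee_fin.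
by split=> //; apply/(esum_sum_bounded _ a0); rewrite fineK.
Qed.

Lemma has_rsum_esum (T : choiceType) (a : T -> R) C : (forall x, 0 <= a x) ->
  sum_bounded a C -> has_rsum a (fine (\esum_(x in setT) (a x)%:E)%E).
Proof.
move=> a0 hC e e0; have [h fin] := sum_bounded_esum a0 hC; set L := fine _ in h *.
have [s0 us0 hs0] : exists2 s0 : seq T, uniq s0 & L - e <= \sum_(x <- s0) a x.
  apply: contrapT => no.
  have : sum_bounded a (L - e).
    by move=> s us; rewrite leNgt; apply/negP => lt; apply: no; exists s => //; exact: ltW.
  move=> /(esum_sum_bounded _ a0); rewrite -[X in (X <= _)%E](fineK fin) lee_fin -/L.
  by rewrite leNgt ltrBlDr ltrDl e0.
exists s0 => s us ss; have := h s us; have := sum_le_sub a0 us0 ss.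
by rewrite ler_norml => h1 h2; apply/andP; split; lra.
Qed.

Lemma has_rsum_bounded (T : choiceType) (a : T -> R) C : (forall x, 0 <= a x) ->
  sum_bounded a C -> exists r, has_rsum a r.
Proof. by move=> a0 h; exists (fine (\esum_(x in setT) (a x)%:E)%E); exact: has_rsum_esum h. Qed.

Lemma sum_tail (T : choiceType) (a : T -> R) C e : (forall x, 0 <= a x) ->
  sum_bounded a C -> 0 < e -> exists s0 : seq T,
  forall s, uniq s -> {in s, forall x, x \notin s0} -> \sum_(x <- s) a x <= e.
Proof.
move=> a0 h e0; have [r hr] := has_rsum_bounded a0 h.
have e2 : 0 < e / 2 by rewrite divr_gt0.
have [s0 h0] := hr _ e2; exists (undup s0) => s us ss.
have h1 := h0 _ (undup_uniq s0) _.
have {}h1 : `|r - \sum_(x <- undup s0) a x| <= e / 2.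
  by apply: h1 => x; rewrite mem_undup.
have := h0 (undup s0 ++ s) _ _; rewrite big_cat /=.
have -> : uniq (undup s0 ++ s).
  by rewrite cat_uniq undup_uniq us andbT /= -all_predC; apply/allP => x /ss.
move=> /(_ isT)/(_ _)/wrap[x xs|]; first by rewrite mem_cat mem_undup xs.
by move: h1; rewrite !ler_norml => /andP[? ?] /andP[? ?]; lra.
Qed.

Lemma has_real_sum (T : choiceType) (a : T -> R) C :
  sum_bounded (fun x => `|a x|) C -> has_rsum a (real_sum a).
Proof.
move=> h; have h1 : sum_bounded (fun x => Num.max (a x) 0) C.
  by apply: sum_bounded_le h => x; rewrite ge_max normr_ge0 ler_norm.
have h2 : sum_bounded (fun x => Num.max (- a x) 0) C.
  by apply: sum_bounded_le h => x; rewrite ge_max normr_ge0 -normrN ler_norm.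
have m0 (b : R) : 0 <= Num.max b 0 by rewrite le_max lexx orbT.
have s1 := has_rsum_esum (fun x => m0 (a x)) h1.
have s2 := has_rsum_esum (fun x => m0 (- a x)) h2.
apply: eq_has_sum (has_sumD real_group_norm s1 (has_sumN real_group_norm s2)).
by move=> x /=; rewrite /Num.max; case: ltP => c1; case: ltP => c2; lra.
Qed.

End real_sums.

Notation has_rsum := (has_sum (fun x => `|x|)).

Section l2_dot.
Variables (R : realType) (T : choiceType).
Local Notation H := (l2 R T).
Implicit Types (f g h : H) (a b : T -> R[i]) (z w : R[i]).

Definition has_csum a z := has_rsum (fun x => complex.Re (a x)) (complex.Re z) /\
  has_rsum (fun x => complex.Im (a x)) (complex.Im z).

Lemma has_csum_unique a z w : has_csum a z -> has_csum a w -> z = w.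
Proof.
move=> [r1 i1] [r2 i2].
have := has_sum_unique (real_group_norm R) r1 r2.
have := has_sum_unique (real_group_norm R) i1 i2.
by case: z w {r1 i1 r2 i2} => [? ?] [? ?] /= -> ->.
Qed.

Lemma has_rsumZ k (u : T -> R) r : has_rsum u r -> has_rsum (fun x => k * u x) (k * r).
Proof.
apply: (has_sum_map (f := *%R k) (K := `|k|) (real_group_norm R)).
- by move=> v w; rewrite mulrBr.
- by move=> v; rewrite normrM.
Qed.

Lemma has_csumZD c a b z w : has_csum a z -> has_csum b w ->
  has_csum (fun x => c * a x + b x) (c * z + w).
Proof.
move=> [ra ia] [rb ib]; have D := has_sumD (real_group_norm R); case: c => c d; split.
  apply: eq_has_sum (_ : has_rsum (fun x => c * complex.Re (a x) +
    (- d) * complex.Im (a x) + complex.Re (b x)) _).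
    by move=> x; case: (a x) (b x) => [? ?] [? ?] /=; ring.
  have -> : complex.Re (Complex c d * z + w) =
    c * complex.Re z + (- d) * complex.Im z + complex.Re w.
    by case: (z) (w) => [? ?] [? ?] /=; ring.
  by apply: (D _ _ _ _ _ (D _ _ _ _ _ (has_rsumZ c ra) (has_rsumZ (- d) ia)) rb).
apply: eq_has_sum (_ : has_rsum (fun x => c * complex.Im (a x) +
  d * complex.Re (a x) + complex.Im (b x)) _).
  by move=> x; case: (a x) (b x) => [? ?] [? ?] /=; ring.
have -> : complex.Im (Complex c d * z + w) =
  c * complex.Im z + d * complex.Re z + complex.Im w.
  by case: (z) (w) => [? ?] [? ?] /=; ring.
by apply: (D _ _ _ _ _ (D _ _ _ _ _ (has_rsumZ c ia) (has_rsumZ d ra)) ib).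
Qed.

Lemma has_csum_conj a z : has_csum a z -> has_csum (fun x => conjc (a x)) (conjc z).
Proof.
move=> [r i]; split.
  rewrite (_ : complex.Re (conjc z) = complex.Re z); last by case: (z).
  by apply: eq_has_sum r => x; case: (a x).
rewrite (_ : complex.Im (conjc z) = - complex.Im z); last by case: (z).
by apply: eq_has_sum (has_sumN (real_group_norm R) i) => x; case: (a x).
Qed.

Lemma l2_memP a : reflect (exists C, sum_bounded (fun x => normsq (a x)) C) (a \in @l2_pred R T).
Proof.
have n0 x := normsq_ge0 (a x); apply: (iffP idP); rewrite inE /=.
  move=> h; exists (fine (\esum_(x in setT) (normsq (a x))%:E)%E).
  apply/(esum_sum_bounded _ n0); rewrite fineK// ge0_fin_numE//.
  by apply: esum_ge0 => x _; rewrite lee_fin.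
by move=> [C /(esum_sum_bounded _ n0) h]; apply: le_lt_trans h (ltry _).
Qed.

Lemma l2_bounded f C : sum_bounded (fun x => normsq (f x)) C <-> l2_normsq f <= C.
Proof.
have n0 x := normsq_ge0 (f x).
rewrite -(esum_sum_bounded _ n0) -lee_fin l2_normsqE; by split.
Qed.

Lemma l2_sum_normsq f : sum_bounded (fun x => normsq (f x)) (l2_normsq f).
Proof. exact/l2_bounded. Qed.

Lemma has_sum_normsq f : has_rsum (fun x => normsq (f x)) (l2_normsq f).
Proof. exact: has_rsum_esum (fun x => normsq_ge0 (f x)) (l2_sum_normsq f). Qed.

Lemma l2_dotP f g : has_csum (fun x => f x * conjc (g x)) (l2_dot f g).
Proof.
have bd := sum_boundedD (l2_sum_normsq f) (l2_sum_normsq g).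
have le (a b c d : R) : `|a * c + b * d| <= a ^+ 2 + b ^+ 2 + (c ^+ 2 + d ^+ 2).
  have := sqr_ge0 (a - c); have := sqr_ge0 (b - d); have := sqr_ge0 (a + c).
  by have := sqr_ge0 (b + d); rewrite ler_norml !expr2 => *; apply/andP; split; nra.
split; apply: (@has_real_sum _ _ _ (l2_normsq f + l2_normsq g)); apply: sum_bounded_le bd => x.
  case: (f x) (g x) => [a b] [c d] /=; rewrite /normsq /=.
  by have := le a b c d; rewrite mulrN opprK.
case: (f x) (g x) => [a b] [c d] /=; rewrite /normsq /= addrC.
by have := le b (- a) c d; rewrite sqrrN mulNr mulrN (addrC (b ^+ 2)).
Qed.

Lemma l2_dotE f g z : has_csum (fun x => f x * conjc (g x)) z -> l2_dot f g = z.
Proof. exact: has_csum_unique (l2_dotP f g). Qed.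

Lemma l2_dotZDl c f g h : l2_dot (c *: f + g) h = c * l2_dot f h + l2_dot g h.
Proof.
apply: l2_dotE; have := has_csumZD c (l2_dotP f h) (l2_dotP g h).
by congr has_csum; apply/funext => x /=; rewrite mulrDl mulrA.
Qed.

Lemma l2_dotC f g : l2_dot g f = conjc (l2_dot f g).
Proof.
apply: l2_dotE; have := has_csum_conj (l2_dotP f g).
by congr has_csum; apply/funext => x /=; rewrite rmorphM /= conjcK mulrC.
Qed.

Lemma l2_dot0l h : l2_dot 0 h = 0.
Proof.
have := l2_dotZDl 1 0 0 h; rewrite scaler0 addr0 mul1r => /eqP.
by rewrite -subr_eq0 opprD addrA subrr sub0r oppr_eq0 => /eqP.
Qed.

Lemma l2_dotDl f g h : l2_dot (f + g) h = l2_dot f h + l2_dot g h.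
Proof. by rewrite -[f]scale1r l2_dotZDl mul1r scale1r. Qed.

Lemma l2_dotZl c f h : l2_dot (c *: f) h = c * l2_dot f h.
Proof. by rewrite -[c *: f]addr0 l2_dotZDl l2_dot0l addr0. Qed.

Lemma l2_dotBl f g h : l2_dot (f - g) h = l2_dot f h - l2_dot g h.
Proof. by rewrite -[- g]scaleN1r l2_dotDl l2_dotZl mulN1r. Qed.

Lemma l2_dotDr f g h : l2_dot h (f + g) = l2_dot h f + l2_dot h g.
Proof. by rewrite (l2_dotC (f + g)) (l2_dotC f) (l2_dotC g) l2_dotDl rmorphD. Qed.

Lemma l2_dotZr c f h : l2_dot h (c *: f) = conjc c * l2_dot h f.
Proof. by rewrite (l2_dotC (c *: f)) (l2_dotC f) l2_dotZl rmorphM. Qed.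

Lemma l2_dotBr f g h : l2_dot h (f - g) = l2_dot h f - l2_dot h g.
Proof. by rewrite (l2_dotC (f - g)) (l2_dotC f) (l2_dotC g) l2_dotBl rmorphB. Qed.

Lemma l2_dot_delta f x : l2_dot f (l2_delta R x) = f x.
Proof.
have e y : f y * conjc (l2_delta R x y) = if y == x then f x else 0.
  by rewrite /= conjc_nat; case: eqVneq => [->|_]; rewrite ?mulr1 ?mulr0.
have fin (u : T -> R) : (forall y, y != x -> u y = 0) -> has_rsum u (u x).
  move=> u0; have := has_sum_fin (real_group_norm R) (isT : uniq [:: x]) (F := u).
  by rewrite big_seq1; apply=> y; rewrite inE; exact: u0.
apply: l2_dotE; split.
  have := fin (fun y => complex.Re (f y * conjc (l2_delta R x y))).
  by rewrite e eqxx; apply=> y /negPf yx; rewrite e yx.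
have := fin (fun y => complex.Im (f y * conjc (l2_delta R x y))).
by rewrite e eqxx; apply=> y /negPf yx; rewrite e yx.
Qed.

Lemma l2_dotxx f : l2_dot f f = (l2_normsq f)%:C%C.
Proof.
apply: l2_dotE; split => /=.
  apply: eq_has_sum (has_sum_normsq f) => x.
  by case: (f x) => a b; rewrite /normsq /= mulrN opprK !expr2.
have := has_sum_fin (real_group_norm R) (isT : uniq ([::] : seq T)) (F := fun=> 0).
rewrite big_nil => /(_ (fun _ _ => erefl)); apply: eq_has_sum => x.
by case: (f x) => a b /=; ring.
Qed.

Lemma l2_normsq_eq0 f : l2_normsq f = 0 -> f = 0.
Proof.
move=> f0; apply/val_inj/funext => x /=.
have := l2_sum_normsq f; rewrite f0 => /(_ [:: x] isT); rewrite big_seq1 => h.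
have : normsq (f x) = 0 by apply/le_anti; rewrite h normsq_ge0.
case: (f x) => a b; rewrite /normsq /= => /eqP; rewrite paddr_eq0 ?sqr_ge0// !sqrf_eq0.
by move=> /andP[/eqP -> /eqP ->].
Qed.

Lemma l2_cauchy_schwarz f g : normsq (l2_dot f g) <= l2_normsq f * l2_normsq g.
Proof.
have G0 := l2_normsq_ge0 g; have [g0|gn0] := eqVneq (l2_normsq g) 0.
  by rewrite (l2_normsq_eq0 g0) l2_dotC l2_dot0l conjc0 normsq0 mulr_ge0 ?l2_normsq_ge0.
have Gp : 0 < l2_normsq g by rewrite lt_neqAle eq_sym gn0.
pose u := (l2_normsq g)%:C%C *: f - l2_dot f g *: g.
have := l2_normsq_ge0 u; have := l2_dotxx u; move: (l2_normsq u) => N; rewrite /u.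
rewrite !(l2_dotBl, l2_dotBr, l2_dotZl, l2_dotZr) !l2_dotxx (l2_dotC f g) conjc_real.
move: (l2_normsq f) (l2_normsq g) (l2_dot f g) Gp => F G [p q] Gp.
move=> /(congr1 (@complex.Re R)) /=; rewrite /normsq /= => <- h.
by rewrite -subr_ge0 -(pmulr_rge0 _ Gp); move: h; rewrite !expr2; lra.
Qed.

Lemma l2_group_norm : group_norm (@l2_norm R T).
Proof.
split; [exact: l2_norm_ge0| |exact: l2_norm0|].
  by move=> f f0; apply: l2_normsq_eq0; rewrite -sqr_l2_norm f0 expr0n.
move=> u v; rewrite -(@ler_pXn2r _ 2) ?nnegrE ?addr_ge0 ?l2_norm_ge0//.
have cs : - complex.Re (l2_dot u v) <= l2_norm u * l2_norm v.
  rewrite (le_trans (ler_norm _))// normrN -(@ler_pXn2r _ 2) ?nnegrE ?mulr_ge0 ?l2_norm_ge0//.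
  rewrite real_normK ?num_real// exprMn !sqr_l2_norm.
  apply: le_trans (l2_cauchy_schwarz u v); rewrite /normsq lerDl sqr_ge0//.
rewrite sqrrD !sqr_l2_norm; have := l2_dotxx (u - v).
rewrite !(l2_dotBl, l2_dotBr) !l2_dotxx (l2_dotC u v) => /(congr1 (@complex.Re R)).
by case: (l2_dot u v) cs => p q /= cs <-; lra.
Qed.

Lemma l2_normZ c f : l2_norm (c *: f) = Num.sqrt (normsq c) * l2_norm f.
Proof.
rewrite /l2_norm -sqrtrM ?normsq_ge0//; congr (Num.sqrt _).
have := l2_dotxx (c *: f); rewrite l2_dotZl l2_dotZr l2_dotxx => /(congr1 (@complex.Re R)).
by case: c => a b /=; rewrite /normsq /= => <-; ring.
Qed.

Lemma l2_norm_coord f x : normsq (f x) <= l2_normsq f.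
Proof. by have := l2_sum_normsq f (isT : uniq [:: x]); rewrite big_seq1. Qed.

Lemma l2_norm_le f C : 0 <= C -> sum_bounded (fun x => normsq (f x)) (C ^+ 2) -> l2_norm f <= C.
Proof.
by move=> C0 /l2_bounded; rewrite -sqr_l2_norm ler_pXn2r ?nnegrE ?l2_norm_ge0.
Qed.

End l2_dot.

Section l2_completeness.
Variables (R : realType) (T : choiceType).
Local Notation H := (l2 R T).
Implicit Types (f g h : H) (x y : T).

Lemma l2_sumE (I : Type) (s : seq I) (F : I -> H) x :
  (\sum_(i <- s) F i) x = \sum_(i <- s) F i x.
Proof. by elim: s => [|i s IH]; rewrite ?big_nil// !big_cons -IH. Qed.

Lemma Re_sum (I : Type) (s : seq I) (F : I -> R[i]) :
  complex.Re (\sum_(i <- s) F i) = \sum_(i <- s) complex.Re (F i).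
Proof. by elim: s => [|i s IH]; rewrite ?big_nil// !big_cons -IH; case: (F i) => ? ?; case: (\sum_(_ <- s) _). Qed.

Lemma Im_sum (I : Type) (s : seq I) (F : I -> R[i]) :
  complex.Im (\sum_(i <- s) F i) = \sum_(i <- s) complex.Im (F i).
Proof. by elim: s => [|i s IH]; rewrite ?big_nil// !big_cons -IH; case: (F i) => ? ?; case: (\sum_(_ <- s) _). Qed.

Lemma has_sum_finsum (I : eqType) (J : Type) (t : seq J) (u : J -> I -> R) (r : J -> R) :
  (forall j, has_rsum (u j) (r j)) ->
  has_rsum (fun i => \sum_(j <- t) u j i) (\sum_(j <- t) r j).
Proof.
move=> h; elim: t => [|j t IH].
  rewrite big_nil; apply: eq_has_sum (_ : has_rsum (fun=> 0) 0) => [i|].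
    by rewrite big_nil.
  by have := has_sum_fin (real_group_norm R) (isT : uniq ([::] : seq I)) (F := fun=> 0);
    rewrite big_nil; apply.
rewrite big_cons; apply: eq_has_sum (has_sumD (real_group_norm R) (h j) IH) => i.
by rewrite big_cons.
Qed.

(* If [N ^ 2] is the squared norm of the coordinatewise sum [S] on a finite set, pairing
   the partial sums with [S] gives [N ^ 2 <= N * C]. *)
Lemma coordinate_sum_bounded (I : choiceType) (F : I -> H) (S : T -> R[i]) C :
  (forall x, has_csum (fun i => F i x) (S x)) -> sum_bounded (fun i => l2_norm (F i)) C ->
  sum_bounded (fun x => normsq (S x)) (C ^+ 2).
Proof.
move=> hS hC t ut; have C0 := sum_bounded_ge0 hC.
set N2 := \sum_(x <- t) _; have N20 : 0 <= N2 by apply: sumr_ge0 => x _; exact: normsq_ge0.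
pose u x i := complex.Re (S x) * complex.Re (F i x) + complex.Im (S x) * complex.Im (F i x).
have hu : has_rsum (fun i => \sum_(x <- t) u x i) N2.
  apply: has_sum_finsum => x; have [r i] := hS x.
  have -> : normsq (S x) = complex.Re (S x) * complex.Re (S x) + complex.Im (S x) * complex.Im (S x).
    by rewrite /normsq !expr2.
  by apply: has_sumD; [exact: real_group_norm|exact: has_rsumZ|exact: has_rsumZ].
have le : N2 <= Num.sqrt N2 * C.
  rewrite -[leLHS]ger0_norm//; apply: (has_sum_le (real_group_norm R) hu) => s us.
  set v := \sum_(i <- s) F i.
  have vC : l2_norm v <= C.
    by apply: le_trans (nrm_sum (l2_group_norm R T) _ _) _; exact: hC.
  have -> : \sum_(i <- s) \sum_(x <- t) u x i =
      \sum_(x <- t) complex.Re (S x) * complex.Re (v x) +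
      \sum_(x <- t) complex.Im (S x) * complex.Im (v x).
    rewrite exchange_big -big_split /=; apply: eq_bigr => x _.
    by rewrite /u big_split /= -!mulr_sumr l2_sumE Re_sum Im_sum.
  rewrite -(@ler_pXn2r _ 2) ?nnegrE ?mulr_ge0 ?sqrtr_ge0// exprMn sqr_sqrtr//.
  rewrite real_normK ?num_real//.
  have split2 (w z : T -> R[i]) : \sum_(x <- t) complex.Re (w x) * complex.Re (z x) +
      \sum_(x <- t) complex.Im (w x) * complex.Im (z x) =
      \sum_(p <- [seq (x, b) | x <- t, b <- [:: true; false]])
        (if p.2 then complex.Re (w p.1) else complex.Im (w p.1)) *
        (if p.2 then complex.Re (z p.1) else complex.Im (z p.1)).
    by rewrite big_allpairs -big_split /=; apply: eq_bigr => x _;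
      rewrite !big_cons big_nil addr0.
  rewrite split2; apply: le_trans (cauchy_schwarz_seq _ _ _) _.
  apply: ler_pM.
  - by apply: sumr_ge0 => p _; exact: sqr_ge0.
  - by apply: sumr_ge0 => p _; exact: sqr_ge0.
  - by under eq_bigr do rewrite expr2; rewrite -split2 -big_split /=; apply: ler_sum => x _;
      rewrite /normsq !expr2.
  apply: (@le_trans _ _ (l2_normsq v)).
    under eq_bigr do rewrite expr2; rewrite -split2 -big_split /=.
    by under eq_bigr do rewrite -!expr2; exact: l2_sum_normsq.
  by rewrite -sqr_l2_norm ler_pXn2r ?nnegrE ?l2_norm_ge0.
have q : Num.sqrt N2 ^+ 2 = N2 by rewrite sqr_sqrtr.
have [z|nz] := eqVneq (Num.sqrt N2) 0.
  by rewrite -q z expr0n sqr_ge0.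
have np : 0 < Num.sqrt N2 by rewrite lt_neqAle eq_sym nz sqrtr_ge0.
by rewrite -q ler_pXn2r ?nnegrE ?sqrtr_ge0// -(ler_pM2l np) -expr2 q.
Qed.

(** The coordinates converge absolutely; [coordinate_sum_bounded] controls the norm of the sum, and
    that of the remainders. *)
Lemma l2_complete (I : choiceType) (F : I -> H) C :
  sum_bounded (fun i => l2_norm (F i)) C -> exists S, has_sum (@l2_norm R T) F S.
Proof.
move=> hC; have nc i x : normsq (F i x) <= l2_norm (F i) ^+ 2.
  by rewrite sqr_l2_norm l2_norm_coord.
have re (z : R[i]) : complex.Re z ^+ 2 <= normsq z by rewrite /normsq lerDl sqr_ge0.
have im (z : R[i]) : complex.Im z ^+ 2 <= normsq z by rewrite /normsq lerDr sqr_ge0.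
have abs (r N : R) : 0 <= N -> r ^+ 2 <= N ^+ 2 -> `|r| <= N.
  by move=> N0; rewrite -[X in X <= _]real_normK ?num_real// ler_pXn2r ?nnegrE.
pose S x := Complex (real_sum (fun i => complex.Re (F i x))) (real_sum (fun i => complex.Im (F i x))).
have hS x : has_csum (fun i => F i x) (S x).
  by split; apply: (@has_real_sum _ _ _ C); apply: sum_bounded_le hC => i;
    apply: abs; rewrite ?l2_norm_ge0//; apply: le_trans (nc i x).
have SP : S \in @l2_pred R T.
  by apply/l2_memP; exists (C ^+ 2); exact: coordinate_sum_bounded hS hC.
exists (L2 SP) => e e0.
have [s0 h0] := sum_tail (fun i => l2_norm_ge0 (F i)) hC e0.
exists s0 => s us ss; apply: l2_norm_le; first exact: ltW.
(* The remainder is the sum of the family in which the terms of [s] are replaced with 0. *)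
apply: (coordinate_sum_bounded (F := fun i => if i \in s then 0 else F i)).
  move=> x; have fin (u : I -> R) :
      has_rsum (fun i => if i \in s then u i else 0) (\sum_(i <- s) u i).
    have := has_sum_fin (real_group_norm R) us (F := fun i => if i \in s then u i else 0).
    move=> /(_ _)/wrap[i /negPf ->//|].
    by congr has_sum; rewrite big_seq [RHS]big_seq; apply: eq_bigr => i ->.
  have hfin : has_csum (fun i => if i \in s then F i x else 0) (\sum_(i <- s) F i x).
    rewrite /has_csum Re_sum Im_sum; split.
      by apply: eq_has_sum (fin (fun i => complex.Re (F i x))) => i; case: ifP.
    by apply: eq_has_sum (fin (fun i => complex.Im (F i x))) => i; case: ifP.
  have := has_csumZD (-1) hfin (hS x).
  have -> : (L2 SP - \sum_(i <- s) F i) x = -1 * (\sum_(i <- s) F i x) + S x.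
    by rewrite mulN1r addrC -l2_sumE.
  congr has_csum; apply/funext => i; case: ifP => _ /=; last by rewrite mulr0 add0r.
  by rewrite mulN1r addNr.
move=> t ut; rewrite (bigID (fun i => i \in s)) /= big1 ?add0r; last first.
  by move=> i ->; rewrite l2_norm0.
rewrite -big_filter; apply: le_trans (h0 [seq i <- t | i \notin s] _ _); last first.
- by move=> i; rewrite mem_filter => /andP[+ _]; apply: contra => /ss.
- exact: filter_uniq.
by rewrite !big_filter; apply: ler_sum => i /negPf ->.
Qed.

End l2_completeness.

Section bounded_operators.
Variables (R : realType) (T : choiceType).
Local Notation H := (l2 R T).
Implicit Types (f g h : H) (x y : T) (A B : H -> H).

Lemma normc_group_norm : group_norm (@Normc.normc R).
Proof.
split; [by case=> a b; exact: sqrtr_ge0|exact: Normc.eq0_normc|exact: Normc.normc0|].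
by move=> u v; rewrite -(normcN v); exact: le_normcD.
Qed.

Lemma normcE2 (z : R[i]) : Normc.normc z = Num.sqrt (normsq z). Proof. by case: z. Qed.

Lemma delta_sumE (s : seq T) f y : uniq s ->
  (\sum_(x <- s) f x *: l2_delta R x) y = if y \in s then f y else 0.
Proof.
move=> us; rewrite l2_sumE; case: ifP => ys.
  rewrite (bigD1_seq y)//= [X in X + _ = _](_ : _ = f y); last first.
    by rewrite -[LHS]/(f y * (y == y)%:R) eqxx mulr1.
  rewrite big1_seq ?addr0// => x /andP[xy _].
  by rewrite -[LHS]/(f x * (y == x)%:R) eq_sym (negPf xy) mulr0.
rewrite big1_seq// => x /andP[_ xs]; rewrite -[LHS]/(f x * (y == x)%:R).
by case: eqVneq => [e|_]; [rewrite e xs in ys|rewrite mulr0].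
Qed.

Lemma l2_delta_sum f : has_sum (@l2_norm R T) (fun x => f x *: l2_delta R x) f.
Proof.
move=> e e0; have e2 : 0 < e ^+ 2 by rewrite exprn_gt0.
have [s0 h0] := sum_tail (fun x => normsq_ge0 (f x)) (l2_sum_normsq f) e2.
exists s0 => s us ss; apply: l2_norm_le; first exact: ltW.
move=> t ut; rewrite (bigID (fun i => i \in s)) /= big1 ?add0r; last first.
  by move=> y ys; rewrite -[X in normsq X]/(f y - (\sum_(x <- s) f x *: l2_delta R x) y)
    delta_sumE// ys subrr normsq0.
rewrite -big_filter; apply: le_trans (h0 [seq i <- t | i \notin s] _ _); last first.
- by move=> i; rewrite mem_filter => /andP[+ _]; apply: contra => /ss.
- exact: filter_uniq.
rewrite !big_filter; apply: ler_sum => y /negPf ys.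
by rewrite -[X in normsq X]/(f y - (\sum_(x <- s) f x *: l2_delta R x) y)
  delta_sumE// ys subr0.
Qed.

Lemma linear_sub (V : lmodType R[i]) (A : H -> V) : linear A ->
  (forall u v, A (u - v) = A u - A v) /\ (forall c u, A (c *: u) = c *: A u).
Proof.
move=> lA; have A0 : A 0 = 0.
  have := lA 1 0 0; rewrite scaler0 addr0 scale1r => /eqP.
  by rewrite -subr_eq0 opprD addrA subrr sub0r oppr_eq0 => /eqP.
split=> [u v|c u]; last by have := lA c u 0; rewrite addr0 A0 addr0.
by have := lA (-1) v u; rewrite !scaleN1r => e; rewrite addrC e addrC.
Qed.

(** By [l2_delta_sum] and continuity, both values are the sum of the same series. *)
Lemma bounded_op_ext (V : lmodType R[i]) (nv : V -> R) (A B : H -> V) C D : group_norm nv ->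
  linear A -> linear B -> (forall f, nv (A f) <= C * l2_norm f) ->
  (forall f, nv (B f) <= D * l2_norm f) ->
  (forall x, A (l2_delta R x) = B (l2_delta R x)) -> A =1 B.
Proof.
move=> gn lA lB bA bB AB f.
have [A1 A2] := linear_sub lA; have [B1 B2] := linear_sub lB.
have hA := has_sum_map (l2_group_norm R T) A1 bA (l2_delta_sum f).
have hB := has_sum_map (l2_group_norm R T) B1 bB (l2_delta_sum f).
apply: (has_sum_unique gn hA); apply: eq_has_sum hB => x /=.
by rewrite A2 B2 AB.
Qed.

Lemma l2_dot_le f g : Normc.normc (l2_dot f g) <= l2_norm f * l2_norm g.
Proof.
rewrite normcE2 -(@ler_pXn2r _ 2) ?nnegrE ?mulr_ge0 ?l2_norm_ge0 ?sqrtr_ge0//.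
by rewrite sqr_sqrtr ?normsq_ge0// exprMn !sqr_l2_norm l2_cauchy_schwarz.
Qed.

Lemma l2_dot_inj f g : (forall h, l2_dot h f = l2_dot h g) -> f = g.
Proof.
move=> h; apply/val_inj/funext => x /=.
by rewrite -(l2_dot_delta f) -(l2_dot_delta g) l2_dotC [RHS]l2_dotC h.
Qed.

End bounded_operators.

(** * Hilbert-Schmidt operators as square-summable matrices *)

Section hilbert_schmidt.
Variables (R : realType) (T : choiceType).
Local Notation H := (l2 R T).
Local Notation V := (hs_op R T).
Implicit Types (f g h : H) (x y : T) (A B : V) (M : l2 R (T * T)%type).

Lemma hs_linear A : linear A. Proof. by have := hs_funP A; rewrite inE => -[]. Qed.

Lemma hs_bounded A : bounded_op A. Proof. by have := hs_funP A; rewrite inE => -[]. Qed.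

Lemma hs_ext A B : (forall x, A (l2_delta R x) = B (l2_delta R x)) -> A = B.
Proof.
move=> AB; have [C hC] := hs_bounded A; have [D hD] := hs_bounded B.
apply/val_inj/funext; apply: (bounded_op_ext (l2_group_norm R T)) hC hD AB.
  exact: hs_linear.
exact: hs_linear.
Qed.

Definition hs_entry (A : H -> H) (p : T * T) : R[i] := A (l2_delta R p.2) p.1.

Lemma hs_entry_esum (A : H -> H) :
  hs_esum A = (\esum_(p in setT) (normsq (hs_entry A p))%:E)%E.
Proof.
rewrite /hs_esum (eq_esum (b := fun x => \esum_(y in setT)
    (normsq (hs_entry A (y, x)))%:E)%E); last first.
  by move=> x _; rewrite sqr_l2_norm l2_normsqE.
rewrite (esum_esum (J := fun=> setT) (a := fun x y => (normsq (hs_entry A (y, x)))%:E)); last first.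
  by move=> *; rewrite lee_fin normsq_ge0.
rewrite (@reindex_esum _ _ _ (setT `*`` (fun=> setT)) setT (fun p => (p.2, p.1)))//.
split=> //.
- by move=> [? ?] [? ?] _ _ /= [-> ->].
- by move=> [x y] _; exists (y, x).
Qed.

Lemma hs_vec_proof A : hs_entry A \in @l2_pred R (T * T)%type.
Proof. by have := hs_funP A; rewrite !inE /= => -[_ _]; rewrite hs_entry_esum. Qed.

Definition hs_vec A : l2 R (T * T)%type := L2 (hs_vec_proof A).

Lemma hs_normE A : hs_norm A = l2_norm (hs_vec A).
Proof. by rewrite /hs_norm hs_entry_esum. Qed.

Lemma hs_vecB A B : hs_vec (A - B) = hs_vec A - hs_vec B.
Proof. exact/val_inj/funext. Qed.

Lemma hs_vecZ c A : hs_vec (c *: A) = c *: hs_vec A.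
Proof. exact/val_inj/funext. Qed.

Lemma hs_vec_inj A B : hs_vec A = hs_vec B -> A = B.
Proof.
move=> AB; apply: hs_ext => y; apply/val_inj/funext => x.
by have := congr1 (fun M => M (x, y)) AB.
Qed.

Lemma hs_group_norm : group_norm (@hs_norm R T).
Proof.
have gn := l2_group_norm R (T * T)%type; split.
- by move=> A; rewrite hs_normE l2_norm_ge0.
- move=> A; rewrite hs_normE => /(nrm_eq0 gn) A0; apply: hs_vec_inj; rewrite A0.
  exact/val_inj/funext.
- rewrite hs_normE (_ : hs_vec 0 = 0) ?l2_norm0//; exact/val_inj/funext.
- by move=> A B; rewrite !hs_normE hs_vecB; exact: nrmB gn _ _.
Qed.

Lemma mat_row_proof M x : (fun y => conjc (M (x, y))) \in @l2_pred R T.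
Proof.
apply/l2_memP; exists (l2_normsq M) => s us.
have := l2_sum_normsq M (s := [seq (x, y) | y <- s]).
rewrite map_inj_uniq ?us//; last by move=> ? ? [].
move=> /(_ isT); rewrite big_map; apply: le_trans; apply: ler_sum => y _.
by case: (M _) => a b; rewrite /normsq /= sqrrN.
Qed.

(** Rows are conjugated because [l2_dot] is conjugate-linear in its second argument; a matrix then
    acts by scalar products with its rows. *)
Definition mat_row M x : H := L2 (mat_row_proof M x).

Lemma mat_row_bounded M : sum_bounded (fun x => l2_normsq (mat_row M x)) (l2_normsq M).
Proof.
have h0 (p : T * T) : (0 <= (normsq (M p))%:E)%E by rewrite lee_fin normsq_ge0.
apply/esum_sum_bounded => [x|]; first exact: l2_normsq_ge0.
rewrite l2_normsqE (eq_esum (b := fun x => \esum_(y in setT) (normsq (M (x, y)))%:E)%E).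
  rewrite (esum_esum (J := fun=> setT) (a := fun x y => (normsq (M (x, y)))%:E))//.
  rewrite le_eqVlt; apply/orP; left; apply/eqP.
  rewrite (_ : _ `*`` _ = setT); last by apply/seteqP; split=> // -[].
  by apply: eq_esum => -[].
move=> x _; rewrite l2_normsqE; apply: eq_esum => y _ /=.
by case: (M _) => a b; rewrite /normsq /= sqrrN.
Qed.

Lemma mat_app_bounded M f :
  sum_bounded (fun x => normsq (l2_dot f (mat_row M x))) (l2_normsq f * l2_normsq M).
Proof.
apply: sum_bounded_le (_ : sum_bounded (fun x => l2_normsq f * l2_normsq (mat_row M x)) _).
  by move=> x; exact: l2_cauchy_schwarz.
by apply: sum_boundedZ (l2_normsq_ge0 f) _; exact: mat_row_bounded.
Qed.

Lemma mat_app_proof M f : (fun x => l2_dot f (mat_row M x)) \in @l2_pred R T.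
Proof. by apply/l2_memP; exists (l2_normsq f * l2_normsq M); exact: mat_app_bounded. Qed.

Definition mat_app M f : H := L2 (mat_app_proof M f).

Lemma mat_app_norm M f : l2_norm (mat_app M f) <= l2_norm M * l2_norm f.
Proof.
rewrite mulrC; apply: l2_norm_le; first by rewrite mulr_ge0 ?l2_norm_ge0.
by rewrite exprMn !sqr_l2_norm; exact: mat_app_bounded.
Qed.

Lemma mat_app_linear M : linear (mat_app M).
Proof. by move=> c f g; apply/val_inj/funext => x /=; rewrite l2_dotZDl. Qed.

Lemma mat_app_delta M x y : mat_app M (l2_delta R y) x = M (x, y).
Proof. by rewrite /= l2_dotC l2_dot_delta /= conjcK. Qed.

Lemma hs_of_proof M : mat_app M \in @hs_pred R T.
Proof.
rewrite inE; split; first exact: mat_app_linear.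
  by exists (l2_norm M) => f; exact: mat_app_norm.
rewrite hs_entry_esum; have := l2_funP M; rewrite inE /=.
by congr (_ < _)%E; apply: eq_esum => -[x y] _; rewrite /hs_entry mat_app_delta.
Qed.

Definition hs_of M : V := HSOp (hs_of_proof M).

Lemma hs_ofK M : hs_vec (hs_of M) = M.
Proof. by apply/val_inj/funext => -[x y]; exact: mat_app_delta. Qed.

Lemma hs_vecK A : hs_of (hs_vec A) = A. Proof. by apply: hs_vec_inj; rewrite hs_ofK. Qed.

Lemma hs_norm_app A f : l2_norm (A f) <= hs_norm A * l2_norm f.
Proof. by rewrite -{1}(hs_vecK A) hs_normE; exact: mat_app_norm. Qed.

Lemma hs_complete (I : choiceType) (F : I -> V) C :
  sum_bounded (fun i => hs_norm (F i)) C -> exists S, has_sum (@hs_norm R T) F S.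
Proof.
move=> hC; have [M hM] : exists M, has_sum (@l2_norm R (T * T)%type) (hs_vec \o F) M.
  by apply: (@l2_complete _ _ _ _ C); apply: sum_bounded_le hC => i; rewrite hs_normE.
exists (hs_of M) => e e0; have [s0 h0] := hM e e0; exists s0 => s us ss.
rewrite hs_normE hs_vecB hs_ofK.
have [_ _ ->] := subr_morph hs_vecB; exact: h0.
Qed.

Lemma hs_mul_proof A B : (A : H -> H) \o B \in @hs_pred R T.
Proof.
rewrite inE; split.
- by move=> c f g /=; rewrite hs_linear hs_linear.
- have [D hD] := hs_bounded B; exists (hs_norm A * D) => f /=.
  by apply: le_trans (hs_norm_app _ _) _; rewrite -mulrA ler_wpM2l// (nrm_ge0 hs_group_norm).
- have := hs_funP B; rewrite inE => -[_ _ hB].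
  apply: (@le_lt_trans _ _ (\esum_(x in setT) ((hs_norm A ^+ 2)%:E *
      (l2_norm (B (l2_delta R x)) ^+ 2)%:E))%E).
    apply: le_esum => x _; rewrite -EFinM lee_fin -exprMn.
    by apply: sqr_le; [exact: l2_norm_ge0|exact: hs_norm_app].
  by apply: esumZ_lty => //; rewrite ?sqr_ge0// => x; rewrite lee_fin sqr_ge0.
Qed.

Definition hs_mul A B : V := HSOp (hs_mul_proof A B).

Lemma hs_entry_bounded A C : 0 <= C ->
  sum_bounded (fun x => l2_norm (A (l2_delta R x)) ^+ 2) (C ^+ 2) <-> hs_norm A <= C.
Proof.
move=> C0; rewrite -esum_sum_bounded => [|x]; last exact: sqr_ge0.
rewrite -/(hs_esum A) hs_entry_esum hs_normE -(@ler_pXn2r _ 2) ?nnegrE ?l2_norm_ge0//.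
by rewrite sqr_l2_norm -lee_fin l2_normsqE; split.
Qed.

Lemma hs_norm_mul A B : hs_norm (hs_mul A B) <= hs_norm A * hs_norm B.
Proof.
have A0 := nrm_ge0 hs_group_norm A; have B0 := nrm_ge0 hs_group_norm B.
apply/hs_entry_bounded; first exact: mulr_ge0.
rewrite exprMn; apply: sum_bounded_le (_ : sum_bounded
  (fun x => hs_norm A ^+ 2 * l2_norm (B (l2_delta R x)) ^+ 2) _).
  move=> x; rewrite -exprMn; apply: sqr_le; first exact: l2_norm_ge0.
  exact: (hs_norm_app A (B (l2_delta R x))).
by apply: sum_boundedZ; [exact: sqr_ge0|exact/hs_entry_bounded].
Qed.

Lemma hs_mulBl A B D : hs_mul (A - B) D = hs_mul A D - hs_mul B D.
Proof. exact/val_inj/funext. Qed.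

Lemma hs_mulBr A B D : hs_mul D (A - B) = hs_mul D A - hs_mul D B.
Proof.
apply/val_inj/funext => f /=; have [h _] := linear_sub (@hs_linear D).
exact: (h (A f) (B f)).
Qed.

Lemma hs_mulZl c A B : hs_mul (c *: A) B = c *: hs_mul A B.
Proof. exact/val_inj/funext. Qed.

Lemma hs_mulZr c A B : hs_mul A (c *: B) = c *: hs_mul A B.
Proof.
apply/val_inj/funext => f /=; have [_ h] := linear_sub (@hs_linear A).
exact: (h c (B f)).
Qed.

Lemma hs_mulA A B D : hs_mul A (hs_mul B D) = hs_mul (hs_mul A B) D.
Proof. exact/val_inj/funext. Qed.

Lemma star_vec_proof A :
  (fun p : T * T => conjc (hs_entry A (p.2, p.1))) \in @l2_pred R (T * T)%type.
Proof.
apply/l2_memP; have /l2_memP[C hC] := hs_vec_proof A; exists C.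
apply: sum_bounded_le (sum_bounded_inj (h := fun p : T * T => (p.2, p.1)) _ hC).
  by move=> p /=; case: (hs_entry A _) => a b; rewrite /normsq /= sqrrN.
by move=> [? ?] [? ?] /= [-> ->].
Qed.

Lemma mat_row_star A x : mat_row (L2 (star_vec_proof A)) x = A (l2_delta R x).
Proof.
apply/val_inj/funext => y.
by rewrite -[LHS]/(conjc (conjc (A (l2_delta R x) y))) conjcK.
Qed.

Definition hs_star A : V := hs_of (L2 (star_vec_proof A)).

Lemma hs_adjoint A f g : l2_dot (A f) g = l2_dot f (hs_star A g).
Proof.
have gn := @normc_group_norm R.
have A0 := nrm_ge0 hs_group_norm A; have S0 := nrm_ge0 hs_group_norm (hs_star A).
apply: (@bounded_op_ext R T (R[i]^o) (@Normc.normc R) (fun f => l2_dot (A f) g)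
  (fun f => l2_dot f (hs_star A g)) (hs_norm A * l2_norm g) (hs_norm (hs_star A) * l2_norm g)) => //.
- by move=> c u v; rewrite hs_linear l2_dotZDl.
- by move=> c u v; rewrite l2_dotZDl.
- move=> u; apply: le_trans (l2_dot_le _ _) _.
  by rewrite mulrAC ler_wpM2r ?l2_norm_ge0// hs_norm_app.
- move=> u; apply: le_trans (l2_dot_le _ _) _.
  by rewrite mulrC ler_wpM2r ?l2_norm_ge0// hs_norm_app.
- move=> x /=; rewrite (l2_dotC (hs_star A g)) l2_dot_delta.
  rewrite -[hs_star A g x]/(l2_dot g (mat_row (L2 (star_vec_proof A)) x)) -l2_dotC.
  by rewrite mat_row_star.
Qed.

Lemma hs_star_unique A B : adjoint_ops A B -> hs_star A = B.
Proof.
move=> AB; apply/val_inj/funext => g; apply: l2_dot_inj => f.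
by rewrite -hs_adjoint AB.
Qed.

Lemma hs_starK A : hs_star (hs_star A) = A.
Proof.
by apply: hs_star_unique => f g; rewrite l2_dotC -hs_adjoint -l2_dotC.
Qed.

Lemma hs_star_mul A B : hs_star (hs_mul A B) = hs_mul (hs_star B) (hs_star A).
Proof. by apply: hs_star_unique => f g /=; rewrite !hs_adjoint. Qed.

Lemma hs_starB A B : hs_star (A - B) = hs_star A - hs_star B.
Proof.
apply: hs_star_unique => f g; rewrite -[(A - B) f]/(A f - B f).
by rewrite l2_dotBl !hs_adjoint -l2_dotBr.
Qed.

Lemma hs_starZ (r : R) A : hs_star (r%:C%C *: A) = r%:C%C *: hs_star A.
Proof.
apply: hs_star_unique => f g; rewrite -[(_ *: A) f]/(r%:C%C *: A f).
by rewrite l2_dotZl hs_adjoint -[(_ *: hs_star A) g]/(r%:C%C *: hs_star A g) l2_dotZr conjc_real.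
Qed.

Lemma hs_norm_star A : hs_norm (hs_star A) = hs_norm A.
Proof.
suff le B : hs_norm (hs_star B) <= hs_norm B.
  by apply/le_anti; rewrite le/= -{1}(hs_starK A) le.
rewrite !hs_normE hs_ofK; apply: l2_norm_le; first exact: l2_norm_ge0.
rewrite sqr_l2_norm; have := l2_sum_normsq (hs_vec B) => hC.
apply: sum_bounded_le (sum_bounded_inj (h := fun p : T * T => (p.2, p.1)) _ hC).
  by move=> p /=; case: (hs_entry B _) => a b; rewrite /normsq /= sqrrN.
by move=> [? ?] [? ?] /= [-> ->].
Qed.

Lemma hs_normZ (r : R) A : hs_norm (r%:C%C *: A) = `|r| * hs_norm A.
Proof.
by rewrite !hs_normE hs_vecZ l2_normZ /normsq /= expr0n addr0 sqrtr_sqr.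
Qed.

End hilbert_schmidt.

(** * Formal deformations *)

(** Operators and series of operators are both instances. There is no unit, as the identity of an
    infinite-dimensional space is not Hilbert-Schmidt; [circ] makes up for it. *)
Record star_ring (G : groupType) (W : zmodType) (mul : W -> W -> W) (star : W -> W)
    (gact : G -> W -> W) : Prop := StarRing {
  smulBl : forall u v w, mul (u - v) w = mul u w - mul v w ;
  smulBr : forall u v w, mul w (u - v) = mul w u - mul w v ;
  smulA : forall u v w, mul u (mul v w) = mul (mul u v) w ;
  starB : forall u v, star (u - v) = star u - star v ;
  starM : forall u v, star (mul u v) = mul (star v) (star u) ;
  starK : forall u, star (star u) = u ;
  sactB : forall g u v, gact g (u - v) = gact g u - gact g v ;
  sact_mul : forall g u v, gact g (mul u v) = mul (gact g u) (gact g v) ;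
  sact_star : forall g u, gact g (star u) = star (gact g u) ;
  sactM : forall g h u, gact (g * h)%g u = gact g (gact h u)
}.

(* The law of [1 + a], so that [circ a b = (1 + a) (1 + b) - 1]. *)
Definition circ (W : zmodType) (mul : W -> W -> W) (a b : W) : W := a + b + mul a b.

(* The defect of multiplicativity of the twisted map [1 + D]. *)
Definition curvature (G : groupType) (W : zmodType) (mul : W -> W -> W) (gact : G -> W -> W)
  (D : G -> W) (g h : G) : W := circ mul (D g) (gact g (D h)) - D (g * h)%g.

Definition unitary_defect (W : zmodType) (mul : W -> W -> W) (star : W -> W) (a : W) : W :=
  circ mul (star a) a.

Section star_rings.
Variables (G : groupType) (W : zmodType) (mul : W -> W -> W) (star : W -> W).
Variable gact : G -> W -> W.
Hypothesis sr : star_ring mul star gact.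
Implicit Types (a b c u v w : W) (g h k : G).
Local Notation "a \o' b" := (circ mul a b) (at level 40, left associativity).

Lemma smul0l w : mul 0 w = 0.
Proof. by have [-> _ _] := subr_morph (fun u v => smulBl sr u v w). Qed.

Lemma smul0r w : mul w 0 = 0.
Proof. by have [-> _ _] := subr_morph (fun u v => smulBr sr u v w). Qed.

Lemma smulDl u v w : mul (u + v) w = mul u w + mul v w.
Proof. by have [_ -> _] := subr_morph (fun u v => smulBl sr u v w). Qed.

Lemma smulDr u v w : mul w (u + v) = mul w u + mul w v.
Proof. by have [_ -> _] := subr_morph (fun u v => smulBr sr u v w). Qed.

Lemma starD u v : star (u + v) = star u + star v.
Proof. by have [_ -> _] := subr_morph (starB sr). Qed.

Lemma star0 : star 0 = 0.
Proof. by have [-> _ _] := subr_morph (starB sr). Qed.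

Lemma sactD g u v : gact g (u + v) = gact g u + gact g v.
Proof. by have [_ -> _] := subr_morph (sactB sr g). Qed.

Lemma sact0 g : gact g 0 = 0.
Proof. by have [-> _ _] := subr_morph (sactB sr g). Qed.

Lemma sactN g u : gact g (- u) = - gact g u.
Proof. by rewrite -[- u]sub0r (sactB sr) sact0 sub0r. Qed.

Lemma circA a b c : a \o' (b \o' c) = a \o' b \o' c.
Proof.
rewrite /circ !(smulDl, smulDr) (smulA sr) !addrA.
by rewrite [RHS](ACl (1*2*4*6*3*5*7)).
Qed.

Lemma circ0l a : 0 \o' a = a. Proof. by rewrite /circ smul0l addr0 add0r. Qed.

Lemma circBr a b c : a \o' b - a \o' c = (b - c) + mul a (b - c).
Proof. by rewrite /circ (smulBr sr) opprD addrACA; congr (_ + _); rewrite opprD addrACA subrr add0r. Qed.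

Lemma circBl a b c : b \o' a - c \o' a = (b - c) + mul (b - c) a.
Proof. by rewrite /circ (smulBl sr) opprD addrACA; congr (_ + _); rewrite opprD addrACA subrr addr0. Qed.

Lemma star_circ a b : star (a \o' b) = star b \o' star a.
Proof. by rewrite /circ !starD (starM sr) (addrC (star a)). Qed.

Lemma sact_circ g a b : gact g (a \o' b) = gact g a \o' gact g b.
Proof. by rewrite /circ !sactD (sact_mul sr). Qed.

(** Associativity of [circ] on three factors. In the lowest degree where the curvature survives, its
    products with [D] disappear and it becomes a 2-cocycle. *)
Lemma bianchi (D : G -> W) g h k : let K := curvature mul gact D in
  (gact g (K h k) + mul (D g) (gact g (K h k))) + K g (h * k)%g =
  (K g h + mul (K g h) (gact (g * h)%g (D k))) + K (g * h)%g k.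
Proof.
rewrite /= /curvature !(sactB sr) sact_circ -(sactM sr) -circBr -circBl.
by rewrite -!mulgA !subrKA circA.
Qed.

Lemma star_unitary_defect a : star (unitary_defect mul star a) = unitary_defect mul star a.
Proof. by rewrite /unitary_defect star_circ (starK sr). Qed.

(** Regrouping [star b \o' (star a \o' a) \o' b] around the defect of [a] shows that the defect is
    additive up to products. *)
Lemma unitary_defect_circ a b : let u := unitary_defect mul star a in
  let d := u + mul u b in
  unitary_defect mul star (a \o' b) = unitary_defect mul star b + (d + mul (star b) d).
Proof.
rewrite /= /unitary_defect star_circ -circA (circA (star a)); set u := star a \o' a.
have -> : u + mul u b = u \o' b - 0 \o' b by rewrite circBl subr0.
by rewrite circ0l -circBr addrCA subrr addr0.
Qed.

End star_rings.

(** * Power series in non-commuting variables *)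

Section series.
Variables (n : nat) (G : groupType) (V : zmodType) (mul : V -> V -> V) (star : V -> V).
Variable gact : G -> V -> V.
Hypothesis sr : star_ring mul star gact.
Local Notation word := (seq 'I_n).
Local Notation series := (word -> V).
Implicit Types (A B C : series) (s w : word) (i : 'I_n) (g h : G).

(* Functions on words are power series in non-commuting variables; the involution reverses
   words. The parameters of the deformation commute, so the words of a given content are
   added up in the end. *)
Fixpoint splits (s : word) : seq (word * word) :=
  ([::], s) :: if s is i :: s' then [seq (i :: p.1, p.2) | p <- splits s'] else [::].

Definition word_conv A B : series := fun s => \sum_(p <- splits s) mul (A p.1) (B p.2).

Definition series_star A : series := fun s => star (A (rev s)).

Definition series_act g A : series := fun s => gact g (A s).

Lemma conv_nil A B : word_conv A B [::] = mul (A [::]) (B [::]).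
Proof. by rewrite /word_conv big_seq1. Qed.

Lemma conv_cons A B i s :
  word_conv A B (i :: s) = mul (A [::]) (B (i :: s)) + word_conv (fun w => A (i :: w)) B s.
Proof. by rewrite /word_conv big_cons big_map. Qed.

Lemma conv_rcons A B i s :
  word_conv A B (rcons s i) = word_conv A (fun w => B (rcons w i)) s + mul (A (rcons s i)) (B [::]).
Proof.
elim: s A => [|j s IH] A /=; first by rewrite conv_cons !conv_nil.
by rewrite !conv_cons IH addrA.
Qed.

Lemma mem_splits s p : (p \in splits s) = (p.1 ++ p.2 == s).
Proof.
elim: s p => [|i s IH] [w w'] /=; first by rewrite inE; case: w => [|? ?]; case: w'.
rewrite inE; case: w => [|j w] /=.
  rewrite xpair_eqE eqxx /= orb_idr// => /mapP[q _ [e _]]; discriminate e.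
rewrite eqseq_cons; apply/mapP/andP => [[q qs [-> -> ->]]|[/eqP -> h]].
  by rewrite eqxx -IH; split=> //; case: (q) qs.
by exists (w, w') => //; rewrite IH.
Qed.

Lemma splits_uniq s : uniq (splits s).
Proof.
elim: s => [//|i s IH] /=; rewrite map_inj_uniq ?IH ?andbT.
  by apply/mapP => -[q _ [e _]]; discriminate e.
by move=> [? ?] [? ?] /= [-> ->].
Qed.

Lemma convBl A B C : word_conv (A - B) C = word_conv A C - word_conv B C.
Proof.
apply/funext => s; rewrite -[RHS]/(word_conv A C s - word_conv B C s) /word_conv -sumrB.
by apply: eq_bigr => p _; rewrite -(smulBl sr).
Qed.

Lemma convBr A B C : word_conv C (A - B) = word_conv C A - word_conv C B.
Proof.
apply/funext => s; rewrite -[RHS]/(word_conv C A s - word_conv C B s) /word_conv -sumrB.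
by apply: eq_bigr => p _; rewrite -(smulBr sr).
Qed.

Lemma convA A B C : word_conv A (word_conv B C) = word_conv (word_conv A B) C.
Proof.
apply/funext => s; elim: s A B => [|i s IH] A B; first by rewrite !conv_nil (smulA sr).
rewrite !conv_cons (smulDr sr) -addrA (smulA sr) conv_nil; congr (_ + _).
rewrite IH; have -> : (fun w => word_conv A B (i :: w)) =
    (fun w => mul (A [::]) (B (i :: w))) + word_conv (fun w => A (i :: w)) B.
  by apply/funext => w; rewrite conv_cons.
have -> : word_conv ((fun w => mul (A [::]) (B (i :: w))) + word_conv (fun w => A (i :: w)) B) C s =
    word_conv (fun w => mul (A [::]) (B (i :: w))) C s + word_conv (word_conv (fun w => A (i :: w)) B) C s.
  rewrite /word_conv -big_split; apply: eq_bigr => p _; exact: (smulDl sr).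
congr (_ + _); rewrite /word_conv; have [_ _ ->] := subr_morph (fun u v => smulBr sr u v (A [::])).
by apply: eq_bigr => p _; rewrite (smulA sr).
Qed.

Lemma conv_star A B : series_star (word_conv A B) = word_conv (series_star B) (series_star A).
Proof.
apply/funext => s; elim: s A B => [|i s IH] A B.
  by rewrite /series_star /= !conv_nil (starM sr).
rewrite [LHS]/series_star rev_cons conv_rcons conv_cons (starD sr) (starM sr) addrC.
congr (_ + _); first by rewrite /series_star rev_cons.
rewrite -[LHS]/(series_star (word_conv A (fun w => B (rcons w i))) s) IH.
by congr (word_conv _ _ s); apply/funext => w; rewrite /series_star rev_cons.
Qed.

Lemma series_star_ring : star_ring word_conv series_star series_act.
Proof.
split; [exact: convBl|exact: convBr|exact: convA| |exact: conv_star| | | | |].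
- by move=> A B; apply/funext => s; exact: (starB sr).
- by move=> A; apply/funext => s; rewrite /series_star revK (starK sr).
- by move=> g A B; apply/funext => s; exact: (sactB sr).
- move=> g A B; apply/funext => s; rewrite /series_act /word_conv.
  have [_ _ ->] := subr_morph (sactB sr g); apply: eq_bigr => p _; exact: (sact_mul sr).
- by move=> g A; apply/funext => s; exact: (sact_star sr).
- by move=> g h A; apply/funext => s; exact: (sactM sr).
Qed.

(** Order at least [m], as a power series. *)
Definition below m A := forall s, (size s < m)%N -> A s = 0.

Lemma conv_below p q A B : below p A -> below q B -> below (p + q) (word_conv A B).
Proof.
move=> hA hB s sz; rewrite /word_conv big_seq big1// => -[w w'].
rewrite mem_splits /= => /eqP e; move: sz; rewrite -e size_cat => sz.
have [wp|wp] := ltnP (size w) p; first by rewrite hA// (smul0l sr).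
have wq : (size w' < q)%N by move: (size w) (size w') sz wp => a b; lia.
by rewrite hB// (smul0r sr).
Qed.

Definition agree m A B := forall s, (size s <= m)%N -> A s = B s.

Lemma conv_agree m A A' B B' : agree m A A' -> agree m B B' -> agree m (word_conv A B) (word_conv A' B').
Proof.
move=> hA hB s sz; rewrite /word_conv big_seq [RHS]big_seq; apply: eq_bigr => -[w w'].
rewrite mem_splits /= => /eqP e; move: sz; rewrite -e size_cat => sz.
by rewrite hA ?hB//; move: sz; lia.
Qed.

(** Without constant terms, only factors of length at most [m] contribute in degree [m + 1]. The
    quadratic terms of a new degree are thus already known, which makes the recursion possible. *)
Lemma conv_agreeS m A A' B B' : below 1 A -> below 1 A' -> below 1 B -> below 1 B' ->
  agree m A A' -> agree m B B' -> agree m.+1 (word_conv A B) (word_conv A' B').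
Proof.
move=> a1 a1' b1 b1' hA hB s sz; rewrite /word_conv big_seq [RHS]big_seq; apply: eq_bigr => -[w w'].
rewrite mem_splits /= => /eqP e; move: sz; rewrite -e size_cat => sz.
case: w sz {e} => [|i w] sz; first by rewrite a1// a1'// !(smul0l sr).
case: w' sz => [|j w'] sz; first by rewrite b1// b1'// !(smul0r sr).
by rewrite hA ?hB//; move: sz => /=; lia.
Qed.

Lemma act_agree m g A B : agree m A B -> agree m (series_act g A) (series_act g B).
Proof. by move=> h s sz; rewrite /series_act h. Qed.

Lemma star_agree m A B : agree m A B -> agree m (series_star A) (series_star B).
Proof. by move=> h s sz; rewrite /series_star h ?size_rev. Qed.

Lemma act_below m g A : below m A -> below m (series_act g A).
Proof. by move=> h s sz; rewrite /series_act h// (sact0 sr). Qed.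

Lemma star_below m A : below m A -> below m (series_star A).
Proof. by move=> h s sz; rewrite /series_star h ?size_rev// (star0 sr). Qed.

End series.

(** * Construction of the deformation degree by degree *)

Section recursion.
Variables (n : nat) (R : realType) (G : groupType) (V : lmodType R[i]).
Variables (mul : V -> V -> V) (star : V -> V) (gact : G -> V -> V).
Hypothesis sr : star_ring mul star gact.
Hypothesis starZ : forall (r : R) u, star (r%:C%C *: u) = r%:C%C *: star u.
Hypothesis sactZ : forall g (r : R) u, gact g (r%:C%C *: u) = r%:C%C *: gact g u.
Local Notation word := (seq 'I_n).
Local Notation series := (word -> V).
Implicit Types (A B : series) (D E : G -> series) (s w : word) (i : 'I_n) (g h k : G).

Let ssr := series_star_ring n sr.
Local Notation cv := (word_conv mul).
Local Notation sst := (series_star star).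
Local Notation sac := (series_act gact).
Local Notation curv := (curvature cv sac).
Local Notation udef := (unitary_defect cv sst).

Definition cocycle2 (Z : G -> G -> V) := forall g h k,
  gact g (Z h k) + Z g (h * k)%g = Z g h + Z (g * h)%g k.

Lemma addfE A B s : (A + B) s = A s + B s. Proof. by []. Qed.

Lemma circE A B s : circ cv A B s = A s + B s + cv A B s. Proof. by []. Qed.

Lemma circ_agree m A A' B B' : agree m A A' -> agree m B B' ->
  agree m (circ cv A B) (circ cv A' B').
Proof. by move=> hA hB s sz; rewrite !circE hA// hB// (conv_agree mul hA hB). Qed.

Lemma udef_agree m A B : agree m A B -> agree m (udef A) (udef B).
Proof. by move=> h; apply: circ_agree => //; exact: star_agree. Qed.

Lemma udef_act g A : udef (sac g A) = sac g (udef A).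
Proof. by rewrite /unitary_defect (sact_circ ssr) (sact_star ssr). Qed.

Definition ext N A B : series := fun s => if size s == N.+1 then B s else A s.

Lemma ext_agree N A B : agree N (ext N A B) A.
Proof. by move=> s sN; rewrite /ext ltn_eqF// ltnS. Qed.

Lemma ext_below N A B : (0 < N)%N -> below 1 A -> below 1 (ext N A B).
Proof.
by move=> N0 h s; rewrite ltnS leqn0 => /eqP e; rewrite (@ext_agree N A B) ?e// h ?e.
Qed.

Definition vanish_above N A := forall s, (N < size s)%N -> A s = 0.

(** The coefficients above degree [N] are 0, so that the curvature in degree [N + 1] is purely
    quadratic: it is the obstruction. *)
Record deformation N D : Prop := Deformation {
  def_below : forall g, below 1 (D g) ;
  def_above : forall g, vanish_above N (D g) ;
  def_curv : forall g h s, (size s <= N)%N -> curv D g h s = 0 ;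
  def_unit : forall g s, (size s <= N)%N -> udef (D g) s = 0
}.

Lemma curvE D g h s :
  curv D g h s = D g s + gact g (D h s) + cv (D g) (sac g (D h)) s - D (g * h)%g s.
Proof. by []. Qed.

Lemma udefE A s : udef A s = star (A (rev s)) + A s + cv (sst A) A s. Proof. by []. Qed.

Section extension.
Variables (N : nat) (D E : G -> series).
Hypotheses (N0 : (0 < N)%N) (hD : deformation N D).
Let D' g := ext N (D g) (E g).

Lemma ext_curv g h s : (size s <= N)%N -> curv D' g h s = 0.
Proof.
move=> sN; rewrite -[RHS](def_curv hD g h sN) !curvE.
rewrite /D' !(@ext_agree N _ _ s sN); congr (_ + _ - _); apply: (conv_agree mul _ _ (leqnn _)).
  by move=> t st; apply: ext_agree (leq_trans st sN).
by move=> t st; rewrite /series_act (@ext_agree N)// (leq_trans st).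
Qed.

Lemma top_curv g h s : size s = N.+1 ->
  curv D' g h s = E g s + gact g (E h s) + curv D g h s - E (g * h)%g s.
Proof.
move=> sN; have ab x : D x s = 0 by rewrite (def_above hD)// sN.
rewrite !curvE !ab (sact0 sr) addr0 add0r subr0 /D' /ext sN eqxx; congr (_ + _ - _).
have bl x := def_below hD x; have b' x := ext_below (E x) N0 (bl x).
have ag x := @ext_agree N (D x) (E x).
apply: (conv_agreeS sr _ _ _ _ _ _ (eq_leq sN)).
- exact: b'.
- exact: bl.
- exact: (act_below sr g (b' h)).
- exact: (act_below sr g (bl h)).
- exact: ag.
- exact: act_agree (ag h).
Qed.

Lemma ext_udef g s : (size s <= N)%N -> udef (D' g) s = 0.
Proof.
by move=> sN; rewrite (udef_agree (@ext_agree N (D g) (E g)) sN) (def_unit hD).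
Qed.

Lemma top_udef g s : size s = N.+1 ->
  udef (D' g) s = star (E g (rev s)) + E g s + cv (sst (D g)) (D g) s.
Proof.
move=> sN; rewrite udefE /D' {1 2}/ext size_rev sN eqxx; congr (_ + _).
have bl x := def_below hD x; have b' x := ext_below (E x) N0 (bl x).
have ag x := @ext_agree N (D x) (E x).
apply: (conv_agreeS sr _ _ _ _ _ _ (eq_leq sN)).
- exact: (star_below sr (b' g)).
- exact: (star_below sr (bl g)).
- exact: b'.
- exact: bl.
- exact: star_agree (ag g).
- exact: ag.
Qed.

End extension.

Variable solve : (G -> G -> V) -> G -> V.
Hypothesis solveP : forall Z, cocycle2 Z -> forall g h,
  gact g (solve Z h) + solve Z g = Z g h + solve Z (g * h)%g.

Definition raw D g : series := fun s => solve (fun a b => - curv D a b s) g.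

Definition half (v : V) : V := (2^-1)%:C%C *: v.

Lemma halfD v : half v + half v = v.
Proof.
rewrite /half -scalerDl -[RHS]scale1r; congr (_ *: _).
by apply/eqP; rewrite eq_complex /= addr0 eqxx andbT; apply/eqP; lra.
Qed.

(* Subtracting half of the defect of unitarity does not spoil multiplicativity, since that defect
   is invariant under the twisted action in degree [N + 1]. *)
Definition corrected N D g : series :=
  fun s => raw D g s - half (udef (ext N (D g) (raw D g)) s).

Definition next N D g := ext N (D g) (corrected N D g).

Section step.
Variables (N : nat) (D : G -> series).
Hypotheses (N0 : (0 < N)%N) (hD : deformation N D).
Let D1 g := ext N (D g) (raw D g).

(** The Bianchi identity in degree [N + 1], where the products of [D] with the curvature vanish
    since they have order [N + 2]. *)
Lemma curv_cocycle2 s : size s = N.+1 -> cocycle2 (fun a b => - curv D a b s).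
Proof.
move=> sN g h k; have b := congr1 (fun A => A s) (bianchi ssr D g h k).
have K0 a c : below N.+1 (curv D a c) by move=> t; rewrite ltnS; exact: (def_curv hD).
move: b; rewrite !addfE.
have -> : cv (D g) (sac g (curv D h k)) s = 0.
  apply: (conv_below sr (def_below hD g) (act_below sr g (K0 h k))).
  by rewrite sN.
have -> : cv (curv D g h) (sac (g * h)%g (D k)) s = 0.
  apply: (conv_below sr (K0 g h) (act_below sr (g * h)%g (def_below hD k))).
  by rewrite sN addn1.
rewrite !addr0 => b; rewrite (sactN sr) -!opprD; congr (- _).
exact: b.
Qed.

Lemma raw_curv g h s : (size s <= N.+1)%N -> curv D1 g h s = 0.
Proof.
rewrite leq_eqVlt => /orP[/eqP sN|sN]; last exact: ext_curv.
rewrite (top_curv _ N0 hD)//; have := solveP (curv_cocycle2 sN) g h.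
rewrite -/(raw D h s) -/(raw D g s) -/(raw D (g * h)%g s) (addrC (raw D g s)) => ->.
by rewrite addrAC addrK addNr.
Qed.

(** In degree [N + 1] the defect is an additive 1-cocycle, so a multiple of it can be subtracted
    from [raw] without changing the curvature. *)
Lemma raw_udef g h s : size s = N.+1 ->
  udef (D1 (g * h)%g) s = gact g (udef (D1 h) s) + udef (D1 g) s.
Proof.
move=> sN; have b1 x : below 1 (D1 x) by exact: ext_below (def_below hD x).
have ag : agree N.+1 (D1 (g * h)%g) (circ cv (D1 g) (sac g (D1 h))).
  by move=> t tN; apply/eqP; rewrite eq_sym -subr_eq0; apply/eqP; exact: raw_curv.
rewrite (udef_agree ag) ?sN// (unitary_defect_circ ssr) udef_act addfE.
congr (_ + _); rewrite -/(udef _).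
have u0 : below N.+1 (udef (D1 g)) by move=> t; rewrite ltnS; exact: ext_udef.
have ab := act_below sr g (b1 h).
set d := udef _ + _; have d0 : below N.+1 d.
  move=> t tN; rewrite /d addfE u0// add0r.
  by apply: (conv_below sr u0 ab); rewrite addn1 (leq_trans tN).
rewrite addfE (conv_below sr (star_below sr ab) d0) ?sN// addr0 /d addfE.
by rewrite (conv_below sr u0 ab) ?addr0// sN addn1.
Qed.

Lemma next_deformation : deformation N.+1 (next N D).
Proof.
have N1 := ltnW N0; split.
- by move=> g; exact: ext_below (def_below hD g).
- move=> g s sN; rewrite /next /ext gtn_eqF//.
  by apply: (def_above hD); exact: ltnW.
- move=> g h s; rewrite leq_eqVlt => /orP[/eqP sN|sN]; last exact: ext_curv.
  have := raw_curv g h (eq_leq sN); rewrite !(top_curv _ N0 hD)// /corrected.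
  rewrite -/(D1 g) -/(D1 h) -/(D1 (g * h)%g) (raw_udef g h sN) (sactB sr) sactZ.
  rewrite /half -!sactZ.
  move: (udef (D1 g) s) (udef (D1 h) s) (raw D (g * h)%g s) (raw D g s) (raw D h s).
  move=> u v d a b; rewrite scalerDr -sactZ; move: (gact g b) (curv D g h s) => {}b c e.
  move: (_ *: u) (gact g _) => p q.
  by rewrite opprB (addrACA a) -opprD (addrAC (a + b)) addrA (addrC q) subrK.
- move=> g s; rewrite leq_eqVlt => /orP[/eqP sN|sN]; last exact: ext_udef.
  (* The defect is self-adjoint, so removing half of it from the coefficient removes it entirely. *)
  have ss : star (udef (D1 g) (rev s)) = udef (D1 g) s.
    by rewrite -[RHS](congr1 (fun A => A s) (star_unitary_defect ssr (D1 g))).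
  rewrite (top_udef _ N0 hD)// /corrected -/(D1 g) (starB sr) starZ ss.
  have t := top_udef (raw D) N0 hD g sN; rewrite -/(D1 g) in t.
  rewrite -/(half _) addrACA -opprD halfD [LHS]addrAC -t; exact: subrr.
Qed.

End step.

Section limit.
Variable c : 'I_n -> G -> V.
Hypothesis c_cocycle : forall i g h, c i (g * h)%g = c i g + gact g (c i h).
Hypothesis c_skew : forall i g, star (c i g) = - c i g.

Definition first_order g : series := fun s => if s is [:: i] then c i g else 0.

Lemma first_order_deformation : deformation 1 first_order.
Proof.
have b1 g : below 1 (first_order g) by move=> [|? ?].
split=> //; first by move=> g [|? [|? ?]].
  move=> g h [|i [|? ?]] // _; rewrite curvE.
    by rewrite conv_nil /= (smul0l sr) (sact0 sr) !addr0 subrr.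
  rewrite (conv_below sr (b1 g) (act_below sr g (b1 h)))// addr0 /= c_cocycle.
  exact: subrr.
move=> g [|i [|? ?]] // _; rewrite udefE.
  by rewrite conv_nil /series_star /= (star0 sr) (smul0l sr) !addr0.
rewrite (conv_below sr (star_below sr (b1 g)) (b1 g))// addr0 /= c_skew.
exact: addNr.
Qed.

Fixpoint approx (k : nat) : G -> series :=
  if k is k'.+1 then next k'.+1 (approx k') else first_order.

Lemma approx_deformation (k : nat) : deformation k.+1 (approx k).
Proof.
elim: k => [|k IH]; first exact: first_order_deformation.
exact: next_deformation.
Qed.

(** [approx k] is final in degrees up to [k + 1]; the index [size s] is therefore large enough, also
    for the empty word. *)
Definition full g : series := fun s => approx (size s) g s.

Lemma approx_stable (k m : nat) g s : (size s <= k.+1)%N -> (k <= m)%N -> approx m g s = approx k g s.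
Proof.
move=> sk; elim: m => [|m IH]; first by rewrite leqn0 => /eqP ->.
rewrite leq_eqVlt => /orP[/eqP -> //|]; rewrite ltnS => km; rewrite -IH//.
by apply: ext_agree; exact: leq_trans sk _.
Qed.

Lemma approx_agree (k : nat) g : agree k.+1 (approx k g) (full g).
Proof.
move=> s; rewrite leq_eqVlt => /orP[/eqP sk|sk]; rewrite /full.
  by rewrite sk (@approx_stable k k.+1) ?sk.
by rewrite (@approx_stable (size s) k).
Qed.

Lemma full_below g : below 1 (full g).
Proof. by move=> s s1; apply: (def_below (approx_deformation _)). Qed.

Lemma full_first g i : full g [:: i] = c i g.
Proof. by rewrite -(@approx_agree 0). Qed.

Lemma full_curv g h : curv full g h = 0.
Proof.
apply/funext => s; rewrite -[RHS](def_curv (approx_deformation (size s)) g h (leqnSn _)).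
have ag x : agree (size s) (full x) (approx (size s) x).
  by move=> t ts; rewrite (@approx_agree (size s))// (leq_trans ts).
rewrite !curvE !ag//; congr (_ + _ - _); apply: (conv_agree mul _ _ (leqnn _)) => //.
exact: act_agree.
Qed.

Lemma full_unit g : udef (full g) = 0.
Proof.
apply/funext => s; rewrite -[RHS](def_unit (approx_deformation (size s)) g (leqnSn _)).
apply: udef_agree (leqnn _) => t ts.
by rewrite (@approx_agree (size s))// (leq_trans ts).
Qed.

Section bound.
Variable nrm : V -> R.
Hypothesis gn : group_norm nrm.
Hypothesis nrmZ : forall (r : R) u, nrm (r%:C%C *: u) = `|r| * nrm u.
Hypothesis nrm_star : forall u, nrm (star u) = nrm u.
Hypothesis solve_bound : forall g, exists2 K : R, 0 <= K & exists H : seq (G * G),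
  forall Z, cocycle2 Z -> nrm (solve Z g) <= K * \sum_(h <- H) nrm (Z h.1 h.2).

Definition quadratic (H : seq (G * G)) s : R :=
  \sum_(h <- H) nrm (cv (full h.1) (sac h.1 (full h.2)) s).

(** In degree at least 2, a coefficient is a primitive of a quadratic expression plus the unitary
    correction, which involves another one. [rev s] appears because the involution reverses words;
    [H] does not depend on [s]. *)
Lemma full_bound g : exists2 K : R, 0 <= K & exists H : seq (G * G),
  forall s, (2 <= size s)%N -> nrm (full g s) <=
  K * (quadratic H s + quadratic H (rev s)) + nrm (cv (sst (full g)) (full g) s).
Proof.
have [K K0 [H hK]] := solve_bound g; exists (2 * K); first by rewrite mulr_ge0.
exists H => s s2; set q := quadratic H; have [k sk] : exists k : nat, size s = k.+2.
  by case: (size s) s2 => [|[|k]] // _; exists k.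
have hD := approx_deformation k; set D := approx k in hD.
have fb x := full_below x; have ab x : below 1 (D x) by exact: (def_below hD).
have ag x : agree k.+1 (D x) (full x) by exact: approx_agree.
have fE t : size t = k.+2 -> full g t = corrected k.+1 D g t.
  by move=> tk; rewrite -(@approx_agree k.+1) ?tk// /approx -/approx /next /ext tk eqxx.
have rawK t : size t = k.+2 -> nrm (raw D g t) <= K * q t.
  move=> tk; have := hK _ (curv_cocycle2 hD tk); rewrite -/(raw D g t).
  move=> /le_trans; apply; rewrite ler_wpM2l//; apply: ler_sum => h _.
  rewrite nrmN//= curvE !(def_above hD) ?tk// (sact0 sr) subr0 !add0r.
  rewrite (conv_agreeS sr _ _ _ _ _ _ (eq_leq tk) (A' := full h.1) (B' := sac h.1 (full h.2))) //.
    exact: (act_below sr h.1 (ab h.2)).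
    exact: (act_below sr h.1 (fb h.2)).
  exact: act_agree.
have nh v : nrm (half v) <= 2^-1 * nrm v by rewrite /half nrmZ ger0_norm// invr_ge0.
rewrite fE// /corrected (top_udef _ _ hD)//.
apply: le_trans (nrmB gn _ _) _; apply: le_trans (lerD (lexx _) (nh _)) _.
have e : cv (sst (D g)) (D g) s = cv (sst (full g)) (full g) s.
  apply: (conv_agreeS sr _ _ _ _ _ _ (eq_leq sk)) => //.
  - exact: (star_below sr (ab g)).
  - exact: (star_below sr (fb g)).
  - exact: star_agree.
have t1 := nrmD gn (star (raw D g (rev s)) + raw D g s) (cv (sst (D g)) (D g) s).
have t2 := nrmD gn (star (raw D g (rev s))) (raw D g s).
have := rawK s sk; have := rawK (rev s); rewrite size_rev sk => /(_ erefl).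
move: t1 t2; rewrite nrm_star e mulrDr -!(mulrA 2 K).
have q0 t : 0 <= K * q t by rewrite mulr_ge0// sumr_ge0// => h _; exact: (nrm_ge0 gn).
have := q0 s; have := q0 (rev s); have := nrm_ge0 gn (cv (sst (full g)) (full g) s).
move: (nrm (raw D g s)) (nrm (raw D g (rev s))) (nrm (cv _ _ _)) (nrm (_ + _)).
move: (nrm (_ + _ + _)) (K * q s) (K * q (rev s)) => *; lra.
Qed.

End bound.

End limit.

End recursion.

(** * Convergence of the formal deformation *)

Section words.
Variable n : nat.
Local Notation word := (seq 'I_n).

Fixpoint words (N : nat) : seq word :=
  [::] :: if N is N'.+1 then [seq i :: w | i <- enum 'I_n, w <- words N'] else [::].

Lemma mem_words N (w : word) : (w \in words N) = (size w <= N)%N.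
Proof.
elim: N w => [|N IH] [|i w] //=; rewrite inE /=.
apply/allpairsP/idP => [[[j v] /= [_ h [_ ->]]]|h]; first by rewrite ltnS -IH.
by exists (i, w); rewrite mem_enum IH.
Qed.

Lemma words_uniq N : uniq (words N).
Proof.
elim: N => [//|N IH] /=; rewrite allpairs_uniq ?enum_uniq ?IH//; last first.
  by move=> [i w] [j v] _ _ /= [-> ->].
by rewrite andbT; apply/allpairsP => -[[i w] [_ _ e]]; discriminate e.
Qed.

End words.

Lemma sum_le_supp (R : realType) (T : eqType) (f : T -> R) (s t : seq T) :
  (forall x, 0 <= f x) -> uniq s -> (forall x, x \in s -> f x != 0 -> x \in t) ->
  \sum_(x <- s) f x <= \sum_(x <- t) f x.
Proof.
move=> f0 us st; apply: (@le_trans _ _ (\sum_(x <- [seq x <- s | f x != 0]) f x)).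
  rewrite big_filter [leLHS](bigID (fun x => f x != 0))/= [X in _ + X]big1 ?addr0// => x.
  by rewrite negbK => /eqP.
apply: sum_le_sub => //; first exact: filter_uniq.
by move=> x; rewrite mem_filter => /andP[h xs]; exact: st.
Qed.

Section majorant.
Variables (n : nat) (R : realType) (G : groupType) (V : zmodType) (nrm : V -> R).
Variables (mul : V -> V -> V) (star : V -> V) (gact : G -> V -> V).
Hypothesis sr : star_ring mul star gact.
Hypothesis gn : group_norm nrm.
Hypothesis nrmM : forall u v, nrm (mul u v) <= nrm u * nrm v.
Hypothesis nrm_star : forall u, nrm (star u) = nrm u.
Hypothesis nrm_act : forall g u, nrm (gact g u) = nrm u.
Local Notation word := (seq 'I_n).
Local Notation series := (word -> V).
Local Notation cv := (word_conv mul).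
Local Notation sst := (series_star star).
Local Notation sac := (series_act gact).
Implicit Types (A B : series) (tau : R) (N : nat) (g h : G) (s w : word).

Let n0 := nrm_ge0 gn.

(** Truncation at degree [N] keeps the sum finite and allows bounds by induction on [N]. *)
Definition wnorm tau N A := \sum_(w <- words n N) tau ^+ size w * nrm (A w).

Lemma wnorm_ge0 tau N A : 0 <= tau -> 0 <= wnorm tau N A.
Proof. by move=> t0; apply: sumr_ge0 => w _; rewrite mulr_ge0 ?exprn_ge0. Qed.

Lemma wnorm_rev tau N (f : word -> R) :
  \sum_(w <- words n N) tau ^+ size w * f (rev w) = \sum_(w <- words n N) tau ^+ size w * f w.
Proof.
under eq_bigr do rewrite -size_rev.
rewrite -(big_map (@rev 'I_n) predT (fun w => tau ^+ size w * f w)).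
apply: perm_big; apply: uniq_perm; rewrite ?words_uniq//.
  by rewrite map_inj_uniq ?words_uniq//; exact: (can_inj revK).
move=> w; rewrite mem_words; apply/mapP/idP => [[v vN ->]|h].
  by rewrite size_rev -mem_words.
by exists (rev w); rewrite ?revK// mem_words size_rev.
Qed.

Lemma wnorm_star tau N A : wnorm tau N (sst A) = wnorm tau N A.
Proof.
rewrite /wnorm -[RHS](wnorm_rev tau N (fun w => nrm (A w))).
by apply: eq_bigr => w _; rewrite /series_star nrm_star.
Qed.

Lemma wnorm_act tau N g A : wnorm tau N (sac g A) = wnorm tau N A.
Proof. by apply: eq_bigr => w _; rewrite /series_act nrm_act. Qed.

Lemma wnorm_conv_supp tau N M A B : 0 <= tau ->
  (forall w w', (size w + size w' <= N)%N -> nrm (A w) * nrm (B w') != 0 ->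
    (size w <= M)%N && (size w' <= M)%N) ->
  wnorm tau N (cv A B) <= wnorm tau M A * wnorm tau M B.
Proof.
move=> t0 hM.
pose f (p : word * word) := (tau ^+ size p.1 * nrm (A p.1)) * (tau ^+ size p.2 * nrm (B p.2)).
have f0 p : 0 <= f p by rewrite !mulr_ge0 ?exprn_ge0.
apply: (@le_trans _ _ (\sum_(s <- words n N) \sum_(p <- splits s) f p)).
  apply: ler_sum => s _; apply: le_trans (ler_wpM2l _ (nrm_sum gn _ _)) _.
    by rewrite exprn_ge0.
  rewrite mulr_sumr big_seq [leRHS]big_seq; apply: ler_sum => p.
  rewrite mem_splits => /eqP <-; rewrite size_cat exprD /f mulrACA.
  by rewrite ler_wpM2l ?mulr_ge0 ?exprn_ge0.
rewrite -big_allpairs_dep; apply: (@le_trans _ _ (\sum_(p <- [seq (w, w') | w <- words n M, w' <- words n M]) f p)).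
  apply: sum_le_supp => //.
    apply: (@uniq_fibers _ _ (fun p : word * word => p.1 ++ p.2)); last exact: words_uniq.
      by move=> s; exact: splits_uniq.
    by move=> p s; rewrite mem_splits.
  move=> [w w'] /allpairsPdep[s [p [sN ps ep]]] fp.
  move: ps; rewrite -ep mem_splits /= => /eqP e.
  have /andP[h1 h2] : (size w <= M)%N && (size w' <= M)%N.
    apply: hM; first by rewrite -size_cat e -mem_words.
    by apply: contraNneq fp => z; rewrite /f /= mulrACA z mulr0.
  by apply: allpairs_f; rewrite mem_words.
rewrite big_allpairs /wnorm mulr_suml le_eqVlt; apply/orP; left; apply/eqP.
by apply: eq_bigr => w _; rewrite mulr_sumr.
Qed.

Lemma wnorm_conv tau N A B : 0 <= tau ->
  wnorm tau N (cv A B) <= wnorm tau N A * wnorm tau N B.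
Proof. by move=> t0; apply: wnorm_conv_supp => // w w' h _; apply/andP; split; lia. Qed.

Lemma wnorm_convS tau N A B : 0 <= tau -> below 1 A -> below 1 B ->
  wnorm tau N.+1 (cv A B) <= wnorm tau N A * wnorm tau N B.
Proof.
move=> t0 a1 b1; apply: wnorm_conv_supp => // w w' h nz.
case: w h nz => [|i w] h nz; first by rewrite a1// (nrm0 gn) mul0r eqxx in nz.
case: w' h nz => [|j w'] h nz; first by rewrite b1// (nrm0 gn) mulr0 eqxx in nz.
by move: h => /= h; apply/andP; split; lia.
Qed.

(** Crude, but linear in [x] with a constant that depends on [L] only. *)
Lemma pow1D_le (x : R) (L : nat) : 0 <= x -> x <= 1 -> (1 + x) ^+ L <= 1 + 3 ^+ L * x.
Proof.
move=> x0 x1; elim: L => [|L IH]; first by rewrite !expr0 mul1r lerDl.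
have p1 : 1 <= 3 ^+ L :> R by rewrite exprn_ege1// ler1n.
rewrite exprS [3 ^+ L.+1]exprS; move: (3 ^+ L : R) ((1 + x) ^+ L) p1 IH => P Q p1 IH.
apply: (@le_trans _ _ ((1 + x) * (1 + P * x))); first by rewrite ler_wpM2l// addr_ge0.
have xx : x * x <= x by rewrite -[leRHS]mulr1 ler_wpM2l.
have : P * (x * x) <= P * x by rewrite ler_wpM2l// (le_trans ler01).
have : x <= P * x by rewrite ler_peMl.
lra.
Qed.

Variable D : G -> series.
Hypothesis D_below : forall g, below 1 (D g).
Hypothesis D_mul : forall g h, D (g * h)%g = circ cv (D g) (sac g (D h)).
Hypothesis D_bound : forall g, exists2 K : R, 0 <= K & exists H : seq (G * G),
  forall s, (2 <= size s)%N -> nrm (D g s) <=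
  K * (\sum_(h <- H) nrm (cv (D h.1) (sac h.1 (D h.2)) s) +
       \sum_(h <- H) nrm (cv (D h.1) (sac h.1 (D h.2)) (rev s))) + nrm (cv (sst (D g)) (D g) s).
Variable S : seq G.
Hypothesis S_gen : forall Q : G -> Prop, Q 1%g ->
  (forall g (x : G), x \in S -> Q g -> Q (g * x)%g) -> forall g, Q g.

Definition gen_norm tau N := \sum_(x <- 1%g :: S) wnorm tau N (D x).

Lemma gen_norm_ge0 tau N : 0 <= tau -> 0 <= gen_norm tau N.
Proof. by move=> t0; apply: sumr_ge0 => x _; exact: wnorm_ge0. Qed.

Lemma gen_norm_le tau N x : 0 <= tau -> x \in 1%g :: S -> wnorm tau N (D x) <= gen_norm tau N.
Proof. by move=> t0 xS; apply: (sum_term_le _ xS) => y; exact: wnorm_ge0. Qed.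

(** By multiplicativity of [1 + D], the quantity [1 + wnorm] is submultiplicative along a word in
    the generators. *)
Lemma wnorm_word_length g : exists L : nat, forall tau N, 0 <= tau ->
  1 + wnorm tau N (D g) <= (1 + gen_norm tau N) ^+ L.
Proof.
apply: (S_gen (Q := fun g => exists L : nat, forall tau N, 0 <= tau ->
  1 + wnorm tau N (D g) <= (1 + gen_norm tau N) ^+ L)).
  (* [1] is listed with the generators, which bounds [D 1] without computing it. *)
  by exists 1%N => tau N t0; rewrite expr1 lerD2l; apply: gen_norm_le => //; exact: mem_head.
move=> {}g x xS [L hL]; exists L.+1 => tau N t0; rewrite exprS mulrC D_mul.
have -> : wnorm tau N (circ cv (D g) (sac g (D x))) =
  \sum_(w <- words n N) tau ^+ size w * nrm (D g w + gact g (D x w) + cv (D g) (sac g (D x)) w).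
  by [].
apply: (@le_trans _ _ ((1 + wnorm tau N (D g)) * (1 + wnorm tau N (D x)))); last first.
  apply: ler_pM; rewrite ?addr_ge0 ?wnorm_ge0 ?hL// lerD2l.
  by apply: gen_norm_le => //; rewrite inE xS orbT.
have := wnorm_conv N (D g) (sac g (D x)) t0; rewrite wnorm_act => hc.
have : \sum_(w <- words n N) tau ^+ size w * nrm (D g w + gact g (D x w) + cv (D g) (sac g (D x)) w) <=
    wnorm tau N (D g) + wnorm tau N (D x) + wnorm tau N (cv (D g) (sac g (D x))).
  rewrite /wnorm -!big_split /=; apply: ler_sum => w _; rewrite -!mulrDr ler_wpM2l ?exprn_ge0//.
  apply: le_trans (nrmD gn _ _) _; rewrite lerD2r; apply: le_trans (nrmD gn _ _) _.
  by rewrite nrm_act.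
by move: hc; move: (wnorm _ _ _) (wnorm _ _ _) (wnorm _ _ _) (\sum_(_ <- _) _) => *; nra.
Qed.

(** The coefficients of degree 1 give [tau * m]; in higher degrees [D_bound] is quadratic, and
    [wnorm_convS] lowers the degree of truncation by one. *)
Lemma wnorm_step g : exists2 m : R, 0 <= m & exists2 K : R, 0 <= K & exists H : seq (G * G),
  forall tau N, 0 <= tau -> wnorm tau N.+1 (D g) <= tau * m +
    K * (\sum_(h <- H) wnorm tau N (D h.1) * wnorm tau N (D h.2)) + wnorm tau N (D g) ^+ 2.
Proof.
have [K K0 [H hK]] := D_bound g.
exists (\sum_(i <- enum 'I_n) nrm (D g [:: i])); first exact: sumr_ge0.
exists (2 * K); first exact: mulr_ge0.
exists H => tau N t0.
pose q s := \sum_(h <- H) nrm (cv (D h.1) (sac h.1 (D h.2)) s).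
have q0 s : 0 <= q s by exact: sumr_ge0.
pose W (f : word -> R) := \sum_(s <- words n N.+1) tau ^+ size s * f s.
have hq : W q <= \sum_(h <- H) wnorm tau N (D h.1) * wnorm tau N (D h.2).
  rewrite /W; under eq_bigr do rewrite mulr_sumr.
  rewrite exchange_big; apply: ler_sum => h _.
  rewrite -(wnorm_act tau N h.1 (D h.2)); apply: wnorm_convS => //.
  exact: (act_below sr h.1 (D_below h.2)).
have hs : wnorm tau N.+1 (cv (sst (D g)) (D g)) <= wnorm tau N (D g) ^+ 2.
  rewrite expr2 -{1}(wnorm_star tau N (D g)); apply: wnorm_convS => //.
  exact: (star_below sr (D_below g)).
pose f1 (s : word) := (size s == 1%N)%:R * (tau ^+ size s * nrm (D g s)).
have h1 : \sum_(s <- words n N.+1) f1 s <= tau * \sum_(i <- enum 'I_n) nrm (D g [:: i]).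
  rewrite mulr_sumr; apply: (@le_trans _ _ (\sum_(s <- [seq [:: i] | i <- enum 'I_n]) f1 s)).
    apply: sum_le_supp; rewrite ?words_uniq//.
      by move=> s; rewrite !mulr_ge0 ?exprn_ge0.
    move=> [|i [|j s]] _; rewrite /f1 ?mul0r ?eqxx// => _.
    by apply/mapP; exists i; rewrite ?mem_enum.
  by rewrite big_map; apply: ler_sum => i _; rewrite /f1 /= mul1r expr1.
apply: (@le_trans _ _ (\sum_(s <- words n N.+1) (f1 s + tau ^+ size s *
    (K * (q s + q (rev s)) + nrm (cv (sst (D g)) (D g) s))))).
  apply: ler_sum => s _; have p0 : 0 <= tau ^+ size s by rewrite exprn_ge0.
  have r0 : 0 <= K * (q s + q (rev s)) + nrm (cv (sst (D g)) (D g) s).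
    by rewrite addr_ge0// mulr_ge0// addr_ge0.
  have := @hK s; rewrite /f1; case: s p0 r0 => [|i [|j s]] p0 r0 hs'.
  - by rewrite D_below// (nrm0 gn) mulr0 mulr0 add0r mulr_ge0.
  - by rewrite eqxx mul1r lerDl mulr_ge0.
  - by rewrite mul0r add0r ler_wpM2l// hs'.
rewrite big_split /= -addrA; apply: lerD => //.
have -> : \sum_(s <- words n N.+1) tau ^+ size s * (K * (q s + q (rev s)) +
    nrm (cv (sst (D g)) (D g) s)) = 2 * K * W q + wnorm tau N.+1 (cv (sst (D g)) (D g)).
  have e := wnorm_rev tau N.+1 q; rewrite -/(W q) in e.
  rewrite -[2 * K]mulrC -mulrA [2 * _]mulr_natl mulr2n -{2}e /W -big_split /= mulr_sumr /wnorm -big_split /=.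
  by apply: eq_bigr => s _; ring.
by apply: lerD => //; rewrite ler_wpM2l ?mulr_ge0.
Qed.

(* Multiplicativity bounds the norm on a generator by a polynomial, without linear term, in
   the norms on the generators of one degree less, so that the norms stay below a small
   multiple of [tau]. *)
Lemma wnorm_bounded : exists2 tau : R, 0 < tau & forall g, exists C : R, forall N,
  wnorm tau N (D g) <= C.
Proof.
have [L hL] := choice wnorm_word_length.
have /choice[m hm] : forall g, exists m : R, 0 <= m /\ exists K : R, 0 <= K /\ exists H : seq (G * G),
    forall tau N, 0 <= tau -> wnorm tau N.+1 (D g) <= tau * m +
    K * (\sum_(h <- H) wnorm tau N (D h.1) * wnorm tau N (D h.2)) + wnorm tau N (D g) ^+ 2.
  by move=> g; have [m m0 [K K0 [H hH]]] := wnorm_step g; exists m; split=> //; exists K; split=> //; exists H.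
have /choice[K hK] := fun g => proj2 (hm g).
have /choice[H hH] := fun g => proj2 (hK g).
have m0 g : 0 <= m g by case: (hm g).
have K0 g : 0 <= K g by case: (hK g).
pose T := 1%g :: S.
pose L0 := (\sum_(x <- T) (L x + \sum_(h <- H x) (L h.1 + L h.2)))%N.
pose m1 := \sum_(x <- T) m x.
pose K1 := \sum_(x <- T) (K x * (size (H x))%:R + 1).
have m10 : 0 <= m1 by exact: sumr_ge0.
have K10 : 0 <= K1 by apply: sumr_ge0 => x _; rewrite addr_ge0 ?mulr_ge0.
have leL x : x \in T -> (L x <= L0)%N /\ forall h : G * G, h \in H x -> (L h.1 <= L0)%N /\ (L h.2 <= L0)%N.
  move=> xT; rewrite /L0 (big_rem x)//=; split; first by rewrite -addnA leq_addr.
  by move=> h hh; rewrite (big_rem h)//=; split; lia.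
have step tau N : 0 <= tau -> gen_norm tau N.+1 <= tau * m1 +
    K1 * ((1 + gen_norm tau N) ^+ L0 - 1) ^+ 2.
  move=> t0; set P := _ ^+ L0 - 1.
  have M0 := gen_norm_ge0 N t0.
  have bd x : (L x <= L0)%N -> wnorm tau N (D x) <= P.
    move=> xL; rewrite lerBrDl; apply: le_trans (hL x tau N t0) _.
    by rewrite ler_weXn2l// lerDl.
  rewrite /gen_norm /m1 /K1 mulr_sumr mulr_suml -big_split /= big_seq [leRHS]big_seq.
  apply: ler_sum => x xT; have [xL hLh] := leL x xT.
  apply: le_trans (hH x tau N t0) _; rewrite -addrA lerD2l mulrDl mul1r; apply: lerD.
    rewrite -mulrA ler_wpM2l//; apply: (@le_trans _ _ (\sum_(h <- H x) P ^+ 2)).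
      rewrite big_seq [leRHS]big_seq; apply: ler_sum => h hh; have [l1 l2] := hLh h hh.
      by rewrite expr2; apply: ler_pM; rewrite ?wnorm_ge0 ?bd.
    by rewrite big_const_seq count_predT iter_addr_0 mulr_natl.
  by rewrite sqr_le ?wnorm_ge0 ?bd.
(* The interval from 0 to [e] is stable under the recursion: [tau] makes the linear term at most
   [e / 2], and [9 = 3 ^ 2] comes from squaring the bound of [pow1D_le]. *)
pose e := Num.min 1 (2 * (K1 + 1) * 9 ^+ L0)^-1.
have q0 : 0 < 2 * (K1 + 1) * 9 ^+ L0 by rewrite !mulr_gt0 ?exprn_gt0// ltr_wpDl.
have e0 : 0 < e by rewrite lt_min ltr01 invr_gt0.
have e1 : e <= 1 by rewrite ge_min lexx.
have eq : (K1 + 1) * 9 ^+ L0 * e <= 2^-1.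
  rewrite -(ler_pM2l (ltr0Sn R 1)) divff// mulrA mulrA -ler_pdivlMl// mulr1.
  by rewrite /e ge_min lexx orbT.
pose tau := e / (2 * (m1 + 1)).
have t0 : 0 < tau by rewrite divr_gt0// mulr_gt0// ltr_wpDl.
have tm : tau * m1 <= e / 2.
  rewrite /tau; have p0 : 0 < m1 + 1 by rewrite ltr_wpDl.
  have -> : e / (2 * (m1 + 1)) * m1 = e / 2 * (m1 / (m1 + 1)) by field; rewrite gt_eqF.
  rewrite ger_pMr ?divr_gt0// ler_pdivrMr// mul1r lerDl//.
have Me N : gen_norm tau N <= e.
  elim: N => [|N IH].
    rewrite /gen_norm big1 ?ltW// => x _.
    by rewrite /wnorm /= big_seq1 D_below// (nrm0 gn) mulr0.
  apply: le_trans (step tau N (ltW t0)) _.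
  have M0 := gen_norm_ge0 N (ltW t0).
  have P1 : (1 + gen_norm tau N) ^+ L0 - 1 <= 3 ^+ L0 * e.
    rewrite lerBlDl; apply: le_trans (pow1D_le L0 M0 (le_trans IH e1)) _.
    by rewrite lerD2l ler_wpM2l// exprn_ge0.
  have P0 : 0 <= (1 + gen_norm tau N) ^+ L0 - 1 by rewrite subr_ge0 exprn_ege1// lerDl.
  have P2 := sqr_le P0 P1; rewrite exprMn exprAC in P2.
  have P3 : K1 * ((1 + gen_norm tau N) ^+ L0 - 1) ^+ 2 <= e / 2.
    apply: (@le_trans _ _ ((K1 + 1) * ((3 ^+ 2) ^+ L0 * e ^+ 2))).
      by apply: ler_pM; rewrite ?sqr_ge0// lerDl.
    have -> : (3 : R) ^+ 2 = 9 by rewrite expr2; ring.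
    by rewrite expr2 !mulrA mulrC ler_wpM2l// ltW.
  by rewrite [leRHS](splitr e) lerD.
exists tau => // g; exists ((1 + e) ^+ L g) => N.
have := hL g tau N (ltW t0); have M0 := gen_norm_ge0 N (ltW t0).
have : (1 + gen_norm tau N) ^+ L g <= (1 + e) ^+ L g.
  by rewrite lerXn2r ?nnegrE ?addr_ge0 ?(ltW e0)// lerD2l.
lra.
Qed.

End majorant.

Section contents.
Variable n : nat.
Local Notation word := (seq 'I_n).
Implicit Types (w : word) (alpha : {ffun 'I_n -> nat}).

Definition content w : {ffun 'I_n -> nat} := [ffun i => count_mem i w].

Lemma content_rev w : content (rev w) = content w.
Proof. by apply/ffunP => i; rewrite !ffunE count_rev. Qed.

Lemma content_degree w : multi_degree (content w) = size w.
Proof.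
rewrite /multi_degree; under eq_bigr do rewrite ffunE.
elim: w => [|j w IH] /=; first by rewrite big1.
rewrite big_split /= IH -add1n; congr (_ + _)%N.
by rewrite (bigD1 j)//= eqxx big1 ?addn0// => i /negPf ij; rewrite eq_sym ij.
Qed.

Definition content_fiber alpha : seq word :=
  [seq w <- words n (multi_degree alpha) | content w == alpha].

Lemma mem_content_fiber alpha w : (w \in content_fiber alpha) = (content w == alpha).
Proof.
rewrite mem_filter mem_words andb_idr// => /eqP <-.
by rewrite content_degree.
Qed.

Lemma content_fiber_uniq alpha : uniq (content_fiber alpha).
Proof. by rewrite filter_uniq// words_uniq. Qed.

Lemma content_unit w i : (content w == multi_unit i) = (w == [:: i]).
Proof.
apply/eqP/eqP => [e|->]; last by apply/ffunP => j; rewrite !ffunE /= addn0 eq_sym.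
have : size w = 1%N.
  rewrite -content_degree e /multi_degree (bigD1 i)//= ffunE eqxx big1// => j ji.
  by rewrite ffunE (negPf ji).
case: w e => [|j [|? ?]]// /ffunP/(_ j) + _; rewrite !ffunE /= eqxx addn0.
by case: eqVneq => [->|].
Qed.

End contents.

Section monomials.
Variables (n : nat) (R : realType) (t : 'rV[R]_n).
Local Notation word := (seq 'I_n).
Implicit Types (w : word) (alpha : {ffun 'I_n -> nat}).

(** Being multiplicative for concatenation and invariant under reversal, it makes evaluation at real
    parameters compatible with the product and the involution of series. *)
Definition monomial w : R := multi_pow t (content w).

Lemma monomial_cat w w' : monomial (w ++ w') = monomial w * monomial w'.
Proof.
rewrite /monomial /multi_pow -big_split; apply: eq_bigr => i _.
by rewrite !ffunE count_cat exprD.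
Qed.

Lemma monomial_cons i w : monomial (i :: w) = t 0 i * monomial w.
Proof.
rewrite -cat1s monomial_cat; congr (_ * _).
rewrite /monomial /multi_pow (bigD1 i)//= ffunE /= eqxx expr1 big1 ?mulr1// => j ji.
by rewrite ffunE /= eq_sym (negPf ji) expr0.
Qed.

Lemma monomial_le tau w : (forall i, `|t 0 i| <= tau) -> `|monomial w| <= tau ^+ size w.
Proof.
move=> ht; elim: w => [|i w IH].
  rewrite /monomial /multi_pow big1 ?normr1 ?expr0// => i _.
  by rewrite ffunE expr0.
by rewrite monomial_cons normrM exprS ler_pM.
Qed.

End monomials.

Lemma sum_bounded_prod (R : realType) (I J : eqType) (f : I -> R) (g : J -> R) C D :
  (forall i, 0 <= f i) -> (forall j, 0 <= g j) -> sum_bounded f C -> sum_bounded g D ->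
  sum_bounded (fun p : I * J => f p.1 * g p.2) (C * D).
Proof.
move=> f0 g0 hC hD s us.
apply: (@le_trans _ _ (\sum_(p <- [seq (i, j) | i <- undup (map fst s), j <- undup (map snd s)])
    f p.1 * g p.2)).
  apply: sum_le_sub => // [p|[i j] ps]; first exact: mulr_ge0.
  by apply: allpairs_f; rewrite mem_undup; [exact: (map_f fst ps)|exact: (map_f snd ps)].
rewrite big_allpairs /=; under eq_bigr do rewrite -mulr_sumr.
rewrite -mulr_suml; apply: ler_pM; rewrite ?sumr_ge0 ?hC ?hD ?undup_uniq//.
Qed.

(** * Evaluation at commuting parameters *)

Section convergence.
Variables (n : nat) (R : realType) (G : groupType) (V : lmodType R[i]) (nrm : V -> R).
Variables (mul : V -> V -> V) (star : V -> V) (gact : G -> V -> V).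
Hypothesis sr : star_ring mul star gact.
Hypothesis gn : group_norm nrm.
Hypothesis nrmM : forall u v, nrm (mul u v) <= nrm u * nrm v.
Hypothesis nrm_star : forall u, nrm (star u) = nrm u.
Hypothesis nrm_act : forall g u, nrm (gact g u) = nrm u.
Hypothesis nrmZ : forall (r : R) u, nrm (r%:C%C *: u) = `|r| * nrm u.
Hypothesis starZ : forall (r : R) u, star (r%:C%C *: u) = r%:C%C *: star u.
Hypothesis sactZ : forall g (r : R) u, gact g (r%:C%C *: u) = r%:C%C *: gact g u.
Hypothesis mulZl : forall (r : R[i]) u v, mul (r *: u) v = r *: mul u v.
Hypothesis mulZr : forall (r : R[i]) u v, mul u (r *: v) = r *: mul u v.
Hypothesis complete : forall (I : choiceType) (F : I -> V) C,
  sum_bounded (fun i => nrm (F i)) C -> exists S, has_sum nrm F S.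
Local Notation word := (seq 'I_n).
Local Notation cv := (word_conv mul).
Local Notation sst := (series_star star).
Local Notation sac := (series_act gact).

Variables (D : G -> word -> V) (tau : R).
Hypothesis D_below : forall g, below 1 (D g).
Hypothesis D_mul : forall g h, D (g * h)%g = circ cv (D g) (sac g (D h)).
Hypothesis D_unit : forall g, unitary_defect cv sst (D g) = 0.
Hypothesis tau0 : 0 < tau.
Hypothesis D_bounded : forall g, exists C, forall N, wnorm nrm tau N (D g) <= C.

Section evaluation.
Variable t : 'rV[R]_n.
Hypothesis t_small : forall i, `|t 0 i| <= tau.

Definition term g w : V := (monomial t w)%:C%C *: D g w.

Lemma term_bounded g : exists C, sum_bounded (fun w => nrm (term g w)) C.
Proof.
have [C hC] := D_bounded g; exists C => s us; pose N := (\max_(w <- s) size w)%N.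
apply: le_trans (hC N); apply: (@le_trans _ _ (\sum_(w <- s) tau ^+ size w * nrm (D g w))).
  apply: ler_sum => w _; rewrite nrmZ ler_wpM2r ?(nrm_ge0 gn)//; exact: monomial_le.
apply: sum_le_sub => // [w|w ws]; first by rewrite mulr_ge0 ?exprn_ge0 ?(nrm_ge0 gn)// ltW.
by rewrite mem_words /N (@leq_bigmax_seq _ s xpredT size).
Qed.

Definition value g : V := xget 0 [set S | has_sum nrm (term g) S].

Lemma valueP g : has_sum nrm (term g) (value g).
Proof.
have [C hC] := term_bounded g; have [S hS] := complete hC.
by rewrite /value; case: xgetP => [_ -> //|/(_ S)].
Qed.

(** Cauchy product: the products over pairs of words are absolutely summable, and are regrouped by
    the concatenation of the pair. *)
Lemma value_conv A B a b C C' : has_sum nrm A a -> has_sum nrm B b ->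
  sum_bounded (fun w => nrm (A w)) C -> sum_bounded (fun w => nrm (B w)) C' ->
  has_sum nrm (fun w : word => \sum_(p <- splits w) mul (A p.1) (B p.2)) (mul a b).
Proof.
move=> hA hB bA bB.
have [P hP] : exists P, has_sum nrm (fun p : word * word => mul (A p.1) (B p.2)) P.
  apply: (@complete _ _ (C * C')).
  apply: sum_bounded_le (sum_bounded_prod _ _ bA bB) => *; try exact: (nrm_ge0 gn).
  exact: nrmM.
rewrite -(has_sum_prod gn (smulBl sr) (smulBr sr) nrmM hA hB hP).
apply: (has_sum_regroup (p := fun p : word * word => p.1 ++ p.2)) hP.
  by move=> s; exact: splits_uniq.
by move=> p s; rewrite mem_splits.
Qed.

Lemma value_act g h : has_sum nrm (fun w => gact g (term h w)) (gact g (value h)).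
Proof.
apply: (has_sum_map (K := 1) gn (sactB sr g)) (valueP h) => v.
by rewrite nrm_act mul1r.
Qed.

Lemma value_star g : has_sum nrm (fun w => star (term g (rev w))) (star (value g)).
Proof.
have h : has_sum nrm (fun w => star (term g w)) (star (value g)).
  apply: (has_sum_map (K := 1) gn (starB sr)) (valueP g) => v.
  by rewrite nrm_star mul1r.
have := has_sum_regroup (p := rev) (fib := fun w => [:: rev w]) _ _ h.
move=> /(_ (fun _ => isT)) /(_ _)/wrap[w w'|].
  by rewrite inE -(inj_eq (can_inj revK)) revK.
by apply: eq_has_sum => w; rewrite big_seq1.
Qed.

Lemma value_mul g h : value (g * h)%g = circ mul (value g) (gact g (value h)).
Proof.
have [C hC] := term_bounded g; have [C' hC'] := term_bounded h.
have bh : sum_bounded (fun w => nrm (gact g (term h w))) C'.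
  by apply: sum_bounded_le hC' => w; rewrite nrm_act.
have hp := value_conv (valueP g) (value_act g h) hC bh.
have hs := has_sumD gn (has_sumD gn (valueP g) (value_act g h)) hp.
apply: (has_sum_unique gn (valueP _)); apply: eq_has_sum hs => w.
rewrite /term D_mul -[circ _ _ _ w]/(D g w + gact g (D h w) + cv (D g) (sac g (D h)) w).
rewrite !scalerDr sactZ; congr (_ + _); rewrite /word_conv scaler_sumr big_seq [RHS]big_seq.
apply: eq_bigr => -[w1 w2]; rewrite mem_splits /= => /eqP <-.
by rewrite sactZ mulZl mulZr scalerA -rmorphM monomial_cat.
Qed.

Lemma value_unit g : unitary_defect mul star (value g) = 0.
Proof.
have [C hC] := term_bounded g.
have bs : sum_bounded (fun w => nrm (star (term g (rev w)))) C.
  have := sum_bounded_inj (h := rev) (can_inj revK) hC.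
  by apply: sum_bounded_le => w; rewrite nrm_star.
have hp := value_conv (value_star g) (valueP g) bs hC.
have hs := has_sumD gn (has_sumD gn (value_star g) (valueP g)) hp.
apply: (has_sum_unique gn hs).
have z : has_sum nrm (fun _ : word => 0) 0.
  have := has_sum_fin gn (isT : uniq ([::] : seq word)) (F := fun=> 0).
  by rewrite big_nil; apply.
apply: eq_has_sum z => w; have := congr1 (fun A => A w) (D_unit g).
rewrite -[LHS]/(star (D g (rev w)) + D g w + cv (sst (D g)) (D g) w).
move=> /(congr1 (fun v => (monomial t w)%:C%C *: v)); rewrite scaler0 !scalerDr => e.
rewrite -[LHS]e /term starZ /monomial content_rev; congr (_ + _).
rewrite /word_conv scaler_sumr big_seq [RHS]big_seq.
apply: eq_bigr => -[w1 w2]; rewrite mem_splits /= => /eqP <-.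
rewrite starZ mulZl mulZr scalerA -rmorphM /series_star.
by rewrite -/(monomial t _) -/(monomial t _) -/(monomial t _) monomial_cat /monomial content_rev.
Qed.

Definition coefficient alpha g : V := \sum_(w <- content_fiber alpha) D g w.

Lemma coefficient_term alpha g :
  (multi_pow t alpha)%:C%C *: coefficient alpha g = \sum_(w <- content_fiber alpha) term g w.
Proof.
rewrite /coefficient scaler_sumr big_seq [RHS]big_seq; apply: eq_bigr => w.
by rewrite mem_content_fiber /term /monomial => /eqP ->.
Qed.

Lemma coefficient_sum g :
  has_sum nrm (fun alpha => (multi_pow t alpha)%:C%C *: coefficient alpha g) (value g).
Proof.
apply: eq_has_sum (has_sum_regroup (p := @content n) (fib := @content_fiber n) _ _ (valueP g)).
- by move=> alpha; rewrite coefficient_term.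
- exact: content_fiber_uniq.
- by move=> w alpha; rewrite mem_content_fiber.
Qed.

Lemma coefficient_bounded g : exists C,
  sum_bounded (fun alpha => nrm ((multi_pow t alpha)%:C%C *: coefficient alpha g)) C.
Proof.
have [C hC] := term_bounded g; exists C.
have h := sum_bounded_fibers (p := @content n) (@content_fiber_uniq n)
  (fun w alpha => mem_content_fiber alpha w) hC.
by apply: sum_bounded_le h => alpha; rewrite coefficient_term; exact: nrm_sum.
Qed.

End evaluation.

Lemma coefficient_unit i g : coefficient (multi_unit i) g = D g [:: i].
Proof.
have -> : D g [:: i] = \sum_(w <- [:: [:: i]]) D g w by rewrite big_seq1.
apply: perm_big; apply: uniq_perm => //.
  exact: content_fiber_uniq.
by move=> w; rewrite mem_content_fiber content_unit inE.
Qed.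

Lemma coefficient0 alpha g : multi_degree alpha = 0%N -> coefficient alpha g = 0.
Proof.
move=> a0; rewrite /coefficient big_seq big1// => w.
by rewrite mem_filter mem_words a0 => /andP[_ h]; apply: D_below.
Qed.

End convergence.

(** * Cohomology of the regular and Hilbert-Schmidt modules *)

Section regular.
Variables (R : realType) (G : groupType).
Local Notation H := (l2 R G).
Local Notation V := (hs_op R G).
Implicit Types (f : H) (A B : V) (g h x : G).

Lemma lregM g h f : lreg (g * h)%g f = lreg g (lreg h f).
Proof. by apply/val_inj/funext => x /=; rewrite invgM mulgA. Qed.

Lemma lreg1 f : lreg 1%g f = f.
Proof. by apply/val_inj/funext => x /=; rewrite invg1 mul1g. Qed.

Lemma lregK g : cancel (lreg (R := R) g) (lreg g^-1%g).
Proof. by move=> f; rewrite -lregM mulVg lreg1. Qed.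

Lemma lreg_dot g f1 f2 : l2_dot (lreg g f1) f2 = l2_dot f1 (lreg g^-1%g f2).
Proof.
have gn := normc_group_norm R.
apply: (@bounded_op_ext R G (R[i]^o) (@Normc.normc R) (fun f => l2_dot (lreg g f) f2)
  (fun f => l2_dot f (lreg g^-1%g f2)) (l2_norm f2) (l2_norm (lreg g^-1%g f2))) => //.
- by move=> c u v; rewrite lreg_linear l2_dotZDl.
- by move=> c u v; rewrite l2_dotZDl.
- by move=> u; apply: le_trans (l2_dot_le _ _) _; rewrite lreg_norm mulrC.
- by move=> u; apply: le_trans (l2_dot_le _ _) _; rewrite mulrC.
- move=> x /=; rewrite lreg_delta (l2_dotC f2) l2_dot_delta.
  by rewrite (l2_dotC (lreg g^-1%g f2)) l2_dot_delta /= invgK.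
Qed.

Lemma lreg_sub g f1 f2 : lreg g (f1 - f2) = lreg g f1 - lreg g f2.
Proof. exact/val_inj/funext. Qed.

Lemma hs_adE g A f : hs_ad g A f = lreg g (A (lreg g^-1%g f)). Proof. by []. Qed.

Lemma hs_ad_star g A : hs_ad g (hs_star A) = hs_star (hs_ad g A).
Proof.
symmetry; apply: hs_star_unique => f1 f2; rewrite !hs_adE lreg_dot hs_adjoint.
by rewrite lreg_dot invgK.
Qed.

Lemma hs_adM g h A : hs_ad (g * h)%g A = hs_ad g (hs_ad h A).
Proof. by apply/val_inj/funext => f; rewrite /= invgM !lregM. Qed.

Lemma hs_ad1 A : hs_ad 1%g A = A.
Proof. by apply/val_inj/funext => f; rewrite /= invg1 !lreg1. Qed.

Lemma hs_star_ring : star_ring (@hs_mul R G) (@hs_star R G) (@hs_ad R G).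
Proof.
split; [exact: hs_mulBl|exact: hs_mulBr|exact: hs_mulA|exact: hs_starB|exact: hs_star_mul
  |exact: hs_starK| | |exact: hs_ad_star|exact: hs_adM].
- by move=> g A B; apply/val_inj/funext => f; exact: lreg_sub.
- by move=> g A B; apply/val_inj/funext => f; rewrite /= lregK.
Qed.

Lemma hs_norm_ad g A : hs_norm (hs_ad g A) = hs_norm A.
Proof.
have le h B : hs_norm (hs_ad h B) <= hs_norm B.
  have n0 := nrm_ge0 (hs_group_norm R G) B.
  apply/hs_entry_bounded => //; have := proj2 (hs_entry_bounded B n0) (lexx _).
  move=> /(sum_bounded_inj (h := fun x => (h^-1 * x)%g) (@mulgI _ _)).
  by apply: sum_bounded_le => x /=; rewrite lreg_norm lreg_delta.
by apply/le_anti; rewrite le/= -{1}[A]hs_ad1 -(mulVg g) hs_adM le.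
Qed.

Lemma hs_adZ g (r : R[i]) A : hs_ad g (r *: A) = r *: hs_ad g A.
Proof. by apply/val_inj/funext => f; apply/val_inj/funext. Qed.

Lemma hs_vec_ad g A x y : hs_vec (hs_ad g A) (x, y) = hs_vec A ((g^-1 * x)%g, (g^-1 * y)%g).
Proof. by rewrite /= /hs_entry /= lreg_delta. Qed.

End regular.

(** The boolean becomes a component of the inert index [K], which lets the real estimates serve
    complex functions. *)
Definition part (R : realType) (b : bool) (z : R[i]) : R :=
  if b then complex.Re z else complex.Im z.

Lemma partD (R : realType) b (z w : R[i]) : part b (z + w) = part b z + part b w.
Proof. by case: b z w => [] [? ?] [? ?]. Qed.

Lemma partB (R : realType) b (z w : R[i]) : part b (z - w) = part b z - part b w.
Proof. by case: b z w => [] [? ?] [? ?]. Qed.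

Lemma part_inj (R : realType) (z w : R[i]) : (forall b, part b z = part b w) -> z = w.
Proof. by case: z w => [a b] [c d] h; have := h true; have := h false => /= -> ->. Qed.

Lemma sum_bounded_part (R : realType) (I : eqType) (f : I -> R[i]) C :
  sum_bounded (fun ib : I * bool => part ib.2 (f ib.1) ^+ 2) C <->
  sum_bounded (fun i => normsq (f i)) C.
Proof.
have e s : \sum_(ib <- [seq (i, b) | i <- s, b <- [:: true; false]]) part ib.2 (f ib.1) ^+ 2 =
    \sum_(i <- s) normsq (f i).
  by rewrite big_allpairs; apply: eq_bigr => i _; rewrite !big_cons big_nil /= addr0.
split=> h s us.
  by rewrite -e; apply: h; rewrite allpairs_uniq// => -[? ?] [? ?].
apply: le_trans (h (undup (map fst s)) (undup_uniq _)); rewrite -e.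
apply: sum_le_sub => //; first by move=> ib; exact: sqr_ge0.
move=> [i b] ib; apply: allpairs_f; last by case: b {ib}.
by rewrite mem_undup (map_f fst ib).
Qed.

Section cohomology_filling.
Variables (R : realType) (G : groupType) (T : Type) (theta : T -> T -> R).
Variables (xi : G -> T) (nn : G -> nat).
Hypothesis fil : filling theta xi nn.
Implicit Types (g h k x y : G).

Lemma group_primitive : exists P : (G -> G -> G -> R) -> G -> G -> R,
  (forall z, (forall g h k x, z h k (g^-1 * x)%g - z (g * h)%g k x + z g (h * k)%g x -
      z g h x = 0) ->
    forall g h x, P z h (g^-1 * x)%g - P z (g * h)%g x + P z g x = z g h x) /\
  forall g, exists2 D : R, 0 <= D & exists S : seq (G * G),
    forall (K : eqType) (z : K -> G -> G -> G -> R) (N : G * G -> R),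
    (forall i g h k x, z i h k (g^-1 * x)%g - z i (g * h)%g k x + z i g (h * k)%g x -
      z i g h x = 0) ->
    (forall h : G * G, h \in S -> sum_bounded (fun xk : G * K => z xk.2 h.1 h.2 xk.1 ^+ 2) (N h)) ->
    sum_bounded (fun xk : G * K => P (z xk.2) g xk.1 ^+ 2) (D * \sum_(h <- S) N h).
Proof.
have [B [hB bB]] := filling_primitive fil.
(* The homogeneous cochain of [z] sends [(x, y, w)] to the translate by [x] of
   [z (x^-1 * y) (y^-1 * w)]; by equivariance it is determined by its value at [1], which is
   [hom]. *)
pose hom (z : G -> G -> G -> R) x y w := z (x^-1 * y)%g (y^-1 * w)%g (x^-1)%g.
have homP z : (forall g h k x, z h k (g^-1 * x)%g - z (g * h)%g k x + z g (h * k)%g x -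
    z g h x = 0) -> forall x y w v, hom z y w v - hom z x w v + hom z x y v - hom z x y w = 0.
  move=> hz x y w v; have := hz (x^-1 * y)%g (y^-1 * w)%g (w^-1 * v)%g (x^-1)%g.
  by rewrite /hom invgM invgK mulgK -!mulgA !mulVKg.
exists (fun z g x => B (hom z) x^-1%g (x^-1 * g)%g); split.
  move=> z hz g h x; have := hB _ (homP z hz) (x^-1)%g (x^-1 * g)%g (x^-1 * g * h)%g.
  have -> : hom z (x^-1)%g (x^-1 * g)%g (x^-1 * g * h)%g = z g h x.
    by rewrite /hom invgK mulVKg mulKg.
  by move=> <-; rewrite invgM invgK !mulgA.
move=> g; have [D D0 [S hS]] := bB g; exists D => //.
pose sh (p : G * G) := (p.1, (p.1^-1 * p.2)%g); exists (map sh S) => K z N hz hN.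
rewrite big_map.
have inj : injective (fun xk : G * K => (xk.1^-1%g, xk.2)).
  by move=> [x k] [y l] /= [/invg_inj -> ->].
have := hS K (fun i => hom (z i)) (N \o sh) (fun i => homP _ (hz i)).
move=> /(_ _)/wrap[h hh|/(sum_bounded_inj inj)]; last first.
  by apply: sum_bounded_le => -[x k].
have := hN _ (map_f sh hh) => /(sum_bounded_inj inj).
apply: sum_bounded_le => -[x k] /=; rewrite /hom invgM -!mulgA !mulKg //.
Qed.

Definition arg1 g : 'I_1 -> G := fun=> g.
Definition arg2 g h : 'I_2 -> G := fun i => if i == ord0 then g else h.
Definition arg3 g h k : 'I_3 -> G :=
  fun i => if i == ord0 then g else if i == lift ord0 ord0 then h else k.

Lemma arg2E (s : 'I_2 -> G) : s = arg2 (s ord0) (s (lift ord0 ord0)).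
Proof.
apply/funext => i; rewrite /arg2; case: eqP => [->//|].
by case: i => [[|[|?]]] //= p ne; [case: ne; exact: val_inj|congr s; exact: val_inj].
Qed.

Section low_degree.
Variables (V : zmodType) (act : G -> V -> V).

Lemma coboundary0 (c : cochain G V 0) s :
  coboundary act c s = act (s ord0) (c (fun=> 1%g)) - c (fun=> 1%g).
Proof.
have e (u : 'I_0 -> G) : u = fun=> 1%g by apply/funext; case.
by rewrite /coboundary big_ord0 addr0 expr1 mulrN1z; congr (act _ (c _) - c _); exact: e.
Qed.

Lemma coboundary1 (c : cochain G V 1) g h : coboundary act c (arg2 g h) =
  act g (c (arg1 h)) - c (arg1 (g * h)%g) + c (arg1 g).
Proof.
rewrite /coboundary big_ord1 expr1 mulrN1z sqrrN expr1n mulr1z.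
congr (act _ (c _) - c _ + c _); apply/funext => i; rewrite (ord1 i) //.
Qed.

Lemma coboundary2 (c : cochain G V 2) g h k : coboundary act c (arg3 g h k) =
  act g (c (arg2 h k)) - c (arg2 (g * h)%g k) + c (arg2 g (h * k)%g) - c (arg2 g h).
Proof.
rewrite /coboundary !big_ord_recl big_ord0 addr0 /= expr1 mulrN1z sqrrN expr1n mulr1z.
have -> : (-1) ^+ 3 = -1 :> int by []; rewrite mulrN1z addrA.
by congr (act _ (c _) - c _ + c _ - c _); rewrite [LHS]arg2E.
Qed.

End low_degree.

Lemma l2_H1_nonzero : ~ cohomology_vanishes (@lreg R G) 1.
Proof.
have [z hz] := dist_not_sqr_bounded fil.
(* [filling] controls right translations while [lreg] translates on the left; inversion exchanges
   them. *)
pose psi x := theta z (xi x^-1%g).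
have iinj : injective (fun x : G => x^-1%g) by exact: invg_inj.
have mem g : (fun x => (psi (g^-1 * x)%g - psi x)%:C%C) \in @l2_pred R G.
  have [C hC] := lipschitz_sqr_bounded fil z g; apply/l2_memP; exists C.
  apply: sum_bounded_le (sum_bounded_inj iinj hC) => x.
  by rewrite /normsq /= expr0n addr0 /psi invgM invgK.
pose c : cochain G (l2 R G) 1 := fun s => L2 (mem (s ord0)).
move=> vanish; have /vanish[v _ vc] : cocycles (@lreg R G) c.
  apply/funext => s; rewrite [s]arg2E coboundary1; apply/val_inj/funext => x.
  move: (s ord0) (s (lift ord0 ord0)) => g h.
  rewrite -[LHS]/((psi (h^-1 * (g^-1 * x))%g - psi (g^-1 * x)%g)%:C%C -
    (psi ((g * h)^-1 * x)%g - psi x)%:C%C + (psi (g^-1 * x)%g - psi x)%:C%C).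
  by rewrite -rmorphB -rmorphD invgM mulgA -[RHS](rmorph0 (real_complex R)); congr (_%:C%C); ring.
pose u := v (fun=> 1%g).
have inv g x : (psi (g^-1 * x)%g - psi x)%:C%C = u (g^-1 * x)%g - u x.
  have := congr1 (fun w => (w (arg1 g) : l2 R G) x) vc.
  by rewrite coboundary0 -[c _ _]/((psi (g^-1 * x)%g - psi x)%:C%C) => <-.
(* [psi] minus the real part of [u] is invariant under translations, hence equal to its value at
   [1]. *)
apply: (hz (psi 1%g - complex.Re (u 1%g)) (l2_normsq u)).
apply: sum_bounded_le (sum_bounded_inj iinj (l2_sum_normsq u)) => x.
have := inv x^-1%g x^-1%g; rewrite mulVg => /(congr1 (@complex.Re R)).
rewrite /psi invgK /=; move: (theta z (xi 1^-1%g)) (theta z (xi x)) => p q.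
case: (u 1%g) (u x^-1%g) => [a b] [d e] /= h; rewrite /normsq /=.
by have -> : q - (p - a) = d; [lra|rewrite lerDl sqr_ge0].
Qed.

Lemma l2_H2_zero : cohomology_vanishes (@lreg R G) 2.
Proof.
have [P [hP bP]] := group_primitive; move=> c cc.
pose z b g h x := part b (c (arg2 g h) x).
have zc b g h k x : z b h k (g^-1 * x)%g - z b (g * h)%g k x + z b g (h * k)%g x - z b g h x = 0.
  have cc' : coboundary (@lreg R G) c = (fun=> 0) by exact: cc.
  have := congr1 (fun w : cochain G (l2 R G) 3 => part b ((w (arg3 g h k) : l2 R G) x)) cc'.
  rewrite coboundary2 /= /z => e; rewrite -!(partB, partD) -[RHS](_ : part b 0 = 0).
    exact: e.
  by case: (b).
pose f g x := Complex (P (z true) g x) (P (z false) g x).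
have fE b g x : part b (f g x) = P (z b) g x by case: b.
have mem g : f g \in @l2_pred R G.
  have [D D0 [S hS]] := bP g; apply/l2_memP.
  exists (D * \sum_(h <- S) l2_normsq (c (arg2 h.1 h.2))).
  apply/sum_bounded_part.
  have := hS _ (fun b => z b) (fun h : G * G => l2_normsq (c (arg2 h.1 h.2))) zc.
  move=> /(_ _)/wrap[h _|]; last by apply: sum_bounded_le => -[x b] /=; rewrite fE.
  by rewrite /z; apply/sum_bounded_part; exact: l2_sum_normsq.
exists (fun s => L2 (mem (s ord0))) => //.
apply/funext => s; rewrite [s]arg2E coboundary1; move: (s ord0) (s (lift ord0 ord0)) => g h.
apply/val_inj/funext => x; apply: part_inj => b.
rewrite -[LHS]/(part b (f h (g^-1 * x)%g - f (g * h)%g x + f g x)) partD partB !fE.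
by rewrite hP.
Qed.

Lemma sum_sqr_le (I : Type) (s : seq I) (f : I -> R) : (forall i, 0 <= f i) ->
  \sum_(i <- s) f i ^+ 2 <= (\sum_(i <- s) f i) ^+ 2.
Proof.
move=> f0; elim: s => [|i s IH]; first by rewrite !big_nil expr0n.
rewrite !big_cons; have := f0 i; have : 0 <= \sum_(j <- s) f j by exact: sumr_ge0.
move: (\sum_(j <- s) f j) (\sum_(j <- s) _) (f i) IH => S Q a h S0 a0.
by have := mulr_ge0 a0 S0; rewrite expr2 in h; rewrite !expr2; lra.
Qed.

Local Notation V := (hs_op R G).

(* The conjugation action preserves the difference of the two indices of a matrix entry:
   for fixed [k], the entries of index [(x, x k)] form a copy of the left regular module. *)
Lemma hs_solve : exists solve : (G -> G -> V) -> G -> V,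
  (forall Z, cocycle2 (@hs_ad R G) Z -> forall g h,
     hs_ad g (solve Z h) + solve Z g = Z g h + solve Z (g * h)%g) /\
  forall g, exists2 K : R, 0 <= K & exists S : seq (G * G),
    forall Z, cocycle2 (@hs_ad R G) Z ->
    hs_norm (solve Z g) <= K * \sum_(h <- S) hs_norm (Z h.1 h.2).
Proof.
have [P [hP bP]] := group_primitive.
pose z (Z : G -> G -> V) (kb : G * bool) g h x :=
  part kb.2 (hs_vec (Z g h) (x, (x * kb.1)%g)).
have zc Z : cocycle2 (@hs_ad R G) Z -> forall kb g h k x, z Z kb h k (g^-1 * x)%g -
    z Z kb (g * h)%g k x + z Z kb g (h * k)%g x - z Z kb g h x = 0.
  move=> hZ [m b] g h k x.
  have := congr1 (fun A : V => part b (hs_vec A (x, (x * m)%g))) (hZ g h k).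
  rewrite -[LHS]/(part b (hs_vec (hs_ad g (Z h k)) (x, (x * m)%g) +
    hs_vec (Z g (h * k)%g) (x, (x * m)%g))).
  rewrite -[RHS]/(part b (hs_vec (Z g h) (x, (x * m)%g) + hs_vec (Z (g * h)%g k) (x, (x * m)%g))).
  by rewrite !partD hs_vec_ad mulgA /z /=; lra.
pose vec Z g (p : G * G) := Complex (P (z Z ((p.1^-1 * p.2)%g, true)) g p.1)
  (P (z Z ((p.1^-1 * p.2)%g, false)) g p.1).
have vecE Z g b p : part b (vec Z g p) = P (z Z ((p.1^-1 * p.2)%g, b)) g p.1 by case: b.
(* The default 0 is taken when [vec Z g] is not square-summable, which [bd] excludes for
   cocycles. *)
pose solve Z g : V := hs_of (insubd (0 : l2 R (G * G)%type) (vec Z g)).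
have [D hD] := choice (fun g => let: ex_intro2 D D0 h := bP g in ex_intro _ D (conj D0 h)).
have D0 g : 0 <= D g by case: (hD g).
have [S hS] := choice (fun g => proj2 (hD g)).
have bd Z g : cocycle2 (@hs_ad R G) Z -> sum_bounded (fun p => normsq (vec Z g p))
    (D g * \sum_(h <- S g) hs_norm (Z h.1 h.2) ^+ 2).
  move=> hZ; apply/sum_bounded_part.
  have := hS g _ (z Z) (fun h : G * G => hs_norm (Z h.1 h.2) ^+ 2) (zc Z hZ).
  move=> /(_ _)/wrap[h _|].
    have := proj2 (sum_bounded_part _ _) (l2_sum_normsq (hs_vec (Z h.1 h.2))).
    rewrite -sqr_l2_norm -hs_normE => /(sum_bounded_inj (h := fun xk : G * (G * bool) =>
      ((xk.1, (xk.1 * xk.2.1)%g), xk.2.2))); apply.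
    by move=> [x [k b]] [y [l d]] /= [-> /mulgI -> ->].
  have inj : injective (fun pb : (G * G) * bool => (pb.1.1, ((pb.1.1^-1 * pb.1.2)%g, pb.2))).
    by move=> [[x y] b] [[u v] d] /= [-> /mulgI -> ->].
  by move=> /(sum_bounded_inj inj); apply: sum_bounded_le => -[p b]; rewrite /= vecE.
have solveE Z g : cocycle2 (@hs_ad R G) Z -> forall p, hs_vec (solve Z g) p = vec Z g p.
  move=> hZ p; rewrite hs_ofK; congr (_ p); apply: insubdK.
  by apply/l2_memP; exists (D g * \sum_(h <- S g) hs_norm (Z h.1 h.2) ^+ 2); exact: bd.
exists solve; split.
  move=> Z hZ g h; apply: hs_vec_inj; apply/val_inj/funext => -[x y]; apply: part_inj => b.
  rewrite -[LHS]/(part b (hs_vec (hs_ad g (solve Z h)) (x, y) + hs_vec (solve Z g) (x, y))).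
  rewrite -[RHS]/(part b (hs_vec (Z g h) (x, y) + hs_vec (solve Z (g * h)%g) (x, y))).
  rewrite hs_vec_ad !solveE// !partD !vecE /= invgM invgK -mulgA mulVKg.
  have := hP _ (zc Z hZ ((x^-1 * y)%g, b)) g h x; rewrite {4}/z /= mulVKg; lra.
move=> g; exists (Num.sqrt (D g)); first exact: sqrtr_ge0.
exists (S g) => Z hZ; have n0 := nrm_ge0 (hs_group_norm R G).
have s0 : 0 <= \sum_(h <- S g) hs_norm (Z h.1 h.2) by exact: sumr_ge0.
rewrite hs_normE; apply: l2_norm_le; first by rewrite mulr_ge0 ?sqrtr_ge0.
rewrite exprMn sqr_sqrtr//.
have -> : (fun p => normsq (hs_vec (solve Z g) p)) = (fun p => normsq (vec Z g p)).
  by apply/funext => p; rewrite solveE.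
have := bd Z g hZ; set Q := \sum_(h <- _) _ ^+ 2 => hQ t ut.
by apply: le_trans (hQ t ut) _; rewrite ler_wpM2l// /Q sum_sqr_le.
Qed.

End cohomology_filling.

Section unitary.
Variables (R : realType) (G : groupType).
Local Notation H := (l2 R G).
Local Notation V := (hs_op R G).
Implicit Types (f : H) (A B : V) (g h x : G).

(** Preservation of scalar products makes each [p g] injective. As [p 1] is idempotent, it is then
    the identity, so [p g^-1] is a right inverse of [p g] and surjectivity follows. *)
Lemma unitary_rep_hs (D : G -> V) :
  (forall g h, D (g * h)%g = circ (@hs_mul R G) (D g) (hs_ad g (D h))) ->
  (forall g, unitary_defect (@hs_mul R G) (@hs_star R G) (D g) = 0) ->
  unitary_rep (fun g f => lreg g f + D g (lreg g f)).
Proof.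
move=> Dm Du; pose p g f := lreg g f + D g (lreg g f).
have pE g f : p g f = lreg g f + D g (lreg g f) by [].
have addE A B f : (A + B) f = A f + B f by [].
have linD A f1 f2 : A (f1 + f2) = A f1 + A f2.
  by have := hs_linear A 1 f1 f2; rewrite !scale1r.
have lregD g f1 f2 : lreg g (f1 + f2) = lreg g f1 + lreg g f2 by exact/val_inj/funext.
have pM g h f : p (g * h)%g f = p g (p h f).
  rewrite !pE Dm /circ !addE hs_adE lregM lregK lregD linD.
  rewrite -[hs_mul _ _ _]/(D g (lreg g (D h (lreg g^-1%g (lreg g (lreg h f)))))) lregK.
  by rewrite !addrA; congr (_ + _); rewrite addrAC.
have plin g : linear (p g).
  move=> a u v; rewrite !pE lreg_linear hs_linear scalerDr -!addrA; congr (_ + _).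
  by rewrite addrCA.
have pdot g f1 f2 : l2_dot (p g f1) (p g f2) = l2_dot f1 f2.
  rewrite !pE; have -> : l2_dot f1 f2 = l2_dot (lreg g f1) (lreg g f2) by rewrite lreg_dot lregK.
  move: (lreg g f1) (lreg g f2) => u v; rewrite l2_dotDl hs_adjoint -l2_dotDr; congr (l2_dot _ _).
  rewrite linD -addrA -[RHS]addr0; congr (_ + _).
  have := congr1 (fun A : V => A v) (Du g).
  rewrite -[LHS]/(hs_star (D g) v + D g v + hs_star (D g) (D g v)) => e.
  by rewrite addrA (addrC (D g v)) e.
have pinj g f1 f2 : p g f1 = p g f2 -> f1 = f2.
  have [psub _] := linear_sub (plin g).
  move=> e; apply/eqP; rewrite -subr_eq0; apply/eqP/l2_normsq_eq0.
  have := pdot g (f1 - f2) (f1 - f2); rewrite psub e subrr l2_dot0l l2_dotxx.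
  by move=> /(congr1 (@complex.Re R)).
have p1 f : p 1%g f = f by apply: (pinj 1%g); rewrite -pM mulg1.
split.
- move=> g; split; [exact: plin| |exact: pdot].
  by move=> f; exists (p g^-1%g f); rewrite -[LHS]/(p g (p g^-1%g f)) -pM mulgV p1.
- by apply/funext; exact: p1.
- by move=> g h; apply/funext => f; exact: pM.
Qed.

Lemma hs_abs_sum_of (I : choiceType) (P : set I) (F : I -> V) S C :
  (forall i, ~ P i -> F i = 0) -> sum_bounded (fun i => hs_norm (F i)) C ->
  has_sum (@hs_norm R G) F S -> hs_abs_sum P F S.
Proof.
move=> F0 hC hS; split.
  apply: (@le_lt_trans _ _ C%:E); last exact: ltry.
  apply: ge_ereal_sup => /= _ [A [finA _]] <-.
  by rewrite fsbig_finite//= sumEFin lee_fin; exact: hC.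
move=> e e0; have [s0 h0] := hS _ (divr_gt0 e0 (ltr0Sn R 1)).
exists [fset i in s0 | `[< P i >]]%fset.
  by move=> i /=; rewrite !inE /= => /andP[_ /asboolP].
move=> J sub JP; have half_lt : e / 2 < e by rewrite ltr_pdivrMr// ltr_pMr// ltr1n.
apply: le_lt_trans half_lt.
(* The terms of [s0] outside [P] are zero; adding them to [J] makes the estimate of [has_sum]
   applicable. *)
pose s := J ++ [seq i <- undup s0 | ~~ `[< P i >]].
have -> : \sum_(i <- J) F i = \sum_(i <- s) F i.
  rewrite big_cat /= big_filter [X in _ = _ + X]big1 ?addr0// => i /asboolPn; exact: F0.
apply: h0.
  rewrite cat_uniq fset_uniq filter_uniq ?undup_uniq// andbT /= -all_predC.
  apply/allP => i; rewrite mem_filter => /andP[/asboolPn nP _] /=.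
  by apply/negP => iJ; apply: nP; exact: JP.
move=> i is0; rewrite mem_cat mem_filter mem_undup is0 andbT.
have [Pi|nP] := boolP `[< P i >]; last by rewrite orbT.
by rewrite orbF; apply: sub => /=; rewrite !inE is0.
Qed.

Lemma open_small_coordinates n (tau : R) :
  open [set t : 'rV[R]_n | forall i, `|t 0 i| < tau].
Proof.
rewrite openE => t ht; pose e : R := \big[Num.min/1%R]_(i < n) (tau - `|t 0 i|).
have e0 : (0 : R) < e.
  rewrite /e; elim/big_ind: _; first exact: ltr01.
    by move=> x y x0 y0; rewrite lt_min x0 y0.
  by move=> i _; rewrite subr_gt0.
apply/nbhs_ballP; exists e => //= y hy i.
have hyi : `|t 0 i - y 0 i| < e by exact: (proj2 hy 0 i).
have ei : e <= tau - `|t 0 i| by apply: bigmin_le_cond.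
have := ler_normB (t 0 i) (t 0 i - y 0 i); rewrite opprB addrCA subrr addr0; lra.
Qed.

End unitary.

Section integrability.
Variables (R : realType) (G : groupType) (T : Type) (theta : T -> T -> R).
Variables (xi : G -> T) (nn : G -> nat).
Hypothesis fil : filling theta xi nn.
Variable gens : seq G.
Hypothesis generate : forall Q : G -> Prop, Q 1%g ->
  (forall g (x : G), x \in gens -> Q g -> Q (g * x)%g) -> forall g, Q g.
Local Notation V := (hs_op R G).

Lemma skew_cocycles_integrate n (c : 'I_n -> cochain G V 1) :
  (forall i, cocycles (@hs_ad R G) (c i) /\ forall s, skew_adjoint (c i s)) -> integrates c.
Proof.
move=> hc; have [solve [solveP solve_bound]] := hs_solve fil.
have sr := hs_star_ring R G; have gn := hs_group_norm R G.
pose c1 i g := c i (fun=> g).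
have c1c i g h : c1 i (g * h)%g = c1 i g + hs_ad g (c1 i h).
  have e : coboundary (@hs_ad R G) (c i) = (fun=> 0) by exact: (proj1 (hc i)).
  have := congr1 (fun w : cochain G V 2 => w (arg2 g h)) e; rewrite coboundary1 => /eqP.
  by rewrite addrAC subr_eq0 eq_sym addrC => /eqP.
have c1s i g : hs_star (c1 i g) = - c1 i g.
  by apply: hs_star_unique; exact: (proj2 (hc i)).
have aZ g (r : R) (A : V) : hs_ad g (r%:C%C *: A) = r%:C%C *: hs_ad g A by exact: hs_adZ.
pose D := full (@hs_mul R G) (@hs_star R G) (@hs_ad R G) solve c1.
have Db g : below 1 (D g) by exact: (full_below sr (@hs_starZ R G) aZ solveP c1c c1s).
have Dm g h : D (g * h)%g = circ (word_conv (@hs_mul R G)) (D g) (series_act (@hs_ad R G) g (D h)).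
  apply/eqP; rewrite eq_sym -subr_eq0; apply/eqP.
  exact: (full_curv sr (@hs_starZ R G) aZ solveP c1c c1s).
have Du g : unitary_defect (word_conv (@hs_mul R G)) (series_star (@hs_star R G)) (D g) = 0.
  exact: (full_unit sr (@hs_starZ R G) aZ solveP c1c c1s).
have nM := @hs_norm_mul R G; have nS := @hs_norm_star R G; have nA := @hs_norm_ad R G.
have nZ := @hs_normZ R G.
have Dn := full_bound sr (@hs_starZ R G) aZ solveP c1c c1s gn nZ nS solve_bound.
have [tau tau0 tauP] := wnorm_bounded sr gn nM nS nA Db Dm Dn generate.
pose Dt t := value (@hs_norm R G) D t.
exists [set t : 'rV[R]_n | forall i, `|t 0 i| < tau], (coefficient D), Dt; split.
- by split; [exact: open_small_coordinates|move=> i; rewrite mxE normr0].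
- by move=> i g; rewrite coefficient_unit /D full_first.
- move=> t ht g; have ht' i : `|t 0 i| <= tau by exact/ltW/ht.
  have [C hC] := coefficient_bounded gn nZ tau0 tauP ht' g.
  apply: (hs_abs_sum_of _ hC); last first.
    exact: (coefficient_sum gn nZ (@hs_complete R G) tau0 tauP ht').
  move=> alpha a0; rewrite (coefficient0 Db) ?scaler0//.
  by apply/eqP; rewrite -leqn0 leqNgt; apply/negP.
- move=> t ht; have ht' i : `|t 0 i| <= tau by exact/ltW/ht.
  apply: unitary_rep_hs => g.
    move=> h; exact: (value_mul sr gn nM nA nZ aZ (@hs_mulZl R G) (@hs_mulZr R G)
      (@hs_complete R G) Dm tau0 tauP ht').
  exact: (value_unit sr gn nM nS nZ (@hs_starZ R G) (@hs_mulZl R G) (@hs_mulZr R G)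
      (@hs_complete R G) Du tau0 tauP ht').
Qed.

End integrability.

Section assembly.
Variables (R : realType) (P : coxeter_polygon R) (X : polygonal_complex P).
Variables (G : groupType) (act : G -> X -> X).
Local Notation d := (@path_dist R P X).

Lemma rho_bounded (o : X) (rho : gromov_boundary d -> gromov_boundary d -> R) a C :
  hyp_space d -> 0 < a -> 0 < C ->
  (forall xi eta,
    (C^-1%:E * expeR (- (a%:E * boundary_prod o xi eta)) <= (rho xi eta)%:E <=
     C%:E * expeR (- (a%:E * boundary_prod o xi eta)))%E) ->
  forall p q, rho p q <= C.
Proof.
move=> hX a0 C0 vis p q; have [u [gu ->]] := bclassP p; have [v [gv ->]] := bclassP q.
have := rho_le a0 C0 vis gu gv (m := 0) (N := 0).
rewrite mulr0 oppr0 expR0 mulr1; apply=> i j _ _; exact: gp_ge0.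
Qed.

Lemma building_filling : fuchsian_building X -> cocompact_lattice act ->
  (boundary_confdim d < 2%:E)%E ->
  exists (gens : seq G) (T : Type) (theta : T -> T -> R) (xi : G -> T) (nn : G -> nat),
    (forall Q : G -> Prop, Q 1%g -> (forall g (x : G), x \in gens -> Q g -> Q (g * x)%g) ->
      forall g, Q g) /\ filling theta xi nn.
Proof.
move=> build lat /ereal_inf_lt[_ [theta [mtheta ar [rho [mrho [pt [a [C [a0 C0 vis]]]]] qs]] <-] dim2].
have hX := building_hyp_space build.
have [D [S hG]] := lattice_proper_action build pt lat.
have /finite_seqP[gens gensE] := gen_finite hG.
have gE := gdistE hG.
have lip x y : len d act pt y <= len d act pt x + len d act pt (x^-1 * y)%g.
  by rewrite -gE; exact: len_lip.
have lenV x y : len d act pt (x^-1 * y)%g = len d act pt (y^-1 * x)%g.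
  by rewrite -!gE; exact: gdistC.
have near r : exists2 K : R, 0 < K & forall x y, len d act pt (x^-1 * y)%g <= r ->
    rho (bd_end act pt hX x) (bd_end act pt hX y) <= K * expR (- (a * len d act pt x)).
  have [K K0 hK] := bd_end_near act hX a0 C0 vis r.
  by exists K => // x y; rewrite -gE; exact: hK.
have far K : 0 < K -> exists r, forall x y,
    rho (bd_end act pt hX x) (bd_end act pt hX y) <= K * expR (- (a * len d act pt x)) ->
    len d act pt x <= len d act pt y + K -> len d act pt y <= len d act pt x + K ->
    len d act pt (x^-1 * y)%g <= r.
  move=> K0; have [r hr] := bd_end_far act hX a0 C0 vis K0.
  by exists r => x y; rewrite -gE; exact: hr.
exists gens, _, theta, (bd_end act pt hX), (level mrho mtheta (bd_end_side act hX a0 C0 vis)); split.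
  by move=> Q Q1 QS g; apply: (act_gen hG Q1) => h x Sx; apply: QS; rewrite gensE in Sx.
apply: (boundary_filling mrho mtheta qs ar dim2 _ a0 (len_finite hG) lip lenV
  (bd_end_side act hX a0 C0 vis) near far (bd_dense hX hG a0 C0 vis)).
  by exists C; exact: rho_bounded vis.
have [K K0 hK] := bd_walk hX hG a0 C0 vis; exists K => // x.
have [w [w1 w2 w3 w4 w5]] := hK x; exists w.
by split=> // i; rewrite -gE; [exact: w2|exact: w4].
Qed.

End assembly.

Theorem theoremB (R : realType) (P : coxeter_polygon R)
    (X : polygonal_complex P) (G : groupType) (act : G -> X -> X) :
  fuchsian_building X ->
  cocompact_complex X ->
  cocompact_lattice act ->
  (boundary_confdim (@path_dist R P X) < 2%:E)%E ->
  [/\ ~ cohomology_vanishes (@lreg R G) 1,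
      cohomology_vanishes (@lreg R G) 2
    & forall (n : nat) (c : 'I_n -> cochain G (hs_op R G) 1), (1 <= n)%N ->
        (forall i, cocycles (@hs_ad R G) (c i) /\
                   forall s, skew_adjoint (c i s)) ->
        integrates c].
Proof.
move=> build _ lat dim2.
have [gens [T [theta [xi [nn [gen fil]]]]]] := building_filling build lat dim2.
split; [exact: l2_H1_nonzero fil|exact: l2_H2_zero fil|].
by move=> n c _; exact: skew_cocycles_integrate fil gens gen n c.
Qed.
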